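(* Let $M$ be a uniformly $2$-nondegenerate CR hypersurface in $\mathbb{C}^{n+1}$ with rank $s$ Levi form given near $0$ by $$\Re(w)=z^TH(\zeta,\overline{\zeta})\overline{z}+\Re(\overline{z}^TS(\zeta,\overline{\zeta})\overline{z}),$$ where $H$ and $S$ are respectively $s\times s$ Hermitian and symmetric matrix valued functions of $(\zeta,\overline\zeta)$ with $H(0,0)$ nondegenerate. If $M$ is smooth and has a subset of its holomorphic infinitesimal symmetries acting locally transitively at $0$ on the space of leaves of the Levi kernel, then $M$ is locally equivalent to a $2$-nondegenerate model given by a defining equation of the same form with $$H(\zeta,\overline{\zeta})=\tfrac12\left(\mathbf{H}(\mathrm{Id}-\overline{\mathbf{S}(\zeta)}\mathbf{H}^T\mathbf{S}(\zeta)\mathbf{H})^{-1}+(\mathrm{Id}-\mathbf{H}\overline{\mathbf{S}(\zeta)}\mathbf{H}^T\mathbf{S}(\zeta))^{-1}\mathbf{H}\right),$$ $$S(\zeta,\overline{\zeta})=\mathbf{H}^T(\mathrm{Id}-\mathbf{S}(\zeta)\mathbf{H}\overline{\mathbf{S}(\zeta)}\mathbf{H}^T)^{-1}\mathbf{S}(\zeta)\mathbf{H},$$ for some $s\times s$ nondegenerate Hermitian matrix $\mathbf H$ and some $s\times s$ symmetric matrix $\mathbf S(\zeta)$ of holomorphic functions of $\zeta_1,\dots,\zeta_{n-s}$ that vanish at $0$ and have linearly independent partial derivatives $\mathbf{S}_{\zeta_1}(0),\dots,\mathbf{S}_{\zeta_{n-s}}(0)$.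
   Context: Coordinates on $\mathbb{C}^{n+1}$ are $(w,z,\zeta)\in\mathbb{C}\oplus\mathbb{C}^s\oplus\mathbb{C}^{n-s}$. For a real hypersurface $M\subset\mathbb{C}^{n+1}$, $\mathcal H\subset\mathbb{C}TM$ is the bundle of $(1,0)$-vectors tangent to $M$; the Levi form is $\mathcal L^1(X_p,Y_p)=\frac1{2i}[X,\overline Y]_p \bmod \mathcal H\oplus\overline{\mathcal H}$ and its kernel $\mathcal K_2\subset\mathcal H$ is the Levi kernel. $M$ is uniformly $2$-nondegenerate if the Levi form has constant rank, $\mathcal K_2\ne0$, and at every point the only $v\in\mathcal K_2$ with $[[V,\overline{X_1}],\overline{X_2}]_p\in\mathcal H\oplus\overline{\mathcal H}$ for all sections $X_1,X_2$ of $\mathcal H$ ($V$ a section of $\mathcal K_2$ extending $v$) is $v=0$. The integrable distribution $TM\cap(\mathcal K_2\oplus\overline{\mathcal K_2})$ generates a foliation whose leaves are the leaves of the Levi kernel. A $2$-nondegenerate model is a real analytic CR hypersurface given near $0$ by $\Re(w)=z^TH(\zeta,\overline{\zeta})\overline{z}+\Re(\overline{z}^TS(\zeta,\overline{\zeta})\overline{z})$, with $H,S$ respectively $s\times s$ Hermitian and symmetric matrix valued functions of $(\zeta,\overline\zeta)$ and $H(0,0)$ nondegenerate, with constant rank $s$ Levi form and $2$-nondegenerate everywhere in some neighborhood of $0$. A holomorphic infinitesimal symmetry of $M$ is (the real part of) a holomorphic vector field, defined locally, whose real part is tangent to $M$. Locally equivalent means locally CR equivalent. *)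

(* Defs.v *)
From HB Require Import structures.
From mathcomp Require Import all_boot all_order all_algebra.
From mathcomp Require Import all_classical all_reals all_analysis.
From mathcomp Require Import complex.
Set Implicit Arguments.
Unset Strict Implicit.
Unset Printing Implicit Defensive.
Import Order.TTheory GRing.Theory Num.Theory.
Import numFieldNormedType.Exports.
Local Open Scope classical_set_scope.
Local Open Scope ring_scope.

(* The library attaches these structures only to carriers presented as
   [Num.NumField.sort _]; here they are given to the literal type [R[i]]. *)
HB.instance Definition _ (R : realType) := Vector.copy R[i] R[i]^o.
HB.instance Definition _ (R : realType) :=
  NormedModule.copy R[i] (R[i] : numFieldType).

Section RealCalculus.
Variables (R : realType) (N : nat).
Implicit Types (f : 'cV[R[i]]_N -> R[i]) (U : set 'cV[R[i]]_N).
Implicit Types (p v x : 'cV[R[i]]_N).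

Definition rderivable f v x : Prop :=
  derivable (fun t : R => complex.Re (f (x + (t%:C)%C *: v))) 0 1 /\
  derivable (fun t : R => complex.Im (f (x + (t%:C)%C *: v))) 0 1.

(* Derivative of f at x along the real direction v, i.e. with respect to a
   real parameter, unlike the complex ['D_v f x]. *)
Definition rderive f v x : R[i] :=
  Complex (derive1 (fun t : R => complex.Re (f (x + (t%:C)%C *: v))) 0)
          (derive1 (fun t : R => complex.Im (f (x + (t%:C)%C *: v))) 0).

Fixpoint Ck (k : nat) U f : Prop :=
  match k with
  | 0 => forall x, U x -> {for x, continuous f}
  | k'.+1 => (forall v x, U x -> rderivable f v x) /\
             (forall v, Ck k' U (rderive f v))
  end.

Definition smooth_on U f : Prop := forall k, Ck k U f.

(* Wirtinger derivatives *)
Definition dz f (j : 'I_N) x : R[i] :=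
  2^-1 * (rderive f (delta_mx j 0) x - 'i * rderive f ('i *: delta_mx j 0) x).

Definition dzbar f (j : 'I_N) x : R[i] :=
  2^-1 * (rderive f (delta_mx j 0) x + 'i * rderive f ('i *: delta_mx j 0) x).

Definition deg_part (d : nat) (c : {ffun 'I_N + 'I_N -> 'I_d.+1} -> R[i]) v :
    R[i] :=
  \sum_(a : {ffun 'I_N + 'I_N -> 'I_d.+1} | (\sum_i (a i : nat) == d)%N)
    c a * \prod_j (v j 0 ^+ a (inl j) * (v j 0)^* ^+ a (inr j)).

Definition deg_norm (d : nat) (c : {ffun 'I_N + 'I_N -> 'I_d.+1} -> R[i]) :
    R[i] :=
  \sum_(a : {ffun 'I_N + 'I_N -> 'I_d.+1} | (\sum_i (a i : nat) == d)%N) `|c a|.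

(* Sum of an absolutely convergent power series in x - p and its conjugate,
   grouped by total degree. *)
Definition real_analytic_at f p : Prop :=
  exists (r : R[i]) (c : forall d, {ffun 'I_N + 'I_N -> 'I_d.+1} -> R[i]),
  [/\ 0 < r,
      cvgn (series (fun d => deg_norm (c d) * r ^+ d)) &
      forall x, ball p r x -> series (fun d => deg_part (c d) (x - p)) @ \oo --> f x].

Definition holomorphic_on (W : normedModType R[i]) U (f : 'cV[R[i]]_N -> W) :
    Prop :=
  forall x, U x -> differentiable f x.

End RealCalculus.

Section VectorFields.
Variables (R : realType) (N : nat).

(* (a, b) : cvec is the complexified tangent vector
   \sum_j a_j d/dz_j + b_j d/d(conj z_j) of C^N. *)
Definition cvec : Type := ('cV[R[i]]_N * 'cV[R[i]]_N)%type.

Definition cfield : Type := 'cV[R[i]]_N -> cvec.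

Definition cconj (X : cvec) : cvec :=
  (map_mx (@Num.conj R[i]) X.2, map_mx (@Num.conj R[i]) X.1).

Definition vder (X : cvec) (f : 'cV[R[i]]_N -> R[i]) p : R[i] :=
  \sum_j (X.1 j 0 * dz f j p + X.2 j 0 * dzbar f j p).

Definition lie (X Y : cfield) : cfield := fun p =>
  (\col_j (vder (X p) (fun q => (Y q).1 j 0) p
           - vder (Y p) (fun q => (X q).1 j 0) p),
   \col_j (vder (X p) (fun q => (Y q).2 j 0) p
           - vder (Y p) (fun q => (X q).2 j 0) p)).

Definition conj_field (X : cfield) : cfield := fun p => cconj (X p).

Definition smooth_field (U : set 'cV[R[i]]_N) (X : cfield) : Prop :=
  forall j, smooth_on U (fun q => (X q).1 j 0) /\
            smooth_on U (fun q => (X q).2 j 0).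

(* Real part of the (1,0)-vector with components a. *)
Definition re_part (a : 'cV[R[i]]_N) : cvec :=
  2^-1 *: ((a, 0) + cconj (a, 0) : cvec).

End VectorFields.

Section CRGeometry.
Variables (R : realType) (N : nat).
Implicit Types (M : set 'cV[R[i]]_N) (p : 'cV[R[i]]_N) (v : cvec R N).
Implicit Types (X Y V : cfield R N).

Definition local_defining M p (rho : 'cV[R[i]]_N -> R[i]) : Prop :=
  exists U : set 'cV[R[i]]_N,
  [/\ open U, U p, smooth_on U rho, (forall x, U x -> rho x \is Num.real) &
      (forall x, U x -> (M x <-> rho x = 0)) /\
      exists v, vder v rho p != 0].

Definition smooth_hypersurface M : Prop :=
  forall p, M p -> exists rho, local_defining M p rho.

Definition analytic_hypersurface M : Prop :=
  forall p, M p -> exists rho, local_defining M p rho /\ real_analytic_at rho p.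

(* Fibre at p of the complexified tangent bundle CTM. *)
Definition ctangent M p v : Prop :=
  forall rho, local_defining M p rho -> vder v rho p = 0.

(* TM consists of the real vectors of CTM. *)
Definition rtangent M p v : Prop := ctangent M p v /\ cconj v = v.

Definition Hbundle M p v : Prop := ctangent M p v /\ v.2 = 0.

Definition HHbar M p v : Prop :=
  exists v1 v2, [/\ Hbundle M p v1, Hbundle M p v2 & v = v1 + cconj v2].

(* Sections over M near p of a subbundle B of CTM, presented as ambient smooth
   vector fields with values in B along M; the brackets of fields tangent to
   M depend, along M, only on their restrictions to M. *)
Definition section_near M (B : 'cV[R[i]]_N -> cvec R N -> Prop) p X : Prop :=
  exists U : set 'cV[R[i]]_N,
  [/\ open U, U p, smooth_field U X & forall q, U q -> M q -> B q (X q)].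

(* Representative in CTM of the Levi form, which takes values in
   CTM / (H + conj H). *)
Definition levi X Y p : cvec R N :=
  (2 * 'i)^-1 *: lie X (conj_field Y) p.

Definition levi_kernel M p v : Prop :=
  Hbundle M p v /\
  forall X Y, section_near M (Hbundle M) p X -> X p = v ->
    section_near M (Hbundle M) p Y -> HHbar M p (levi X Y p).

(* Rank of the Levi form at p: rank of its matrix in a local frame X of H,
   after identifying the line CT_pM / (H + conj H) with C through theta. *)
Definition levi_rank M p (r : nat) : Prop :=
  exists (m : nat) (X : 'I_m -> cfield R N) (theta : {scalar cvec R N}),
  [/\ forall i, section_near M (Hbundle M) p (X i),
      forall v, Hbundle M p v ->
        exists! c : 'rV[R[i]]_m, v = \sum_i c 0 i *: X i p,
      forall v, ctangent M p v -> (theta v = 0 <-> HHbar M p v) &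
      \rank (\matrix_(i, j) theta (levi (X i) (X j) p)) = r].

Definition nondegenerate2_at M p : Prop :=
  forall v, levi_kernel M p v ->
    (forall V X1 X2, section_near M (levi_kernel M) p V -> V p = v ->
       section_near M (Hbundle M) p X1 -> section_near M (Hbundle M) p X2 ->
       HHbar M p (lie (lie V (conj_field X1)) (conj_field X2) p)) ->
    v = 0.

Definition uniformly_2nondegenerate M : Prop :=
  [/\ exists r, forall p, M p -> levi_rank M p r,
      forall p, M p -> exists v, levi_kernel M p v /\ v <> 0 &
      forall p, M p -> nondegenerate2_at M p].

(* Tangent space at p of the leaf of the Levi kernel through p: the real
   vectors of K_2 + conj K_2. *)
Definition leaf_tangent M p v : Prop :=
  rtangent M p v /\
  exists v1 v2, [/\ levi_kernel M p v1, levi_kernel M p v2 & v = v1 + cconj v2].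

Definition hol_symmetry M p (f : 'cV[R[i]]_N -> 'cV[R[i]]_N) : Prop :=
  exists U : set 'cV[R[i]]_N,
  [/\ open U, U p, holomorphic_on U f &
      forall q, U q -> M q -> rtangent M q (re_part (f q))].

(* The tangent space at the leaf through p of the local leaf space is
   T_pM modulo the tangent space of that leaf; a set of symmetries acts locally
   transitively there when its values span this quotient over the reals. *)
Definition leaf_transitive M p (A : set ('cV[R[i]]_N -> 'cV[R[i]]_N)) : Prop :=
  forall v, rtangent M p v ->
    exists (m : nat) (f : 'I_m -> 'cV[R[i]]_N -> 'cV[R[i]]_N) (c : 'I_m -> R),
      (forall i, A (f i)) /\
      leaf_tangent M p (v - \sum_i ((c i)%:C)%C *: re_part (f i p)).

(* Differential at p of the real-smooth map phi on complexified vectors. *)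
Definition pushforward (phi : 'cV[R[i]]_N -> 'cV[R[i]]_N) p v : cvec R N :=
  (\col_j vder v (fun q => phi q j 0) p,
   \col_j vder v (fun q => (phi q j 0)^*) p).

(* phi is a smooth ambient extension of a CR map from M near U into M'; no
   holomorphic extension is assumed. *)
Definition CR_map_on (U M M' : set 'cV[R[i]]_N)
    (phi : 'cV[R[i]]_N -> 'cV[R[i]]_N) : Prop :=
  (forall j, smooth_on U (fun q => phi q j 0)) /\
  forall p, U p -> M p ->
    M' (phi p) /\
    forall v, Hbundle M p v -> Hbundle M' (phi p) (pushforward phi p v).

(* Local CR equivalence at 0 of (M, 0) and (M', 0). *)
Definition locally_CR_equivalent M M' : Prop :=
  exists (U U' : set 'cV[R[i]]_N) (phi psi : 'cV[R[i]]_N -> 'cV[R[i]]_N),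
  [/\ [/\ open U, open U', U 0, U' 0 & phi 0 = 0],
      CR_map_on U M M' phi, CR_map_on U' M' M psi,
      forall p, U p -> M p -> U' (phi p) /\ psi (phi p) = p &
      forall q, U' q -> M' q -> U (psi q) /\ phi (psi q) = q].

End CRGeometry.

Section Models.
Variables (R : realType) (s k : nat).
Implicit Types (H S : 'cV[R[i]]_k -> 'M[R[i]]_s).

(* Coordinates (w, z, zeta) of C + C^s + C^k. *)
Definition coord_w (x : 'cV[R[i]]_(1 + (s + k))) : R[i] := usubmx x 0 0.
Definition coord_z (x : 'cV[R[i]]_(1 + (s + k))) : 'cV[R[i]]_s :=
  usubmx (dsubmx x).
Definition coord_zeta (x : 'cV[R[i]]_(1 + (s + k))) : 'cV[R[i]]_k :=
  dsubmx (dsubmx x).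

Definition conjCmx m n (A : 'M[R[i]]_(m, n)) : 'M[R[i]]_(m, n) :=
  map_mx (@Num.conj R[i]) A.

(* The function of (zeta, conj zeta) is encoded as a function of zeta. *)
Definition model_graph H S : set 'cV[R[i]]_(1 + (s + k)) :=
  [set x | let z := coord_z x in let zeta := coord_zeta x in
     'Re (coord_w x) = (z^T *m H zeta *m conjCmx z) 0 0
                       + 'Re (((conjCmx z)^T *m S zeta *m conjCmx z) 0 0)].

Definition model_data H S : Prop :=
  (\forall zeta \near (0 : 'cV[R[i]]_k),
     H zeta \is hermsymmx /\ S zeta \is symmetricmx) /\
  H 0 \in unitmx.

Definition given_near0 (M : set 'cV[R[i]]_(1 + (s + k))) H S : Prop :=
  model_data H S /\
  exists U : set 'cV[R[i]]_(1 + (s + k)),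
    [/\ open U, U 0 & M `&` U = model_graph H S `&` U].

Definition nondegenerate2_model H S : Prop :=
  model_data H S /\
  exists U : set 'cV[R[i]]_(1 + (s + k)),
    let M := model_graph H S `&` U in
    [/\ open U, U 0, analytic_hypersurface M,
        forall p, M p -> levi_rank M p s & uniformly_2nondegenerate M].

Definition model_H (HH : 'M[R[i]]_s) (SS : 'cV[R[i]]_k -> 'M[R[i]]_s)
    (zeta : 'cV[R[i]]_k) : 'M[R[i]]_s :=
  2^-1 *:
  (HH *m invmx (1%:M - conjCmx (SS zeta) *m HH^T *m SS zeta *m HH)
   + invmx (1%:M - HH *m conjCmx (SS zeta) *m HH^T *m SS zeta) *m HH).

Definition model_S (HH : 'M[R[i]]_s) (SS : 'cV[R[i]]_k -> 'M[R[i]]_s)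
    (zeta : 'cV[R[i]]_k) : 'M[R[i]]_s :=
  HH^T *m invmx (1%:M - SS zeta *m HH *m conjCmx (SS zeta) *m HH^T)
  *m SS zeta *m HH.

End Models.

(* Main.v *)
Require Import Defs.
From HB Require Import structures.
From mathcomp Require Import all_boot all_order all_algebra.
From mathcomp Require Import all_classical all_reals all_analysis.
From mathcomp Require Import complex ring lra.
Set Implicit Arguments.
Unset Strict Implicit.
Unset Printing Implicit Defensive.
Import Order.TTheory GRing.Theory Num.Theory.
Import numFieldNormedType.Exports.
Local Open Scope classical_set_scope.
Local Open Scope ring_scope.

(** The Levi kernel of the hypersurface M : Re w = F(z, zeta) at a point with
    z = 0 consists of the zeta-directions, so a point of the leaf space near 0
    is described by z (and Im w).  Local transitivity on leaves thus yields,
    for every vector of C^s, a holomorphic symmetry with that z-component at 0.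
    Differentiating the tangency condition once in z along z = 0 gives, for a
    symmetry with z-component c(zeta) there and a(zeta) half the z-gradient of
    its w-component,
      a = conj(S) c + H conj(c),   a and c holomorphic
    ([sym_jet]).  Combining the symmetries attached to the vectors e_m and
    i e_m produces holomorphic matrices P, Q, E, G with P(0) = 1, Q(0) = 0 and
      E = conj(S) P + H conj(Q),   G = conj(S) Q + H conj(P)   ([sym_PQ]).

    Put T = P^-1 Q, H' = P^T H conj(P), S' = P^T conj(S) P.  Then E' = P^T E
    and N = P^T G - E' T are holomorphic, with E' = S' + H' conj(T) and
    N = H' (1 - conj(T) T).  Hermitian symmetry of H' is an identity between
    holomorphic and antiholomorphic functions; treating zeta and conj(zeta) as
    independent variables and putting conj(zeta) = 0 forces N to be the
    constant Hermitian matrix HH = H(0).  The symmetry of S' forces E' to be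
    symmetric in the same way ([normal]).  Hence H' = HH (1 - conj(T) T)^-1
    and S' - E' = - H' conj(T), which are the two model formulas for the
    symmetric matrix SS = - T HH^-1 ([model_HE], [model_SE]).  The
    biholomorphism z = P z', w = w' + z'^T E' z' therefore carries M to the
    model ([normalize]); the CR invariants of the model are those of M, and
    the derivatives of SS are independent because a linear relation between
    them would be a vector violating 2-nondegeneracy at 0 ([nondeg_free]).

    Two analytic facts are needed on the way.  The matrices H and S are
    arbitrary functions to begin with: they are smooth because F(z, zeta) is
    minus half the second derivative in the direction z of any defining
    function of M at (0, 0, zeta), divided by its derivative in the direction
    of the real w-axis ([curve2], [extract]).  And a function of zeta that is
    complex differentiable is smooth and equal to its Taylor series, which is
    obtained from Cauchy's formula ([cauchy_avg]): the proof, in the style of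
    Goursat, works with midpoint sums on dyadic grids and represents the
    circle integral by the limit of such sums along an ultrafilter. *)

(** * The modulus of a complex number as a real number *)

Section ComplexNorm.
Variable R : realType.
Implicit Types (z w : R[i]) (t : R).

Definition cn z : R := Normc.normc z.

Lemma normr_cn z : `|z| = ((cn z)%:C)%C.
Proof. by []. Qed.

Lemma cn_ge0 z : 0 <= cn z.
Proof. by case: z => a b; rewrite /cn /= sqrtr_ge0. Qed.

Lemma cn0 : cn 0 = 0. Proof. exact: Normc.normc0. Qed.
Lemma cn1 : cn 1 = 1. Proof. exact: Normc.normc1. Qed.
Lemma cnM z w : cn (z * w) = cn z * cn w. Proof. exact: Normc.normcM. Qed.
Lemma cnV z : cn z^-1 = (cn z)^-1. Proof. exact: Normc.normcV. Qed.
Lemma cnf z w : cn (z / w) = cn z / cn w. Proof. by rewrite cnM cnV. Qed.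
Lemma cnN z : cn (- z) = cn z. Proof. exact: normcN. Qed.
Lemma cnD z w : cn (z + w) <= cn z + cn w. Proof. exact: le_normcD. Qed.
Lemma cnB z w : cn (z - w) <= cn z + cn w.
Proof. by rewrite -(cnN w) cnD. Qed.
Lemma cnC z w : cn (z - w) = cn (w - z).
Proof. by rewrite -cnN opprB. Qed.
Lemma cn_tri w z v : cn (z - v) <= cn (z - w) + cn (w - v).
Proof. by rewrite -(subrKA w) cnD. Qed.

Lemma cn_eq0 z : (cn z == 0) = (z == 0).
Proof. by apply/eqP/eqP => [/Normc.eq0_normc|->] //; rewrite cn0. Qed.

Lemma cn_gt0 z : (0 < cn z) = (z != 0).
Proof. by rewrite lt_neqAle cn_ge0 andbT eq_sym cn_eq0. Qed.

Lemma cnX z n : cn (z ^+ n) = cn z ^+ n.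
Proof. by elim: n => [|n IH]; rewrite ?expr0 ?cn1 // !exprS cnM IH. Qed.

Lemma cn_real t : cn ((t%:C)%C) = `|t|.
Proof. by rewrite /cn /= expr0n /= addr0 sqrtr_sqr. Qed.

Lemma cnJ z : cn z^* = cn z.
Proof. by have := normcJ z; rewrite !normr_cn => -[]. Qed.

Lemma cn_Re z : `|complex.Re z| <= cn z.
Proof. by have := normc_ge_Re z; rewrite normr_cn lecR. Qed.

Lemma cn_Im z : `|complex.Im z| <= cn z.
Proof.
case: z => a b; rewrite /cn /= -sqrtr_sqr ler_sqrt ?sqr_ge0 //.
  by rewrite lerDr sqr_ge0.
by rewrite addr_ge0 ?sqr_ge0.
Qed.

Lemma cni : cn 'i = 1.
Proof.
have H : cn ('i : R[i]) ^+ 2 = 1 by rewrite -cnX sqrCi cnN cn1.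
have := cn_ge0 'i; move/eqP: H; rewrite sqrf_eq1 => /orP[/eqP->//|/eqP->].
by rewrite oppr_ge0 real_leNgt ?ltr01 // ?real1 ?real0.
Qed.

Lemma iE : 'i = ('i)%C :> R[i].
Proof. by []. Qed.

Lemma cn_ReIm z : cn z <= `|complex.Re z| + `|complex.Im z|.
Proof.
rewrite {1}[z]complexE; apply: (le_trans (cnD _ _)).
by rewrite cnM -iE cni mul1r !cn_real.
Qed.

Lemma cn_sum (I : Type) (r : seq I) (P : pred I) (F : I -> R[i]) :
  cn (\sum_(i <- r | P i) F i) <= \sum_(i <- r | P i) cn (F i).
Proof.
elim/big_rec2: _ => [|i y x _ IH]; first by rewrite cn0.
by apply: (le_trans (cnD _ _)); rewrite lerD2l.
Qed.

Lemma cn_nat n : cn n%:R = n%:R.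
Proof.
have -> : n%:R = ((n%:R : R)%:C)%C :> R[i] by rewrite rmorph_nat.
by rewrite cn_real normr_nat.
Qed.

Lemma Re_add z w : complex.Re (z + w) = complex.Re z + complex.Re w.
Proof. by case: z; case: w. Qed.
Lemma Im_add z w : complex.Im (z + w) = complex.Im z + complex.Im w.
Proof. by case: z; case: w. Qed.
Lemma Re_opp z : complex.Re (- z) = - complex.Re z.
Proof. by case: z. Qed.
Lemma Im_opp z : complex.Im (- z) = - complex.Im z.
Proof. by case: z. Qed.
Lemma Re_mul z w : complex.Re (z * w) =
  complex.Re z * complex.Re w - complex.Im z * complex.Im w.
Proof. by case: z; case: w. Qed.
Lemma Im_mul z w : complex.Im (z * w) =
  complex.Re z * complex.Im w + complex.Im z * complex.Re w.
Proof. by case: z; case: w. Qed.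
Lemma conjE z : z^* = Complex (complex.Re z) (- complex.Im z).
Proof. by case: z. Qed.

End ComplexNorm.

Section Neighborhoods.
Variable R : realType.

Lemma posC_ex (e : R[i]) : 0 < e -> exists2 d : R, 0 < d & e = (d%:C)%C.
Proof.
move=> e0; exists (complex.Re e).
  by move: e0; rewrite ltcE => /andP[_].
by rewrite RRe_real // realE (ltW e0).
Qed.

Lemma ltcn (z : R[i]) (d : R) : (`|z| < (d%:C)%C) = (cn z < d).
Proof. by rewrite normr_cn ltcR. Qed.

Lemma nbhs_cvP N (x : 'cV[R[i]]_N) (A : set 'cV[R[i]]_N) :
  nbhs x A <-> exists2 d : R, 0 < d &
    forall y : 'cV[R[i]]_N, (forall j, cn (y j 0 - x j 0) < d) -> A y.
Proof.
split=> [/nbhs_ballP[e e0 H]|[d d0 H]].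
  have [d d0 ed] := posC_ex e0; exists d => // y Hy; apply: H.
  split => [|i j]; first exact: e0.
  by rewrite /ball /= !ord1 ed ltcn cnC; apply: Hy.
apply/nbhs_ballP; exists ((d%:C)%C) => /=; first by rewrite ltcR.
by move=> y [_ Hy]; apply: H => j; rewrite cnC -ltcn; apply: Hy.
Qed.

Lemma nbhs_CP (x : R[i]) (A : set R[i]) :
  nbhs x A <-> exists2 d : R, 0 < d & forall y, cn (y - x) < d -> A y.
Proof.
split=> [/nbhs_ballP[e e0 H]|[d d0 H]].
  have [d d0 ed] := posC_ex e0; exists d => // y Hy; apply: H.
  by rewrite /ball /= ed distrC ltcn.
apply/nbhs_ballP; exists ((d%:C)%C) => /=; first by rewrite ltcR.
by move=> y; rewrite /ball /= distrC ltcn; apply: H.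
Qed.

End Neighborhoods.

(** * Goursat's theorem for dyadic midpoint sums *)

Section Goursat.
Variable R : realType.
Local Notation C := R[i].

Definition midpt (n j : nat) : R := (j%:R + 2^-1) / 2 ^+ n.

Definition midsum (n : nat) (a l : R) (g : R -> C) : C :=
  (((l / 2 ^+ n)%:C)%C) * \sum_(j < 2 ^ n) g (a + l * midpt n j).

Lemma midsum_split n a l g :
  midsum n.+1 a l g = midsum n a (l / 2) g + midsum n (a + l / 2) (l / 2) g.
Proof.
have E2 : 2 ^+ n.+1 = 2 * 2 ^+ n :> R by rewrite exprS.
have p0 : 2 ^+ n != 0 :> R by rewrite expf_neq0 ?pnatr_eq0.
have El : l / 2 ^+ n.+1 = l / 2 / 2 ^+ n by rewrite E2; field.
rewrite /midsum -mulrDr El expnS mul2n -addnn big_split_ord /=; congr (_ * (_ + _)).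
  by apply: eq_bigr => j _; congr (g (_ + _)); rewrite /midpt E2; field.
apply: eq_bigr => j _; congr g.
rewrite /midpt E2 natrD natrX; field; exact: p0.
Qed.

Lemma midsumD n a l g h : midsum n a l (fun t => g t + h t) = midsum n a l g + midsum n a l h.
Proof. by rewrite /midsum big_split mulrDr. Qed.

Lemma midsumZ n a l c g : midsum n a l (fun t => c * g t) = c * midsum n a l g.
Proof. by rewrite /midsum -mulr_sumr mulrCA. Qed.

Lemma midsum_eq n a l g h : (forall t, g t = h t) -> midsum n a l g = midsum n a l h.
Proof. by move=> gh; rewrite /midsum; under eq_bigr do rewrite gh. Qed.

Lemma midpt_bounds n j : (j < 2 ^ n)%N -> 0 <= midpt n j <= 1.
Proof.
move=> jn; have p0 : 0 < 2 ^+ n :> R by rewrite exprn_gt0.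
have jn' : j%:R + 1 <= 2 ^+ n :> R.
  by rewrite -natrX -[1]/(1%:R) -natrD addn1 ler_nat.
have j0 : 0 <= j%:R :> R by [].
by rewrite /midpt divr_ge0 ?(ltW p0) //= ?ler_pdivrMr //; lra.
Qed.

Lemma midsum_bound n a l g M : 0 <= l ->
  (forall t, a <= t <= a + l -> cn (g t) <= M) -> cn (midsum n a l g) <= l * M.
Proof.
move=> l0 H; have p0 : 0 < 2 ^+ n :> R by rewrite exprn_gt0.
rewrite /midsum cnM cn_real ger0_norm ?divr_ge0 ?(ltW p0) //.
have /le_trans : cn (\sum_(j < 2 ^ n) g (a + l * midpt n j)) <= 2 ^+ n * M.
  apply: (le_trans (cn_sum _ _ _)).
  apply: (@le_trans _ _ (\sum_(j < 2 ^ n) M)); last first.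
    by rewrite sumr_const card_ord -natrX mulr_natl.
  apply: ler_sum => j _; apply: H.
  have /andP[m0 m1] := midpt_bounds (ltn_ord j).
  by rewrite lerDl mulr_ge0 //= lerD2l ler_piMr.
move=> H2; rewrite mulrAC ler_pdivrMr // -mulrA ler_wpM2l // [M * _]mulrC.
exact: H2.
Qed.

Lemma sum_midpt n : \sum_(j < 2 ^ n) midpt n j = 2 ^+ n / 2.
Proof.
have p0 : 2 ^+ n != 0 :> R by rewrite expf_neq0 ?pnatr_eq0.
rewrite -mulr_suml.
have -> : forall m, \sum_(j < m) (j%:R + 2^-1) = m%:R ^+ 2 / 2 :> R.
  elim=> [|m IH]; first by rewrite big_ord0 expr0n mul0r.
  by rewrite big_ord_recr /= IH -addn1 natrD; field.
by rewrite natrX; field.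
Qed.

(** Midpoint sums integrate affine functions exactly, so that no error term appears in [small_good]. *)
Lemma midsum_affine n a l c d :
  midsum n a l (fun t => c + (t%:C)%C * d) = ((l%:C)%C) * (c + ((a + l / 2)%:C)%C * d).
Proof.
have p0 : 2 ^+ n != 0 :> R by rewrite expf_neq0 ?pnatr_eq0.
have q0 : (((2 ^+ n)%:C)%C : C) != 0 by rewrite -(rmorph0 (real_complex R)) (inj_eq (@complexI R)).
rewrite /midsum.
have -> : \sum_(j < 2 ^ n) (c + (((a + l * midpt n j)%:C)%C) * d) =
   (((2 ^+ n)%:C)%C) * c + (((2 ^+ n * a + l * (2 ^+ n / 2))%:C)%C) * d.
  rewrite big_split /= -mulr_suml sumr_const card_ord -sum_midpt.
  congr (_ + _ * _).
    have -> : (((2 ^+ n)%:C)%C : C) = ((2 ^ n)%N)%:R by rewrite -natrX rmorph_nat.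
    by rewrite mulr_natl.
  rewrite -(rmorph_sum (real_complex R)) /=; congr ((_)%:C)%C.
  by rewrite big_split /= -mulr_sumr sumr_const card_ord -natrX mulr_natl.
rewrite !rmorphM /= !rmorphD /= !rmorphM /= !fmorphV /=; field.
exact: q0.
Qed.

Variables (P Q : R -> R -> C).

(** The midpoint sum of P du + Q dv around the boundary of a square of side [l] with lower left corner (a, b), with [2 ^ n] points on each side. *)
Definition bsum (n : nat) (a b l : R) : C :=
  midsum n a l (fun t => P t b) - midsum n a l (fun t => P t (b + l))
  + (midsum n b l (Q (a + l)) - midsum n b l (Q a)).

(** The sums over the interior sides of the four half-size squares cancel, at the price of one level of refinement. *)
Lemma bsum_split n a b l : bsum n.+1 a b l =
  bsum n a b (l / 2) + bsum n (a + l / 2) b (l / 2)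
  + bsum n a (b + l / 2) (l / 2) + bsum n (a + l / 2) (b + l / 2) (l / 2).
Proof.
rewrite /bsum !midsum_split -[a + l / 2 + l / 2]addrA -[b + l / 2 + l / 2]addrA -splitr.
ring.
Qed.

(** The final estimate of Goursat's argument, scaled by the area of the square so that it is inherited by a square from its four quarters. *)
Definition good (e a b l : R) :=
  exists n0, forall n, (n0 <= n)%N -> cn (bsum n a b l) <= e * l ^+ 2.

Lemma good_split e a b l :
  good e a b (l / 2) -> good e (a + l / 2) b (l / 2) ->
  good e a (b + l / 2) (l / 2) -> good e (a + l / 2) (b + l / 2) (l / 2) ->
  good e a b l.
Proof.
move=> [n1 H1] [n2 H2] [n3 H3] [n4 H4].
exists (maxn n1 (maxn n2 (maxn n3 n4))).+1 => -[//|n].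
rewrite ltnS !geq_max => /and4P[/H1 K1 /H2 K2 /H3 K3 /H4 K4].
rewrite bsum_split.
apply: (le_trans (cnD _ _)); apply: (@le_trans _ _ (cn (bsum n a b (l / 2)) +
  cn (bsum n (a + l / 2) b (l / 2)) + cn (bsum n a (b + l / 2) (l / 2)) +
  cn (bsum n (a + l / 2) (b + l / 2) (l / 2)))).
  rewrite lerD2r; apply: (le_trans (cnD _ _)); rewrite lerD2r; exact: cnD.
have -> : e * l ^+ 2 = e * (l / 2) ^+ 2 + e * (l / 2) ^+ 2 + e * (l / 2) ^+ 2 + e * (l / 2) ^+ 2.
  by field.
lra.
Qed.

(** P du + Q dv is differentiable at (u, v), with the cross derivatives equal ([Pv] occurs in both expansions): closedness of the form at a point, without continuity of the derivatives. *)
Definition closed_form_at (u v : R) := exists (Pu Pv Qv : C),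
  forall e, 0 < e -> exists2 d, 0 < d & forall u' v', 0 <= u' <= 1 -> 0 <= v' <= 1 ->
   `|u' - u| < d -> `|v' - v| < d ->
   cn (P u' v' - (P u v + ((u' - u)%:C)%C * Pu + ((v' - v)%:C)%C * Pv))
     <= e * (`|u' - u| + `|v' - v|) /\
   cn (Q u' v' - (Q u v + ((u' - u)%:C)%C * Pv + ((v' - v)%:C)%C * Qv))
     <= e * (`|u' - u| + `|v' - v|).

(** Around a point where the form is closed, its linear part has zero boundary sum and the remainder is small relative to the size of the square. *)
Lemma small_good u v e : closed_form_at u v -> 0 < e ->
  exists2 d, 0 < d & forall a b l, 0 < l -> l < d -> 0 <= a -> a + l <= 1 ->
   0 <= b -> b + l <= 1 -> a <= u <= a + l -> b <= v <= b + l -> good e a b l.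
Proof.
move=> [Pu [Pv [Qv H]]] e0.
have [|d d0 {}H] := H (e / 8); first by rewrite divr_gt0.
exists d => // a b l l0 ld a0 al b0 bl /andP[ua ua'] /andP[vb vb'].
exists 0%N => n _.
pose P' t s := P u v + ((t - u)%:C)%C * Pu + ((s - v)%:C)%C * Pv.
pose Q' t s := Q u v + ((t - u)%:C)%C * Pv + ((s - v)%:C)%C * Qv.
have HP t s : a <= t <= a + l -> b <= s <= b + l ->
    cn (P t s - P' t s) <= e / 4 * l /\ cn (Q t s - Q' t s) <= e / 4 * l.
  move=> /andP[t1 t2] /andP[s1 s2].
  have tl : `|t - u| <= l by rewrite ler_norml; lra.
  have sl : `|s - v| <= l by rewrite ler_norml; lra.
  have [| | | |H1 H2] := H t s; try (apply/andP; lra); try lra.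
  have K : e / 8 * (`|t - u| + `|s - v|) <= e / 4 * l.
    have -> : e / 4 * l = e / 8 * (l + l) by field.
    by rewrite ler_wpM2l ?divr_ge0 ?(ltW e0) //; lra.
  split; [exact: le_trans H1 K|exact: le_trans H2 K].
have aff : bsum n a b l =
  midsum n a l (fun t => P t b - P' t b) - midsum n a l (fun t => P t (b + l) - P' t (b + l))
  + (midsum n b l (fun s => Q (a + l) s - Q' (a + l) s)
     - midsum n b l (fun s => Q a s - Q' a s)).
  have sB g h x : midsum n x l (fun t => g t - h t) = midsum n x l g - midsum n x l h.
    by rewrite /midsum sumrB mulrBr.
  rewrite /bsum !sB.
  have affP s : midsum n a l (fun t => P' t s) = ((l%:C)%C) *
      (P u v + ((s - v)%:C)%C * Pv - ((u%:C)%C) * Pu + ((a + l / 2)%:C)%C * Pu).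
    by rewrite -(midsum_affine n); apply: midsum_eq => t; rewrite /P' !rmorphB /=; ring.
  have affQ t : midsum n b l (Q' t) = ((l%:C)%C) *
      (Q u v + ((t - u)%:C)%C * Pv - ((v%:C)%C) * Qv + ((b + l / 2)%:C)%C * Qv).
    by rewrite -(midsum_affine n); apply: midsum_eq => s; rewrite /Q' !rmorphB /=; ring.
  rewrite !affP !affQ !rmorphB !rmorphD /=; ring.
have B1 g x : (forall t, x <= t <= x + l -> cn (g t) <= e / 4 * l) ->
   cn (midsum n x l g) <= e / 4 * l ^+ 2.
  by move=> Hg; rewrite expr2 mulrA mulrC; apply: midsum_bound Hg; rewrite ltW.
have bb : b <= b <= b + l by apply/andP; lra.
have bb' : b <= b + l <= b + l by apply/andP; lra.
have aa : a <= a <= a + l by apply/andP; lra.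
have aa' : a <= a + l <= a + l by apply/andP; lra.
have K1 := B1 _ a (fun t ht => (HP t b ht bb).1).
have K2 := B1 _ a (fun t ht => (HP t (b + l) ht bb').1).
have K3 := B1 _ b (fun s hs => (HP (a + l) s aa' hs).2).
have K4 := B1 _ b (fun s hs => (HP a s aa hs).2).
rewrite aff.
apply: (le_trans (cnD _ _)).
have -> : e * l ^+ 2 = (e / 4 * l ^+ 2 + e / 4 * l ^+ 2) + (e / 4 * l ^+ 2 + e / 4 * l ^+ 2).
  by field.
by apply: lerD; apply: (le_trans (cnB _ _)); apply: lerD.
Qed.

Theorem goursat :
  (forall u v, 0 <= u <= 1 -> 0 <= v <= 1 -> closed_form_at u v) ->
  forall e, 0 < e -> exists n0, forall n, (n0 <= n)%N -> cn (bsum n 0 0 1) <= e.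
Proof.
move=> H e e0; apply: contrapT => Hn.
have bad0 : ~ good e 0 0 1 by rewrite /good expr1n mulr1.
pose st := (R * R)%type.
pose ok (n : nat) (p : st) := [/\ 0 <= p.1, p.1 + 2 ^- n <= 1, 0 <= p.2, p.2 + 2 ^- n <= 1 &
   ~ good e p.1 p.2 (2 ^- n)].
have step n (p : st) : {q : st | ok n p -> ok n.+1 q /\
    (p.1 <= q.1 /\ q.1 + 2 ^- n.+1 <= p.1 + 2 ^- n) /\
    (p.2 <= q.2 /\ q.2 + 2 ^- n.+1 <= p.2 + 2 ^- n)}.
  apply: cid.
  have [okp|] := pselect (ok n p); last by move=> np; exists p.
  case: okp => p1 p1' p2 p2' bad.
  have l0 : 0 < 2 ^- n :> R by rewrite invr_gt0 exprn_gt0.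
  have El : 2 ^- n.+1 = 2 ^- n / 2 :> R by rewrite exprSr invfM mulrC.
  apply: contrapT => /forallNP Hq; apply: bad; apply: good_split.
  - apply: contrapT => bad; apply: (Hq (p.1, p.2)) => _; rewrite /ok El /=.
    by split; [split => //|split]; lra.
  - apply: contrapT => bad; apply: (Hq (p.1 + 2 ^- n / 2, p.2)) => _; rewrite /ok El /=.
    by split; [split => //|split]; lra.
  - apply: contrapT => bad; apply: (Hq (p.1, p.2 + 2 ^- n / 2)) => _; rewrite /ok El /=.
    by split; [split => //|split]; lra.
  - apply: contrapT => bad; apply: (Hq (p.1 + 2 ^- n / 2, p.2 + 2 ^- n / 2)) => _; rewrite /ok El /=.
    by split; [split => //|split]; lra.
pose s := fix s n : st := if n is m.+1 then projT1 (step m (s m)) else (0, 0).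
have sok n : ok n (s n).
  elim: n => [|n IH]; first by rewrite /ok /= expr0 invr1 add0r; split.
  by have [] := projT2 (step n (s n)) IH.
have sS n : ((s n).1 <= (s n.+1).1 /\ (s n.+1).1 + 2 ^- n.+1 <= (s n).1 + 2 ^- n) /\
            ((s n).2 <= (s n.+1).2 /\ (s n.+1).2 + 2 ^- n.+1 <= (s n).2 + 2 ^- n).
  by have [_] := projT2 (step n (s n)) (sok n).
have mono (x : nat -> R) : (forall n, x n <= x n.+1 /\ x n.+1 + 2 ^- n.+1 <= x n + 2 ^- n) ->
   exists p, forall n, x n <= p <= x n + 2 ^- n.
  move=> Hx.
  have up n k : x n <= x (n + k)%N.
    elim: k => [|k IH]; first by rewrite addn0.
    by rewrite addnS; apply: (le_trans IH); case: (Hx (n + k)%N).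
  have dn n k : x (n + k)%N + 2 ^- (n + k) <= x n + 2 ^- n.
    elim: k => [|k IH]; first by rewrite addn0.
    by rewrite addnS; apply: (le_trans _ IH); case: (Hx (n + k)%N).
  have l0 n : 0 < 2 ^- n :> R by rewrite invr_gt0 exprn_gt0.
  have xle m n : x m <= x n + 2 ^- n.
    case: (leqP m n) => mn.
      have := up m (n - m)%N; rewrite subnKC // => K; have := l0 n; lra.
    have := dn n (m - n)%N; rewrite subnKC ?(ltnW mn) // => K; have := l0 m; lra.
  exists (sup (range x)) => n; apply/andP; split.
    apply: ub_le_sup; last by exists n.
    by exists (x 0%N + 2 ^- 0) => _ [m _ <-].
  apply: ge_sup; first by exists (x 0%N); exists 0%N.
  by move=> _ [m _ <-].
have [u Hu] := mono (fun n => (s n).1) (fun n => (sS n).1).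
have [v Hv] := mono (fun n => (s n).2) (fun n => (sS n).2).
have u01 : 0 <= u <= 1.
  have [? ? ? ? _] := sok 0%N; have /andP[? ?] := Hu 0%N; apply/andP; lra.
have v01 : 0 <= v <= 1.
  have [? ? ? ? _] := sok 0%N; have /andP[? ?] := Hv 0%N; apply/andP; lra.
have [d d0 Hd] := small_good (H u v u01 v01) e0.
have [n Hnd] : exists n, 2 ^- n < d :> R.
  have [n Hn'] := ltr_add_invr (y := 0) (x := d) d0; rewrite add0r in Hn'.
  exists n; apply: le_lt_trans Hn'; rewrite lef_pV2 ?posrE ?exprn_gt0 //.
  by rewrite -natrX ler_nat ltn_expl.
have [k1 k2 k3 k4 bad] := sok n; apply: bad; apply: Hd => //.
Qed.

End Goursat.

(** * First-order expansions *)

Section Frechet.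
Variables (R : realType) (T : Type) (sz : T -> R) (p : T).
Hypothesis sz_ge0 : forall q, 0 <= sz q.
Local Notation C := R[i].
Implicit Types (g h : T -> C).

(** [L] is the differential of [g] at [p], with [sz] measuring the distance to [p]: [L] is bounded by [sz] and the error is o(sz). *)
Definition fr g (L : T -> C) :=
  (exists2 K, 0 <= K & forall q, cn (L q) <= K * sz q) /\
  forall e, 0 < e -> exists2 d, 0 < d & forall q, sz q < d ->
    cn (g q - g p - L q) <= e * sz q.

Lemma fr_eq g L L' : (forall q, L q = L' q) -> fr g L -> fr g L'.
Proof.
move=> E [[K K0 HK] H]; split; first by exists K => // q; rewrite -E.
by move=> e /H[d d0 Hd]; exists d => // q; rewrite -E; apply: Hd.
Qed.

Lemma fr_lip g L : fr g L -> exists2 K, 0 <= K & exists2 d, 0 < d &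
  forall q, sz q < d -> cn (g q - g p) <= K * sz q.
Proof.
move=> [[K K0 HK] H]; exists (K + 1); first by rewrite addr_ge0.
have [d d0 Hd] := H 1 ltr01; exists d => // q /Hd H1.
rewrite -[g q - g p](subrK (L q)) mulrDl mul1r addrC.
by apply: (le_trans (cnD _ _)); rewrite lerD // ?(le_trans H1) // mul1r.
Qed.

Lemma fr_cst c : fr (fun=> c) (fun=> 0).
Proof.
split; first by exists 0 => // q; rewrite cn0 mul0r.
by move=> e e0; exists 1 => // q _; rewrite !subrr cn0 mulr_ge0 // ltW.
Qed.

Lemma fr_add g h L M : fr g L -> fr h M ->
  fr (fun q => g q + h q) (fun q => L q + M q).
Proof.
move=> [[K K0 HK] Hg] [[K' K0' HK'] Hh]; split.
  exists (K + K'); first by rewrite addr_ge0.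
  by move=> q; rewrite mulrDl; apply: (le_trans (cnD _ _)); rewrite lerD.
move=> e e0.
have [|d d0 Hd] := Hg (e / 2); first by rewrite divr_gt0.
have [|d' d0' Hd'] := Hh (e / 2); first by rewrite divr_gt0.
exists (Num.min d d'); first by rewrite lt_min d0.
move=> q; rewrite lt_min => /andP[/Hd H1 /Hd' H2].
have -> : g q + h q - (g p + h p) - (L q + M q) =
  (g q - g p - L q) + (h q - h p - M q) by ring.
apply: (le_trans (cnD _ _)); have -> : e * sz q = e / 2 * sz q + e / 2 * sz q by field.
exact: lerD.
Qed.

Lemma fr_mul g h L M : fr g L -> fr h M ->
  fr (fun q => g q * h q) (fun q => L q * h p + g p * M q).
Proof.
move=> Fg Fh.
have [Kg Kg0 [dg dg0 Hg]] := fr_lip Fg; have [Kh Kh0 [dh dh0 Hh]] := fr_lip Fh.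
case: Fg Fh => [[K K0 HK] Fg] [[K' K0' HK'] Fh]; split.
  exists (K * cn (h p) + cn (g p) * K').
    by rewrite addr_ge0 ?mulr_ge0 ?cn_ge0.
  move=> q; apply: (le_trans (cnD _ _)); rewrite !cnM mulrDl lerD //.
    by rewrite [_ * _ * sz q]mulrAC ler_wpM2r ?cn_ge0.
  by rewrite -mulrA ler_wpM2l ?cn_ge0.
move=> e e0.
pose A := cn (h p) + cn (g p) + 1.
have A0 : 0 < A by rewrite /A; have := cn_ge0 (h p); have := cn_ge0 (g p); lra.
have [|d d0 Hd] := Fg (e / 3 / A); first by rewrite !divr_gt0.
have [|d' d0' Hd'] := Fh (e / 3 / A); first by rewrite !divr_gt0.
pose B := Kg * Kh + 1.
have B0 : 0 < B by rewrite /B; have := mulr_ge0 Kg0 Kh0; lra.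
exists (Num.min (Num.min d d') (Num.min (Num.min dg dh) (e / 3 / B))).
  by rewrite !lt_min d0 d0' dg0 dh0 !divr_gt0.
move=> q; rewrite !lt_min => /andP[/andP[/Hd H1 /Hd' H2] /andP[/andP[/Hg H3 /Hh H4] H5]].
have -> : g q * h q - g p * h p - (L q * h p + g p * M q) =
  (g q - g p - L q) * h p + g p * (h q - h p - M q) + (g q - g p) * (h q - h p) by ring.
have -> : e * sz q = e / 3 * sz q + e / 3 * sz q + e / 3 * sz q by field.
have S := sz_ge0 q.
apply: (le_trans (cnD _ _)); rewrite lerD //.
  apply: (le_trans (cnD _ _)); rewrite !cnM lerD //.
    apply: (le_trans (ler_wpM2r (cn_ge0 _) H1)).
    have -> : e / 3 / A * sz q * cn (h p) = e / 3 * sz q * (cn (h p) / A) by field; rewrite lt0r_neq0.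
    rewrite ler_piMr ?mulr_ge0 ?divr_ge0 ?(ltW e0) // ler_pdivrMr // mul1r /A.
    by have := cn_ge0 (g p); lra.
  apply: (le_trans (ler_wpM2l (cn_ge0 _) H2)).
  have -> : cn (g p) * (e / 3 / A * sz q) = e / 3 * sz q * (cn (g p) / A) by field; rewrite lt0r_neq0.
  rewrite ler_piMr ?mulr_ge0 ?divr_ge0 ?(ltW e0) // ler_pdivrMr // mul1r /A.
  by have := cn_ge0 (h p); lra.
rewrite cnM.
apply: (@le_trans _ _ ((Kg * sz q) * (Kh * sz q))).
  by rewrite ler_pM ?cn_ge0.
have -> : Kg * sz q * (Kh * sz q) = (Kg * Kh * sz q) * sz q by ring.
rewrite ler_wpM2r //.
apply: (@le_trans _ _ (B * sz q)); first by rewrite ler_wpM2r // /B lerDl.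
by rewrite mulrC -ler_pdivlMr // ltW.
Qed.

(** Complex differentiability at [z] with derivative [l]. *)
Definition cdiff (f : C -> C) (z l : C) := forall e, 0 < e -> exists2 d, 0 < d &
  forall w, cn (w - z) < d -> cn (f w - f z - l * (w - z)) <= e * cn (w - z).

Lemma fr_comp g L f l : fr g L -> cdiff f (g p) l -> fr (fun q => f (g q)) (fun q => l * L q).
Proof.
move=> Fg Hf; have [Kg Kg0 [dg dg0 Hg]] := fr_lip Fg.
case: Fg => [[K K0 HK] Fg]; split.
  exists (cn l * K); first by rewrite mulr_ge0 ?cn_ge0.
  by move=> q; rewrite cnM -mulrA ler_wpM2l ?cn_ge0.
move=> e e0.
pose B := Kg + 1; have B0 : 0 < B by rewrite /B; lra.
pose A := cn l + 1; have A0 : 0 < A by rewrite /A; have := cn_ge0 l; lra.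
have [|d d0 Hd] := Hf (e / 2 / B); first by rewrite !divr_gt0.
have [|d' d0' Hd'] := Fg (e / 2 / A); first by rewrite !divr_gt0.
exists (Num.min d' (Num.min dg (d / B))); first by rewrite !lt_min d0' dg0 divr_gt0.
move=> q; rewrite !lt_min => /andP[/Hd' H1 /andP[/Hg H2 H3]].
have S := sz_ge0 q.
have H2' : cn (g q - g p) <= B * sz q.
  by apply: (le_trans H2); rewrite ler_wpM2r // /B; lra.
have H4 : cn (g q - g p) < d.
  by apply: (le_lt_trans H2'); rewrite mulrC -ltr_pdivlMr.
have -> : f (g q) - f (g p) - l * L q =
   (f (g q) - f (g p) - l * (g q - g p)) + l * (g q - g p - L q) by ring.
have -> : e * sz q = e / 2 * sz q + e / 2 * sz q by field.
apply: (le_trans (cnD _ _)); apply: lerD.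
  apply: (le_trans (Hd _ H4)); apply: (@le_trans _ _ (e / 2 / B * (B * sz q))).
    by rewrite ler_wpM2l // !divr_ge0 ?(ltW e0) ?(ltW B0).
  by rewrite mulrA divfK // lt0r_neq0.
rewrite cnM; apply: (le_trans (ler_wpM2l (cn_ge0 _) H1)).
have -> : cn l * (e / 2 / A * sz q) = e / 2 * sz q * (cn l / A) by field; rewrite lt0r_neq0.
by rewrite ler_piMr ?mulr_ge0 ?divr_ge0 ?(ltW e0) // ler_pdivrMr // mul1r /A; lra.
Qed.

End Frechet.

Section ComplexDiff.
Variable R : realType.
Local Notation C := R[i].

Lemma cdiff_inv (z : C) : z != 0 -> cdiff (fun w => w^-1) z (- z ^- 2).
Proof.
move=> z0 e e0; have c0 : 0 < cn z by rewrite cn_gt0.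
exists (Num.min (cn z / 2) (e * cn z ^+ 3 / 2)).
  by rewrite lt_min !divr_gt0 ?mulr_gt0 ?exprn_gt0.
move=> w; rewrite lt_min => /andP[w1 w2].
have cw : cn z / 2 < cn w.
  have := cn_tri w z 0; rewrite !subr0 cnC => H; lra.
have w0 : w != 0 by rewrite -cn_gt0; apply: lt_trans cw; rewrite divr_gt0.
have -> : w^-1 - z^-1 - - z ^- 2 * (w - z) = (w - z) ^+ 2 / (w * z ^+ 2).
  by field; rewrite w0 z0.
rewrite cnf cnX [cn (w * _)]cnM cnX expr2 -mulrA mulrC ler_wpM2r ?cn_ge0 //.
rewrite ler_pdivrMr ?mulr_gt0 ?exprn_gt0 //; last by rewrite cn_gt0.
apply: (le_trans (ltW w2)).
have -> : e * cn z ^+ 3 / 2 = e * (cn z / 2 * cn z ^+ 2) by field.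
by rewrite ler_wpM2l ?(ltW e0) // ler_wpM2r ?exprn_ge0 ?cn_ge0 // ltW.
Qed.

Lemma is_derive_lo (g : R -> R) (t l : R) : is_derive t 1 g l ->
  forall e, 0 < e -> exists2 d, 0 < d & forall t', `|t' - t| < d ->
   `|g t' - g t - l * (t' - t)| <= e * `|t' - t|.
Proof.
move=> [dg <-] e e0.
have /cvgrPdist_lt/(_ e e0) := dg.
move=> /nbhs_ballP[d /= d0 Hd]; exists d => // t' Ht.
have [->|tt] := eqVneq t' t; first by rewrite !subrr mulr0 subr0 normr0 mulr0.
have t0 : t' - t != 0 by rewrite subr_eq0.
have {}Ht : ball 0 d (t' - t) by rewrite /ball /= distrC subr0.
have := Hd (t' - t) Ht t0; rewrite /= scaler1 subrK => H.
have -> : g t' - g t - 'D_1 g t * (t' - t) =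
  - (('D_1 g t - (t' - t)^-1 *: (g t' - g t)) * (t' - t)).
  by rewrite /GRing.scale /=; field; apply/eqP => h; case/eqP: t0.
by rewrite normrN normrM ler_wpM2r // ltW.
Qed.

Definition cis (t : R) : C := Complex (cos t) (sin t).

Lemma cisD s t : cis (s + t) = cis s * cis t.
Proof. by rewrite /cis cosD sinD; congr Complex; rewrite addrC. Qed.

Lemma cis0 : cis 0 = 1. Proof. by rewrite /cis cos0 sin0. Qed.

Lemma cn_cis t : cn (cis t) = 1.
Proof. by rewrite /cn /= cos2Dsin2 sqrtr1. Qed.

Lemma cis_neq0 t : cis t != 0.
Proof. by rewrite -cn_gt0 cn_cis. Qed.

Lemma cis_lo t e : 0 < e -> exists2 d, 0 < d & forall t', `|t' - t| < d ->
  cn (cis t' - cis t - ((t' - t)%:C)%C * ('i * cis t)) <= e * `|t' - t|.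
Proof.
move=> e0; have e2 : 0 < e / 2 by rewrite divr_gt0.
have [d d0 Hd] := is_derive_lo (is_derive_cos t) e2.
have [d' d0' Hd'] := is_derive_lo (is_derive_sin t) e2.
exists (Num.min d d'); first by rewrite lt_min d0.
move=> t'; rewrite lt_min => /andP[/Hd H1 /Hd' H2].
apply: (le_trans (cn_ReIm _)).
have -> : e * `|t' - t| = e / 2 * `|t' - t| + e / 2 * `|t' - t| by field.
rewrite !(Re_add, Im_add, Re_opp, Im_opp, Re_mul, Im_mul) /=.
apply: lerD.
  have -> : cos t' - cos t - ((t' - t) * (0 * cos t - 1 * sin t) - 0 * (0 * sin t + 1 * cos t))
    = cos t' - cos t - - sin t * (t' - t) by ring.
  exact: H1.
have -> : sin t' - sin t - ((t' - t) * (0 * sin t + 1 * cos t) + 0 * (0 * cos t - 1 * sin t))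
    = sin t' - sin t - cos t * (t' - t) by ring.
exact: H2.
Qed.

End ComplexDiff.

Arguments fr_cst {R T sz p}.

(** * Deforming a circle to a point *)

Section Cauchy.
Variable R : realType.
Local Notation C := R[i].

Definition sz2 (p q : R * R) : R := `|q.1 - p.1| + `|q.2 - p.2|.

Lemma sz2_ge0 p q : 0 <= sz2 p q.
Proof. by rewrite addr_ge0. Qed.

Lemma fr_fst p : fr (sz2 p) p (fun q => (q.1%:C)%C : C) (fun q => ((q.1 - p.1)%:C)%C).
Proof.
split; first by exists 1 => // q; rewrite cn_real mul1r lerDl.
move=> e e0; exists 1 => // q _.
by rewrite rmorphB subrr cn0 mulr_ge0 ?sz2_ge0 ?ltW.
Qed.

Lemma fr_cis2 p (c : R) : 0 < c ->
  fr (sz2 p) p (fun q => cis (c * q.2))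
     (fun q => ((q.2 - p.2)%:C)%C * (((c%:C)%C) * 'i * cis (c * p.2))).
Proof.
move=> c0; split.
  exists c => [|q]; first exact: ltW.
  rewrite !cnM cni cn_cis !cn_real mulr1 mulr1 mulrC (ger0_norm (ltW c0)).
  by rewrite ler_wpM2l ?(ltW c0) // lerDr.
move=> e e0; have ec : 0 < e / c by rewrite divr_gt0.
have [d d0 Hd] := cis_lo (c * p.2) ec.
exists (d / c) => [|q Hq]; first by rewrite divr_gt0.
have q2 : `|q.2 - p.2| <= sz2 p q by rewrite lerDr.
have := Hd (c * q.2); rewrite -mulrBr normrM (gtr0_norm c0) mulrC -ltr_pdivlMr //.
move=> /(_ (le_lt_trans q2 Hq)) H.
have -> : cis (c * q.2) - cis (c * p.2) - ((q.2 - p.2)%:C)%C * (((c%:C)%C) * 'i * cis (c * p.2))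
  = cis (c * q.2) - cis (c * p.2) - ((c * (q.2 - p.2))%:C)%C * ('i * cis (c * p.2)).
  by rewrite rmorphM /=; ring.
apply: (le_trans H).
by rewrite [X in _ * X]mulrC mulrA divfK ?lt0r_neq0 // ler_wpM2l // ltW.
Qed.

(** The closedness condition in terms of first-order expansions. *)
Lemma closed_of_fr (P Q : R -> R -> C) u v Pu Pv Qv :
  fr (sz2 (u, v)) (u, v) (fun q => P q.1 q.2)
    (fun q => ((q.1 - u)%:C)%C * Pu + ((q.2 - v)%:C)%C * Pv) ->
  fr (sz2 (u, v)) (u, v) (fun q => Q q.1 q.2)
    (fun q => ((q.1 - u)%:C)%C * Pv + ((q.2 - v)%:C)%C * Qv) ->
  closed_form_at P Q u v.
Proof.
move=> [_ HP] [_ HQ]; exists Pu, Pv, Qv => e e0.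
have [d d0 Hd] := HP e e0; have [d' d0' Hd'] := HQ e e0.
exists (Num.min d d' / 2); first by rewrite divr_gt0 // lt_min d0.
move=> u' v' _ _ hu hv.
have : sz2 (u, v) (u', v') < Num.min d d'.
  by rewrite /sz2 /= [Num.min d d']splitr ltrD.
rewrite lt_min => /andP[h1 h2].
have := Hd _ h1; have := Hd' _ h2; rewrite /= !opprD !addrA => K2 K1; split=> //.
Qed.

Variables (f : C -> C) (r : R) (x : C).
Hypothesis r0 : 0 < r.
Hypothesis xr : cn x < r.

Definition avg n (g : C -> C) : C :=
  midsum n 0 1 (fun v => g (((r%:C)%C) * cis (2 * pi * v))).

Let zz v : C := ((r%:C)%C) * cis (2 * pi * v).
Let c2 : R := 2 * pi.

Lemma c2_gt0 : 0 < c2. Proof. by rewrite mulr_gt0 // pi_gt0. Qed.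

Lemma cn_zz v : cn (zz v) = r.
Proof. by rewrite cnM cn_cis mulr1 cn_real gtr0_norm. Qed.

Lemma zz_subx v : zz v - x != 0.
Proof. by rewrite subr_eq0; apply: contraTneq xr => <-; rewrite cn_zz ltxx. Qed.

Lemma fr_zz p : fr (sz2 p) p (fun q => zz q.2)
  (fun q => ((q.2 - p.2)%:C)%C * (((c2%:C)%C) * 'i * zz p.2)).
Proof.
have := fr_mul (sz2_ge0 p) (fr_cst (sz2_ge0 p) ((r%:C)%C)) (fr_cis2 p c2_gt0).
by apply: fr_eq => q; rewrite /zz; ring.
Qed.

Section Deform.
Variable s0 : R.
Hypothesis s01 : 0 < s0 < 1.
Hypothesis fd : forall z, cn z <= r -> exists l, cdiff f z l.

Let ss (u : R) : C := (((s0 + (1 - s0) * u)%:C)%C).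
Let dss : C := (((1 - s0)%:C)%C).
Let ze (u v : R) : C := x + ss u * (zz v - x).
Let P (u v : R) : C := f (ze u v) * (dss / ss u).
Let Q (u v : R) : C := f (ze u v) * (((c2%:C)%C) * 'i * (zz v / (zz v - x))).

Lemma ss_neq0 u : 0 <= u -> ss u != 0.
Proof.
move=> u0; rewrite -cn_gt0 cn_real normr_gt0.
move: s01 => /andP[h1 h2]; apply: lt0r_neq0.
have := mulr_ge0 (_ : 0 <= 1 - s0) u0; lra.
Qed.

Lemma ze_in (u v : R) : 0 <= u <= 1 -> cn (ze u v) <= r.
Proof.
move=> /andP[u0 u1]; move: s01 => /andP[h1 h2].
have E : ze u v = (((1 - (s0 + (1 - s0) * u))%:C)%C) * x + ss u * zz v.
  by rewrite /ze /ss !(rmorphB, rmorphD, rmorphM) /= rmorph1; ring.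
have := mulr_ge0 (_ : 0 <= 1 - s0) u0 => H1.
have := ler_wpM2l (_ : 0 <= 1 - s0) u1 => H2.
have K1 : 0 <= s0 + (1 - s0) * u by lra.
have K2 : 0 <= 1 - (s0 + (1 - s0) * u) by lra.
rewrite E; apply: (le_trans (cnD _ _)).
rewrite [cn (_ * x)]cnM [cn (ss u * _)]cnM cn_zz !cn_real !ger0_norm //.
rewrite [leRHS](_ : r = (1 - (s0 + (1 - s0) * u)) * r + (s0 + (1 - s0) * u) * r); last by ring.
by rewrite lerD2r ler_wpM2l // ltW.
Qed.

Lemma PQ_closed (u v : R) : 0 <= u <= 1 -> 0 <= v <= 1 -> closed_form_at P Q u v.
Proof.
move=> hu hv; set p := (u, v).
have u0 : 0 <= u by case/andP: hu.
have S := sz2_ge0 p.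
have [l Hl] := fd (ze_in v hu).
have Fs : fr (sz2 p) p (fun q => ss q.1) (fun q => ((q.1 - u)%:C)%C * dss).
  have := fr_add (fr_cst S ((s0%:C)%C)) (fr_mul S (fr_cst S dss) (fr_fst p)).
  move=> [H1 H2]; have [K K0 HK] := H1.
  split; first by exists K => // q; have := HK q; congr (cn _ <= _); rewrite /=; ring.
  move=> e /H2[d d0 Hd]; exists d => // q /Hd; congr (cn _ <= _).
  by rewrite /ss /dss /= !(rmorphD, rmorphM, rmorphB) /=; ring.
have Fz := fr_zz p.
have Fzx : fr (sz2 p) p (fun q => zz q.2 - x)
   (fun q => ((q.2 - p.2)%:C)%C * (((c2%:C)%C) * 'i * zz p.2)).
  by apply: fr_eq (fr_add Fz (fr_cst S (- x))) => q; rewrite addr0.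
have Fze := fr_add (fr_cst S x) (fr_mul S Fs Fzx).
have Ff := fr_comp S Fze Hl.
have Fsi := fr_comp S Fs (cdiff_inv (ss_neq0 u0)).
have Fzi := fr_comp S Fzx (cdiff_inv (zz_subx v)).
have FP := fr_mul S Ff (fr_mul S (fr_cst S dss) Fsi).
have FQ := fr_mul S Ff (fr_mul S (fr_cst S (((c2%:C)%C) * 'i)) (fr_mul S Fz Fzi)).
have n1 := ss_neq0 u0; have n2 := zz_subx v.
apply: (@closed_of_fr _ _ _ _
   (l * (dss * (zz v - x)) * (dss / ss u) - f (ze u v) * (dss * ss u ^- 2 * dss))
   (l * dss * (((c2%:C)%C) * 'i * zz v))
   (l * (ss u * (((c2%:C)%C) * 'i * zz v)) * (((c2%:C)%C) * 'i * (zz v / (zz v - x)))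
     + f (ze u v) * (((c2%:C)%C) * 'i * ((((c2%:C)%C) * 'i * zz v) / (zz v - x)
         - zz v * (zz v - x) ^- 2 * (((c2%:C)%C) * 'i * zz v))))).
  apply: fr_eq FP => q; rewrite /p /= /ze.
  by move: n1 n2; move: (ss u) (zz v) dss => a b c n1 n2; field.
apply: fr_eq FQ => q; rewrite /p /= /ze.
by move: n1 n2; move: (ss u) (zz v) dss => a b c n1 n2; field.
Qed.

(** Pulling back f(z) dz / (z - x) by the homotopy that contracts the circle towards [x] gives a closed form on the unit square; its boundary sum compares the two circles. *)
Lemma deform e : 0 < e -> exists n0, forall n, (n0 <= n)%N ->
  cn (avg n (fun z => f z * (z / (z - x))) -
      avg n (fun z => f (x + ((s0%:C)%C) * (z - x)) * (z / (z - x)))) <= e.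
Proof.
move=> e0; have ec : 0 < e * c2 by rewrite mulr_gt0 // c2_gt0.
have [n0 H] := goursat PQ_closed ec; exists n0 => n /H.
have zz01 : zz (0 + 1) = zz 0.
  by rewrite /zz add0r mulr1 mulr0 cis0 mulr_natl /cis cos2pi sin2pi.
have -> : bsum P Q n 0 0 1 = (((c2%:C)%C) * 'i) *
  (avg n (fun z => f z * (z / (z - x))) -
      avg n (fun z => f (x + ((s0%:C)%C) * (z - x)) * (z / (z - x)))).
  rewrite /bsum mulrBr /avg -!midsumZ.
  have -> : midsum n 0 1 (fun t => P t 0) = midsum n 0 1 (fun t => P t (0 + 1)).
    by apply: midsum_eq => t; rewrite /P /ze zz01.
  rewrite subrr add0r; congr (_ - _); apply: midsum_eq => t; rewrite /Q /ze /ss -/(zz t).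
    have -> : s0 + (1 - s0) * (0 + 1) = 1 by ring.
    by rewrite rmorph1 mul1r addrC subrK; ring.
  by rewrite mulr0 addr0; ring.
by rewrite !cnM cni cn_real mulr1 gtr0_norm ?c2_gt0 // mulrC ler_pM2r // c2_gt0.
Qed.

End Deform.
End Cauchy.

(** * Cauchy's formula for circle means *)

Section CauchyFormula.
Variable R : realType.
Local Notation C := R[i].
Implicit Types (f g h : C -> C).

Lemma cisMn (t : R) n : cis (n%:R * t) = cis t ^+ n.
Proof.
elim: n => [|n IH]; first by rewrite mul0r cis0 expr0.
by rewrite -addn1 natrD mulrDl mul1r cisD IH addn1 exprSr.
Qed.

Lemma cis_neq1 (t : R) : 0 < t < 2 * pi -> cis t != 1.
Proof.
move=> /andP[t0 t2]; apply/eqP => -[c1 _].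
have s0 : 0 < sin (t / 2) by apply: sin_gt0_pi; apply/andP; lra.
have := cosD (t / 2) (t / 2); rewrite -splitr c1.
have := cos2Dsin2 (t / 2); nra.
Qed.

Lemma cisN (t : R) : cis (- t) = (cis t)^-1.
Proof.
apply: (mulfI (cis_neq0 t)); rewrite mulfV ?cis_neq0 // -cisD subrr; exact: cis0.
Qed.

Lemma cis_pi : cis (pi : R) = -1.
Proof. by rewrite /cis cospi sinpi; apply/eqP; rewrite eq_complex /= oppr0 !eqxx. Qed.

Lemma cis_2pi : cis (2 * pi : R) = 1.
Proof. by rewrite mulr_natl /cis cos2pi sin2pi. Qed.

Variables (r : R) (x : C).
Hypothesis r0 : 0 < r.
Hypothesis xr : cn x < r.

Let rC : C := ((r%:C)%C).
Lemma rC_neq0 : rC != 0. Proof. by rewrite -cn_gt0 cn_real normr_gt0 lt0r_neq0. Qed.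

Lemma avg_pow n k : (0 < k < 2 ^ n)%N -> avg r n (fun z => (x / z) ^+ k) = 0.
Proof.
move=> /andP[k0 kn]; rewrite /avg /midsum.
pose N : R := 2 ^+ n.
have N0 : N != 0 by rewrite expf_neq0 ?pnatr_eq0.
pose w := cis (- (2 * pi * (k%:R / N))) : C.
pose c := (x / rC) ^+ k * cis (- (2 * pi * (k%:R / N)) / 2).
rewrite (eq_bigr (fun j : 'I__ => c * w ^+ j)); last first.
  move=> j _; rewrite add0r mul1r invfM -cisN mulrA exprMn /c -[RHS]mulrA; congr (_ * _).
  rewrite -!cisMn -cisD; congr cis; rewrite /midpt -/N; field; exact: N0.
rewrite -mulr_sumr.
have w1 : w != 1.
  rewrite /w cisN invr_eq1; apply: cis_neq1.
  have Np : 0 < N by rewrite exprn_gt0.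
  have p0 := pi_gt0 R.
  rewrite !mulr_gt0 ?invr_gt0 // ?ltr0n //=.
  rewrite gtr_pMr ?mulr_gt0 // ltr_pdivrMr // mul1r /N -natrX ltr_nat //.
have : (w - 1) * \sum_(j < 2 ^ n) w ^+ j = 0.
  rewrite -subrX1 -cisMn natrX -/N.
  have -> : N * - (2 * pi * (k%:R / N)) = - (k%:R * (2 * pi)) by field; exact: N0.
  by rewrite cisN cisMn cis_2pi expr1n invr1 subrr.
by move/eqP; rewrite mulf_eq0 subr_eq0 (negbTE w1) /= => /eqP ->; rewrite !mulr0.
Qed.

Lemma avg_cst n c : avg r n (fun=> c) = c.
Proof.
rewrite /avg /midsum sumr_const card_ord mul1r -[c *+ _]mulr_natl mulrA.
have -> : (((2 ^ n)%N)%:R : C) = ((2 ^+ n)%:C)%C by rewrite -natrX rmorph_nat.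
by rewrite -rmorphM mulVf ?expf_neq0 ?pnatr_eq0 // rmorph1 mul1r.
Qed.

(** Expansion of z / (z - x) in a geometric series: only the powers that are multiples of [2 ^ n] survive averaging over the [2 ^ n] midpoints, which are the roots of z ^ (2 ^ n) = - r ^ (2 ^ n). *)
Lemma avg_kernel n :
  (1 + (x / rC) ^+ (2 ^ n)) * avg r n (fun z => z / (z - x)) = 1.
Proof.
rewrite /avg -midsumZ.
transitivity (\sum_(k < 2 ^ n) avg r n (fun z => (x / z) ^+ k)).
  rewrite /avg /midsum -[RHS]mulr_sumr exchange_big /=; congr (_ * _).
  apply: eq_bigr => j _; set z := _ * cis _.
  have z0 : z != 0 by rewrite mulf_neq0 ?cis_neq0 // rC_neq0.
  have zx : z - x != 0.
    rewrite subr_eq0; apply: contraTneq xr => <-.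
    by rewrite cnM cn_cis mulr1 cn_real gtr0_norm // ltxx.
  have zN : z ^+ (2 ^ n) = - rC ^+ (2 ^ n).
    rewrite exprMn -cisMn add0r mul1r /midpt.
    have N0 : 2 ^+ n != 0 :> R by rewrite expf_neq0 ?pnatr_eq0.
    have -> : ((2 ^ n)%N)%:R * (2 * pi * ((j%:R + 2^-1) / 2 ^+ n)) = j%:R * (2 * pi) + pi :> R.
      by rewrite natrX; field; exact: N0.
    by rewrite cisD cisMn cis_2pi expr1n mul1r cis_pi mulrN1.
  have q1 : 1 - x / z != 0.
    by rewrite -[1](divff z0) -mulrBl mulf_neq0 ?invr_eq0.
  apply: (mulfI q1).
  rewrite -[in RHS]opprB [RHS]mulNr -subrX1 opprB.
  have -> : (x / z) ^+ (2 ^ n) = - (x / rC) ^+ (2 ^ n) by rewrite !expr_div_n zN invrN mulrN.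
  rewrite opprK; field; by rewrite z0 zx.
have : (0 < 2 ^ n)%N by rewrite expn_gt0.
case: (2 ^ n)%N (@avg_pow n) => // m Hm _.
rewrite big_ord_recl big1; last by move=> k _; rewrite Hm //= /bump /= add1n ltnS.
by rewrite addr0; under [LHS]midsum_eq do rewrite expr0; exact: avg_cst.
Qed.

Lemma avg_bound n g M : (forall z, cn z = r -> cn (g z) <= M) -> cn (avg r n g) <= M.
Proof.
move=> H; rewrite -[leRHS]mul1r; apply: midsum_bound => // t _; apply: H.
by rewrite cnM cn_cis mulr1 cn_real gtr0_norm.
Qed.

Lemma geo_small (q e : R) : 0 <= q -> q < 1 -> 0 < e -> exists n0, forall n, (n0 <= n)%N -> q ^+ (2 ^ n) < e.
Proof.
move=> q0 q1 e0; have : (fun n => q ^+ n) @ \oo --> (0 : R) by apply: cvg_expr; rewrite ger0_norm.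
move=> /cvgrPdist_lt/(_ e e0)[n0 _ H]; exists n0 => n nn.
have := H (2 ^ n)%N; rewrite /= sub0r normrN ger0_norm ?exprn_ge0 //; apply.
by apply: (leq_trans nn); apply: ltnW; apply: ltn_expl.
Qed.

Lemma avg_kernel_cvg e : 0 < e -> exists n0, forall n, (n0 <= n)%N ->
  cn (avg r n (fun z => z / (z - x)) - 1) <= e.
Proof.
move=> e0; pose q := cn x / r.
have q0 : 0 <= q by rewrite divr_ge0 ?cn_ge0 ?ltW.
have q1 : q < 1 by rewrite ltr_pdivrMr // mul1r.
have h0 : 0 < Num.min (2^-1) (e / 2) by rewrite lt_min invr_gt0 divr_gt0 // ltr0n.
have [n0 H] := geo_small q0 q1 h0; exists n0 => n /H; rewrite lt_min => /andP[h1 h2].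
have := avg_kernel n; set A := avg _ _ _; set y := (x / rC) ^+ _ => EA.
have cy : cn y = q ^+ (2 ^ n) by rewrite /y cnX cnf cn_real gtr0_norm.
have E : A - 1 = - (y * A) by rewrite -[X in A - X]EA; ring.
have cA : cn A <= 2.
  have : cn A <= 1 + cn y * cn A.
    have EA' : A = 1 + - (y * A) by rewrite -E addrC subrK.
    by rewrite {1}EA'; apply: (le_trans (cnD _ _)); rewrite cn1 cnN cnM.
  have := cn_ge0 A; rewrite cy; nra.
rewrite E cnN cnM cy; have := cn_ge0 A; have := exprn_ge0 (2 ^ n) q0; nra.
Qed.

(** Contract the circle to a small one around [x], where [f] is nearly constant, and use the exact average of the kernel. *)
Lemma cauchy_avg f : (forall z, cn z <= r -> exists l, cdiff f z l) ->
  forall e, 0 < e -> exists n0, forall n, (n0 <= n)%N ->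
  cn (avg r n (fun z => f z * (z / (z - x))) - f x) <= e.
Proof.
move=> fd e e0.
pose K := r / (r - cn x) + 1.
have K0 : 0 < K by rewrite ltr_wpDl // divr_ge0 ?subr_ge0 ?ltW.
have ker z : cn z = r -> cn (z / (z - x)) <= K.
  move=> zr; rewrite cnf zr /K.
  have : r - cn x <= cn (z - x) by rewrite -zr lerBlDr; have := cnD (z - x) x; rewrite subrK.
  move=> H; apply: (@le_trans _ _ (r / (r - cn x))); last by rewrite lerDl.
  rewrite ler_pM2l // lef_pV2 ?posrE ?subr_gt0 //.
  by apply: lt_le_trans H; rewrite subr_gt0.
have [l Hl] := fd x (ltW xr).
have [d d0 Hd] := Hl 1 ltr01.
pose D := (1 + cn l) * (2 * r).
have D0 : 0 < D by rewrite !mulr_gt0 // ltr_pwDl ?cn_ge0.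
pose s := Num.min (2^-1) (Num.min (d / (4 * r)) (e / 3 / (D * K))).
have DK : 0 < D * K by rewrite mulr_gt0.
have r4 : 0 < 4 * r by rewrite mulr_gt0.
have s0 : 0 < s by rewrite /s !lt_min invr_gt0 ltr0n /= !divr_gt0.
have s1 : s < 1 by rewrite gt_min; apply/orP; left; rewrite invf_lt1 // ltr1n.
have sd : s <= d / (4 * r) by rewrite !ge_min lexx orbT.
have se : s <= e / 3 / (D * K) by rewrite !ge_min lexx !orbT.
have s01 : 0 < s < 1 by rewrite s0.
have e3 : 0 < e / 3 by rewrite divr_gt0.
have [n1 H1] := deform r0 xr s01 fd e3.
have [|n2 H2] := avg_kernel_cvg (e := e / 3 / (cn (f x) + 1)).
  by rewrite !divr_gt0 // ltr_wpDl ?cn_ge0.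
exists (maxn n1 n2) => n; rewrite geq_max => /andP[/H1 {}H1 /H2 {}H2].
set A := avg _ _ _ in H1 *; set B := avg _ _ _ in H1.
set k := avg _ _ _ in H2.
have BK : cn (B - f x * k) <= e / 3.
  have -> : B - f x * k =
     avg r n (fun z => (f (x + ((s%:C)%C) * (z - x)) - f x) * (z / (z - x))).
    rewrite /B /k /avg -midsumZ -[- midsum _ _ _ _]mulN1r -midsumZ -midsumD; apply: midsum_eq => v.
    by ring.
  apply: avg_bound => z zr.
  rewrite cnM.
  have c1 : cn (((s%:C)%C) * (z - x)) <= s * (2 * r).
    rewrite cnM cn_real gtr0_norm // ler_pM2l //; apply: (le_trans (cnB _ _)).
    by rewrite zr; have := xr; lra.
  have c2 : cn (((s%:C)%C) * (z - x)) < d.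
    apply: (le_lt_trans c1); apply: (@le_lt_trans _ _ (d / (4 * r) * (2 * r))).
      by rewrite ler_wpM2r // mulr_ge0 // ltW.
    have -> : d / (4 * r) * (2 * r) = d / 2 by field; exact: lt0r_neq0.
    by lra.
  have := Hd (x + ((s%:C)%C) * (z - x)); rewrite addrAC subrr add0r => /(_ c2) H3.
  have H4 : cn (f (x + ((s%:C)%C) * (z - x)) - f x) <= s * D.
    rewrite -[X in cn X](subrK (l * (((s%:C)%C) * (z - x)))).
    apply: (le_trans (cnD _ _)); rewrite [cn (l * _)]cnM.
    apply: (@le_trans _ _ ((1 + cn l) * (s * (2 * r)))).
      by rewrite mulrDl; apply: lerD; [apply: (le_trans H3); rewrite !mul1r|rewrite ler_wpM2l ?cn_ge0].
    by rewrite /D mulrCA.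
  apply: (@le_trans _ _ (s * D * K)).
    by rewrite ler_pM ?cn_ge0 // ker.
  by rewrite -mulrA -ler_pdivlMr // mulr_gt0.
have -> : A - f x = (A - B) + (B - f x * k) + f x * (k - 1) by ring.
have -> : e = e / 3 + e / 3 + e / 3 by field.
apply: (le_trans (cnD _ _)); apply: lerD.
  by apply: (le_trans (cnD _ _)); apply: lerD.
rewrite cnM; apply: (le_trans (ler_wpM2l (cn_ge0 _) H2)).
rewrite mulrCA ler_piMr ?(ltW e3) // ler_pdivrMr ?mul1r ?lerDl //.
by rewrite ltr_wpDl ?cn_ge0.
Qed.

End CauchyFormula.

Section Mean.
Variable R : realType.
Local Notation C := R[i].
Implicit Types (f g h : C -> C).

Lemma ultra_oo : exists U : set_system nat, UltraFilter U /\ \oo `<=` U.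
Proof. exact: (@ultraFilterLemma nat (\oo)). Qed.

(** An ultrafilter of sets of indices refining convergence to infinity: bounded sequences have limits along it, which replaces any proof that the averages converge. *)
Definition UU : set_system nat := sval (cid ultra_oo).
Lemma UU_ultra : UltraFilter UU. Proof. by case: (svalP (cid ultra_oo)). Qed.
#[local] Instance UU_proper : ProperFilter UU. Proof. exact: (@ultra_proper _ _ UU_ultra). Qed.
Lemma UU_ge (A : set nat) n0 : (forall n, (n0 <= n)%N -> A n) -> UU A.
Proof. by move=> H; apply: (svalP (cid ultra_oo)).2; exists n0. Qed.

Definition ulimR (u : nat -> R) : R := sup [set t | UU [set n | t <= u n]].

Lemma ulimRP (u : nat -> R) M : (forall n, `|u n| <= M) ->
  forall e, 0 < e -> UU [set n | `|u n - ulimR u| <= e].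
Proof.
move=> HM e e0.
have hs : has_sup [set t | UU [set n | t <= u n]].
  split; first by exists (- M); apply: (@UU_ge _ 0%N) => n _ /=; have := HM n; rewrite ler_norml => /andP[].
  exists M => t /= /filter_ex[n /= tn]; apply: (le_trans tn).
  by have := HM n; rewrite ler_norml => /andP[].
have [t Ht tl] := sup_adherent e0 hs.
have U2 : UU [set n | u n < ulimR u + e].
  have [|//] := @in_ultra_setVsetC _ _ [set n | ulimR u + e <= u n] UU_ultra.
    move=> /(ub_le_sup hs.2); rewrite -/(ulimR u); lra.
  apply: filterS => n /= /negP; rewrite -ltNge; exact: id.
apply: filterS (filterI Ht U2) => n [/= h1 h2].
by rewrite ler_norml; rewrite -/(ulimR u) in tl; apply/andP; lra.
Qed.

Definition ulim (u : nat -> C) : C :=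
  Complex (ulimR (fun n => complex.Re (u n))) (ulimR (fun n => complex.Im (u n))).

Lemma ulimP (u : nat -> C) M : (forall n, cn (u n) <= M) ->
  forall e, 0 < e -> UU [set n | cn (u n - ulim u) <= e].
Proof.
move=> HM e e0; have e2 : 0 < e / 2 by rewrite divr_gt0.
have H1 := ulimRP (fun n => le_trans (cn_Re (u n)) (HM n)) e2.
have H2 := ulimRP (fun n => le_trans (cn_Im (u n)) (HM n)) e2.
apply: filterS (filterI H1 H2) => n [/= h1 h2]; apply: (le_trans (cn_ReIm _)).
by rewrite !(Re_add, Im_add, Re_opp, Im_opp) /= [e]splitr lerD.
Qed.

Lemma ulim_uniq (u : nat -> C) M a : (forall n, cn (u n) <= M) ->
  (forall e, 0 < e -> UU [set n | cn (u n - a) <= e]) -> ulim u = a.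
Proof.
move=> HM Ha; apply/eqP; rewrite -subr_eq0 -cn_eq0; apply/eqP/le_anti; rewrite cn_ge0 andbT.
apply/ler_addgt0Pr => e e0; rewrite add0r; have e2 : 0 < e / 2 by rewrite divr_gt0.
have [n [/= h1 h2]] := filter_ex (filterI (ulimP HM e2) (Ha _ e2)).
apply: (le_trans (cn_tri (u n) _ _)); rewrite [e]splitr lerD // cnC.
exact: h1.
Qed.

(** The integral mean of [g] over the circle of radius [r].  For non-continuous [g] it depends on the chosen ultrafilter; only linearity and the bound by the supremum are used. *)
Definition mean (r : R) (g : C -> C) : C := ulim (fun n => avg r n g).

Definition bdc (r : R) g := exists M, forall z, cn z = r -> cn (g z) <= M.

Variable r : R.
Hypothesis r0 : 0 < r.

Lemma mean_eq g h : (forall z, cn z = r -> g z = h z) -> mean r g = mean r h.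
Proof.
move=> gh; congr ulim; apply/funext => n; rewrite /avg /midsum; congr (_ * _).
by apply: eq_bigr => j _; apply: gh; rewrite cnM cn_cis mulr1 cn_real gtr0_norm.
Qed.

Lemma meanD g h : bdc r g -> bdc r h -> mean r (fun z => g z + h z) = mean r g + mean r h.
Proof.
move=> [M HM] [M' HM'].
have Bg n : cn (avg r n g) <= M by exact: avg_bound.
have Bh n : cn (avg r n h) <= M' by exact: avg_bound.
apply: (@ulim_uniq _ (M + M')) => [n|e e0].
  by rewrite /avg midsumD; apply: (le_trans (cnD _ _)); rewrite lerD ?Bg ?Bh.
have e2 : 0 < e / 2 by rewrite divr_gt0.
apply: filterS (filterI (ulimP Bg e2) (ulimP Bh e2)) => n [/= h1 h2].
rewrite /avg midsumD -/(avg r n g) -/(avg r n h) opprD addrACA.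
by apply: (le_trans (cnD _ _)); rewrite [e]splitr lerD.
Qed.

Lemma meanZ c g : bdc r g -> mean r (fun z => c * g z) = c * mean r g.
Proof.
move=> [M HM].
have Bg n : cn (avg r n g) <= M by exact: avg_bound.
apply: (@ulim_uniq _ (cn c * M)) => [n|e e0].
  by rewrite /avg midsumZ cnM ler_wpM2l ?cn_ge0 ?Bg.
have c0 : 0 < cn c + 1 by rewrite ltr_wpDl ?cn_ge0.
have e2 : 0 < e / (cn c + 1) by rewrite divr_gt0.
apply: filterS (ulimP Bg e2) => n /= h1.
rewrite /avg midsumZ -/(avg r n g) -mulrBr cnM.
apply: (le_trans (ler_wpM2l (cn_ge0 _) h1)).
by rewrite mulrCA ler_piMr ?(ltW e0) // ler_pdivrMr // mul1r lerDl.
Qed.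

Lemma mean_bound g M : (forall z, cn z = r -> cn (g z) <= M) -> cn (mean r g) <= M.
Proof.
move=> HM; have Bg n : cn (avg r n g) <= M by exact: avg_bound.
rewrite /mean; move: (ulim _) (ulimP Bg) => m Hm.
apply/ler_addgt0Pr => e e0.
have [n /= h] := filter_ex (Hm e e0).
rewrite -[m](subrK (avg r n g)) addrC; apply: (le_trans (cnD _ _)).
by apply: lerD; [exact: Bg|rewrite cnC].
Qed.

Lemma mean_cst c : mean r (fun=> c) = c.
Proof.
apply: (@ulim_uniq _ (cn c)) => [n|e e0]; first by rewrite avg_cst.
by apply: (@UU_ge _ 0%N) => n _ /=; rewrite avg_cst subrr cn0 ltW.
Qed.

Theorem mean_cauchy f x M : cn x < r ->
  (forall z, cn z <= r -> exists l, cdiff f z l) ->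
  (forall z, cn z <= r -> cn (f z) <= M) ->
  mean r (fun z => f z * (z / (z - x))) = f x.
Proof.
move=> xr fd fM; apply: (@ulim_uniq _ (M * (r / (r - cn x)))) => [n|e e0].
  apply: avg_bound => // z zr; rewrite cnM ler_pM ?cn_ge0 ?fM ?zr //.
  rewrite cnf zr ler_pM2l // lef_pV2 ?posrE ?subr_gt0 //.
    by rewrite -zr lerBlDr; have := cnD (z - x) x; rewrite subrK.
  by rewrite cn_gt0 subr_eq0; apply: contraTneq xr => <-; rewrite zr ltxx.
by have [n0 H] := cauchy_avg r0 xr fd e0; apply: UU_ge H.
Qed.

End Mean.

(** * Real differentiability and Wirtinger derivatives *)

Section Wirtinger.
Variables (R : realType) (N : nat).
Local Notation C := R[i].
Local Notation V := 'cV[R[i]]_N.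
Implicit Types (f g h : V -> C) (x y v : V).

(** The l1-distance; sums over coordinates are easier to handle than the maximum that defines the norm. *)
Definition nsz x y : R := \sum_j cn (y j 0 - x j 0).

Lemma nsz_ge0 x y : 0 <= nsz x y.
Proof. by apply: sumr_ge0 => j _; apply: cn_ge0. Qed.

Lemma nsz_coord x y j : cn (y j 0 - x j 0) <= nsz x y.
Proof. by rewrite /nsz (bigD1 j) //= lerDl; apply: sumr_ge0 => k _; apply: cn_ge0. Qed.

Lemma nszxx x : nsz x x = 0.
Proof. by rewrite /nsz big1 // => j _; rewrite subrr cn0. Qed.

Lemma nsz0 x v : nsz x (x + v) = nsz 0 v.
Proof. by rewrite /nsz; apply: eq_bigr => j _; rewrite !mxE subr0 addrAC subrr add0r. Qed.

Lemma nsz_sub x y : nsz 0 (y - x) = nsz x y.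
Proof. by rewrite /nsz; apply: eq_bigr => j _; rewrite !mxE subr0. Qed.

Lemma nsz_tri x y z : nsz x z <= nsz x y + nsz y z.
Proof.
rewrite /nsz -big_split; apply: ler_sum => j _ /=; rewrite addrC.
exact: cn_tri.
Qed.

Lemma nszZ (t : C) v : nsz 0 (t *: v) = cn t * nsz 0 v.
Proof. by rewrite /nsz mulr_sumr; apply: eq_bigr => j _; rewrite !mxE !subr0 cnM. Qed.

Lemma nbhs_nszP x (A : set V) :
  nbhs x A <-> exists2 d : R, 0 < d & forall y, nsz x y < d -> A y.
Proof.
split=> [/nbhs_cvP[d d0 H]|[d d0 H]].
  by exists d => // y yd; apply: H => j; apply: le_lt_trans yd; apply: nsz_coord.
apply/nbhs_cvP; exists (d / (N%:R + 1)); first by rewrite divr_gt0 // ltr_wpDl.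
move=> y Hy; apply: H.
apply: (@le_lt_trans _ _ (\sum_(j < N) d / (N%:R + 1))).
  by apply: ler_sum => j _; apply: ltW.
rewrite sumr_const card_ord -[_ *+ N]mulr_natl mulrCA -[ltRHS]mulr1 ltr_pM2l //.
by rewrite ltr_pdivrMr ?mul1r ?ltrDl // ltr_wpDl.
Qed.

Lemma cont_nszP f x :
  {for x, continuous f} <-> forall e : R, 0 < e -> exists2 d : R, 0 < d &
    forall y, nsz x y < d -> cn (f y - f x) < e.
Proof.
split=> [fc e e0|H].
  have : nbhs (f x) [set w | cn (w - f x) < e] by apply/nbhs_CP; exists e.
  by move=> /fc /nbhs_nszP.
move=> A /nbhs_CP[e e0 HA]; apply/nbhs_nszP.
by have [d d0 Hd] := H e e0; exists d => // y /Hd; apply: HA.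
Qed.

(** A real tangent direction as a complexified vector; the differential of [f] at [x] applied to [v] is [vder (rv v) f x]. *)
Definition rv v : cvec R N := (v, map_mx (@Num.conj C) v).

(** Real Frechet differentiability at [x]; the differential is then necessarily expressed by the Wirtinger derivatives. *)
Definition W f x := fr (nsz x) x f (fun y => vder (rv (y - x)) f x).

Lemma lo_is_derive (g : R -> R) (t l : R) :
  (forall e, 0 < e -> exists2 d, 0 < d & forall t', `|t' - t| < d ->
   `|g t' - g t - l * (t' - t)| <= e * `|t' - t|) -> is_derive t 1 g l.
Proof.
move=> H.
have Hc : h^-1 *: (g (h *: 1 + t) - g t) @[h --> (0 : R)^'] --> l.
  apply/cvgrPdist_le => e e0; have [d d0 Hd] := H e e0.
  apply/nbhs_ballP; exists d => // h; rewrite /ball /= sub0r normrN => hd h0.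
  have := Hd (h + t); rewrite addrK scaler1 => /(_ hd) K.
  have hn : 0 < `|h| by rewrite normr_gt0.
  rewrite /= -(ler_pM2r hn) distrC -normrM. rewrite /GRing.scale /= mulrBl mulrAC mulVf // mul1r.
  exact: K.
have dg : derivable g t 1 by apply/cvg_ex; exists l.
by split=> //; apply: cvg_lim.
Qed.

Lemma fr_rderive f x (a b : 'I_N -> C) :
  fr (nsz x) x f (fun y => \sum_j (a j * (y - x) j 0 + b j * ((y - x) j 0)^*)) ->
  forall v, rderivable f v x /\ rderive f v x = \sum_j (a j * v j 0 + b j * (v j 0)^*).
Proof.
move=> [_ H] v; set l := \sum_j _.
have K e : 0 < e -> exists2 d, 0 < d & forall t : R, `|t| < d ->
    cn (f (x + ((t%:C)%C) *: v) - f x - ((t%:C)%C) * l) <= e * `|t|.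
  move=> e0; have n0 : 0 < nsz 0 v + 1 by rewrite ltr_wpDl // nsz_ge0.
  have [|d d0 Hd] := H (e / (nsz 0 v + 1)); first by rewrite divr_gt0.
  exists (d / (nsz 0 v + 1)) => [|t td]; first by rewrite divr_gt0.
  have S : nsz x (x + ((t%:C)%C) *: v) = `|t| * nsz 0 v by rewrite nsz0 nszZ cn_real.
  have := Hd (x + ((t%:C)%C) *: v); rewrite S.
  have -> : \sum_j (a j * (x + t%:C%C *: v - x) j 0 + b j * ((x + t%:C%C *: v - x) j 0)^*)
     = ((t%:C)%C) * l.
    rewrite addrAC subrr add0r mulr_sumr; apply: eq_bigr => j _.
    have tJ : (((t%:C)%C) : C)^* = ((t%:C)%C) by rewrite conjE /= oppr0.
    by rewrite !mxE rmorphM /= tJ; ring.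
  move=> /(_ _) K; apply: (le_trans (K _)).
    apply: (@le_lt_trans _ _ (`|t| * (nsz 0 v + 1))).
      by rewrite ler_wpM2l // lerDl.
    by rewrite -ltr_pdivlMr.
  rewrite mulrCA [leRHS]mulrC ler_wpM2l // mulrAC -mulrA ler_piMr ?(ltW e0) //.
  by rewrite ler_pdivrMr // mul1r lerDl.
have D1 : is_derive (0 : R) 1 (fun t : R => complex.Re (f (x + (t%:C)%C *: v))) (complex.Re l).
  apply: lo_is_derive => e /K[d d0 Hd]; exists d => // t; rewrite subr0 => /Hd Ht.
  apply: le_trans Ht; apply: le_trans (cn_Re _).
  rewrite scale0r addr0 !Re_add !Re_opp Re_mul /= mul0r subr0 mulrC.
  by rewrite lexx.
have D2 : is_derive (0 : R) 1 (fun t : R => complex.Im (f (x + (t%:C)%C *: v))) (complex.Im l).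
  apply: lo_is_derive => e /K[d d0 Hd]; exists d => // t; rewrite subr0 => /Hd Ht.
  apply: le_trans Ht; apply: le_trans (cn_Im _).
  rewrite scale0r addr0 !Im_add !Im_opp Im_mul /= mul0r addr0 mulrC.
  by rewrite lexx.
split; first by split; [case: D1|case: D2].
rewrite /rderive !derive1E; case: D1 => _ ->; case: D2 => _ ->.
by case: (l).
Qed.

Lemma fr_dz f x (a b : 'I_N -> C) :
  fr (nsz x) x f (fun y => \sum_j (a j * (y - x) j 0 + b j * ((y - x) j 0)^*)) ->
  forall j, dz f j x = a j /\ dzbar f j x = b j.
Proof.
move=> H j; have D v := (fr_rderive H v).2.
have E1 : rderive f (delta_mx j 0) x = a j + b j.
  rewrite D (bigD1 j) //= big1 => [|k kj].
    by rewrite !mxE !eqxx /= conjC1 !mulr1 addr0.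
  by rewrite !mxE (negbTE kj) /= conjC0 !mulr0 addr0.
have E2 : rderive f ('i *: delta_mx j 0) x = 'i * (a j - b j).
  rewrite D (bigD1 j) //= big1 => [|k kj].
    by rewrite !mxE !eqxx /= mulr1 conjCi; ring.
  by rewrite !mxE (negbTE kj) /= mulr0 conjC0 !mulr0 addr0.
rewrite /dz /dzbar E1 E2 mulrA -expr2 sqrCi; by split; field.
Qed.

Lemma W_intro f x (a b : 'I_N -> C) :
  fr (nsz x) x f (fun y => \sum_j (a j * (y - x) j 0 + b j * ((y - x) j 0)^*)) ->
  W f x.
Proof.
move=> H; apply: fr_eq (H) => y; apply: eq_bigr => j _; have [-> ->] := fr_dz H j.
by rewrite /rv /= !mxE; ring.
Qed.

Lemma W_fr f x : W f x ->
  fr (nsz x) x f (fun y => \sum_j (dz f j x * (y - x) j 0 + dzbar f j x * ((y - x) j 0)^*)).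
Proof.
by apply: fr_eq => y; apply: eq_bigr => j _; rewrite /rv /= !mxE; ring.
Qed.

Lemma W_rderive f x v : W f x -> rderivable f v x /\ rderive f v x = vder (rv v) f x.
Proof.
move=> /W_fr /fr_rderive/(_ v)[h ->]; split=> //.
by apply: eq_bigr => j _; rewrite /rv /= !mxE; ring.
Qed.

Lemma W_cont f x : W f x -> {for x, continuous f}.
Proof.
move=> Wf; have [K K0 [d d0 Hd]] := fr_lip Wf; apply/cont_nszP => e e0.
exists (Num.min d (e / (K + 1))); first by rewrite lt_min d0 divr_gt0 // ltr_wpDl.
move=> y; rewrite lt_min => /andP[/Hd H1 H2]; apply: (le_lt_trans H1).
have K1 : 0 < K + 1 by rewrite ltr_wpDl.
apply: (@le_lt_trans _ _ ((K + 1) * nsz x y)); first by rewrite ler_wpM2r ?nsz_ge0 // lerDl.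
by rewrite mulrC -ltr_pdivlMr.
Qed.

Lemma fr_near f g x L d : 0 < d -> (forall y, nsz x y < d -> f y = g y) ->
  fr (nsz x) x f L -> fr (nsz x) x g L.
Proof.
move=> d0 fg [H1 H2]; split=> // e /H2[d' d0' H]; exists (Num.min d d').
  by rewrite lt_min d0.
move=> y; rewrite lt_min => /andP[h1 h2]; rewrite -!fg ?nszxx //; exact: H.
Qed.

Lemma W_near f g x : (\forall y \near x, f y = g y) -> W f x ->
  W g x /\ forall j, dz g j x = dz f j x /\ dzbar g j x = dzbar f j x.
Proof.
move=> /nbhs_nszP[d d0 fg] /W_fr H.
have H' := fr_near d0 fg H; split; first exact: W_intro H'.
exact: fr_dz.
Qed.

Lemma vder_near f g x (v : cvec R N) : (\forall y \near x, f y = g y) -> W f x ->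
  vder v g x = vder v f x.
Proof.
move=> fg Wf; have [_ H] := W_near fg Wf; apply: eq_bigr => j _.
by have [-> ->] := H j.
Qed.

Lemma W_cst (c : C) x : W (fun=> c) x /\
   forall j, dz (fun=> c) j x = 0 /\ dzbar (fun=> c) j x = 0.
Proof.
have H : fr (nsz x) x (fun=> c) (fun y => \sum_j ((0 : C) * (y - x) j 0 + 0 * ((y - x) j 0)^*)).
  apply: fr_eq (fr_cst (nsz_ge0 x) c) => y.
  by rewrite big1 // => j _; rewrite !mul0r addr0.
by split; [exact: W_intro H|apply: fr_dz H].
Qed.

Lemma W_add f g x : W f x -> W g x -> W (fun y => f y + g y) x /\
   forall j, dz (fun y => f y + g y) j x = dz f j x + dz g j x /\
     dzbar (fun y => f y + g y) j x = dzbar f j x + dzbar g j x.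
Proof.
move=> /W_fr Hf /W_fr Hg.
have H : fr (nsz x) x (fun y => f y + g y) (fun y => \sum_j
   ((dz f j x + dz g j x) * (y - x) j 0 + (dzbar f j x + dzbar g j x) * ((y - x) j 0)^*)).
  apply: fr_eq (fr_add Hf Hg) => y; rewrite -big_split /=.
  by apply: eq_bigr => j _; ring.
by split; [exact: W_intro H|apply: fr_dz H].
Qed.

Lemma W_mul f g x : W f x -> W g x -> W (fun y => f y * g y) x /\
   forall j, dz (fun y => f y * g y) j x = dz f j x * g x + f x * dz g j x /\
     dzbar (fun y => f y * g y) j x = dzbar f j x * g x + f x * dzbar g j x.
Proof.
move=> /W_fr Hf /W_fr Hg.
have H : fr (nsz x) x (fun y => f y * g y) (fun y => \sum_j
   ((dz f j x * g x + f x * dz g j x) * (y - x) j 0 +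
    (dzbar f j x * g x + f x * dzbar g j x) * ((y - x) j 0)^*)).
  apply: fr_eq (fr_mul (nsz_ge0 x) Hf Hg) => y; rewrite mulr_suml mulr_sumr -big_split /=.
  by apply: eq_bigr => j _; ring.
by split; [exact: W_intro H|apply: fr_dz H].
Qed.

Lemma W_conj f x : W f x -> W (fun y => (f y)^*) x /\
   forall j, dz (fun y => (f y)^*) j x = (dzbar f j x)^* /\
     dzbar (fun y => (f y)^*) j x = (dz f j x)^*.
Proof.
move=> /W_fr [[K K0 HK] Hf].
have H : fr (nsz x) x (fun y => (f y)^*) (fun y => \sum_j
   ((dzbar f j x)^* * (y - x) j 0 + (dz f j x)^* * ((y - x) j 0)^*)).
  have E y : \sum_j ((dzbar f j x)^* * (y - x) j 0 + (dz f j x)^* * ((y - x) j 0)^*)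
    = (\sum_j (dz f j x * (y - x) j 0 + dzbar f j x * ((y - x) j 0)^*))^*.
    rewrite rmorph_sum /=; apply: eq_bigr => j _.
    by rewrite rmorphD !rmorphM /= conjCK addrC.
  split; first by exists K => // y; rewrite E cnJ.
  move=> e /Hf[d d0 Hd]; exists d => // y /Hd.
  by rewrite E -!rmorphB cnJ.
by split; [exact: W_intro H|apply: fr_dz H].
Qed.

Lemma W_coord k x : W (fun y => y k 0) x /\
   forall j, dz (fun y => y k 0) j x = (j == k)%:R /\ dzbar (fun y : V => y k 0) j x = 0.
Proof.
have H : fr (nsz x) x (fun y => y k 0) (fun y => \sum_j
   ((j == k)%:R * (y - x) j 0 + 0 * ((y - x) j 0)^*)).
  have E y : \sum_j ((j == k)%:R * (y - x) j 0 + 0 * ((y - x) j 0)^*) = y k 0 - x k 0.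
    rewrite (bigD1 k) //= big1 => [|j jk].
      by rewrite eqxx !mxE mul1r mul0r !addr0.
    by rewrite (negbTE jk) !mul0r addr0.
  split; first by exists 1 => // y; rewrite E mul1r nsz_coord.
  move=> e e0; exists 1 => // y _.
  by rewrite E subrr cn0 mulr_ge0 ?nsz_ge0 ?ltW.
by split; [exact: W_intro H|apply: fr_dz H].
Qed.

Lemma W_cdiff f x (F : C -> C) l : W f x -> cdiff F (f x) l -> W (fun y => F (f y)) x /\
   forall j, dz (fun y => F (f y)) j x = l * dz f j x /\
     dzbar (fun y => F (f y)) j x = l * dzbar f j x.
Proof.
move=> /W_fr Hf HF.
have H : fr (nsz x) x (fun y => F (f y)) (fun y => \sum_j
   (l * dz f j x * (y - x) j 0 + l * dzbar f j x * ((y - x) j 0)^*)).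
  apply: fr_eq (fr_comp (nsz_ge0 x) Hf HF) => y; rewrite mulr_sumr /=.
  by apply: eq_bigr => j _; ring.
by split; [exact: W_intro H|apply: fr_dz H].
Qed.

Lemma vder_cst (v : cvec R N) (c : C) x : vder v (fun=> c) x = 0.
Proof.
apply: big1 => j _; case: (W_cst c x) => _ H; by have [-> ->] := H j; rewrite !mulr0 addr0.
Qed.

Lemma vderD (v : cvec R N) f g x : W f x -> W g x ->
  vder v (fun y => f y + g y) x = vder v f x + vder v g x.
Proof.
move=> Wf Wg; rewrite -big_split; apply: eq_bigr => j _ /=.
by have [-> ->] := (W_add Wf Wg).2 j; ring.
Qed.

Lemma vderM (v : cvec R N) f g x : W f x -> W g x ->
  vder v (fun y => f y * g y) x = vder v f x * g x + f x * vder v g x.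
Proof.
move=> Wf Wg; rewrite mulr_suml mulr_sumr -big_split; apply: eq_bigr => j _ /=.
by have [-> ->] := (W_mul Wf Wg).2 j; ring.
Qed.

Lemma vder_conj (v : cvec R N) f x : W f x ->
  vder v (fun y => (f y)^*) x = (vder (cconj v) f x)^*.
Proof.
move=> Wf; rewrite rmorph_sum; apply: eq_bigr => j _ /=.
have [-> ->] := (W_conj Wf).2 j.
by rewrite rmorphD !rmorphM /= !mxE !conjCK addrC.
Qed.

Lemma vder_coord (v : cvec R N) k x : vder v (fun y => y k 0) x = v.1 k 0.
Proof.
case: (W_coord k x) => _ H.
rewrite /vder (bigD1 k) //= big1 => [|j jk].
  by have [-> ->] := H k; rewrite eqxx mulr1 mulr0 !addr0.
by have [-> ->] := H j; rewrite (negbTE jk) !mulr0 addr0.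
Qed.

Lemma vder_lin (v w : cvec R N) (c : C) f x :
  vder (c *: v + w) f x = c * vder v f x + vder w f x.
Proof.
rewrite /vder mulr_sumr -big_split; apply: eq_bigr => j _ /=.
by rewrite !mxE; ring.
Qed.

Lemma vderDv (v w : cvec R N) f x : vder (v + w) f x = vder v f x + vder w f x.
Proof. by have := vder_lin v w 1 f x; rewrite scale1r mul1r. Qed.

Lemma vder0v f x : vder (0 : cvec R N) f x = 0.
Proof. by apply: big1 => j _; rewrite /= !mxE !mul0r addr0. Qed.

Lemma vderZv (v : cvec R N) (c : C) f x : vder (c *: v) f x = c * vder v f x.
Proof. by have := vder_lin v 0 c f x; rewrite vder0v !addr0. Qed.

Lemma W_sum (I : eqType) (r : seq I) (F : I -> V -> C) x :
  (forall i, W (F i) x) -> W (fun y => \sum_(i <- r) F i y) x /\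
  forall v : cvec R N, vder v (fun y => \sum_(i <- r) F i y) x = \sum_(i <- r) vder v (F i) x.
Proof.
move=> H; elim: r => [|i r [IH1 IH2]].
  have -> : (fun y => \sum_(i <- [::]) F i y) = (fun=> 0).
    by apply/funext => y; rewrite big_nil.
  by split=> [|v]; rewrite ?vder_cst ?big_nil //; exact: (W_cst 0 x).1.
have -> : (fun y => \sum_(i0 <- (i :: r)) F i0 y) = (fun y => F i y + \sum_(i0 <- r) F i0 y).
  by apply/funext => y; rewrite big_cons.
split=> [|v]; first exact: (W_add (H i) IH1).1.
by rewrite vderD // big_cons IH2.
Qed.

End Wirtinger.

(** * Continuous partial derivatives imply differentiability *)

Section MeanValue.
Variable R : realType.
Local Notation C := R[i].

Lemma mv_real (g dg : R -> R) (l e : R) :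
  (forall t : R, 0 <= t <= 1 -> is_derive t 1 g (dg t)) ->
  (forall t : R, 0 <= t <= 1 -> `|dg t - l| <= e) -> `|g 1 - g 0 - l| <= e.
Proof.
move=> Hd He.
have [||c c01 ->] := @MVT R g dg 0 1 ltr01.
- by move=> t; rewrite in_itv /= => /andP[t0 t1]; apply: Hd; rewrite !ltW.
- apply: derivable_within_continuous => t; rewrite in_itv /= => t01.
  by case: (Hd t t01).
rewrite subr0 mulr1; apply: He.
by move: c01; rewrite in_itv /= => /andP[t0 t1]; rewrite !ltW.
Qed.

End MeanValue.

Section C1.
Variables (R : realType) (N : nat).
Local Notation C := R[i].
Local Notation V := 'cV[R[i]]_N.
Implicit Types (f g h : V -> C) (x y v : V) (U : set V).

Lemma rderivable_line f b y (t s : R) :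
  rderivable f b (y + (((s * t)%:C)%C) *: b) ->
  is_derive s 1 (fun u : R => complex.Re (f (y + (((u * t)%:C)%C) *: b)))
     (complex.Re (((t%:C)%C) * rderive f b (y + (((s * t)%:C)%C) *: b))) /\
  is_derive s 1 (fun u : R => complex.Im (f (y + (((u * t)%:C)%C) *: b)))
     (complex.Im (((t%:C)%C) * rderive f b (y + (((s * t)%:C)%C) *: b))).
Proof.
set y' := y + (((s * t)%:C)%C) *: b.
have line u : y + (((u * t)%:C)%C) *: b = y' + ((((u - s) * t)%:C)%C) *: b.
  by rewrite /y' -addrA -scalerDl -rmorphD /=; congr (_ + (_)%:C%C *: _); ring.
have gen (phi psi : R -> R) l : derivable phi 0 1 -> l = t * derive1 phi 0 ->
   (forall u, psi u = phi ((u - s) * t)) -> is_derive s 1 psi l.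
  move=> dphi -> E; apply: lo_is_derive => e e0.
  have D : is_derive (0 : R) 1 phi (derive1 phi 0) by rewrite derive1E; apply: DeriveDef.
  have t1 : 0 < `|t| + 1 by rewrite ltr_wpDl.
  have [|d d0 Hd] := is_derive_lo D (e := e / (`|t| + 1)); first by rewrite divr_gt0.
  exists (d / (`|t| + 1)) => [|u Hu]; first by rewrite divr_gt0.
  have := Hd ((u - s) * t); rewrite subr0 normrM => K.
  rewrite !E subrr mul0r.
  have -> : t * derive1 phi 0 * (u - s) = derive1 phi 0 * ((u - s) * t) by ring.
  apply: (le_trans (K _)).
    apply: (@le_lt_trans _ _ (`|u - s| * (`|t| + 1))); first by rewrite ler_wpM2l // lerDl.
    by rewrite -ltr_pdivlMr.
  rewrite mulrCA [leRHS]mulrC ler_wpM2l // -mulrA ler_piMr ?(ltW e0) //.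
  by rewrite mulrC ler_pdivrMr // mul1r lerDl.
move=> [d1 d2]; split; [apply: (gen _ _ _ d1)|apply: (gen _ _ _ d2)].
- by rewrite Re_mul /= mul0r subr0.
- by move=> u; rewrite line.
- by rewrite Im_mul /= mul0r addr0.
- by move=> u; rewrite line.
Qed.

Lemma mv_line f b y (t : R) l e :
  (forall s : R, 0 <= s <= 1 -> rderivable f b (y + (((s * t)%:C)%C) *: b)) ->
  (forall s : R, 0 <= s <= 1 -> cn (rderive f b (y + (((s * t)%:C)%C) *: b) - l) <= e) ->
  cn (f (y + ((t%:C)%C) *: b) - f y - ((t%:C)%C) * l) <= (e + e) * `|t|.
Proof.
move=> Hd He.
pose G (u : R) := f (y + (((u * t)%:C)%C) *: b).
have G1 : f (y + ((t%:C)%C) *: b) = G 1 by rewrite /G mul1r.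
have G0 : f y = G 0 by rewrite /G mul0r scale0r addr0.
have HE s : 0 <= s <= 1 ->
   cn (((t%:C)%C) * rderive f b (y + (((s * t)%:C)%C) *: b) - ((t%:C)%C) * l) <= e * `|t|.
  by move=> s01; rewrite -mulrBr cnM cn_real [leRHS]mulrC ler_wpM2l ?He.
apply: (le_trans (cn_ReIm _)); rewrite mulrDl G1 G0; apply: lerD.
  rewrite !Re_add !Re_opp.
  apply: (@mv_real _ (fun u => complex.Re (G u)) (fun s => complex.Re (((t%:C)%C) * rderive f b (y + (((s * t)%:C)%C) *: b)))).
    by move=> s /Hd /rderivable_line[].
  move=> s /HE; apply: le_trans; rewrite -Re_opp -Re_add; exact: cn_Re.
rewrite !Im_add !Im_opp.
apply: (@mv_real _ (fun u => complex.Im (G u)) (fun s => complex.Im (((t%:C)%C) * rderive f b (y + (((s * t)%:C)%C) *: b)))).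
  by move=> s /Hd /rderivable_line[].
move=> s /HE; apply: le_trans; rewrite -Im_opp -Im_add; exact: cn_Im.
Qed.

(** The coordinates are changed one at a time, with the mean value inequality for each; this gives the expansion for a sum over a list of directions by induction. *)
Lemma C1_list (T : Type) (r : seq T) (b : T -> V) f U x : open U -> U x -> Ck 1 U f ->
  forall e, 0 < e -> exists2 d, 0 < d & forall y t, nsz x y < d -> (forall k, `|t k| < d) ->
  cn (f (y + \sum_(k <- r) ((t k)%:C)%C *: b k) - f y
      - \sum_(k <- r) ((t k)%:C)%C * rderive f (b k) x) <= e * \sum_(k <- r) `|t k|.
Proof.
move=> oU Ux [Hd Hc]; elim: r => [|k r IH] e e0.
  exists 1 => // y t _ _; rewrite !big_nil addr0 subrr subr0 cn0 mulr0; exact: lexx.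
have [d1 d10 H1] := IH e e0.
have e2 : 0 < e / 2 by rewrite divr_gt0.
have [d2 d20 H2] := (cont_nszP (rderive f (b k)) x).1 (Hc (b k) x Ux) _ e2.
have [d3 d30 H3] := (nbhs_nszP x U).1 (open_nbhs_nbhs (conj oU Ux)).
pose nb := nsz 0 (b k) + 1.
have nb1 : 1 <= nb by rewrite lerDr nsz_ge0.
have nb0 : 0 < nb by apply: lt_le_trans nb1.
pose D := Num.min d1 (Num.min d2 d3).
have D0 : 0 < D by rewrite !lt_min d10 d20 d30.
have Db : D <= d1 /\ D <= d2 /\ D <= d3 by rewrite /D !ge_min !lexx !orbT.
exists (D / (nb + nb)); first by rewrite divr_gt0 // addr_gt0.
move=> y t yx tk.
have Dp : 0 < D / (nb + nb) by rewrite divr_gt0 // addr_gt0.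
have Dn : D / (nb + nb) * nb = D / 2 by field; rewrite lt0r_neq0 // addr_gt0.
have small (s : R) : `|s| <= 1 -> nsz x (y + (((s * t k)%:C)%C) *: b k) < D.
  move=> s1; apply: (le_lt_trans (nsz_tri x y _)); rewrite [D]splitr; apply: ltr_leD.
    by rewrite -Dn; apply: (lt_le_trans yx); rewrite ler_peMr // ltW.
  rewrite nsz0 nszZ cn_real -Dn normrM; apply: ler_pM; rewrite ?mulr_ge0 ?nsz_ge0 //.
    by apply: (@le_trans _ _ `|t k|); [rewrite ler_piMl | exact: ltW].
  by rewrite /nb lerDl.
have tD i : `|t i| < d1.
  apply: (lt_le_trans (tk i)); apply: (@le_trans _ _ D); last by case: Db.
  have nn : 0 < nb + nb by rewrite addr_gt0.
  rewrite ler_pdivrMr // ler_peMr ?(ltW D0) //.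
  by apply: (le_trans nb1); rewrite lerDl ltW.
rewrite !big_cons addrA.
set y' := y + ((t k)%:C)%C *: b k.
set S := \sum_(j <- r) _; set S' := \sum_(j <- r) _.
have -> : f (y' + S) - f y - (((t k)%:C)%C * rderive f (b k) x + S') =
  (f y' - f y - ((t k)%:C)%C * rderive f (b k) x) + (f (y' + S) - f y' - S') by ring.
apply: (le_trans (cnD _ _)); rewrite mulrDr; apply: lerD.
  rewrite [e]splitr; apply: mv_line => s s01.
    have /small : `|s| <= 1 by rewrite ger0_norm; case/andP: s01.
    by move=> h; apply: Hd; apply: H3; apply: (lt_le_trans h); case: Db => _ [].
  have /small : `|s| <= 1 by rewrite ger0_norm; case/andP: s01.
  by move=> h; apply: ltW; apply: H2; apply: (lt_le_trans h); case: Db => _ [].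
apply: H1 => //; apply: (@lt_le_trans _ _ D); last by case: Db.
by have := small 1; rewrite mul1r normr1; apply.
Qed.

(** A function with continuous derivatives along all real lines is differentiable, as in the proof with partial derivatives. *)
Lemma C1_W f U x : open U -> U x -> Ck 1 U f -> W f x.
Proof.
move=> oU Ux Hf.
pose b (k : 'I_N + 'I_N) : V := match k with inl j => delta_mx j 0 | inr j => 'i *: delta_mx j 0 end.
pose a j := 2^-1 * (rderive f (delta_mx j 0) x - 'i * rderive f ('i *: delta_mx j 0) x).
pose a' j := 2^-1 * (rderive f (delta_mx j 0) x + 'i * rderive f ('i *: delta_mx j 0) x).
apply: (@W_intro _ _ _ _ a a').
split.
  exists (\sum_j (cn (a j) + cn (a' j))).
    by apply: sumr_ge0 => j _; rewrite addr_ge0 ?cn_ge0.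
  move=> y; apply: (le_trans (cn_sum _ _ _)); rewrite mulr_suml; apply: ler_sum => j _.
  have := nsz_coord x y j; rewrite !mxE => h.
  apply: (le_trans (cnD _ _)); rewrite mulrDl [cn (a j * _)]cnM [cn (a' j * _)]cnM cnJ.
  by apply: lerD; apply: ler_wpM2l => //; apply: cn_ge0.
move=> e e0; have e2 : 0 < e / 2 by rewrite divr_gt0.
have [d d0 Hd] := C1_list (index_enum ('I_N + 'I_N)%type) b oU Ux Hf e2.
exists d => // y yd.
pose t (k : 'I_N + 'I_N) : R := match k with inl j => complex.Re ((y - x) j 0) | inr j => complex.Im ((y - x) j 0) end.
have tn k : `|t k| <= nsz x y.
  by case: k => j /=; apply: le_trans (nsz_coord x y j); rewrite !mxE; [apply: cn_Re|apply: cn_Im].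
have := Hd x t; rewrite nszxx d0 => /(_ isT (fun k => le_lt_trans (tn k) yd)).
have cplx (z : C) : ((complex.Re z)%:C)%C + ((complex.Im z)%:C)%C * 'i = z.
  by rewrite [RHS]complexE mulrC.
have -> : x + \sum_(k <- index_enum ('I_N + 'I_N)%type) ((t k)%:C)%C *: b k = y.
  rewrite big_sumType /= -big_split /=.
  rewrite (eq_bigr (fun j => (y - x) j 0 *: delta_mx j 0)); last first.
    by move=> j _; rewrite scalerA -scalerDl cplx.
  have -> : \sum_(i < N) (y - x) i 0 *: delta_mx i 0 = y - x.
    by rewrite [RHS]matrix_sum_delta; apply: eq_bigr => i _; rewrite big_ord1.
  by rewrite addrC subrK.
have -> : \sum_(k <- index_enum ('I_N + 'I_N)%type) ((t k)%:C)%C * rderive f (b k) x =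
  \sum_j (a j * (y - x) j 0 + a' j * ((y - x) j 0)^*).
  rewrite big_sumType /= -big_split /=; apply: eq_bigr => j _.
  rewrite /a /a'; move: ((y - x) j 0) (rderive _ _ _) (rderive _ _ _) => z B A.
  have cr (u : R) : (((u%:C)%C) : C)^* = ((u%:C)%C) by rewrite conjE /= oppr0.
  have Ez : z^* = ((complex.Re z)%:C)%C - ((complex.Im z)%:C)%C * 'i.
    by rewrite -{1}(cplx z) rmorphD rmorphM /= conjCi !cr mulrN.
  rewrite Ez -{3}(cplx z); move: ((complex.Re z)%:C)%C ((complex.Im z)%:C)%C => p q.
  have i2 : 'i * 'i = -1 :> C by rewrite -expr2 sqrCi.
  transitivity (p * A - ('i * 'i) * q * B); first by rewrite i2; ring.
  by field.
move=> H; apply: (le_trans H).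
rewrite [leRHS](_ : _ = e / 2 * (nsz x y + nsz x y)); last by field.
rewrite ler_wpM2l ?(ltW e2) // big_sumType /=; apply: lerD.
  by apply: ler_sum => j _; rewrite !mxE; apply: cn_Re.
by apply: ler_sum => j _; rewrite !mxE; apply: cn_Im.
Qed.

End C1.

(** * Algebra and composition of C^k functions *)

Section SmoothAlgebra.
Variables (R : realType) (N : nat).
Local Notation C := R[i].
Local Notation V := 'cV[R[i]]_N.
Implicit Types (f g h : V -> C) (x y v : V) (U : set V) (k : nat).

Lemma Ck1_W k U f x : open U -> U x -> Ck k.+1 U f -> W f x.
Proof.
move=> oU; elim: k f x => [|k IH] f x Ux; first exact: C1_W.
move=> Hf; apply: (C1_W oU Ux); case: Hf => Hd Hc; split=> // v y Uy.
by apply: W_cont; apply: IH => //; apply: Hc.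
Qed.

Lemma CkS k U f : open U -> Ck k.+1 U f -> Ck k U f.
Proof.
move=> oU; elim: k f => [|k IH] f Hf.
  by move=> x Ux; apply: W_cont; apply: Ck1_W Hf.
case: Hf => Hd Hc; split=> // v; exact: IH.
Qed.

Lemma Ck_vder k U f v x : open U -> U x -> Ck k.+1 U f -> rderive f v x = vder (rv v) f x.
Proof. by move=> oU Ux Hf; have [] := W_rderive v (Ck1_W oU Ux Hf). Qed.

Lemma open_near U x : open U -> U x -> \forall y \near x, U y.
Proof. by move=> oU Ux; apply: open_nbhs_nbhs. Qed.

Lemma Ck_eq k U f g : open U -> (forall x, U x -> f x = g x) -> Ck k U f -> Ck k U g.
Proof.
move=> oU; elim: k f g => [|k IH] f g fg Hf.
  move=> x Ux; have fx := Hf x Ux; apply/cont_nszP => e e0.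
  have [d d0 Hd] := (cont_nszP f x).1 fx e e0.
  have [d' d0' Hd'] := (nbhs_nszP x U).1 (open_near oU Ux).
  exists (Num.min d d'); first by rewrite lt_min d0.
  by move=> y; rewrite lt_min => /andP[/Hd H1 /Hd' H2]; rewrite -!fg.
have nr x : U x -> \forall y \near x, f y = g y.
  by move=> Ux; apply: filterS (open_near oU Ux).
have Wg x : U x -> W g x by move=> Ux; apply: (W_near (nr x Ux) (Ck1_W oU Ux Hf)).1.
split=> [v x Ux|v]; first by have [] := W_rderive v (Wg x Ux).
apply: (IH (rderive f v)); last exact: (proj2 Hf v).
move=> x Ux; rewrite (Ck_vder v oU Ux Hf); have [_ ->] := W_rderive v (Wg x Ux).
by rewrite (vder_near _ (nr x Ux) (Ck1_W oU Ux Hf)).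
Qed.

(** Once the directional derivatives are known as an explicit family, only that family has to be shown to be of class C^k. *)
Lemma Ck_intro k U f (df : V -> V -> C) : open U -> (forall x, U x -> W f x) ->
  (forall v x, U x -> vder (rv v) f x = df v x) -> (forall v, Ck k U (df v)) ->
  Ck k.+1 U f.
Proof.
move=> oU Wf Ef Hdf; split=> [v x Ux|v]; first by have [] := W_rderive v (Wf x Ux).
apply: (Ck_eq oU) (Hdf v) => x Ux.
by rewrite -Ef //; have [_ ->] := W_rderive v (Wf x Ux).
Qed.

Lemma Ck_cst k U (c : C) : open U -> Ck k U (fun=> c).
Proof.
move=> oU; elim: k c => [|k IH] c; first by move=> x _; apply: cst_continuous.
apply: (Ck_intro (df := fun _ _ => 0)) => //; first by move=> x _; apply: (W_cst c x).1.
by move=> v x _; rewrite vder_cst.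
Qed.

Lemma Ck_add k U f g : open U -> Ck k U f -> Ck k U g -> Ck k U (fun x => f x + g x).
Proof.
move=> oU; elim: k f g => [|k IH] f g Hf Hg.
  by move=> x Ux; exact: (cvgD (Hf x Ux) (Hg x Ux)).
apply: (Ck_intro (df := fun v x => rderive f v x + rderive g v x)) => //.
- by move=> x Ux; apply: (W_add (Ck1_W oU Ux Hf) (Ck1_W oU Ux Hg)).1.
- move=> v x Ux; rewrite vderD ?(Ck_vder v oU Ux Hf) ?(Ck_vder v oU Ux Hg) //;
  [exact: Ck1_W Hf|exact: Ck1_W Hg].
- by move=> v; apply: IH; [exact: (proj2 Hf v)|exact: (proj2 Hg v)].
Qed.

Lemma Ck_mul k U f g : open U -> Ck k U f -> Ck k U g -> Ck k U (fun x => f x * g x).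
Proof.
move=> oU; elim: k f g => [|k IH] f g Hf Hg.
  by move=> x Ux; exact: (cvgM (Hf x Ux) (Hg x Ux)).
apply: (Ck_intro (df := fun v x => rderive f v x * g x + f x * rderive g v x)) => //.
- by move=> x Ux; apply: (W_mul (Ck1_W oU Ux Hf) (Ck1_W oU Ux Hg)).1.
- move=> v x Ux; rewrite vderM ?(Ck_vder v oU Ux Hf) ?(Ck_vder v oU Ux Hg) //;
  [exact: Ck1_W Hf|exact: Ck1_W Hg].
- move=> v; apply: Ck_add => //; apply: IH; try (by apply: CkS); [exact: (proj2 Hf v)|exact: (proj2 Hg v)].
Qed.

Lemma Ck_conj k U f : open U -> Ck k U f -> Ck k U (fun x => (f x)^*).
Proof.
move=> oU; elim: k f => [|k IH] f Hf.
  move=> x Ux; apply/cont_nszP => e e0.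
  have [d d0 Hd] := (cont_nszP f x).1 (Hf x Ux) e e0.
  by exists d => // y /Hd; rewrite -rmorphB cnJ.
apply: (Ck_intro (df := fun v x => (rderive f v x)^*)) => //.
- by move=> x Ux; apply: (W_conj (Ck1_W oU Ux Hf)).1.
- move=> v x Ux; rewrite vder_conj ?(Ck_vder v oU Ux Hf) //; last exact: Ck1_W Hf.
  congr ((vder _ f x)^*); rewrite /cconj /rv /=; congr pair.
  by apply/matrixP => i j; rewrite !mxE conjCK.
- by move=> v; apply: IH; exact: (proj2 Hf v).
Qed.

Lemma Ck_coord k U j : open U -> Ck k U (fun x => x j 0).
Proof.
move=> oU; case: k => [|k]; first by move=> x Ux; apply: W_cont; apply: (W_coord j x).1.
apply: (Ck_intro (df := fun v x => v j 0)) => //.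
- by move=> x _; apply: (W_coord j x).1.
- by move=> v x _; rewrite vder_coord.
- by move=> v; apply: Ck_cst.
Qed.

Lemma Ck_inv k U f : open U -> (forall x, U x -> f x != 0) -> Ck k U f ->
  Ck k U (fun x => (f x)^-1).
Proof.
move=> oU f0; elim: k => [|k IH] Hf.
  by move=> x Ux; exact: (cvgV (f0 x Ux) (Hf x Ux)).
have Wi x (Ux : U x) := W_cdiff (Ck1_W oU Ux Hf) (cdiff_inv (f0 x Ux)).
apply: (Ck_intro (df := fun v x => - 1 * ((f x)^-1 * ((f x)^-1 * rderive f v x)))) => //.
- by move=> x Ux; exact: (Wi x Ux).1.
- move=> v x Ux; rewrite (Ck_vder v oU Ux Hf) /vder !mulr_sumr.
  apply: eq_bigr => j _; have [_ H] := Wi x Ux; have [-> ->] := H j.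
  have := f0 x Ux => f0x; field; exact: f0x.
- move=> v; apply: Ck_mul => //; first exact: Ck_cst.
  by apply: Ck_mul => //; [apply: IH; apply: CkS|apply: Ck_mul => //; [apply: IH; apply: CkS|exact: (proj2 Hf v)]].
Qed.

Lemma Ck_sum (I : Type) (r : seq I) (P : pred I) k U (F : I -> V -> C) : open U -> (forall i, P i -> Ck k U (F i)) ->
  Ck k U (fun x => \sum_(i <- r | P i) F i x).
Proof.
move=> oU H; elim: r => [|i r IH].
  by apply: (Ck_eq (f := fun=> 0)) => // [x _|]; [rewrite big_nil|exact: Ck_cst].
apply: (Ck_eq (f := fun x => if P i then F i x + \sum_(i <- r | P i) F i x else \sum_(i <- r | P i) F i x)) => //.
  by move=> x _; rewrite big_cons.
by case Pi: (P i) => //; apply: Ck_add => //; apply: H.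
Qed.

Lemma Ck_sub k U U' f : U' `<=` U -> Ck k U f -> Ck k U' f.
Proof.
move=> UU; elim: k f => [|k IH] f; first by move=> H x /UU /H.
by move=> [Hd Hc]; split=> [v x /UU h|v]; [exact: Hd|exact: IH (Hc v)].
Qed.

End SmoothAlgebra.

Section Composition.
Variables (R : realType) (M N : nat).
Local Notation C := R[i].
Implicit Types (f : 'cV[C]_N -> C) (phi : 'cV[C]_M -> 'cV[C]_N).

(** The chain rule in Wirtinger form. *)
Lemma W_comp f phi x : W f (phi x) -> (forall j, W (fun y => phi y j 0) x) ->
  W (fun y => f (phi y)) x /\
  forall v, vder v (fun y => f (phi y)) x =
   \sum_j (dz f j (phi x) * vder v (fun y => phi y j 0) x
         + dzbar f j (phi x) * vder v (fun y => (phi y j 0)^*) x).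
Proof.
move=> Wf Wp.
pose p := phi x.
pose G y := \sum_j (dz f j p * phi y j 0 + dzbar f j p * (phi y j 0)^*).
have WT j : W (fun y => dz f j p * phi y j 0) x /\ forall v, vder v (fun y => dz f j p * phi y j 0) x = dz f j p * vder v (fun y => phi y j 0) x.
  split; first exact: (W_mul (W_cst _ x).1 (Wp j)).1.
  by move=> v; rewrite (vderM v (W_cst _ x).1 (Wp j)) vder_cst mul0r add0r.
have WT' j : W (fun y => dzbar f j p * (phi y j 0)^*) x /\ forall v, vder v (fun y => dzbar f j p * (phi y j 0)^*) x = dzbar f j p * vder v (fun y => (phi y j 0)^*) x.
  have Wc := (W_conj (Wp j)).1.
  split; first exact: (W_mul (W_cst _ x).1 Wc).1.
  by move=> v; rewrite (vderM v (W_cst _ x).1 Wc) vder_cst mul0r add0r.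
have [WG DG] : W G x /\ forall v, vder v G x = \sum_j (dz f j p * vder v (fun y => phi y j 0) x
         + dzbar f j p * vder v (fun y => (phi y j 0)^*) x).
  have := @W_sum _ _ _ (index_enum 'I_N) (fun j y => dz f j p * phi y j 0 + dzbar f j p * (phi y j 0)^*) x.
  move=> [j|W1 D1]; first exact: (W_add (WT j).1 (WT' j).1).1.
  split; first exact: W1.
  move=> v; rewrite D1; apply: eq_bigr => j _.
  by rewrite (vderD v (WT j).1 (WT' j).1) (WT j).2 (WT' j).2.
have lip : exists2 K, 0 <= K & exists2 d, 0 < d & forall y, nsz x y < d -> nsz p (phi y) <= K * nsz x y.
  have Hj j : exists Kd : R * R, [/\ 0 <= Kd.1, 0 < Kd.2 & forall y, nsz x y < Kd.2 -> cn (phi y j 0 - phi x j 0) <= Kd.1 * nsz x y].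
    by have [K K0 [d d0 H]] := fr_lip (Wp j); exists (K, d).
  have [kd Hkd] := choice Hj.
  exists (\sum_j (kd j).1); first by apply: sumr_ge0 => j _; case: (Hkd j).
  exists (\big[Num.min/1]_j (kd j).2).
    by elim/big_ind: _ => // [a b a0 b0|j _]; [rewrite lt_min a0|case: (Hkd j)].
  move=> y Hy; rewrite /nsz mulr_suml; apply: ler_sum => j _.
  case: (Hkd j) => _ _; apply; apply: (lt_le_trans Hy).
  by rewrite (bigD1 j) //= ge_min lexx.
have H0 : fr (nsz x) x (fun y => f (phi y) - G y) (fun y => \sum_(j < M) ((0 : C) * (y - x) j 0 + 0 * ((y - x) j 0)^*)).
  have E0 y : \sum_(j < M) ((0 : C) * (y - x) j 0 + 0 * ((y - x) j 0)^*) = 0.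
    by rewrite big1 // => j _; rewrite !mul0r addr0.
  split; first by exists 0 => // y; rewrite E0 cn0 mul0r.
  move=> e e0; have [K K0 [d d0 Hd]] := lip.
  have K1 : 0 < K + 1 by rewrite ltr_wpDl.
  have [_ Hf] := W_fr Wf.
  have [|d' d0' Hd'] := Hf (e / (K + 1)); first by rewrite divr_gt0.
  exists (Num.min d (d' / (K + 1))); first by rewrite lt_min d0 divr_gt0.
  move=> y; rewrite lt_min => /andP[/Hd H1 H2].
  have H3 : nsz p (phi y) <= (K + 1) * nsz x y.
    by apply: (le_trans H1); rewrite ler_wpM2r ?nsz_ge0 // lerDl.
  have H4 : nsz p (phi y) < d' by apply: (le_lt_trans H3); rewrite mulrC -ltr_pdivlMr.
  have := Hd' _ H4; rewrite E0 subr0.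
  have -> : f (phi y) - f (phi x) - \sum_j (dz f j (phi x) * (phi y - phi x) j 0 + dzbar f j (phi x) * ((phi y - phi x) j 0)^*) = f (phi y) - G y - (f (phi x) - G x).
    have -> : \sum_j (dz f j (phi x) * (phi y - phi x) j 0 + dzbar f j (phi x) * ((phi y - phi x) j 0)^*) = G y - G x.
      rewrite /G -sumrB; apply: eq_bigr => j _; rewrite !mxE rmorphB /= -/p; ring.
    by ring.
  move=> h; apply: (le_trans h).
  apply: (@le_trans _ _ (e / (K + 1) * ((K + 1) * nsz x y))).
    by rewrite ler_wpM2l // divr_ge0 // ltW.
  by rewrite mulrA divfK // lt0r_neq0.
have WH := W_intro H0.
have DH v : vder v (fun y => f (phi y) - G y) x = 0.
  by apply: big1 => j _; have [-> ->] := fr_dz H0 j; rewrite !mulr0 addr0.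
have -> : (fun y => f (phi y)) = (fun y => (f (phi y) - G y) + G y).
  by apply/funext => y; rewrite subrK.
split; first exact: (W_add WH WG).1.
by move=> v; rewrite vderD // DH add0r DG.
Qed.

Lemma Ck_comp k f phi (U : set 'cV[C]_N) (U' : set 'cV[C]_M) :
  open U -> open U' -> (forall x, U' x -> U (phi x)) ->
  (forall j, Ck k U' (fun y => phi y j 0)) -> Ck k U f -> Ck k U' (fun y => f (phi y)).
Proof.
move=> oU oU' UU; elim: k f => [|k IH] f Hp Hf.
  move=> x Ux; apply/cont_nszP => e e0.
  have [d d0 Hd] := (nbhs_cvP (phi x) _).1 (Hf (phi x) (UU x Ux) _ ((nbhs_CP (f (phi x)) [set w | cn (w - f (phi x)) < e]).2 (ex_intro2 _ _ e e0 (fun y h => h)))).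
  have Hj j : exists2 d' : R, 0 < d' & forall y, nsz x y < d' -> cn (phi y j 0 - phi x j 0) < d.
    exact: ((cont_nszP (fun y => phi y j 0) x).1 (Hp j x Ux) d d0).
  have Hj' j : exists d' : R, 0 < d' /\ forall y, nsz x y < d' -> cn (phi y j 0 - phi x j 0) < d.
    by have [d' ? ?] := Hj j; exists d'.
  have [kd Hkd] := choice Hj'.
  exists (\big[Num.min/1]_j kd j).
    by elim/big_ind: _ => // [a b a0 b0|j _]; [rewrite lt_min a0|case: (Hkd j)].
  move=> y Hy; apply: Hd => j; case: (Hkd j) => _; apply; apply: (lt_le_trans Hy).
  by rewrite (bigD1 j) //= ge_min lexx.
have Wp x (Ux : U' x) j := Ck1_W oU' Ux (Hp j).
have Wf x (Ux : U' x) := Ck1_W oU (UU x Ux) Hf.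
have Cp j : Ck k U' (fun y => phi y j 0) by apply: CkS => //; apply: Hp.
apply: (Ck_intro (df := fun v x => \sum_j (dz f j (phi x) * rderive (fun y => phi y j 0) v x
   + dzbar f j (phi x) * (rderive (fun y => phi y j 0) v x)^*))) => //.
- by move=> x Ux; apply: (W_comp (Wf x Ux) (Wp x Ux)).1.
- move=> v x Ux; rewrite (W_comp (Wf x Ux) (Wp x Ux)).2; apply: eq_bigr => j _.
  have [_ ->] := W_rderive v (Wp x Ux j); congr (_ + _ * _).
  rewrite vder_conj //; last exact: Wp.
  congr ((vder _ _ x)^*); rewrite /cconj /rv /=; congr pair.
  by apply/matrixP => a b; rewrite !mxE conjCK.
- move=> v; apply: Ck_sum => // j _.
  have Rd u : Ck k U' (fun x => rderive f u (phi x)) by apply: IH => //; exact: (proj2 Hf u).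
  have Rp : Ck k U' (rderive (fun y => phi y j 0) v) by exact: (proj2 (Hp j) v).
  apply: Ck_add => //; apply: Ck_mul => //; last exact: Ck_conj.
    apply: Ck_mul => //; first exact: Ck_cst.
    apply: Ck_add => //; apply: (Ck_eq (f := fun x => (-1) * ('i * rderive f ('i *: delta_mx j 0) (phi x)))) => //.
      by move=> x _; rewrite mulN1r.
    by apply: Ck_mul => //; [exact: Ck_cst|apply: Ck_mul => //; exact: Ck_cst].
  apply: Ck_mul => //; first exact: Ck_cst.
  by apply: Ck_add => //; apply: Ck_mul => //; exact: Ck_cst.
Qed.

End Composition.

(** * Holomorphic functions: Cauchy estimates and smoothness *)

Section Hol.
Variables (R : realType) (N : nat).
Local Notation C := R[i].
Local Notation V := 'cV[R[i]]_N.
Implicit Types (f g : V -> C) (x y v p : V) (U : set V).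

(** Real differentiability together with the Cauchy-Riemann equations. *)
Definition hol f x := W f x /\ forall j, dzbar f j x = 0.
Definition holU U f := forall x, U x -> hol f x.
Definition Dv f v x : C := \sum_j v j 0 * dz f j x.

Lemma hol_intro f x (a : 'I_N -> C) :
  fr (nsz x) x f (fun y => \sum_j a j * (y - x) j 0) ->
  hol f x /\ forall j, dz f j x = a j.
Proof.
move=> H.
have H' : fr (nsz x) x f (fun y => \sum_j (a j * (y - x) j 0 + 0 * ((y - x) j 0)^*)).
  by apply: fr_eq H => y; apply: eq_bigr => j _; rewrite mul0r addr0.
split; last by move=> j; have [] := fr_dz H' j.
by split; [exact: W_intro H'|move=> j; have [] := fr_dz H' j].
Qed.

Lemma hol_vder f x (v : cvec R N) : hol f x -> vder v f x = Dv f v.1 x.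
Proof. by move=> [_ H]; apply: eq_bigr => j _; rewrite H mulr0 addr0. Qed.

Lemma hol_fr f x : hol f x -> fr (nsz x) x f (fun y => Dv f (y - x) x).
Proof.
move=> hf; apply: fr_eq (W_fr hf.1) => y; apply: eq_bigr => j _.
by rewrite hf.2 mul0r addr0 mulrC.
Qed.

Lemma hol_rderive f x v : hol f x -> rderivable f v x /\ rderive f v x = Dv f v x.
Proof. by move=> hf; have [? ->] := W_rderive v hf.1; rewrite hol_vder. Qed.

Lemma DvD f v w x : Dv f (v + w) x = Dv f v x + Dv f w x.
Proof. by rewrite /Dv -big_split; apply: eq_bigr => j _; rewrite mxE mulrDl. Qed.

Lemma DvZ f c v x : Dv f (c *: v) x = c * Dv f v x.
Proof. by rewrite /Dv mulr_sumr; apply: eq_bigr => j _; rewrite mxE mulrA. Qed.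

Lemma Dv_delta f j x : Dv f (delta_mx j 0) x = dz f j x.
Proof.
rewrite /Dv (bigD1 j) //= big1 => [|k kj]; rewrite mxE.
  by rewrite !eqxx /= mul1r addr0.
by rewrite (negbTE kj) /= mul0r.
Qed.

Lemma Dv0 f x : Dv f 0 x = 0.
Proof. by rewrite /Dv big1 // => j _; rewrite mxE mul0r. Qed.

Lemma slice_cdiff f y v (z : C) : hol f (y + z *: v) ->
  cdiff (fun t => f (y + t *: v)) z (Dv f v (y + z *: v)).
Proof.
move=> hf e e0; have n1 : 0 < nsz 0 v + 1 by rewrite ltr_wpDl // nsz_ge0.
have [|d d0 Hd] := (hol_fr hf).2 (e / (nsz 0 v + 1)); first by rewrite divr_gt0.
exists (d / (nsz 0 v + 1)); first by rewrite divr_gt0.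
move=> w Hw.
have E : y + w *: v = (y + z *: v) + (w - z) *: v.
  by rewrite -addrA -scalerDl addrC [z + _]addrC subrK addrC.
have S : nsz (y + z *: v) (y + w *: v) = cn (w - z) * nsz 0 v by rewrite E nsz0 nszZ.
have S1 : cn (w - z) * nsz 0 v <= cn (w - z) * (nsz 0 v + 1).
  by rewrite ler_wpM2l ?cn_ge0 // lerDl.
have := Hd (y + w *: v); rewrite S => K.
have -> : Dv f v (y + z *: v) * (w - z) = Dv f (y + w *: v - (y + z *: v)) (y + z *: v).
  by rewrite E addrAC subrr add0r DvZ mulrC.
apply: (le_trans (K _)); first by apply: (le_lt_trans S1); rewrite -ltr_pdivlMr.
apply: (@le_trans _ _ (e / (nsz 0 v + 1) * (cn (w - z) * (nsz 0 v + 1)))).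
  by rewrite ler_wpM2l // divr_ge0 // ltW.
by rewrite [cn _ * _]mulrC mulrA divfK // lt0r_neq0.
Qed.

(** Holomorphic and bounded by [M] on a ball: the data from which Cauchy estimates are derived. *)
Definition holb p (rho : R) f (M : R) :=
  forall y, nsz p y < rho -> hol f y /\ cn (f y) <= M.

Lemma holU_bounded U f p : open U -> U p -> holU U f ->
  exists rho M, [/\ 0 < rho, 0 <= M, holb p rho f M & forall y, nsz p y < rho -> U y].
Proof.
move=> oU Up hf; have [d d0 Hd] := (nbhs_nszP p U).1 (open_near oU Up).
have [d' d0' Hd'] := (cont_nszP f p).1 (W_cont (hf p Up).1) 1 ltr01.
exists (Num.min d d'), (cn (f p) + 1); split.
- by rewrite lt_min d0.
- by rewrite addr_ge0 ?cn_ge0.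
- move=> y; rewrite lt_min => /andP[/Hd Uy /Hd' H]; split; first exact: hf.
  by have := cnD (f y - f p) (f p); rewrite subrK; lra.
- by move=> y; rewrite lt_min => /andP[/Hd].
Qed.

Lemma holb_mono p p' rho rho' f M : holb p rho f M -> rho' + nsz p p' <= rho -> holb p' rho' f M.
Proof.
move=> H K y Hy; apply: H; apply: (le_lt_trans (nsz_tri p p' y)); rewrite addrC.
by apply: lt_le_trans K; rewrite ltrD2r.
Qed.

Section Slice.
Variables (f : V -> C) (p : V) (rho M : R).
Hypothesis hb : holb p rho f M.

Lemma slice_in y v r (z : C) : nsz p y + r * nsz 0 v < rho -> cn z <= r -> nsz p (y + z *: v) < rho.
Proof.
move=> H zr; apply: le_lt_trans H; apply: (le_trans (nsz_tri p y _)).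
by rewrite lerD2l nsz0 nszZ ler_wpM2r ?nsz_ge0.
Qed.

Lemma slice_cauchy y v (r : R) (x : C) : 0 < r -> nsz p y + r * nsz 0 v < rho -> cn x < r ->
  mean r (fun z => f (y + z *: v) * (z / (z - x))) = f (y + x *: v).
Proof.
move=> r0 H xr; apply: (mean_cauchy r0 (M := M) xr (f := fun z => f (y + z *: v))) => z zr.
  exists (Dv f v (y + z *: v)); apply: slice_cdiff.
  by have [] := hb (slice_in H zr).
by have [] := hb (slice_in H zr).
Qed.

Lemma slice_taylor1 y v (r : R) (x : C) : 0 < r -> nsz p y + r * nsz 0 v < rho -> cn x <= r / 2 ->
  cn (f (y + x *: v) - f y - x * mean r (fun z => f (y + z *: v) / z)) <= 2 * M * (cn x / r) ^+ 2.
Proof.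
move=> r0 H xr.
have xr' : cn x < r by apply: (le_lt_trans xr); rewrite ltr_pdivrMr // ltr_pMr // ltr1n.
have B z : cn z = r -> cn (f (y + z *: v)) <= M.
  by move=> zr; have [] := hb (slice_in H (_ : cn z <= r)); rewrite ?zr.
have M0 : 0 <= M.
  have := B ((r%:C)%C); rewrite cn_real gtr0_norm // => /(_ erefl); apply: le_trans; exact: cn_ge0.
have z0 z : cn z = r -> z != 0 by move=> zr; rewrite -cn_gt0 zr.
have zx z : cn z = r -> r / 2 <= cn (z - x).
  by move=> zr; have := cnD (z - x) x; rewrite subrK zr; lra.
have zx0 z : cn z = r -> z - x != 0.
  by move=> zr; rewrite -cn_gt0; apply: lt_le_trans (zx z zr); rewrite divr_gt0.
pose rem z := f (y + z *: v) * (x ^+ 2 / (z * (z - x))).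
have Brem z : cn z = r -> cn (rem z) <= 2 * M * (cn x / r) ^+ 2.
  move=> zr; rewrite /rem cnM cnf cnX cnM zr.
  have -> : 2 * M * (cn x / r) ^+ 2 = M * (cn x ^+ 2 / (r * (r / 2))) by field; rewrite lt0r_neq0.
  rewrite ler_pM ?cn_ge0 ?B //; first by rewrite divr_ge0 ?mulr_ge0 ?exprn_ge0 ?cn_ge0 // ltW.
  rewrite ler_wpM2l ?exprn_ge0 ?cn_ge0 // lef_pV2 ?posrE ?mulr_gt0 ?divr_gt0 //.
    by rewrite ler_wpM2l ?(ltW r0) // zx.
  by rewrite cn_gt0 zx0.
have b1 : bdc r (fun z => f (y + z *: v)) by exists M.
have b2 : bdc r (fun z => f (y + z *: v) / z).
  exists (M / r) => z zr; rewrite cnf zr ler_wpM2r ?B // invr_ge0 ltW //.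
have b3 : bdc r (fun z => x * (f (y + z *: v) / z)).
  by case: b2 => K HK; exists (cn x * K) => z /HK h; rewrite cnM ler_wpM2l ?cn_ge0.
have b4 : bdc r rem by exists (2 * M * (cn x / r) ^+ 2).
have b5 : bdc r (fun z => f (y + z *: v) + x * (f (y + z *: v) / z)).
  case: b1 => K1 H1; case: b3 => K3 H3; exists (K1 + K3) => z zr.
  by apply: (le_trans (cnD _ _)); rewrite lerD ?H1 ?H3.
have E := slice_cauchy r0 H xr'.
have E0 : mean r (fun z => f (y + z *: v)) = f y.
  have := slice_cauchy r0 H (_ : cn 0 < r); rewrite cn0 scale0r addr0 => /(_ r0) <-.
  by apply: mean_eq => // z zr; rewrite subr0 divff ?mulr1 // z0.
have E2 : f (y + x *: v) = f y + x * mean r (fun z => f (y + z *: v) / z) + mean r rem.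
  rewrite -E -{1}E0 -meanZ // -meanD // -meanD //; apply: mean_eq => // z zr.
  by rewrite /rem; have h1 := z0 z zr; have h2 := zx0 z zr; field; rewrite h1 h2.
rewrite E2; set m := mean r (fun z => _ / z).
have -> : f y + x * m + mean r rem - f y - x * m = mean r rem by ring.
exact: mean_bound.
Qed.

Lemma slice_deriv y v (r : R) : 0 < r -> nsz p y + r * nsz 0 v < rho ->
  Dv f v y = mean r (fun z => f (y + z *: v) / z).
Proof.
move=> r0 H; set m := mean _ _.
have hy : nsz p y < rho.
  by apply: le_lt_trans H; rewrite lerDl mulr_ge0 ?nsz_ge0 // ltW.
have [hf fM] := hb hy.
have M0 : 0 <= M by apply: le_trans fM; exact: cn_ge0.
have := @slice_cdiff f y v 0; rewrite scale0r addr0 => /(_ hf) Hd.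
apply/eqP; rewrite -subr_eq0 -cn_eq0; apply/eqP/le_anti; rewrite cn_ge0 andbT.
set D := Dv f v y in Hd *.
have key e : 0 < e -> cn (D - m) <= e.
  move=> e0; have e2 : 0 < e / 2 by rewrite divr_gt0.
  have [d d0 {}Hd] := Hd _ e2.
  pose B := 2 * M / r ^+ 2 + 1.
  have B0 : 0 < B by rewrite ltr_wpDl // divr_ge0 ?mulr_ge0 ?exprn_ge0 // ltW.
  pose t := Num.min (d / 2) (Num.min (r / 2) (e / 2 / B)).
  have t0 : 0 < t by rewrite /t !lt_min !divr_gt0.
  have td : t < d by rewrite /t gt_min; apply/orP; left; rewrite ltr_pdivrMr // ltr_pMr // ltr1n.
  have tr : t <= r / 2 by rewrite /t !ge_min lexx orbT.
  have te : t <= e / 2 / B by rewrite /t !ge_min lexx !orbT.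
  pose x : C := ((t%:C)%C).
  have cx : cn x = t by rewrite cn_real gtr0_norm.
  have := Hd x; rewrite subr0 cx => /(_ td); rewrite scale0r addr0 => H1.
  have := @slice_taylor1 y v r x r0 H; rewrite cx => /(_ tr); rewrite -/m => H2.
  have H3 : t * cn (D - m) <= t * e.
    have -> : t * cn (D - m) = cn ((f (y + x *: v) - f y - x * m) - (f (y + x *: v) - f y - D * x)).
      by rewrite -{1}cx -cnM; congr cn; ring.
    apply: (le_trans (cnB _ _)); apply: (@le_trans _ _ (2 * M * (t / r) ^+ 2 + e / 2 * t)).
      exact: lerD.
    rewrite expr_div_n.
    have -> : 2 * M * (t ^+ 2 / r ^+ 2) = t * (t * (2 * M / r ^+ 2)) by field; rewrite lt0r_neq0.
    have h : t * (2 * M / r ^+ 2) <= e / 2.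
      apply: (@le_trans _ _ (t * B)); first by rewrite ler_wpM2l ?(ltW t0) // /B lerDl.
      by rewrite -ler_pdivlMr.
    have := ler_wpM2l (ltW t0) h; lra.
  by move: H3; rewrite ler_pM2l.
by apply/ler_addgt0Pr => e e0; rewrite add0r; apply: key.
Qed.

Lemma Dv_bound y v (r : R) : 0 < r -> nsz p y + r * nsz 0 v < rho -> cn (Dv f v y) <= M / r.
Proof.
move=> r0 H; rewrite (slice_deriv r0 H); apply: mean_bound => // z zr.
rewrite cnf zr ler_wpM2r ?invr_ge0 ?(ltW r0) //.
by have [] := hb (slice_in H (_ : cn z <= r)); rewrite ?zr.
Qed.

(** The first-order Taylor remainder is quadratic with a constant that depends only on the bound of [f]; this uniformity is what makes the derivatives differentiable. *)
Lemma quad y v : nsz p y < rho / 2 -> nsz 0 v <= rho / 8 ->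
  cn (f (y + v) - f y - Dv f v y) <= 2 * M * (4 / rho) ^+ 2 * nsz 0 v ^+ 2.
Proof.
move=> yr vr.
have rho0 : 0 < rho by have := nsz_ge0 p y; lra.
have [v0|v0] := eqVneq (nsz 0 v) 0.
  have -> : v = 0.
    apply/matrixP => i j; rewrite ord1 mxE; apply/eqP; rewrite -cn_eq0; apply/eqP/le_anti.
    by rewrite cn_ge0 andbT -v0; have := nsz_coord 0 v i; rewrite mxE subr0.
  by rewrite Dv0 addr0 !subrr cn0 nszxx expr0n mulr0.
have n0 : 0 < nsz 0 v by rewrite lt_neqAle eq_sym v0 nsz_ge0.
pose r := rho / (4 * nsz 0 v).
have r0 : 0 < r by rewrite divr_gt0 // mulr_gt0.
have rn : r * nsz 0 v = rho / 4 by rewrite /r; field.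
have H : nsz p y + r * nsz 0 v < rho by rewrite rn; lra.
have r2 : 1 <= r / 2.
  by rewrite /r ler_pdivlMr // mul1r ler_pdivlMr ?mulr_gt0 //; lra.
have := @slice_taylor1 y v r 1 r0 H; rewrite cn1 scale1r mul1r => /(_ r2).
rewrite -(slice_deriv r0 H).
have -> : 2 * M * (4 / rho) ^+ 2 * nsz 0 v ^+ 2 = 2 * M * (1 / r) ^+ 2.
  by rewrite /r; field; rewrite v0 lt0r_neq0.
exact.
Qed.

End Slice.

(** By Cauchy's formula on complex lines the derivative in the direction [v] is a circle mean of values of [f]; the uniform estimate [quad] allows differentiation under the mean. *)
Lemma holDv_pt f p rho M v : 0 < rho -> 0 <= M -> holb p rho f M ->
  exists r, 0 < r /\ r * nsz 0 v < rho / 4 /\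
  hol (Dv f v) p /\ forall j, dz (Dv f v) j p = mean r (fun z => dz f j (p + z *: v) / z).
Proof.
move=> rho0 M0 hb.
have n1 : 0 < nsz 0 v + 1 by rewrite ltr_wpDl // nsz_ge0.
pose r := rho / (8 * (nsz 0 v + 1)).
have r0 : 0 < r by rewrite divr_gt0 // mulr_gt0.
have rn : r * nsz 0 v < rho / 4.
  apply: (@le_lt_trans _ _ (r * (nsz 0 v + 1))); first by rewrite ler_wpM2l ?(ltW r0) // lerDl.
  have -> : r * (nsz 0 v + 1) = rho / 8 by rewrite /r; field; rewrite lt0r_neq0.
  by lra.
exists r; split=> //; split=> //.
have bd j : bdc r (fun z => dz f j (p + z *: v) / z).
  exists (M / (rho / (4 * (nsz 0 (delta_mx j 0 : V) + 1))) / r) => z zr.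
  have nj : 0 < nsz 0 (delta_mx j 0 : V) + 1 by rewrite ltr_wpDl // nsz_ge0.
  rewrite cnf zr ler_wpM2r ?invr_ge0 ?(ltW r0) // -Dv_delta.
  apply: (Dv_bound hb); first by rewrite divr_gt0 // mulr_gt0.
  have h1 : nsz p (p + z *: v) < rho / 4 by rewrite nsz0 nszZ zr.
  have h2 : rho / (4 * (nsz 0 (delta_mx j 0 : V) + 1)) * nsz 0 (delta_mx j 0 : V) <= rho / 4.
    rewrite invfM mulrA -mulrA ler_piMr ?divr_ge0 ?(ltW rho0) //.
    by rewrite mulrC ler_pdivrMr // mul1r lerDl.
  by lra.
have bdh (h : V) : bdc r (fun z => Dv f h (p + z *: v) / z) /\
   mean r (fun z => Dv f h (p + z *: v) / z) = \sum_j mean r (fun z => dz f j (p + z *: v) / z) * h j 0.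
  have E z : Dv f h (p + z *: v) / z = \sum_j h j 0 * (dz f j (p + z *: v) / z).
    by rewrite /Dv mulr_suml; apply: eq_bigr => j _; rewrite mulrA.
  rewrite (mean_eq r0 (fun z _ => E z)).
  have : bdc r (fun z => \sum_j h j 0 * (dz f j (p + z *: v) / z)) /\
     mean r (fun z => \sum_j h j 0 * (dz f j (p + z *: v) / z)) =
     \sum_j mean r (fun z => dz f j (p + z *: v) / z) * h j 0.
    elim: (index_enum _) => [|j s [[K HK] IH]].
      split; first by exists 0 => z _; rewrite big_nil cn0.
      rewrite big_nil; rewrite (mean_eq r0 (h := fun=> 0)); first exact: mean_cst.
      by move=> z _; rewrite big_nil.
    have b1 : bdc r (fun z => h j 0 * (dz f j (p + z *: v) / z)).
      by case: (bd j) => K' HK'; exists (cn (h j 0) * K') => z zr; rewrite cnM ler_wpM2l ?cn_ge0 ?HK'.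
    have b2 : bdc r (fun z => \sum_(j <- s) h j 0 * (dz f j (p + z *: v) / z)) by exists K.
    rewrite big_cons -IH (mulrC _ (h j 0)) -(meanZ r0 _ (bd j)) -(meanD r0 b1 b2).
    split; last by apply: mean_eq => // z _; rewrite big_cons.
    case: b1 => K1 H1; exists (K1 + K) => z zr; rewrite big_cons.
    by apply: (le_trans (cnD _ _)); rewrite lerD ?H1 ?HK.
  move=> [[K HK] H2]; split=> //; exists K => z zr; rewrite E; exact: HK.
apply: (hol_intro (a := fun j => mean r (fun z => dz f j (p + z *: v) / z))).
pose a j := mean r (fun z => dz f j (p + z *: v) / z).
split.
  exists (\sum_j cn (a j)); first by apply: sumr_ge0 => j _; apply: cn_ge0.
  move=> y; apply: (le_trans (cn_sum _ _ _)); rewrite mulr_suml; apply: ler_sum => j _.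
  by rewrite cnM ler_wpM2l ?cn_ge0 // !mxE nsz_coord.
move=> e e0.
pose Q := 2 * M * (4 / rho) ^+ 2 / r + 1.
have Q0 : 0 < Q.
  by rewrite ltr_wpDl // divr_ge0 ?(ltW r0) // mulr_ge0 ?exprn_ge0 ?divr_ge0 ?mulr_ge0 ?(ltW rho0).
exists (Num.min (rho / 8) (e / Q)); first by rewrite lt_min !divr_gt0.
move=> y; rewrite lt_min => /andP[y1 y2].
pose h := y - p; have nh : nsz 0 h = nsz p y by rewrite nsz_sub.
have Ey : y = p + h by rewrite addrC subrK.
have D1 : Dv f v y = mean r (fun z => f (y + z *: v) / z).
  by apply: (slice_deriv hb) => //; lra.
have D2 : Dv f v p = mean r (fun z => f (p + z *: v) / z).
  by apply: (slice_deriv hb) => //; rewrite nszxx; lra.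
have B q : nsz p q + r * nsz 0 v < rho -> bdc r (fun z => f (q + z *: v) / z).
  move=> Hq; exists (M / r) => z zr; rewrite cnf zr ler_wpM2r ?invr_ge0 ?(ltW r0) //.
  by have [] := hb _ (slice_in Hq (_ : cn z <= r)); rewrite ?zr.
have By : bdc r (fun z => f (y + z *: v) / z) by apply: B; lra.
have Bp : bdc r (fun z => f (p + z *: v) / z) by apply: B; rewrite nszxx; lra.
have [Bh Eh] := bdh h.
have Bn (g : C -> C) : bdc r g -> bdc r (fun z => -1 * g z).
  by move=> [K HK]; exists K => z /HK; rewrite mulN1r cnN.
have Bd (g g' : C -> C) : bdc r g -> bdc r g' -> bdc r (fun z => g z + g' z).
  move=> [K HK] [K' HK']; exists (K + K') => z zr; apply: (le_trans (cnD _ _)).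
  by rewrite lerD ?HK ?HK'.
rewrite -Eh D1 D2.
have -> : mean r (fun z => f (y + z *: v) / z) - mean r (fun z => f (p + z *: v) / z) - mean r (fun z => Dv f h (p + z *: v) / z)
  = mean r (fun z => f (y + z *: v) / z + -1 * (f (p + z *: v) / z) + -1 * (Dv f h (p + z *: v) / z)).
  rewrite meanD //; [|by apply: Bd => //; apply: Bn|exact: Bn].
  rewrite meanD //; last exact: Bn.
  by rewrite !meanZ // !mulN1r.
apply: (@le_trans _ _ (2 * M * (4 / rho) ^+ 2 * nsz p y ^+ 2 / r)); last first.
  have -> : 2 * M * (4 / rho) ^+ 2 * nsz p y ^+ 2 / r = (2 * M * (4 / rho) ^+ 2 / r) * nsz p y * nsz p y by ring.
  rewrite ler_wpM2r ?nsz_ge0 //; apply: (@le_trans _ _ (Q * nsz p y)).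
    by rewrite ler_wpM2r ?nsz_ge0 // /Q lerDl.
  by rewrite mulrC -ler_pdivlMr // ltW.
apply: mean_bound => // z zr.
have -> : f (y + z *: v) / z + -1 * (f (p + z *: v) / z) + -1 * (Dv f h (p + z *: v) / z) =
  (f ((p + z *: v) + h) - f (p + z *: v) - Dv f h (p + z *: v)) / z.
  by rewrite Ey [p + h + _]addrAC !mulrBl !mulN1r.
rewrite cnf zr ler_wpM2r ?invr_ge0 ?(ltW r0) // -nh.
by apply: (quad hb); [rewrite nsz0 nszZ zr; lra|rewrite nh ltW].
Qed.

Lemma holU_Dv U f v : open U -> holU U f -> holU U (Dv f v).
Proof.
move=> oU hf p Up; have [rho [M [r0 M0 hb _]]] := holU_bounded oU Up hf.
by have [r [_ [_ []]]] := holDv_pt v r0 M0 hb.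
Qed.

Lemma holU_dz U f j : open U -> holU U f -> holU U (dz f j).
Proof.
move=> oU hf; have -> : dz f j = Dv f (delta_mx j 0); last exact: holU_Dv.
by apply/funext => x; rewrite Dv_delta.
Qed.

Lemma Dv_comm U f v w p : open U -> U p -> holU U f -> Dv (Dv f v) w p = Dv (Dv f w) v p.
Proof.
move=> oU Up hf; have [rho [M [r0 M0 hb HU]]] := holU_bounded oU Up hf.
suff H j : dz (Dv f v) j p = Dv (dz f j) v p.
  rewrite {1}/Dv (eq_bigr (fun j => w j 0 * Dv (dz f j) v p)); last by move=> j _; rewrite H.
  rewrite /Dv.
  have E k : dz (fun x => \sum_j w j 0 * dz f j x) k p = \sum_j w j 0 * dz (dz f j) k p.
    have Wj j : W (fun x => w j 0 * dz f j x) p.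
      exact: (W_mul (W_cst _ p).1 (holU_dz j oU hf Up).1).1.
    have [_ D1] := @W_sum _ _ _ (index_enum 'I_N) (fun j x => w j 0 * dz f j x) p Wj.
    have h : hol (fun x => \sum_j w j 0 * dz f j x) p by apply: (holU_Dv w oU hf Up).
    rewrite -[LHS]Dv_delta -(hol_vder (delta_mx k 0, 0) h) D1; apply: eq_bigr => j _.
    rewrite (vderM _ (W_cst _ p).1 (holU_dz j oU hf Up).1) vder_cst mul0r add0r.
    by rewrite hol_vder ?Dv_delta //; apply: (holU_dz j oU hf Up).
  under [RHS]eq_bigr do rewrite E mulr_sumr.
  rewrite [RHS]exchange_big /=; apply: eq_bigr => j _; rewrite mulr_sumr.
  by apply: eq_bigr => k _; rewrite mulrCA.
have [rho' [M' [r0' M0' hb' HU']]] := holU_bounded oU Up (holU_dz j oU hf).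
pose m := Num.min rho rho'.
have m0 : 0 < m by rewrite lt_min r0.
have hbm : holb p m f M by apply: (holb_mono hb); rewrite nszxx addr0 ge_min lexx.
have [r [rp [rn [_ ->]]]] := holDv_pt v m0 M0 hbm.
rewrite (slice_deriv hb' rp) // nszxx add0r; apply: (lt_le_trans rn).
apply: (@le_trans _ _ m); first by rewrite ler_pdivrMr // ler_pMr // ler1n.
by rewrite ge_min lexx orbT.
Qed.

Lemma holU_Ck U f k : open U -> holU U f -> Ck k U f.
Proof.
move=> oU; elim: k f => [|k IH] f hf; first by move=> x /hf[Wf _]; apply: W_cont.
apply: (Ck_intro (df := Dv f)) => //.
- by move=> x /hf[].
- by move=> v x /hf h; rewrite hol_vder.
- by move=> v; apply: IH; apply: holU_Dv.
Qed.

End Hol.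

(** * Taylor expansion of holomorphic functions *)

Section HolAlgebra.
Variables (R : realType) (N : nat).
Local Notation C := R[i].
Local Notation V := 'cV[R[i]]_N.
Implicit Types (f g : V -> C) (x y v p : V) (U : set V).

Lemma hol_of_vder f x : W f x -> (forall v : V, vder (0, v) f x = 0) -> hol f x.
Proof.
move=> Wf H; split=> // j; have := H (delta_mx j 0).
rewrite /vder (bigD1 j) //= big1 => [|k kj]; rewrite !mxE mul0r add0r.
  by rewrite !eqxx /= mul1r addr0.
by rewrite (negbTE kj) /= mul0r.
Qed.

Lemma hol_vder0 f x (v : V) : hol f x -> vder (0, v) f x = 0.
Proof. by move=> hf; rewrite hol_vder // Dv0. Qed.

Lemma hol_near f g x : (\forall y \near x, f y = g y) -> hol f x -> hol g x.
Proof.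
move=> fg [Wf Hf]; have [Wg Hg] := W_near fg Wf.
by split=> // j; rewrite (Hg j).2.
Qed.

Lemma hol_cst (c : C) x : hol (fun=> c) x.
Proof. by split=> [|j]; [exact: (W_cst c x).1|exact: ((W_cst c x).2 j).2]. Qed.

Lemma hol_coord j x : hol (fun y => y j 0) x.
Proof. by split=> [|k]; [exact: (W_coord j x).1|exact: ((W_coord j x).2 k).2]. Qed.

Lemma hol_add f g x : hol f x -> hol g x -> hol (fun y => f y + g y) x.
Proof.
move=> hf hg; apply: hol_of_vder => [|v]; first exact: (W_add hf.1 hg.1).1.
by rewrite (vderD _ hf.1 hg.1) !hol_vder0 // addr0.
Qed.

Lemma hol_mul f g x : hol f x -> hol g x -> hol (fun y => f y * g y) x.
Proof.
move=> hf hg; apply: hol_of_vder => [|v]; first exact: (W_mul hf.1 hg.1).1.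
by rewrite (vderM _ hf.1 hg.1) !hol_vder0 // mul0r mulr0 addr0.
Qed.

Lemma hol_opp f x : hol f x -> hol (fun y => - f y) x.
Proof.
move=> hf; have -> : (fun y => - f y) = (fun y => -1 * f y).
  by apply/funext => y; rewrite mulN1r.
by apply: hol_mul => //; apply: hol_cst.
Qed.

Lemma hol_sub f g x : hol f x -> hol g x -> hol (fun y => f y - g y) x.
Proof. by move=> hf hg; apply: hol_add => //; apply: hol_opp. Qed.

Lemma hol_inv f x : f x != 0 -> hol f x -> hol (fun y => (f y)^-1) x.
Proof.
move=> f0 hf; have [H1 H2] := W_cdiff hf.1 (cdiff_inv f0); split=> // j.
by rewrite (H2 j).2 hf.2 mulr0.
Qed.

Lemma hol_sum (I : Type) (r : seq I) (P : pred I) (F : I -> V -> C) x :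
  (forall i, P i -> hol (F i) x) -> hol (fun y => \sum_(i <- r | P i) F i y) x.
Proof.
move=> H; elim: r => [|i r IH].
  have -> : (fun y => \sum_(i <- [::] | P i) F i y) = (fun=> 0) by apply/funext => y; rewrite big_nil.
  exact: hol_cst.
have -> : (fun y => \sum_(j <- i :: r | P j) F j y) = (fun x => if P i then F i x + \sum_(i <- r | P i) F i x else \sum_(i <- r | P i) F i x).
  by apply/funext => y; rewrite big_cons.
by case Pi: (P i) => //; apply: hol_add => //; apply: H.
Qed.

Lemma hol_prod (I : Type) (r : seq I) (P : pred I) (F : I -> V -> C) x :
  (forall i, P i -> hol (F i) x) -> hol (fun y => \prod_(i <- r | P i) F i y) x.
Proof.
move=> H; elim: r => [|i r IH].
  have -> : (fun y => \prod_(i <- [::] | P i) F i y) = (fun=> 1) by apply/funext => y; rewrite big_nil.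
  exact: hol_cst.
have -> : (fun y => \prod_(j <- i :: r | P j) F j y) = (fun x => if P i then F i x * \prod_(i <- r | P i) F i x else \prod_(i <- r | P i) F i x).
  by apply/funext => y; rewrite big_cons.
by case Pi: (P i) => //; apply: hol_mul => //; apply: H.
Qed.

End HolAlgebra.

Lemma hol_comp (R : realType) (M N : nat) (f : 'cV[R[i]]_N -> R[i]) (phi : 'cV[R[i]]_M -> 'cV[R[i]]_N) x :
  hol f (phi x) -> (forall j, hol (fun y => phi y j 0) x) -> hol (fun y => f (phi y)) x.
Proof.
move=> hf hp; have [W1 D1] := W_comp hf.1 (fun j => (hp j).1).
apply: hol_of_vder => // v; rewrite D1 big1 // => j _.
by rewrite (hol_vder0 _ (hp j)) hf.2 mulr0 mul0r addr0.
Qed.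

Section Taylor.
Variable R : realType.
Local Notation C := R[i].

Lemma taylor_real n (u : nat -> R -> R) (B : R) :
  (forall k, (k <= n)%N -> forall t : R, 0 <= t <= 1 -> is_derive t 1 (u k) (u k.+1 t)) ->
  (forall t : R, 0 <= t <= 1 -> `|u n.+1 t| <= B) ->
  `|u 0%N 1 - \sum_(k < n.+1) u k 0 / k`!%:R| <= B / n`!%:R.
Proof.
move=> Hu HB.
pose w m (t : R) := \sum_(k < m.+1) (u k t * (1 - t) ^+ k) / k`!%:R.
have dw m (t : R) : (m <= n)%N -> 0 <= t <= 1 -> is_derive t 1 (w m) (u m.+1 t * (1 - t) ^+ m / m`!%:R).
  elim: m => [|m IH] mn t01.
    have -> : w 0%N = u 0%N.
      by apply/funext => s; rewrite /w big_ord1 /= expr0 mulr1 fact0 divr1.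
    by rewrite expr0 mulr1 fact0 divr1; apply: Hu.
  have -> : w m.+1 = (w m : R -> R) + (fun s => u m.+1 s * (1 - s) ^+ m.+1 * (m.+1)`!%:R^-1).
    by apply/funext => s; rewrite /w big_ord_recr.
  have D1 := IH (ltnW mn) t01; have D2 := Hu _ mn t t01.
  have D3 : is_derive t 1 (fun s : R => (1 - s) ^+ m.+1) (- (m.+1%:R * (1 - t) ^+ m)).
    have -> : (fun s : R => (1 - s) ^+ m.+1) = (cst 1 - id : R -> R) ^+ m.+1.
      by apply/funext => s; rewrite fctE.
    apply: is_derive_eq; rewrite fctE /= sub0r scalerN scaler1.
    by rewrite -mulr_natl.
  have f0 : (m.+1)`!%:R != 0 :> R by rewrite pnatr_eq0 -lt0n fact_gt0.
  have g0 : m`!%:R != 0 :> R by rewrite pnatr_eq0 -lt0n fact_gt0.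
  have D4 : is_derive t 1 (fun s => u m.+1 s * (1 - s) ^+ m.+1 * (m.+1)`!%:R^-1)
     ((u m.+2 t * (1 - t) ^+ m.+1 + u m.+1 t * (- (m.+1%:R * (1 - t) ^+ m))) / (m.+1)`!%:R).
    have D5 := is_deriveM D2 D3.
    have D6 := is_deriveM D5 (is_derive_cst ((m.+1)`!%:R^-1 : R) t 1).
    apply: (is_derive_eq D6); rewrite scaler0 add0r /GRing.scale /=; ring.
  apply: (is_derive_eq (is_deriveD D1 D4)).
  by rewrite factS natrM; field; rewrite g0 /= addrC natr1 pnatr_eq0.
have -> : u 0%N 1 = w n 1.
  rewrite /w big_ord_recl /= expr0 mulr1 fact0 divr1 big1 ?addr0 // => k _.
  by rewrite subrr expr0n /= mulr0 mul0r.
have -> : \sum_(k < n.+1) u k 0 / k`!%:R = w n 0.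
  by apply: eq_bigr => k _; rewrite subr0 expr1n mulr1.
rewrite -[w n 1 - w n 0]subr0.
apply: (@mv_real _ (w n) (fun t => u n.+1 t * (1 - t) ^+ n / n`!%:R) 0 (B / n`!%:R)).
  by move=> t t01; apply: dw.
move=> t t01; rewrite subr0 !normrM normfV normr_nat ler_wpM2r ?invr_ge0 //.
have /andP[t0 t1] := t01.
rewrite -[leRHS]mulr1 ler_pM ?HB // normrX exprn_ile1 // ger0_norm ?subr_ge0 //.
by rewrite lerBlDr lerDl.
Qed.

Lemma pow_fact n : n%:R ^+ n <= expR 1 ^+ n * n`!%:R :> R.
Proof.
elim: n => [|n IH]; first by rewrite !expr0 mul1r fact0.
case: n IH => [|n] IH.
  by rewrite !expr1 mulr1; apply: le_trans (expR_ge1Dx 1); rewrite lerDl.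
have H : (n.+2%:R ^+ n.+1 : R) <= expR 1 * n.+1%:R ^+ n.+1.
  have -> : expR 1 = expR (n.+1%:R^-1) ^+ n.+1 :> R.
    by rewrite -expRM_natl mulfV ?pnatr_eq0.
  rewrite -exprMn lerXn2r ?nnegrE ?mulr_ge0 ?expR_ge0 //.
  apply: (@le_trans _ _ ((1 + n.+1%:R^-1) * n.+1%:R)).
    by rewrite mulrDl mul1r mulVf ?pnatr_eq0 // -natr1.
  by rewrite ler_wpM2r // expR_ge1Dx.
rewrite exprS factS natrM.
apply: (@le_trans _ _ (n.+2%:R * (expR 1 * n.+1%:R ^+ n.+1))); first by rewrite ler_wpM2l.
rewrite [leRHS]mulrCA ler_wpM2l //.
by rewrite [expR 1 ^+ n.+2]exprS -mulrA ler_wpM2l ?expR_ge0.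
Qed.

Variable N : nat.
Local Notation V := 'cV[R[i]]_N.
Implicit Types (f g : V -> C) (x y v p : V) (U : set V).

(** The [k]-th derivative in the direction [v]. *)
Definition iDv k f v : V -> C := iter k (fun g => Dv g v) f.

Lemma holU_iDv U k f v : open U -> holU U f -> holU U (iDv k f v).
Proof. by move=> oU hf; elim: k => [|k IH] //=; apply: holU_Dv. Qed.

Definition oball p (rho : R) : set V := [set y | nsz p y < rho].

Lemma open_oball p rho : open (oball p rho).
Proof.
rewrite openE => y /= Hy; apply/nbhs_nszP; exists (rho - nsz p y); first by rewrite subr_gt0.
move=> z Hz; rewrite /oball /=; apply: (le_lt_trans (nsz_tri p y z)); lra.
Qed.

Lemma holb_Dv p rho f M v r : holb p rho f M -> 0 < r ->
  holb p (rho - r * nsz 0 v) (Dv f v) (M / r).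
Proof.
move=> hb r0 y Hy; split.
  have hU : holU (oball p rho) f by move=> z Hz; have [] := hb z Hz.
  apply: (holU_Dv v (@open_oball p rho) hU).
  by apply: lt_le_trans Hy _; rewrite gerBl mulr_ge0 ?nsz_ge0 // ltW.
by apply: (Dv_bound hb) => //; lra.
Qed.

Lemma iDv_bound k p rho f M v r y : holb p rho f M -> 0 < r ->
  nsz p y + k%:R * (r * nsz 0 v) < rho -> cn (iDv k f v y) <= M / r ^+ k.
Proof.
elim: k rho f M => [|k IH] rho f M hb r0 Hy.
  by rewrite expr0 divr1; apply: (hb y _).2; rewrite mul0r addr0 in Hy.
rewrite /iDv iterSr exprS invfM mulrA; apply: (IH (rho - r * nsz 0 v)) => //.
  exact: holb_Dv.
by move: Hy; rewrite -natr1; lra.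
Qed.

(** The Taylor remainder of order [n] along a real segment, estimated by the Cauchy bound on iterated derivatives. *)
Lemma taylor_bound p rho f M v n : holb p rho f M -> 0 <= M -> 0 < rho ->
  4 * expR 1 * nsz 0 v <= rho ->
  cn (f (p + v) - \sum_(k < n.+1) iDv k f v p / k`!%:R) <= 2 * M * (n.+1%:R / 2 ^+ n.+1).
Proof.
move=> hb M0 rho0 Hv.
have E1 : 1 < expR 1 :> R by rewrite expR_gt1.
have E0 : 0 < expR 1 :> R by rewrite expR_gt0.
have nv0 := nsz_ge0 0 v.
have vr : nsz 0 v <= rho / 4.
  rewrite ler_pdivlMr // mulrC; apply: le_trans Hv; rewrite -mulrA ler_wpM2l //.
  by rewrite ler_peMl ?(ltW E1).
pose r : R := 2 * expR 1 / n.+1%:R.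
have r0 : 0 < r by rewrite divr_gt0 ?mulr_gt0.
have B (t : R) : 0 <= t <= 1 -> nsz p (p + ((t%:C)%C) *: v) <= rho / 4.
  move=> /andP[t0 t1]; rewrite nsz0 nszZ cn_real ger0_norm //.
  by apply: le_trans vr; rewrite ler_piMl.
have n0 : n.+1%:R != 0 :> R by rewrite pnatr_eq0.
have Bn (t : R) : 0 <= t <= 1 -> cn (iDv n.+1 f v (p + ((t%:C)%C) *: v)) <= M * (n.+1`!%:R / 2 ^+ n.+1).
  move=> /B h; apply: (le_trans (iDv_bound hb r0 _)).
    have -> : n.+1%:R * (r * nsz 0 v) = (4 * expR 1 * nsz 0 v) / 2 by rewrite /r; field.
    by lra.
  rewrite ler_wpM2l // /r expr_div_n exprMn invfM invrK.
  rewrite [leLHS](_ : _ = n.+1%:R ^+ n.+1 / expR 1 ^+ n.+1 / 2 ^+ n.+1).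
    rewrite ler_wpM2r ?invr_ge0 ?exprn_ge0 // ler_pdivrMr ?exprn_gt0 // mulrC.
    exact: pow_fact.
  field; rewrite !expf_neq0 ?pnatr_eq0 //; exact: lt0r_neq0.
have hU : holU (oball p rho) f by move=> z Hz; have [] := hb z Hz.
have line k (t : R) : 0 <= t <= 1 ->
  is_derive t 1 (fun s : R => complex.Re (iDv k f v (p + ((s%:C)%C) *: v)))
     (complex.Re (iDv k.+1 f v (p + ((t%:C)%C) *: v))) /\
  is_derive t 1 (fun s : R => complex.Im (iDv k f v (p + ((s%:C)%C) *: v)))
     (complex.Im (iDv k.+1 f v (p + ((t%:C)%C) *: v))).
  move=> t01.
  have hk : hol (iDv k f v) (p + ((t%:C)%C) *: v).
    apply: (holU_iDv k v (@open_oball p rho) hU); apply: (le_lt_trans (B t t01)).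
    by rewrite ltr_pdivrMr // ltr_pMr // ltr1n.
  have [rd rE] := hol_rderive v hk.
  have := @rderivable_line _ _ (iDv k f v) v p 1 t; rewrite mulr1 => /(_ rd).
  rewrite rE mul1r.
  have E : (fun u : R => iDv k f v (p + (((u * 1)%:C)%C) *: v)) = (fun u : R => iDv k f v (p + ((u%:C)%C) *: v)).
    by apply/funext => u; rewrite mulr1.
  by move=> [D1 D2]; split; [move: D1; rewrite -/(_ \o (fun u : R => iDv k f v (p + (((u * 1)%:C)%C) *: v))) E|move: D2; rewrite -/(_ \o (fun u : R => iDv k f v (p + (((u * 1)%:C)%C) *: v))) E].
have M2 : 2 * M * (n.+1%:R / 2 ^+ n.+1) = M * (n.+1`!%:R / 2 ^+ n.+1) / n`!%:R + M * (n.+1`!%:R / 2 ^+ n.+1) / n`!%:R.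
  rewrite factS natrM; field; rewrite !pnatr_eq0 -lt0n fact_gt0 /=; exact: lt0r_neq0 (exprn_gt0 _ _).
have S (g : C -> R) : (forall z w, g (z + w) = g z + g w) -> (forall (t : R) z, g (((t%:C)%C) * z) = t * g z) ->
  g (f (p + v) - \sum_(k < n.+1) iDv k f v p / k`!%:R) =
  g (iDv 0 f v (p + ((1%:C)%C) *: v)) - \sum_(k < n.+1) g (iDv k f v (p + ((0%:C)%C) *: v)) / k`!%:R.
  move=> gD gZ.
  have g0 : g 0 = 0 by have := gZ 0 0; rewrite mulr0 mul0r.
  have gN z : g (- z) = - g z by apply/eqP; rewrite -addr_eq0 -gD addNr g0.
  rewrite gD gN /= rmorph1 scale1r; congr (_ - _).
  rewrite scale0r addr0; elim/big_rec2: _ => // k a b _ <-; rewrite gD; congr (_ + _).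
  have -> : (k`!%:R)^-1 = (((k`!%:R^-1 : R)%:C)%C) :> C by rewrite fmorphV rmorph_nat.
  by rewrite mulrC gZ mulrC.
apply: (le_trans (cn_ReIm _)); rewrite M2; apply: lerD.
  rewrite (S (fun z => complex.Re z)).
  - apply: (@taylor_real n (fun k t => complex.Re (iDv k f v (p + ((t%:C)%C) *: v)))).
      by move=> k _ t t01; have [] := line k t t01.
    by move=> t t01; apply: le_trans (Bn t t01); apply: cn_Re.
  - exact: Re_add.
  - by move=> t z; rewrite Re_mul /= mul0r subr0.
rewrite (S (fun z => complex.Im z)).
- apply: (@taylor_real n (fun k t => complex.Im (iDv k f v (p + ((t%:C)%C) *: v)))).
    by move=> k _ t t01; have [] := line k t t01.
  by move=> t t01; apply: le_trans (Bn t t01); apply: cn_Im.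
- exact: Im_add.
- by move=> t z; rewrite Im_mul /= mul0r addr0.
Qed.

Lemma pow_small (q e : R) : 0 <= q -> q < 1 -> 0 < e ->
  exists n0, forall n, (n0 <= n)%N -> q ^+ n < e.
Proof.
move=> q0 q1 e0; have : (fun n => q ^+ n) @ \oo --> (0 : R) by apply: cvg_expr; rewrite ger0_norm.
move=> /cvgrPdist_lt/(_ e e0)[n0 _ H]; exists n0 => n nn.
by have := H n nn; rewrite /= sub0r normrN ger0_norm ?exprn_ge0.
Qed.

Lemma half_pow_le n : n.+1%:R / 2 ^+ n.+1 <= (3 / 4) ^+ n :> R.
Proof.
have H m : m.+1%:R <= 2 * (3 / 2) ^+ m :> R.
  elim: m => [|[|m] IH]; first by rewrite expr0 mulr1 ler1n.
    by rewrite expr1; lra.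
  have E : m.+3%:R = m.+2%:R + 1 :> R by rewrite natr1.
  have F : 2 <= m.+2%:R :> R by rewrite ler_nat.
  by rewrite exprS E; lra.
rewrite ler_pdivrMr ?exprn_gt0 // exprS mulrCA -exprMn.
apply: (le_trans (H n)); rewrite ler_wpM2l //.
by have -> : 3 / 4 * 2 = 3 / 2 :> R by field.
Qed.

(** Taken on a ball small compared with the one where [f] is bounded, so that the factor [n ^ n / n!] of the Cauchy bounds is absorbed. *)
Lemma taylor_cvg p rho f M v : holb p rho f M -> 0 <= M -> 0 < rho ->
  4 * expR 1 * nsz 0 v <= rho -> forall e, 0 < e -> exists n0, forall n, (n0 <= n)%N ->
  cn (f (p + v) - \sum_(k < n) iDv k f v p / k`!%:R) < e.
Proof.
move=> hb M0 rho0 Hv e e0.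
have M1 : 0 < 2 * M + 1 by rewrite ltr_wpDl // mulr_ge0.
have [|||n0 H] := @pow_small (3 / 4) (e / (2 * M + 1)).
- by rewrite divr_ge0.
- lra.
- by rewrite divr_gt0.
exists n0.+1 => -[//|n] /H h; apply: (le_lt_trans (taylor_bound n hb M0 rho0 Hv)).
apply: (@le_lt_trans _ _ ((2 * M + 1) * (3 / 4) ^+ n)).
  apply: ler_pM; rewrite ?mulr_ge0 ?divr_ge0 ?exprn_ge0 //; first by rewrite lerDl.
  exact: half_pow_le.
by rewrite mulrC -ltr_pdivlMr.
Qed.

End Taylor.

(** * Real analyticity of restrictions to the conjugate diagonal *)

Section PowerSeries.
Variables (R : realType) (N : nat).
Local Notation C := R[i].
Local Notation V := 'cV[R[i]]_N.
Implicit Types (f g : V -> C) (x y v p : V) (U : set V).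

Lemma Dv_near f g v y : (\forall x \near y, f x = g x) -> hol f y -> Dv g v y = Dv f v y.
Proof.
move=> fg [Wf _]; have [_ H] := W_near fg Wf.
by apply: eq_bigr => j _; rewrite (H j).1.
Qed.

Lemma Dv_sum (I : finType) (c : I -> C) (g : I -> V -> C) v y : (forall i, hol (g i) y) ->
  Dv (fun x => \sum_i c i * g i x) v y = \sum_i c i * Dv (g i) v y.
Proof.
move=> hg.
have Wj i : W (fun x => c i * g i x) y by exact: (W_mul (W_cst _ y).1 (hg i).1).1.
have [_ D1] := @W_sum _ _ _ (index_enum I) (fun i x => c i * g i x) y Wj.
have h : hol (fun x => \sum_i c i * g i x) y.
  by apply: hol_sum => i _; apply: hol_mul => //; apply: hol_cst.
rewrite -(hol_vder (v, 0) h) D1; apply: eq_bigr => i _.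
by rewrite (vderM _ (W_cst _ y).1 (hg i).1) vder_cst mul0r add0r hol_vder.
Qed.

Lemma iDv_sum (I : finType) (c : I -> C) (g : I -> V -> C) U k v y : open U ->
  (forall i, holU U (g i)) -> U y ->
  iDv k (fun x => \sum_i c i * g i x) v y = \sum_i c i * iDv k (g i) v y.
Proof.
move=> oU hg; elim: k y => [|k IH] y Uy //=.
rewrite (@Dv_near (fun x => \sum_i c i * iDv k (g i) v x)).
- by rewrite Dv_sum // => i; apply: (holU_iDv k v oU (hg i)).
- by apply: filterS (open_near oU Uy) => z /IH.
- by apply: hol_sum => i _; apply: hol_mul; [exact: hol_cst|apply: (holU_iDv k v oU (hg i))].
Qed.

Fixpoint pds (t : seq 'I_N) f : V -> C := if t is j :: s then pds s (dz f j) else f.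

Lemma big_tuple_cons (T : finType) k (F : seq T -> C) :
  \sum_(t : k.+1.-tuple T) F t = \sum_(j : T) \sum_(t : k.-tuple T) F (j :: t).
Proof.
rewrite pair_big /= (reindex (fun q : T * k.-tuple T => [tuple of q.1 :: q.2])) //=.
exists (fun t : k.+1.-tuple T => (thead t, [tuple of behead t])) => [[j t]|t] _ /=.
  by rewrite theadE; congr pair; apply: val_inj.
by rewrite [RHS]tuple_eta.
Qed.

Lemma iDv_tuple U k f v y : open U -> holU U f -> U y ->
  iDv k f v y = \sum_(t : k.-tuple 'I_N) (\prod_(j <- t) v j 0) * pds t f y.
Proof.
move=> oU; elim: k f => [|k IH] f hf Uy.
  rewrite (big_pred1 [tuple]) => [|t]; last by apply/esym/eqP; exact: tuple0.
  by rewrite big_nil mul1r.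
rewrite (big_tuple_cons k (fun t => (\prod_(j <- t) v j 0) * pds t f y)).
rewrite /iDv iterSr -/(iDv k (Dv f v) v).
rewrite (@iDv_sum _ (fun j => v j 0) (dz f) U) //; last by move=> j; apply: holU_dz.
apply: eq_bigr => j _; rewrite IH //; last exact: holU_dz.
by rewrite mulr_sumr; apply: eq_bigr => t _; rewrite big_cons mulrA.
Qed.

Lemma nsz_delta (j : 'I_N) : nsz 0 (delta_mx j 0 : V) = 1.
Proof.
rewrite /nsz (bigD1 j) //= big1 => [|k kj]; rewrite !mxE subr0.
  by rewrite !eqxx cn1 addr0.
by rewrite (negbTE kj) cn0.
Qed.

Lemma pds_bound t p rho f M r : holb p rho f M -> 0 < r -> (size t)%:R * r < rho ->
  cn (pds t f p) <= M / r ^+ size t.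
Proof.
elim: t f M rho => [|j t IH] f M rho hb r0 H.
  by rewrite /= expr0 divr1; apply: (hb p _).2; rewrite nszxx; rewrite mul0r in H.
rewrite /= exprS invfM mulrA; apply: (IH _ _ (rho - r)) => //; last first.
  by move: H => /=; rewrite -natr1; lra.
have -> : dz f j = Dv f (delta_mx j 0) by apply/funext => x; rewrite Dv_delta.
by have := holb_Dv (v := delta_mx j 0) hb r0; rewrite nsz_delta mulr1.
Qed.

Lemma tuple_sum_bound d p rho f M : holb p rho f M -> 0 <= M -> 0 < rho ->
  \sum_(t : d.-tuple 'I_N) cn (pds t f p / d`!%:R) <= M * (N%:R * (2 * expR 1 / rho)) ^+ d.
Proof.
move=> hb M0 rho0.
have E0 : 0 < expR 1 :> R by rewrite expR_gt0.
have f0 : 0 < d`!%:R :> R by rewrite ltr0n fact_gt0.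
have B (t : d.-tuple 'I_N) : cn (pds t f p / d`!%:R) <= M * (2 * expR 1 / rho) ^+ d.
  rewrite cnf cn_nat ler_pdivrMr //.
  case: d f0 t => [|d] f0 t.
    rewrite tuple0 /= fact0 expr0 !mulr1; apply: (hb p _).2; by rewrite nszxx.
  pose r : R := rho / (2 * d.+1%:R).
  have r0 : 0 < r by rewrite divr_gt0 // mulr_gt0.
  have H : (size t)%:R * r < rho.
    have -> : (size t)%:R * r = rho / 2.
      rewrite size_tuple /r; have : d.+1%:R != 0 :> R by rewrite pnatr_eq0.
      by move: (d.+1%:R) => D D0; field.
    by rewrite ltr_pdivrMr // ltr_pMr // ltr1n.
  apply: (le_trans (pds_bound hb r0 H)); rewrite size_tuple -[leRHS]mulrA ler_wpM2l //.
  have -> : (r ^+ d.+1)^-1 = (2 / rho) ^+ d.+1 * d.+1%:R ^+ d.+1.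
    rewrite -exprMn -exprVn; congr (_ ^+ _); rewrite /r; have : d.+1%:R != 0 :> R by rewrite pnatr_eq0.
    by move: (d.+1%:R) => D D0; field; rewrite D0 lt0r_neq0.
  have -> : 2 * expR 1 / rho = (2 / rho) * expR 1 by rewrite mulrAC.
  rewrite [(2 / rho * expR 1) ^+ _]exprMn -[leRHS]mulrA ler_wpM2l ?exprn_ge0 ?divr_ge0 ?(ltW rho0) //.
  exact: pow_fact.
apply: (@le_trans _ _ (\sum_(t : d.-tuple 'I_N) M * (2 * expR 1 / rho) ^+ d)).
  by apply: ler_sum => t _.
rewrite sumr_const card_tuple card_ord -[_ *+ _]mulr_natl natrX [in leRHS]exprMn.
by rewrite mulrCA.
Qed.

End PowerSeries.

Section RealAnalytic.
Variables (R : realType) (N : nat).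
Local Notation C := R[i].
Local Notation V := 'cV[R[i]]_N.
Local Notation K := ('I_N + 'I_N)%type.

(** The point (x, conj x): a function that is real analytic in [x] is a holomorphic function of two groups of variables restricted to these points. *)
Definition wconj (x : V) : 'cV[C]_(N + N) := col_mx x (map_mx (@Num.conj C) x).

Lemma wconjE x j : wconj x j 0 = match fintype.split j with inl k => x k 0 | inr k => (x k 0)^* end.
Proof. by rewrite /wconj mxE; case: fintype.split => k //; rewrite mxE. Qed.

Lemma Ck_wconj k (U : set V) j : open U -> Ck k U (fun x => wconj x j 0).
Proof.
move=> oU; apply: (Ck_eq (f := fun x => match fintype.split j with inl k => x k 0 | inr k => (x k 0)^* end)) => //.
  by move=> x _; rewrite wconjE.
by case: fintype.split => i; [exact: Ck_coord|apply: Ck_conj => //; exact: Ck_coord].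
Qed.

Lemma nsz_wconj x y : nsz (wconj x) (wconj y) = 2 * nsz x y.
Proof.
rewrite /nsz big_split_ord /= mulr_natl mulr2n; congr (_ + _).
  by apply: eq_bigr => j _; rewrite !wconjE !(unsplitK (inl j)).
by apply: eq_bigr => j _; rewrite !wconjE !(unsplitK (inr j)) -rmorphB cnJ.
Qed.

Lemma wconj_smooth (Phi : 'cV[C]_(N + N) -> C) U' (U : set V) : open U' -> open U ->
  holU U' Phi -> (forall x, U x -> U' (wconj x)) -> smooth_on U (fun x => Phi (wconj x)).
Proof.
move=> oU' oU hP UU k; apply: (Ck_comp oU' oU UU); last exact: holU_Ck.
by move=> j; apply: Ck_wconj.
Qed.

Definition cnt d (t : seq 'I_(N + N)) : {ffun K -> 'I_d.+1} :=
  [ffun k => inord (count_mem (unsplit k) t)].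

Lemma cntE d (t : d.-tuple 'I_(N + N)) k : cnt d t k = count_mem (unsplit k) t :> nat.
Proof. by rewrite ffunE inordK // ltnS -{2}(size_tuple t) count_size. Qed.

Lemma prod_count (T : finType) (F : T -> C) (t : seq T) :
  \prod_(j <- t) F j = \prod_j F j ^+ count_mem j t.
Proof.
elim: t => [|a t IH]; first by rewrite big_nil big1.
rewrite big_cons IH (bigD1 a) //= [RHS](bigD1 a) //= eqxx add1n exprS mulrA; congr (_ * _).
by apply: eq_bigr => j /negbTE ja; rewrite eq_sym ja.
Qed.

Lemma cnt_sum d (t : d.-tuple 'I_(N + N)) : (\sum_k (cnt d t k : nat) == d)%N.
Proof.
rewrite (eq_bigr (fun k => count_mem (unsplit k) t)); last by move=> k _; rewrite cntE.
have -> : (\sum_(k : K) count_mem (unsplit k) t = \sum_(j : 'I_(N + N)) count_mem j t)%N.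
  rewrite (reindex (@unsplit N N)) //; exists (@fintype.split N N) => ? _; rewrite ?splitK ?unsplitK //.
suff H (s : seq 'I_(N + N)) : (\sum_(j : 'I_(N + N)) count_mem j s = size s)%N by rewrite H size_tuple.
elim: s => [|a s IH]; first by rewrite big1.
rewrite /= big_split /= IH (bigD1 a) //= eqxx big1 ?addn0 // => j /negbTE.
by rewrite eq_sym => ->.
Qed.

(** All iterated derivatives in coordinate directions with the same multiplicities are collected in one coefficient. *)
Definition acoef (Phi : 'cV[C]_(N + N) -> C) P d (a : {ffun K -> 'I_d.+1}) : C :=
  \sum_(t : d.-tuple 'I_(N + N) | cnt d t == a) pds t Phi P / d`!%:R.

Lemma acoef_part Phi P d v :
  deg_part (@acoef Phi P d) v =
  \sum_(t : d.-tuple 'I_(N + N)) (\prod_(j <- t) wconj v j 0) * (pds t Phi P / d`!%:R).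
Proof.
rewrite /deg_part [RHS](partition_big (fun t : d.-tuple _ => cnt d t) (fun a => (\sum_i (a i : nat) == d)%N)) /=; last first.
  by move=> t _; apply: cnt_sum.
apply: eq_bigr => a _; rewrite /acoef mulr_suml; apply: eq_bigr => t /eqP ta.
rewrite mulrC; congr (_ * _); rewrite [RHS]prod_count.
rewrite [RHS](reindex (@unsplit N N)) /=; last first.
  by exists (@fintype.split N N) => ? _; rewrite ?splitK ?unsplitK.
rewrite big_sumType /= -big_split /=; apply: eq_bigr => j _.
by rewrite -ta !cntE !wconjE (unsplitK (inl j)) (unsplitK (inr j)).
Qed.

Lemma acoef_norm Phi P d :
  deg_norm (@acoef Phi P d) <= ((\sum_(t : d.-tuple 'I_(N + N)) cn (pds t Phi P / d`!%:R))%:C)%C.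
Proof.
rewrite /deg_norm (eq_bigr (fun a => (((cn (acoef Phi P a))%:C)%C))) //.
rewrite -(rmorph_sum (real_complex R)) /= lecR.
rewrite [leRHS](partition_big (fun t : d.-tuple _ => cnt d t) (fun a => (\sum_i (a i : nat) == d)%N)) /=; last first.
  by move=> t _; apply: cnt_sum.
by apply: ler_sum => a _; apply: cn_sum.
Qed.

Lemma cvgCP (u : nat -> C) l : (forall e : R, 0 < e -> exists n0, forall n, (n0 <= n)%N -> cn (u n - l) < e) ->
  u @ \oo --> l.
Proof.
move=> H A /nbhs_CP[e e0 HA]; have [n0 Hn] := H e e0.
by exists n0 => // n /= /Hn /HA.
Qed.

(** The Taylor series of the holomorphic extension, regrouped by total degree in [x - p] and its conjugate. *)
Lemma wconj_analytic (Phi : 'cV[C]_(N + N) -> C) U' p : open U' ->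
  holU U' Phi -> U' (wconj p) -> real_analytic_at (fun x => Phi (wconj x)) p.
Proof.
move=> oU' hP Up; have [rho [M [rho0 M0 hb _]]] := holU_bounded oU' Up hP.
have E0 : 0 < expR 1 :> R by rewrite expR_gt0.
pose Q : R := (N + N)%:R * (2 * expR 1 / rho).
have Q0 : 0 <= Q by rewrite mulr_ge0 // divr_ge0 ?mulr_ge0 // ltW.
pose r : R := Num.min (1 / (2 * (Q + 1))) (rho / (8 * expR 1 * (N%:R + 1))).
have N1 : 0 < N%:R + 1 :> R by rewrite ltr_wpDl.
have Q1 : 0 < Q + 1 by rewrite ltr_wpDl.
have r0 : 0 < r by rewrite lt_min !divr_gt0 ?mulr_gt0.
have rQ : Q * r <= 1 / 2.
  apply: (@le_trans _ _ ((Q + 1) * (1 / (2 * (Q + 1))))); last first.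
    by rewrite le_eqVlt; apply/orP; left; apply/eqP; field; rewrite lt0r_neq0.
  by apply: ler_pM => //; [exact: ltW|rewrite lerDl|rewrite /r ge_min lexx].
exists ((r%:C)%C), (@acoef Phi (wconj p)); split.
- by rewrite ltcR.
- pose u d : R := \sum_(a : {ffun K -> 'I_d.+1} | (\sum_i (a i : nat) == d)%N) cn (acoef Phi (wconj p) a) * r ^+ d.
  have Eu : (fun d => deg_norm (@acoef Phi (wconj p) d) * ((r%:C)%C) ^+ d) = (fun d => (((u d)%:C)%C)).
    apply/funext => d; rewrite /u -mulr_suml rmorphM rmorphXn /= rmorph_sum /=.
    by congr (_ * _).
  have u0 d : 0 <= u d by apply: sumr_ge0 => a _; rewrite mulr_ge0 ?cn_ge0 ?exprn_ge0 // ltW.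
  have ub d : u d <= M * (1 / 2) ^+ d.
    rewrite /u -mulr_suml; have := acoef_norm Phi (wconj p) d.
    rewrite /deg_norm (eq_bigr (fun a => (((cn (acoef Phi (wconj p) a))%:C)%C))) //.
    rewrite -(rmorph_sum (real_complex R)) /= lecR => h1.
    have h2 := tuple_sum_bound d hb M0 rho0.
    apply: (@le_trans _ _ (M * Q ^+ d * r ^+ d)).
      rewrite ler_wpM2r ?exprn_ge0 ?(ltW r0) //; exact: le_trans h1 h2.
    rewrite -mulrA -exprMn ler_wpM2l // lerXn2r ?nnegrE //.
    by rewrite mulr_ge0 // ltW.
  have cu : cvgn (series u).
    apply: (@series_le_cvg _ u (geometric M (1 / 2))) => //.
    - by move=> d; rewrite /= mulr_ge0 ?exprn_ge0.
    - by apply: is_cvg_geometric_series; rewrite ger0_norm //; lra.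
  have /cvg_ex[/= l Hl] := cu.
  rewrite Eu; apply/cvg_ex; exists ((l%:C)%C); apply: cvgCP => e e0.
  have /cvgrPdist_lt/(_ e e0)[n0 _ H] := Hl; exists n0 => n /H /=.
  by rewrite distrC /series /= -(rmorph_sum (real_complex R)) -(rmorphB (real_complex R)) cn_real.
- move=> x [_ px]; apply: cvgCP => e e0.
  have nx : 4 * expR 1 * nsz 0 (wconj x - wconj p) <= rho.
    rewrite nsz_sub nsz_wconj.
    have h : nsz p x <= N%:R * r.
      rewrite /nsz; apply: (@le_trans _ _ (\sum_(j < N) r)); last by rewrite sumr_const card_ord mulr_natl.
      by apply: ler_sum => j _; rewrite cnC ltW //; have := px j 0; rewrite /ball /= ltcn.
    have h2 : N%:R * r <= rho / (8 * expR 1).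
      apply: (@le_trans _ _ ((N%:R + 1) * (rho / (8 * expR 1 * (N%:R + 1))))).
        by apply: ler_pM => //; [exact: ltW|rewrite lerDl|rewrite /r ge_min lexx orbT].
      by rewrite le_eqVlt; apply/orP; left; apply/eqP; field; rewrite !lt0r_neq0.
    have -> : rho = 4 * expR 1 * (2 * (rho / (8 * expR 1))) by field; rewrite lt0r_neq0.
    by rewrite ler_wpM2l ?mulr_ge0 ?(ltW E0) // ler_wpM2l //; apply: le_trans h2.
  have [n0 H] := taylor_cvg hb M0 rho0 nx e0; exists n0 => n /H.
  rewrite [wconj p + _]addrC subrK cnC /series /=; congr (cn (_ - _) < e).
  rewrite big_mkord; apply: eq_bigr => d _; rewrite (iDv_tuple _ _ oU' hP Up) acoef_part mulr_suml.
  apply: eq_bigr => t _; rewrite mulrA; congr (_ * _ / _); apply: eq_bigr => j _.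
  by rewrite !mxE; case: fintype.split => k; rewrite !mxE ?rmorphB.
Qed.

End RealAnalytic.

(** * Polarization *)

Section Polarization.
Variables (R : realType) (k : nat).
Local Notation C := R[i].
Implicit Type Phi : 'cV[C]_(k + k) -> C.

Lemma wconj_span (v : 'cV[C]_(k + k)) : exists a b : 'cV[C]_k, v = wconj a + 'i *: wconj b.
Proof.
pose a : 'cV[C]_k := \col_l (2^-1 * (v (lshift k l) 0 + (v (rshift k l) 0)^*)).
pose b : 'cV[C]_k := \col_l ((2 * 'i)^-1 * (v (lshift k l) 0 - (v (rshift k l) 0)^*)).
have Ea l : a l 0 = 2^-1 * (v (lshift k l) 0 + (v (rshift k l) 0)^*) by rewrite /a mxE.
have Eb l : b l 0 = (2 * 'i)^-1 * (v (lshift k l) 0 - (v (rshift k l) 0)^*) by rewrite /b mxE.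
clearbody a b; exists a, b.
have i2 : 'i * 'i = -1 :> C by rewrite -expr2 sqrCi.
have i0 : 'i != 0 :> C by exact: neq0Ci.
have c2 : (2^-1 : C)^* = 2^-1 by rewrite fmorphV /= conjC_nat.
have ci : ((2 * 'i : C)^-1)^* = - (2 * 'i)^-1.
  by rewrite fmorphV rmorphM /= conjC_nat conjCi mulrN invrN.
apply/matrixP => i j; rewrite ord1 [RHS]mxE [X in _ + X]mxE !wconjE.
have [l ->|l ->] := split_ordP i.
  rewrite Ea Eb.
  move: (v (lshift _ _) _) ((v (rshift _ _) _)^*) => A B; field; exact: i0.
rewrite Ea Eb.
move: (v (lshift _ _) _) (v (rshift _ _) _) => A B.
rewrite rmorphM rmorphD /= conjCK c2 rmorphM rmorphB /= conjCK ci; field; exact: i0.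
Qed.

Lemma wconj0 : wconj (0 : 'cV[C]_k) = 0.
Proof. by apply/matrixP => i j; rewrite ord1 wconjE mxE; case: fintype.split => l; rewrite mxE ?conjC0. Qed.

(** Each direction in the doubled space is a complex combination of directions tangent to the conjugate diagonal. *)
Lemma Dv_zero_on_conj Phi U d z v : open U -> holU U Phi ->
  (forall z, nsz 0 z < d -> U (wconj z) /\ Phi (wconj z) = 0) -> nsz 0 z < d ->
  Dv Phi v (wconj z) = 0.
Proof.
move=> oU hP Hd zd.
have hz := hP _ (Hd z zd).1.
have Wj j : W (fun y : 'cV[C]_k => wconj y j 0) z.
  exact: (Ck1_W openT I (@Ck_wconj _ _ 1 setT j openT)).
have [_ D1] := W_comp hz.1 Wj.
have D0 b : Dv Phi (wconj b) (wconj z) = 0.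
  have Z : vder (rv b) (fun y => Phi (wconj y)) z = 0.
    rewrite -(vder_cst (rv b) 0 z); apply: vder_near; last exact: (W_cst 0 z).1.
    by apply: filterS (open_near (@open_oball _ _ 0 d) zd) => y /Hd[].
  rewrite -[RHS]Z D1; apply: eq_bigr => j _; rewrite hz.2 mul0r addr0 mulrC; congr (_ * _).
  have -> : (fun y : 'cV[C]_k => wconj y j 0) = match fintype.split j with inl k => (fun y => y k 0) | inr k => (fun y => (y k 0)^*) end.
    by apply/funext => y; rewrite wconjE; case: fintype.split.
  rewrite wconjE; case: fintype.split => l; first by rewrite vder_coord.
  by rewrite (vder_conj _ (W_coord l z).1) vder_coord /= !mxE conjCK.
by have [a [b ->]] := wconj_span v; rewrite DvD DvZ !D0 mulr0 addr0.
Qed.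

(** The diagonal of points (z, conj z) is totally real of maximal dimension, so all derivatives at 0 of a holomorphic function vanishing there are zero, and its Taylor series too. *)
Lemma polarize Phi U : open U -> holU U Phi -> U 0 ->
  (exists2 d : R, 0 < d & forall z, nsz 0 z < d -> Phi (wconj z) = 0) ->
  exists2 d : R, 0 < d & forall w, nsz 0 w < d -> Phi w = 0.
Proof.
move=> oU hP U0 [d d0 Hd].
have [rho [M [rho0 M0 hb HU]]] := holU_bounded oU U0 hP.
have E0 : 0 < expR 1 :> R by rewrite expR_gt0.
pose d1 := Num.min d (rho / 2).
have Z n v z : nsz 0 z < d1 -> U (wconj z) /\ iDv n Phi v (wconj z) = 0.
  elim: n z => [|n IH] z; last first.
    move=> zd; split; first by case: (IH z zd).
    exact: (Dv_zero_on_conj v oU (holU_iDv n v oU hP) IH zd).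
  rewrite lt_min => /andP[z1 z2]; split; last exact: Hd.
  by apply: HU; rewrite -wconj0 nsz_wconj; lra.
exists (rho / (4 * expR 1)) => [|w Hw]; first by rewrite divr_gt0 ?mulr_gt0.
have Hw' : 4 * expR 1 * nsz 0 w <= rho.
  by rewrite mulrC -ler_pdivlMr ?mulr_gt0 // ltW.
apply/eqP; rewrite -cn_eq0; apply/eqP/le_anti; rewrite cn_ge0 andbT.
have key e : 0 < e -> cn (Phi w) <= e.
  move=> e0; have [n0 H] := taylor_cvg hb M0 rho0 Hw' e0.
  have := H n0 (leqnn _); rewrite add0r big1 ?subr0 => [/ltW //|n _].
  rewrite -wconj0; have [|_ ->] := Z n w 0; first by rewrite nszxx /d1 lt_min d0 divr_gt0.
  by rewrite mul0r.
by apply/ler_addgt0Pr => e e0; rewrite add0r; apply: key.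
Qed.

End Polarization.

(** * Transport of CR structures by biholomorphisms *)

Section Preimage.
Variables (R : realType) (N m : nat).
Local Notation V := 'cV[R[i]]_N.
Implicit Types (U : set V) (phi : V -> 'cV[R[i]]_m).

Lemma hol_cont phi x (A : set 'cV[R[i]]_m) : (forall j, W (fun q => phi q j 0) x) ->
  nbhs (phi x) A -> \forall q \near x, A (phi q).
Proof.
move=> Wp /nbhs_cvP[d d0 HA].
have : \forall q \near x, forall j, cn (phi q j 0 - phi x j 0) < d.
  apply: (@filter_forall V 'I_m (fun j q => cn (phi q j 0 - phi x j 0) < d) (nbhs x) _) => j; have [d' d0' H] := (cont_nszP (fun q => phi q j 0) x).1 (W_cont (Wp j)) d d0.
  by apply/nbhs_nszP; exists d'.
by apply: filterS => q /HA.
Qed.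

Lemma open_preim phi U (A : set 'cV[R[i]]_m) : open U -> open A -> (forall x, U x -> forall j, W (fun q => phi q j 0) x) ->
  open [set x | U x /\ A (phi x)].
Proof.
move=> oU oA Wp; rewrite openE => x [Ux Ax].
apply: filterS (filterI (open_near oU Ux) (hol_cont (Wp x Ux) (open_near oA Ax))) => q [] //.
Qed.

End Preimage.

Section Pushforward.
Variables (R : realType) (N : nat).
Local Notation C := R[i].
Local Notation V := 'cV[R[i]]_N.
Implicit Types (phi psi : V -> V) (x y : V) (v w : cvec R N) (U : set V).

Lemma smooth_W U f x : open U -> U x -> smooth_on U f -> W f x.
Proof. by move=> oU Ux sf; apply: (Ck1_W oU Ux (sf 1%N)). Qed.

Lemma smooth_dz U (f : V -> C) j : open U -> smooth_on U f -> smooth_on U (dz f j).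
Proof.
move=> oU sf k; have Rd u : Ck k U (rderive f u) by exact: (proj2 (sf k.+1) u).
apply: Ck_mul => //; first exact: Ck_cst.
apply: Ck_add => //; apply: (Ck_eq (f := fun x => (-1) * ('i * rderive f ('i *: delta_mx j 0) x))) => //.
  by move=> x _; rewrite mulN1r.
by apply: Ck_mul => //; [exact: Ck_cst|apply: Ck_mul => //; exact: Ck_cst].
Qed.

Lemma smooth_dzbar U (f : V -> C) j : open U -> smooth_on U f -> smooth_on U (dzbar f j).
Proof.
move=> oU sf k; have Rd u : Ck k U (rderive f u) by exact: (proj2 (sf k.+1) u).
apply: Ck_mul => //; first exact: Ck_cst.
by apply: Ck_add => //; apply: Ck_mul => //; exact: Ck_cst.
Qed.

Lemma smooth_vder U (X : cfield R N) f : open U -> smooth_field U X -> smooth_on U f ->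
  smooth_on U (fun q => vder (X q) f q).
Proof.
move=> oU sX sf k; apply: Ck_sum => // j _; apply: Ck_add => //; apply: Ck_mul => //.
- exact: (sX j).1.
- exact: smooth_dz.
- exact: (sX j).2.
- exact: smooth_dzbar.
Qed.

Lemma smooth_on_add U (f g : V -> C) : open U -> smooth_on U f -> smooth_on U g ->
  smooth_on U (fun x => f x + g x).
Proof. by move=> oU sf sg k; apply: Ck_add. Qed.

Lemma smooth_on_mul U (f g : V -> C) : open U -> smooth_on U f -> smooth_on U g ->
  smooth_on U (fun x => f x * g x).
Proof. by move=> oU sf sg k; apply: Ck_mul. Qed.

Lemma smooth_on_cst U (c : C) : open U -> smooth_on U (fun=> c).
Proof. by move=> oU k; apply: Ck_cst. Qed.

Lemma smooth_on_opp U (f : V -> C) : open U -> smooth_on U f -> smooth_on U (fun x => - f x).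
Proof.
move=> oU sf k; apply: (Ck_eq (f := fun x => (-1) * f x)) => // [x _|]; first by rewrite mulN1r.
by apply: Ck_mul => //; apply: Ck_cst.
Qed.

Lemma smooth_on_conj U (f : V -> C) : open U -> smooth_on U f -> smooth_on U (fun x => (f x)^*).
Proof. by move=> oU sf k; apply: Ck_conj. Qed.

Lemma smooth_on_eq U (f g : V -> C) : open U -> (forall x, U x -> f x = g x) ->
  smooth_on U f -> smooth_on U g.
Proof. by move=> oU fg sf k; apply: Ck_eq (sf k). Qed.

Lemma smooth_on_sub U U' (f : V -> C) : U' `<=` U -> smooth_on U f -> smooth_on U' f.
Proof. by move=> UU sf k; apply: Ck_sub UU (sf k). Qed.

Lemma smooth_field_sub U U' (X : cfield R N) : U' `<=` U -> smooth_field U X -> smooth_field U' X.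
Proof.
by move=> UU sX j; split; [apply: smooth_on_sub UU (sX j).1|apply: smooth_on_sub UU (sX j).2].
Qed.

Lemma smooth_lie U (X Y : cfield R N) : open U -> smooth_field U X -> smooth_field U Y ->
  smooth_field U (lie X Y).
Proof.
move=> oU sX sY j; split.
  apply: (smooth_on_eq (f := fun q => vder (X q) (fun q => (Y q).1 j 0) q - vder (Y q) (fun q => (X q).1 j 0) q)) => //.
    by move=> x _; rewrite mxE.
  by apply: smooth_on_add => //; [|apply: smooth_on_opp => //]; apply: smooth_vder => //; [exact: (sY j).1|exact: (sX j).1].
apply: (smooth_on_eq (f := fun q => vder (X q) (fun q => (Y q).2 j 0) q - vder (Y q) (fun q => (X q).2 j 0) q)) => //.
  by move=> x _; rewrite mxE.
by apply: smooth_on_add => //; [|apply: smooth_on_opp => //]; apply: smooth_vder => //; [exact: (sY j).2|exact: (sX j).2].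
Qed.

Lemma smooth_conj_field U (X : cfield R N) : open U -> smooth_field U X ->
  smooth_field U (conj_field X).
Proof.
move=> oU sX j; split.
  apply: (smooth_on_eq (f := fun q => ((X q).2 j 0)^*)) => // [x _|]; first by rewrite mxE.
  by apply: smooth_on_conj => //; exact: (sX j).2.
apply: (smooth_on_eq (f := fun q => ((X q).1 j 0)^*)) => // [x _|]; first by rewrite mxE.
by apply: smooth_on_conj => //; exact: (sX j).1.
Qed.

Lemma cconjK v : cconj (cconj v) = v.
Proof.
case: v => a b; congr pair; apply/matrixP => i j /=; rewrite !mxE conjCK //.
Qed.

Lemma pushforward_lin phi x c v w :
  Defs.pushforward phi x (c *: v + w) = c *: Defs.pushforward phi x v + Defs.pushforward phi x w.
Proof. by congr pair; apply/matrixP => i j; rewrite !mxE vder_lin. Qed.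

Lemma pushforwardD phi x v w :
  Defs.pushforward phi x (v + w) = Defs.pushforward phi x v + Defs.pushforward phi x w.
Proof. by have := pushforward_lin phi x 1 v w; rewrite !scale1r. Qed.

Lemma pushforward0 phi x : Defs.pushforward phi x 0 = 0.
Proof. by congr pair; apply/matrixP => i j; rewrite !mxE vder0v. Qed.

Lemma pushforwardZ phi x c v : Defs.pushforward phi x (c *: v) = c *: Defs.pushforward phi x v.
Proof. by have := pushforward_lin phi x c v 0; rewrite pushforward0 !addr0. Qed.

Lemma pushforward_conj phi x v : (forall j, W (fun q => phi q j 0) x) ->
  Defs.pushforward phi x (cconj v) = cconj (Defs.pushforward phi x v).
Proof.
move=> Wp; congr pair; apply/matrixP => i j; rewrite !mxE.
  by rewrite vder_conj // conjCK.
by rewrite vder_conj // cconjK.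
Qed.

(** A holomorphic map preserves the type of vectors. *)
Lemma pushforward_hol0 phi x v : (forall j, hol (fun q => phi q j 0) x) -> v.2 = 0 ->
  (Defs.pushforward phi x v).2 = 0.
Proof.
move=> hp v0; apply/matrixP => i j; rewrite !mxE vder_conj; last exact: (hp i).1.
by rewrite hol_vder // /cconj v0 /= map_mx0 Dv0 conjC0.
Qed.

Lemma vder_comp phi (g : V -> C) x v : W g (phi x) -> (forall j, W (fun q => phi q j 0) x) ->
  vder v (fun q => g (phi q)) x = vder (Defs.pushforward phi x v) g (phi x).
Proof.
move=> Wg Wp; have [_ ->] := W_comp Wg Wp.
by apply: eq_bigr => j _; rewrite !mxE mulrC [_ * dzbar _ _ _]mulrC.
Qed.

Lemma lie_conj (X Y : cfield R N) x :
  (forall j, W (fun q => (X q).1 j 0) x /\ W (fun q => (X q).2 j 0) x) ->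
  (forall j, W (fun q => (Y q).1 j 0) x /\ W (fun q => (Y q).2 j 0) x) ->
  lie (conj_field X) (conj_field Y) x = cconj (lie X Y x).
Proof.
move=> WX WY.
have E1 (Z : cfield R N) j : (fun q => (conj_field Z q).1 j 0) = (fun q => ((Z q).2 j 0)^*).
  by apply/funext => q; rewrite mxE.
have E2 (Z : cfield R N) j : (fun q => (conj_field Z q).2 j 0) = (fun q => ((Z q).1 j 0)^*).
  by apply/funext => q; rewrite mxE.
congr pair; apply/matrixP => j i; rewrite !mxE rmorphB.
  rewrite !E1 (vder_conj _ (WX j).2) (vder_conj _ (WY j).2).
  by rewrite /conj_field !cconjK.
rewrite !E2 (vder_conj _ (WX j).1) (vder_conj _ (WY j).1).
by rewrite /conj_field !cconjK.
Qed.

End Pushforward.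

Section Transport.
Variables (R : realType) (N : nat).
Local Notation C := R[i].
Local Notation V := 'cV[R[i]]_N.
Implicit Types (phi psi : V -> V) (x y : V) (v w : cvec R N) (U : set V) (M : set V).
Implicit Types (X Y : cfield R N).

(** A biholomorphism between open sets, given with its inverse, mapping [M] to [M']. *)
Definition biholo U U' phi psi M M' :=
  [/\ open U, open U',
      forall x, U x -> U' (phi x) /\ psi (phi x) = x,
      forall y, U' y -> U (psi y) /\ phi (psi y) = y &
      [/\ forall j, holU U (fun q => phi q j 0), forall j, holU U' (fun q => psi q j 0) &
          forall x, U x -> (M x <-> M' (phi x))]].

Lemma biholo_sym U U' phi psi M M' : biholo U U' phi psi M M' -> biholo U' U psi phi M' M.
Proof.
move=> [oU oU' H1 H2 [h1 h2 HM]]; split=> //; split=> // y Uy.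
by have [Ux E] := H2 y Uy; rewrite (HM _ Ux) E.
Qed.

Section B.
Variables (U U' : set V) (phi psi : V -> V) (M M' : set V).
Hypothesis b : biholo U U' phi psi M M'.

Lemma biholo_W x : U x -> forall j, W (fun q => phi q j 0) x.
Proof. by case: b => _ _ _ _ [h _ _] Ux j; case: (h j x Ux). Qed.

Lemma biholo_hol x : U x -> forall j, hol (fun q => phi q j 0) x.
Proof. by case: b => _ _ _ _ [h _ _] Ux j; exact: (h j x Ux). Qed.

Lemma biholo_Wpsi y : U' y -> forall j, W (fun q => psi q j 0) y.
Proof. by case: b => _ _ _ _ [_ h _] Ux j; case: (h j y Ux). Qed.

Lemma pushforwardK x v : U x -> Defs.pushforward psi (phi x) (Defs.pushforward phi x v) = v.
Proof.
case: (b) => oU oU' H1 H2 _ Ux; have [Ux' E] := H1 x Ux.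
have near_id : \forall q \near x, psi (phi q) = q.
  by apply: filterS (open_near oU Ux) => q /H1[].
have Wc j := (W_coord j x).1.
have K j : vder (Defs.pushforward phi x v) (fun q => psi q j 0) (phi x) = v.1 j 0.
  rewrite -(vder_comp _ (biholo_Wpsi Ux' j) (biholo_W Ux)) -(vder_coord v j x).
  by apply: vder_near => //; apply: filterS near_id => q ->.
have K2 j : vder (Defs.pushforward phi x v) (fun q => (psi q j 0)^*) (phi x) = v.2 j 0.
  rewrite -(vder_comp _ (W_conj (biholo_Wpsi Ux' j)).1 (biholo_W Ux)).
  rewrite (@vder_near _ _ (fun q => (q j 0)^*)); last exact: (W_conj (Wc j)).1.
    by rewrite vder_conj // vder_coord /= mxE conjCK.
  by apply: filterS near_id => q ->.
rewrite /Defs.pushforward; case: v K K2 => v1 v2 K K2; congr pair; apply/matrixP => i j;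
  by rewrite ord1 mxE ?K ?K2.
Qed.

End B.

Lemma pushforwardK' U U' phi psi M M' x v : biholo U U' phi psi M M' -> U x ->
  Defs.pushforward phi x (Defs.pushforward psi (phi x) v) = v.
Proof.
move=> b Ux; have [_ _ H1 _ _] := b; have [Ux' E] := H1 x Ux.
by have := pushforwardK (biholo_sym b) v Ux'; rewrite E.
Qed.

Lemma local_defining_pull U U' phi psi M M' x rho : biholo U U' phi psi M M' ->
  U x -> local_defining M' (phi x) rho ->
  local_defining M x (fun q => rho (phi q)).
Proof.
move=> b; case: (b) => oU oU' H1 H2 [h1 h2 HM] Ux [A [oA Ax sr rr [Hr [w Hw]]]].
have oP : open [set q | U q /\ A (phi q)] by apply: open_preim => // q Uq; apply: (biholo_W b).
exists [set q | U q /\ A (phi q)]; split=> //.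
- move=> k; apply: (Ck_comp oA oP) => // [q []//|j].
  apply: (Ck_sub (U := U)); first by move=> q [].
  exact: holU_Ck.
- by move=> q [_ Aq]; apply: rr.
- split; first by move=> q [Uq Aq]; rewrite (HM q Uq) (Hr _ Aq).
  exists (Defs.pushforward psi (phi x) w).
  have Wr : W rho (phi x) by apply: smooth_W sr.
  by rewrite (vder_comp _ Wr (biholo_W b Ux)) (pushforwardK' _ b Ux).
Qed.

Lemma ctangent_push U U' phi psi M M' x v : biholo U U' phi psi M M' ->
  U x -> ctangent M x v -> ctangent M' (phi x) (Defs.pushforward phi x v).
Proof.
move=> b Ux Hv rho Hr; have := Hv _ (local_defining_pull b Ux Hr).
rewrite vder_comp //; last exact: (biholo_W b).
by case: Hr => A [oA Ax sr _ _]; apply: smooth_W sr.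
Qed.

Lemma Hbundle_push U U' phi psi M M' x v : biholo U U' phi psi M M' ->
  U x -> Hbundle M x v -> Hbundle M' (phi x) (Defs.pushforward phi x v).
Proof.
move=> b Ux [Hv v0]; split; first exact: ctangent_push b Ux Hv.
by apply: pushforward_hol0 => // j; apply: (biholo_hol b).
Qed.

Lemma HHbar_push U U' phi psi M M' x v : biholo U U' phi psi M M' ->
  U x -> HHbar M x v -> HHbar M' (phi x) (Defs.pushforward phi x v).
Proof.
move=> b Ux [v1 [v2 [h1 h2 ->]]].
exists (Defs.pushforward phi x v1), (Defs.pushforward phi x v2); split.
- exact: Hbundle_push b Ux h1.
- exact: Hbundle_push b Ux h2.
- by rewrite pushforwardD pushforward_conj //; apply: (biholo_W b).
Qed.

Definition frel U phi X X' x := exists U0, [/\ open U0, U0 x, U0 `<=` U, smooth_field U0 X &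
   forall q, U0 q -> X' (phi q) = Defs.pushforward phi q (X q)].

Lemma frel_conj U U' phi psi M M' x X X' : biholo U U' phi psi M M' -> 
  frel U phi X X' x -> frel U phi (conj_field X) (conj_field X') x.
Proof.
move=> b [U0 [oU0 U0x sU sX HX]]; exists U0; split=> //; first exact: smooth_conj_field.
move=> q U0q; rewrite /conj_field HX // pushforward_conj //; apply: (biholo_W b).
exact: sU.
Qed.

Lemma smooth_near U0 (g : V -> C) U U' phi psi M M' x (G : V -> C) : biholo U U' phi psi M M' ->
  open U0 -> U0 x -> U0 `<=` U -> smooth_on U0 g -> (forall q, U0 q -> G (phi q) = g q) ->
  W G (phi x).
Proof.
move=> b oU0 U0x sU sg Hg; have [oU oU' H1 H2 [h1 h2 HM]] := b.
have Ux := sU x U0x; have [Ux' E] := H1 x Ux.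
have Wg : W (fun y => g (psi y)) (phi x).
  have Wp : forall j, W (fun q => psi q j 0) (phi x) by apply: (biholo_Wpsi b).
  by apply: (W_comp _ Wp).1; rewrite E; apply: smooth_W sg.
apply: (W_near _ Wg).1.
have : \forall y \near phi x, U0 (psi y).
  apply: hol_cont; first exact: (biholo_Wpsi b).
  by rewrite E; apply: open_near.
apply: filterS2 (open_near oU' Ux') => y Uy U0y.
by have [_ {2}<-] := H2 y Uy; rewrite Hg.
Qed.

Lemma frel_W U U' phi psi M M' x X X' : biholo U U' phi psi M M' -> frel U phi X X' x ->
  forall j, W (fun q => (X' q).1 j 0) (phi x) /\ W (fun q => (X' q).2 j 0) (phi x).
Proof.
move=> b [U0 [oU0 U0x sU sX HX]] j; have [oU oU' H1 H2 [h1 h2 HM]] := b.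
have sp : smooth_on U0 (fun q => phi q j 0).
  by move=> k; apply: (Ck_sub sU); apply: holU_Ck.
split.
  apply: (smooth_near (g := fun q => vder (X q) (fun q => phi q j 0) q) b oU0 U0x sU).
    exact: smooth_vder.
  by move=> q /HX ->; rewrite mxE.
apply: (smooth_near (g := fun q => vder (X q) (fun q => (phi q j 0)^*) q) b oU0 U0x sU).
  by apply: smooth_vder => //; apply: smooth_on_conj.
by move=> q /HX ->; rewrite mxE.
Qed.

Lemma frel_lie1 U U' phi psi M M' x X X' Y Y' : biholo U U' phi psi M M' ->
  frel U phi X X' x -> frel U phi Y Y' x ->
  (lie X' Y' (phi x)).1 = (Defs.pushforward phi x (lie X Y x)).1.
Proof.
move=> b rX rY; have WX' := frel_W b rX; have WY' := frel_W b rY.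
case: rX => UX [oX Xx sUX sX HX]; case: rY => UY [oY Yx sUY sY HY].
have [oU oU' H1 H2 [h1 h2 HM]] := b; have Ux := sUX x Xx.
have Wp := biholo_W b Ux.
have dzs j l : hol (dz (fun q => phi q j 0) l) x by apply: (holU_dz l oU (h1 j)).
have key (A B B' : cfield R N) UB (j : 'I_N) : open UB -> UB x -> UB `<=` U -> smooth_field UB B ->
   (forall q, UB q -> B' (phi q) = Defs.pushforward phi q (B q)) ->
   W (fun q => (B' q).1 j 0) (phi x) ->
   vder (Defs.pushforward phi x (A x)) (fun q => (B' q).1 j 0) (phi x) =
   \sum_l (vder (A x) (fun q => (B q).1 l 0) x * dz (fun q => phi q j 0) l x
         + (B x).1 l 0 * \sum_m (A x).1 m 0 * dz (dz (fun q => phi q j 0) l) m x).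
  move=> oB Bx sUB sB HB WB'.
  rewrite -(vder_comp _ WB' Wp).
  pose G q := \sum_l (B q).1 l 0 * dz (fun q => phi q j 0) l q.
  have WBl l : W (fun q => (B q).1 l 0) x by apply: smooth_W (sB l).1.
  have WT l : W (fun q => (B q).1 l 0 * dz (fun q => phi q j 0) l q) x.
    exact: (W_mul (WBl l) (dzs j l).1).1.
  have [WG DG] := @W_sum _ _ _ (index_enum 'I_N) (fun l q => (B q).1 l 0 * dz (fun q => phi q j 0) l q) x WT.
  rewrite (@vder_near _ _ G); last exact: WG.
    rewrite DG; apply: eq_bigr => l _; rewrite (vderM _ (WBl l) (dzs j l).1).
    by rewrite (hol_vder _ (dzs j l)).
  apply: filterS (open_near oB Bx) => q UBq; rewrite HB // mxE hol_vder //.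
  by apply: h1; apply: sUB.
apply/matrixP => j i; rewrite ord1 !mxE.
rewrite (HX x Xx) (HY x Yx) (key X Y Y' UY j oY Yx sUY sY HY (WY' j).1).
rewrite (key Y X X' UX j oX Xx sUX sX HX (WX' j).1).
rewrite (hol_vder _ (biholo_hol b Ux j)) /Dv !big_split /= opprD addrACA.
have sym l m : dz (dz (fun q => phi q j 0) l) m x = dz (dz (fun q => phi q j 0) m) l x.
  have E k : dz (fun q => phi q j 0) k = Dv (fun q => phi q j 0) (delta_mx k 0).
    by apply/funext => q; rewrite Dv_delta.
  rewrite -[LHS]Dv_delta -[RHS]Dv_delta !E; exact: (Dv_comm _ _ oU Ux (h1 j)).
rewrite [X in _ + X](_ : _ = 0) ?addr0.
  by rewrite -sumrB; apply: eq_bigr => l _; rewrite mxE mulrBl.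
apply/eqP; rewrite subr_eq0; apply/eqP.
under eq_bigr do rewrite mulr_sumr.
under [RHS]eq_bigr do rewrite mulr_sumr.
rewrite exchange_big /=; apply: eq_bigr => l _; apply: eq_bigr => m _.
have aux (a c d e : C) : d = e -> a * (c * d) = c * (a * e) by move=> ->; rewrite mulrCA.
by apply: aux; exact: (sym m l).
Qed.

Lemma frel_lie U U' phi psi M M' x X X' Y Y' : biholo U U' phi psi M M' ->
  frel U phi X X' x -> frel U phi Y Y' x -> frel U phi (lie X Y) (lie X' Y') x.
Proof.
move=> b rX rY; have rX0 := rX; have rY0 := rY.
case: rX => UX [oX Xx sUX sX HX]; case: rY => UY [oY Yx sUY sY HY].
have oI : open (UX `&` UY) by apply: openI.
have sX' : smooth_field (UX `&` UY) X.
  by move: sX; apply: smooth_field_sub => q [].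
have sY' : smooth_field (UX `&` UY) Y.
  by move: sY; apply: smooth_field_sub => q [].
exists (UX `&` UY); split=> //; first by move=> q [/sUX].
  exact: smooth_lie.
move=> q [Xq Yq].
have rX : frel U phi X X' q by exists UX.
have rY : frel U phi Y Y' q by exists UY.
have E1 := frel_lie1 b rX rY.
have E2 := frel_lie1 b (frel_conj b rX) (frel_conj b rY).
have WX j : W (fun q => (X q).1 j 0) q /\ W (fun q => (X q).2 j 0) q.
  by split; [apply: smooth_W (sX j).1|apply: smooth_W (sX j).2].
have WY j : W (fun q => (Y q).1 j 0) q /\ W (fun q => (Y q).2 j 0) q.
  by split; [apply: smooth_W (sY j).1|apply: smooth_W (sY j).2].
rewrite (lie_conj (frel_W b rX) (frel_W b rY)) (lie_conj WX WY) in E2.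
rewrite pushforward_conj in E2; last by apply: (biholo_W b); apply: sUX.
rewrite [LHS]surjective_pairing [RHS]surjective_pairing E1; congr pair.
move: E2 => /= /(congr1 (map_mx (@Num.conj C))) E2.
have K (A : V) : map_mx (@Num.conj C) (map_mx (@Num.conj C) A) = A.
  by apply/matrixP => i j; rewrite !mxE conjCK.
by move: E2; rewrite !K.
Qed.

(** Sections are pulled back by pushing them forward with the inverse map. *)
Lemma section_pull U U' phi psi M M' (B B' : V -> cvec R N -> Prop) x X' :
  biholo U U' phi psi M M' -> U x ->
  (forall q v, U q -> M q -> B' (phi q) v -> B q (Defs.pushforward psi (phi q) v)) ->
  section_near M' B' (phi x) X' ->
  exists X, [/\ section_near M B x X, frel U phi X X' x &
    X x = Defs.pushforward psi (phi x) (X' (phi x))].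
Proof.
move=> b Ux HB [A [oA Ax sX' HX']]; have [oU oU' H1 H2 [h1 h2 HM]] := b.
have oA' : open (A `&` U') by apply: openI.
have oP : open [set q | U q /\ (A `&` U') (phi q)].
  by apply: open_preim => // q Uq; apply: (biholo_W b).
pose X q := Defs.pushforward psi (phi q) (X' (phi q)).
have Px : [set q | U q /\ (A `&` U') (phi q)] x by split=> //; split=> //; case: (H1 x Ux).
have sp j : smooth_on (A `&` U') (fun q => psi q j 0).
  move=> k; apply: (Ck_sub (U := U')); first by move=> q [].
  exact: holU_Ck.
have sX'' : smooth_field (A `&` U') X'.
  by move: sX'; apply: smooth_field_sub => q [].
have sX : smooth_field [set q | U q /\ (A `&` U') (phi q)] X.
  move=> j; split.
    apply: (smooth_on_eq (f := fun q => (fun y => vder (X' y) (fun q => psi q j 0) y) (phi q))) => //.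
      by move=> q _; rewrite mxE.
    move=> k; apply: (@Ck_comp _ _ _ k (fun y => vder (X' y) (fun q => psi q j 0) y) phi _ _ oA' oP) => [q []//|l|]; last exact: smooth_vder.
    by apply: (Ck_sub (U := U)); [move=> q []|apply: holU_Ck].
  apply: (smooth_on_eq (f := fun q => (fun y => vder (X' y) (fun q => (psi q j 0)^*) y) (phi q))) => //.
    by move=> q _; rewrite mxE.
  move=> k; apply: (@Ck_comp _ _ _ k (fun y => vder (X' y) (fun q => (psi q j 0)^*) y) phi _ _ oA' oP) => [q []//|l|]; last first.
    by apply: smooth_vder => //; apply: smooth_on_conj.
  by apply: (Ck_sub (U := U)); [move=> q []|apply: holU_Ck].
exists X; split=> //.
  exists [set q | U q /\ (A `&` U') (phi q)]; split=> // q [Uq [Aq _]] Mq.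
  by apply: HB => //; apply: HX' => //; rewrite -HM.
exists [set q | U q /\ (A `&` U') (phi q)]; split=> //; first by move=> q [].
by move=> q [Uq _]; rewrite /X (pushforwardK' _ b Uq).
Qed.

Lemma Hbundle_back U U' phi psi M M' q v : biholo U U' phi psi M M' -> U q ->
  Hbundle M' (phi q) v -> Hbundle M q (Defs.pushforward psi (phi q) v).
Proof.
move=> b Uq Hv; have [_ _ H1 _ _] := b; have [Uq' E] := H1 q Uq.
by have := Hbundle_push (biholo_sym b) Uq' Hv; rewrite E.
Qed.

(** Brackets commute with the pushforward, so every defining condition is transported. *)
Lemma levi_kernel_push U U' phi psi M M' x v : biholo U U' phi psi M M' -> U x ->
  levi_kernel M x v -> levi_kernel M' (phi x) (Defs.pushforward phi x v).
Proof.
move=> b Ux [Hv Kv]; split; first exact: Hbundle_push b Ux Hv.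
move=> X' Y' sX' EX' sY'.
have HBk q w : U q -> M q -> Hbundle M' (phi q) w -> Hbundle M q (Defs.pushforward psi (phi q) w).
  by move=> Uq _; apply: (Hbundle_back b).
have [X [sX rX Xx]] := section_pull b Ux HBk sX'.
have [Y [sY rY Yx]] := section_pull b Ux HBk sY'.
rewrite EX' (pushforwardK b _ Ux) in Xx.
have := HHbar_push b Ux (Kv X Y sX Xx sY).
rewrite /levi pushforwardZ.
by have [U0 [_ U0x _ _ <-]] := frel_lie b rX (frel_conj b rY).
Qed.

Lemma levi_kernel_back U U' phi psi M M' q v : biholo U U' phi psi M M' -> U q ->
  levi_kernel M' (phi q) v -> levi_kernel M q (Defs.pushforward psi (phi q) v).
Proof.
move=> b Uq Hv; have [_ _ H1 _ _] := b; have [Uq' E] := H1 q Uq.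
by have := levi_kernel_push (biholo_sym b) Uq' Hv; rewrite E.
Qed.

Lemma nondegenerate2_push U U' phi psi M M' x : biholo U U' phi psi M M' -> U x ->
  nondegenerate2_at M x -> nondegenerate2_at M' (phi x).
Proof.
move=> b Ux nd v' Kv' Hv'; have [oU oU' H1 H2 _] := b; have [Ux' E] := H1 x Ux.
have b' := biholo_sym b.
have K0 : Defs.pushforward psi (phi x) v' = 0.
  apply: nd; first exact: (levi_kernel_back b Ux).
  move=> X Y1 Y2 sX Xx sY1 sY2.
  rewrite -{1}E in sX; rewrite -{1}E in sY1; rewrite -{1}E in sY2.
  have [X' [sX' rX' Xx']] := section_pull b' Ux' (fun q w Uq _ => levi_kernel_back b' Uq) sX.
  have [Y1' [sY1' rY1' _]] := section_pull b' Ux' (fun q w Uq _ => Hbundle_back b' Uq) sY1.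
  have [Y2' [sY2' rY2' _]] := section_pull b' Ux' (fun q w Uq _ => Hbundle_back b' Uq) sY2.
  rewrite E Xx (pushforwardK' _ b Ux) in Xx'.
  have := HHbar_push b' Ux' (Hv' X' Y1' Y2' sX' Xx' sY1' sY2').
  have r := frel_lie b' (frel_lie b' rX' (frel_conj b' rY1')) (frel_conj b' rY2').
  by have [U0 [_ U0x _ _ /(_ _ U0x) <-]] := r; rewrite E.
by rewrite -[v'](pushforwardK' _ b Ux) K0 pushforward0.
Qed.

Section Theta.
Variables (theta : {scalar cvec R N}) (psi0 : V -> V) (y0 : V).
Definition theta_pull v : C := theta (Defs.pushforward psi0 y0 v).
Lemma theta_pull_lin : scalar theta_pull.
Proof. by move=> c v w; rewrite /theta_pull pushforward_lin linearP. Qed.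
HB.instance Definition _ := GRing.isLinear.Build C (cvec R N) C *%R theta_pull theta_pull_lin.
Lemma theta_pullP : exists theta' : {scalar cvec R N},
  forall v, theta' v = theta (Defs.pushforward psi0 y0 v).
Proof. by exists (theta_pull : {scalar cvec R N}). Qed.
End Theta.

(** Frames and the identification of CTM / (H + conj H) with C are transported by the differential. *)
Lemma levi_rank_push U U' phi psi M M' x r : biholo U U' phi psi M M' -> U x ->
  levi_rank M x r -> levi_rank M' (phi x) r.
Proof.
move=> b Ux [m [X [theta [sX fX Ht rk]]]]; have [oU oU' H1 H2 _] := b.
have [Ux' E] := H1 x Ux; have b' := biholo_sym b.
have HX i : exists X', [/\ section_near M' (Hbundle M') (phi x) X', frel U' psi X' (X i) (phi x) &
    X' (phi x) = Defs.pushforward phi x (X i x)].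
  have sXi := sX i; rewrite -{1}E in sXi.
  have [X' [h1 h2 h3]] := section_pull b' Ux' (fun q w Uq _ => Hbundle_back b' Uq) sXi.
  exists X'; split; [exact: h1|exact: h2|by rewrite h3 E].
have [X' HX'] := choice HX.
have [theta' Eth] := theta_pullP theta psi (phi x).
exists m, X', theta'; split.
- by move=> i; case: (HX' i).
- move=> v Hv; have [c [Ec uc]] := fX _ (Hbundle_back b Ux Hv).
  have pfsum (p : V -> V) y (e : 'rV[C]_m) (Z : 'I_m -> cvec R N) :
      Defs.pushforward p y (\sum_i e 0 i *: Z i) = \sum_i e 0 i *: Defs.pushforward p y (Z i).
    elim/big_ind2: _ => [|a a' d d' <- <-|i _]; first exact: pushforward0.
      exact: pushforwardD.
    exact: pushforwardZ.
  exists c; split.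
    rewrite -[LHS](pushforwardK' _ b Ux) Ec pfsum; apply: eq_bigr => i _.
    by case: (HX' i) => _ _ ->.
  move=> c' Ec'; apply: uc; rewrite Ec' pfsum; apply: eq_bigr => i _.
  by case: (HX' i) => _ _ ->; rewrite (pushforwardK b _ Ux).
- move=> v Hv.
  have Hv' : ctangent M x (Defs.pushforward psi (phi x) v).
    by have := ctangent_push b' Ux' Hv; rewrite E.
  have := Ht _ Hv'; rewrite Eth => ->; split=> H.
    by have := HHbar_push b Ux H; rewrite (pushforwardK' _ b Ux).
  by have := HHbar_push b' Ux' H; rewrite E.
- have key i j : theta (Defs.pushforward psi (phi x) (levi (X' i) (X' j) (phi x))) = theta (levi (X i) (X j) x).
    congr (GRing.Linear.sort _ _); case: (HX' i) => _ ri _; case: (HX' j) => _ rj _.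
    rewrite /levi pushforwardZ; congr (_ *: _).
    have [U0 [_ U0x _ _ /(_ _ U0x) <-]] := frel_lie b' ri (frel_conj b' rj).
    by rewrite E.
  rewrite -rk; apply: (congr1 mxrank); apply: eq_mx => i j; rewrite Eth; exact: key.
Qed.

End Transport.

(** * Graphs over the tangent directions *)

Section Graph.
Variables (R : realType) (N : nat) (iw : 'I_N).
Local Notation C := R[i].
Local Notation V := 'cV[R[i]]_N.
Implicit Types (x y p q : V) (v : cvec R N).
Variables (M U : set V) (F : V -> C).
Hypothesis oU : open U.
Hypothesis sF : smooth_on U F.
Hypothesis rF : forall x, U x -> (F x)^* = F x.
Hypothesis Fw : forall x (c : C), F (x + c *: delta_mx iw 0) = F x.
Hypothesis MF : forall x, U x -> (M x <-> 'Re (x iw 0) = F x).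

(** A defining function of the graph, affine in w and normalized by its w-derivative. *)
Definition grho x : C := F x - 'Re (x iw 0).

Lemma ReC2 (z : C) : 'Re z = 2^-1 * (z + z^*).
Proof. by rewrite ReE mulrC. Qed.

Lemma grhoE x : grho x = F x + (- 2^-1) * (x iw 0 + (x iw 0)^*).
Proof. by rewrite /grho ReC2 mulNr. Qed.

Lemma smooth_Rew : smooth_on U (fun x => - 2^-1 * (x iw 0 + (x iw 0)^*)).
Proof.
apply: smooth_on_mul => //; first exact: smooth_on_cst.
apply: smooth_on_add => //; first by move=> k; apply: Ck_coord.
by apply: smooth_on_conj => // k; apply: Ck_coord.
Qed.

Lemma smooth_grho : smooth_on U grho.
Proof.
apply: (smooth_on_eq (f := fun x => F x + (- 2^-1) * (x iw 0 + (x iw 0)^*))) => //.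
  by move=> x _; rewrite grhoE.
by apply: smooth_on_add => //; exact: smooth_Rew.
Qed.

Lemma W_Rew p : W (fun x => - 2^-1 * (x iw 0 + (x iw 0)^*)) p.
Proof.
have Wc := (W_coord iw p).1.
exact: (W_mul (W_cst _ p).1 (W_add Wc (W_conj Wc).1).1).1.
Qed.

Lemma vder_Rew v p : vder v (fun x => - 2^-1 * (x iw 0 + (x iw 0)^*)) p = - 2^-1 * (v.1 iw 0 + v.2 iw 0).
Proof.
have Wc := (W_coord iw p).1; have Wcc := (W_conj Wc).1.
rewrite (vderM _ (W_cst _ p).1 (W_add Wc Wcc).1) vder_cst mul0r add0r.
rewrite (vderD _ Wc Wcc) (vder_conj _ Wc) !vder_coord; congr (_ * (_ + _)).
by rewrite mxE conjCK.
Qed.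

Lemma vder_grho v p : U p -> vder v grho p = vder v F p - 2^-1 * (v.1 iw 0 + v.2 iw 0).
Proof.
move=> Up; have WF := smooth_W oU Up sF.
have -> : grho = (fun x => F x + (- 2^-1) * (x iw 0 + (x iw 0)^*)) by apply/funext => x; rewrite grhoE.
by rewrite (vderD _ WF (W_Rew p)) vder_Rew mulNr.
Qed.

Lemma dzFw p : dz F iw p = 0 /\ dzbar F iw p = 0.
Proof.
have H c : rderive F (c *: delta_mx iw 0) p = 0.
  rewrite /rderive.
  have -> : (fun t : R => complex.Re (F (p + (t%:C)%C *: (c *: delta_mx iw 0)))) = cst (complex.Re (F p)).
    by apply/funext => t; rewrite scalerA Fw.
  have -> : (fun t : R => complex.Im (F (p + (t%:C)%C *: (c *: delta_mx iw 0)))) = cst (complex.Im (F p)).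
    by apply/funext => t; rewrite scalerA Fw.
  by rewrite !derive1_cst.
have H1 := H 1; rewrite scale1r in H1.
by rewrite /dz /dzbar H1 H mulr0 subr0 addr0 !mulr0.
Qed.

Lemma dz_grho p j : U p -> dz grho j p = dz F j p - 2^-1 * (j == iw)%:R /\
   dzbar grho j p = dzbar F j p - 2^-1 * (j == iw)%:R.
Proof.
move=> Up; have WF := smooth_W oU Up sF; have Wg := smooth_W oU Up smooth_grho.
have one (f : V -> C) : vder (delta_mx j 0, 0) f p = dz f j p.
  rewrite /vder (bigD1 j) //= big1 => [|k kj]; rewrite !mxE mul0r addr0.
    by rewrite !eqxx /= mul1r addr0.
  by rewrite (negbTE kj) /= mul0r.
have two (f : V -> C) : vder (0, delta_mx j 0) f p = dzbar f j p.
  rewrite /vder (bigD1 j) //= big1 => [|k kj]; rewrite !mxE mul0r add0r.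
    by rewrite !eqxx /= mul1r addr0.
  by rewrite (negbTE kj) /= mul0r.
rewrite -!one -!two !vder_grho //=; split; congr (_ - _ * _); rewrite !mxE ?eqxx ?andbT ?addr0 ?add0r eq_sym //.
Qed.

Lemma vder_grho_conj v p : U p -> vder (cconj v) grho p = (vder v grho p)^*.
Proof.
move=> Up; rewrite !vder_grho // rmorphB rmorphM rmorphD /= !mxE.
rewrite fmorphV /= conjC_nat [(v.2 _ _)^* + _]addrC; congr (_ - _).
have WF := smooth_W oU Up sF.
transitivity (vder (cconj v) (fun x => (F x)^*) p); last by rewrite vder_conj // cconjK.
apply: vder_near; last exact: (W_conj WF).1.
by apply: filterS (open_near oU Up) => x /rF.
Qed.

Lemma grho_local p : U p -> local_defining M p grho.
Proof.
move=> Up; exists U; split=> //; first exact: smooth_grho.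
- move=> x Ux; rewrite CrealE /grho rmorphB /= rF //.
  have := Creal_Re (x iw 0); rewrite CrealE => /eqP ->; exact: eqxx.
- split.
    move=> x Ux; rewrite MF // /grho; split=> [->|/eqP]; first by rewrite subrr.
    by rewrite subr_eq0 => /eqP ->.
  exists (delta_mx iw 0, 0); rewrite vder_grho //= !mxE !eqxx /= addr0 mulr1.
  rewrite /vder big1 ?sub0r ?oppr_eq0 ?invr_eq0 ?pnatr_eq0 // => j _ /=.
  rewrite !mxE mul0r addr0; have [->|jw] := eqVneq j iw; first by rewrite (dzFw p).1 mulr0.
  by rewrite mul0r.
Qed.

(** Follow the retraction x |-> x + rho(x) e_w onto the graph: [g] composed with it vanishes identically, and its differential at a point of M is the identity on tangent vectors. *)
Lemma kill (g : V -> C) p v : U p -> M p -> W g p -> (\forall q \near p, M q -> g q = 0) ->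
  vder v grho p = 0 -> vder v g p = 0.
Proof.
move=> Up Mp Wg g0 tv.
(* the w-coordinate enters rho through - Re w, so adding rho e_w makes rho vanish *)
pose phi q : V := q + grho q *: delta_mx iw 0.
have tv' : vder (cconj v) grho p = 0 by rewrite vder_grho_conj // tv conjC0.
have Wr := smooth_W oU Up smooth_grho.
have rp : grho p = 0 by rewrite /grho ((MF Up).1 Mp) subrr.
have pE : phi p = p by rewrite /phi rp scale0r addr0.
have phiE j : (fun q => phi q j 0) = (fun q => q j 0 + grho q * (j == iw)%:R).
  by apply/funext => q; rewrite !mxE eqxx andbT.
have Wj j : W (fun q => q j 0) p by exact: (W_coord j p).1.
have Wc j : W (fun q : V => grho q * (j == iw)%:R) p by exact: (W_mul Wr (W_cst _ p).1).1.
have Wp j : W (fun q => phi q j 0) p by rewrite phiE; exact: (W_add (Wj j) (Wc j)).1.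
have Dp u j : vder u grho p = 0 -> vder u (fun q => phi q j 0) p = u.1 j 0.
  move=> ur; rewrite phiE (vderD _ (Wj j) (Wc j)) vder_coord (vderM _ Wr (W_cst _ p).1).
  by rewrite ur vder_cst mul0r mulr0 !addr0.
have Dc j : vder v (fun q => (phi q j 0)^*) p = v.2 j 0.
  by rewrite (vder_conj _ (Wp j)) (Dp _ j tv') mxE conjCK.
rewrite -{1}pE in Wg; have [_ /(_ v)] := W_comp Wg Wp.
rewrite pE => E.
have -> : vder v g p = vder v (fun y => g (phi y)) p.
  by rewrite E; apply: eq_bigr => j _; rewrite Dp // Dc mulrC [_ * dzbar _ _ _]mulrC.
rewrite -(vder_cst v 0 p); apply: vder_near; last exact: (W_cst 0 p).1.
have n1 : \forall q \near p, U (phi q) by apply: hol_cont => //; rewrite pE; apply: open_near.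
have n2 : \forall q \near p, M (phi q) -> g (phi q) = 0.
  by apply: (@hol_cont _ _ _ phi p (fun q => M q -> g q = 0) Wp); rewrite pE.
have n3 : \forall q \near p, (U (phi q) /\ (M (phi q) -> g (phi q) = 0)) /\ U q.
  by apply: filterI; [apply: filterI|apply: open_near].
have H q : (U (phi q) /\ (M (phi q) -> g (phi q) = 0)) /\ U q -> 0 = g (phi q).
  move=> [[Uq gq] Uq0]; rewrite gq // MF //.
  have FE : F (phi q) = F q by rewrite /phi Fw.
  rewrite FE !mxE !eqxx mulr1 raddfD /=.
  have -> : 'Re (grho q) = grho q.
    rewrite ReC2 /grho rmorphB /= rF //.
    have := Creal_Re (q iw 0); by rewrite CrealE => /eqP ->; field.
  by rewrite /grho addrC subrK.
have [d d0 Hd] := (nbhs_nszP p _).1 n3.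
by apply/nbhs_nszP; exists d => // q /Hd /H.
Qed.

Lemma ctangentP p v : U p -> M p -> (ctangent M p v <-> vder v grho p = 0).
Proof.
move=> Up Mp; split=> [H|tv rho [A [oA Ap sr _ [Hr _]]]]; first by apply: H; exact: grho_local.
apply: kill => //; first exact: smooth_W sr.
by apply: filterS (open_near oA Ap) => q Aq; rewrite (Hr q Aq).
Qed.

Lemma HbundleP p v : U p -> M p -> (Hbundle M p v <-> vder v grho p = 0 /\ v.2 = 0).
Proof. by move=> Up Mp; rewrite /Hbundle ctangentP. Qed.

(** A vector lies in H + conj H when both its (1,0)-part and its (0,1)-part are tangent to [M]. *)
Lemma HHbarP p v : U p -> M p ->
  (HHbar M p v <-> vder (v.1, 0) grho p = 0 /\ vder (0, v.2) grho p = 0).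
Proof.
move=> Up Mp; split=> [[v1 [v2 [h1 h2 ->]]]|[t1 t2]].
  have [t1 z1] := (HbundleP v1 Up Mp).1 h1; have [t2 z2] := (HbundleP v2 Up Mp).1 h2.
  have E : v1 + cconj v2 = (v1.1, (cconj v2).2) :> cvec R N.
    rewrite [LHS]surjective_pairing /= z1 add0r; congr pair.
    by rewrite /cconj /= z2 map_mx0 addr0.
  rewrite E /=; split.
    by move: t1; rewrite {1}[v1]surjective_pairing z1.
  have -> : (0, map_mx (@Num.conj C) v2.1) = cconj v2 :> cvec R N.
    by rewrite /cconj z2 map_mx0.
  by rewrite vder_grho_conj // t2 conjC0.
exists (v.1, 0), (cconj (0, v.2)); split.
- by apply/HbundleP.
- by apply/HbundleP => //; rewrite vder_grho_conj // t2 conjC0 /cconj /= map_mx0.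
- rewrite cconjK [LHS]surjective_pairing; congr pair; rewrite /=; first by rewrite addr0.
  by rewrite add0r.
Qed.

Lemma HHbar_ctangent p v : HHbar M p v -> ctangent M p v.
Proof.
move=> [v1 [v2 [[h1 _] [h2 _] ->]]] rho Hr; rewrite vderDv (h1 _ Hr) add0r.
have := h2 _ Hr; case: Hr => A [oA Ap sr rr _] h.
have Wr := smooth_W oA Ap sr.
transitivity (vder (cconj v2) (fun x => (rho x)^*) p); last by rewrite vder_conj // cconjK h conjC0.
apply: vder_near; last exact: (W_conj Wr).1.
by apply: filterS (open_near oA Ap) => q /rr; rewrite CrealE => /eqP.
Qed.

(** The (1,0)-field with constant components [a] in the directions other than w, corrected along e_w to be tangent. *)
Definition frame (a : V) : cfield R N := fun q =>
  (a + (2 * \sum_j a j 0 * dz F j q) *: delta_mx iw 0, 0).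

Lemma frame_section (a : V) p : U p -> M p -> a iw 0 = 0 -> section_near M (Hbundle M) p (frame a).
Proof.
move=> Up Mp aw; exists U; split=> //.
  move=> j; split; last first.
    by apply: (smooth_on_eq (f := fun=> 0)) => // [x _|]; [rewrite mxE|exact: smooth_on_cst].
  apply: (smooth_on_eq (f := fun q => a j 0 + (2 * \sum_l a l 0 * dz F l q) * (j == iw)%:R)) => //.
    by move=> x _; rewrite !mxE eqxx andbT.
  apply: smooth_on_add => //; first exact: smooth_on_cst.
  apply: smooth_on_mul => //; last exact: smooth_on_cst.
  apply: smooth_on_mul => //; first exact: smooth_on_cst.
  move=> k; apply: Ck_sum => // l _; apply: Ck_mul => //; first exact: Ck_cst.
  exact: smooth_dz.
move=> q Uq Mq; apply/HbundleP => //; split=> //.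
rewrite vder_grho // /vder.
rewrite (eq_bigr (fun j => a j 0 * dz F j q)); last first.
  move=> j _; rewrite !mxE mul0r addr0 mulrDl; have [->|jw] := eqVneq j iw.
    by rewrite (dzFw q).1 !mulr0 addr0.
  by rewrite mulr0 mul0r addr0.
rewrite !mxE !eqxx aw /= addr0 add0r mulr1 mulrA mulVf ?pnatr_eq0 // mul1r subrr.
by [].
Qed.

(** Pairing a bracket with the (1,0)-differential of rho: since both fields annihilate it along [M], differentiating these relations moves the derivatives from the fields to rho. *)
Lemma bracket1 (X Y : cfield R N) p A : open A -> A p -> A `<=` U -> M p ->
  smooth_field A X -> smooth_field A Y ->
  (forall q, A q -> M q -> HHbar M q (X q)) -> (forall q, A q -> M q -> HHbar M q (Y q)) ->
  \sum_j dz grho j p * (lie X Y p).1 j 0 =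
  \sum_j ((X p).1 j 0 * vder (Y p) (dz grho j) p - (Y p).1 j 0 * vder (X p) (dz grho j) p).
Proof.
move=> oA Ap AU Mp sX sY HX HY; have Up := AU p Ap.
have Wd j : W (dz grho j) p by apply: smooth_W (smooth_dz j oU smooth_grho).
have key (Z T : cfield R N) : smooth_field A Z -> (forall q, A q -> M q -> HHbar M q (Z q)) ->
   HHbar M p (T p) ->
   \sum_j (vder (T p) (fun q => (Z q).1 j 0) p * dz grho j p + (Z p).1 j 0 * vder (T p) (dz grho j) p) = 0.
  move=> sZ HZ HT.
  have Wz j : W (fun q => (Z q).1 j 0) p by apply: smooth_W (sZ j).1.
  have WT j : W (fun q => (Z q).1 j 0 * dz grho j q) p by exact: (W_mul (Wz j) (Wd j)).1.
  have [WG DG] := @W_sum _ _ _ (index_enum 'I_N) (fun j q => (Z q).1 j 0 * dz grho j q) p WT.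
  transitivity (vder (T p) (fun y => \sum_j (Z y).1 j 0 * dz grho j y) p).
    by rewrite DG; apply: eq_bigr => j _; rewrite (vderM _ (Wz j) (Wd j)).
  apply: kill => //; last by apply/ctangentP => //; apply: HHbar_ctangent.
  apply: filterS (open_near oA Ap) => q Aq Mq.
  have [h _] := (HHbarP _ (AU q Aq) Mq).1 (HZ q Aq Mq).
  rewrite -[RHS]h; apply: eq_bigr => j _; rewrite /= mxE mul0r addr0 //.
have K1 := key X Y sX HX (HY p Ap Mp); have K2 := key Y X sY HY (HX p Ap Mp).
rewrite (eq_bigr (fun j => vder (X p) (fun q => (Y q).1 j 0) p * dz grho j p -
     vder (Y p) (fun q => (X q).1 j 0) p * dz grho j p)); last first.
  by move=> j _; rewrite mxE mulrC mulrBl.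
move/eqP: K1; rewrite big_split /= addrC addr_eq0 => /eqP K1.
move/eqP: K2; rewrite big_split /= addrC addr_eq0 => /eqP K2.
by rewrite !sumrB K1 K2 opprK addrC.
Qed.

Lemma bracket2 (X Y : cfield R N) p A : open A -> A p -> A `<=` U -> M p ->
  smooth_field A X -> smooth_field A Y ->
  (forall q, A q -> M q -> HHbar M q (X q)) -> (forall q, A q -> M q -> HHbar M q (Y q)) ->
  \sum_j dzbar grho j p * (lie X Y p).2 j 0 =
  \sum_j ((X p).2 j 0 * vder (Y p) (dzbar grho j) p - (Y p).2 j 0 * vder (X p) (dzbar grho j) p).
Proof.
move=> oA Ap AU Mp sX sY HX HY; have Up := AU p Ap.
have Wd j : W (dzbar grho j) p by apply: smooth_W (smooth_dzbar j oU smooth_grho).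
have key (Z T : cfield R N) : smooth_field A Z -> (forall q, A q -> M q -> HHbar M q (Z q)) ->
   HHbar M p (T p) ->
   \sum_j (vder (T p) (fun q => (Z q).2 j 0) p * dzbar grho j p + (Z p).2 j 0 * vder (T p) (dzbar grho j) p) = 0.
  move=> sZ HZ HT.
  have Wz j : W (fun q => (Z q).2 j 0) p by apply: smooth_W (sZ j).2.
  have WT j : W (fun q => (Z q).2 j 0 * dzbar grho j q) p by exact: (W_mul (Wz j) (Wd j)).1.
  have [WG DG] := @W_sum _ _ _ (index_enum 'I_N) (fun j q => (Z q).2 j 0 * dzbar grho j q) p WT.
  transitivity (vder (T p) (fun y => \sum_j (Z y).2 j 0 * dzbar grho j y) p).
    by rewrite DG; apply: eq_bigr => j _; rewrite (vderM _ (Wz j) (Wd j)).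
  apply: kill => //; last by apply/ctangentP => //; apply: HHbar_ctangent.
  apply: filterS (open_near oA Ap) => q Aq Mq.
  have [_ h] := (HHbarP _ (AU q Aq) Mq).1 (HZ q Aq Mq).
  rewrite -[RHS]h; apply: eq_bigr => j _; rewrite /= mxE mul0r add0r //.
have K1 := key X Y sX HX (HY p Ap Mp); have K2 := key Y X sY HY (HX p Ap Mp).
rewrite (eq_bigr (fun j => vder (X p) (fun q => (Y q).2 j 0) p * dzbar grho j p -
     vder (Y p) (fun q => (X q).2 j 0) p * dzbar grho j p)); last first.
  by move=> j _; rewrite mxE mulrC mulrBl.
move/eqP: K1; rewrite big_split /= addrC addr_eq0 => /eqP K1.
move/eqP: K2; rewrite big_split /= addrC addr_eq0 => /eqP K2.
by rewrite !sumrB K1 K2 opprK addrC.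
Qed.

End Graph.

(** * Quadratic graphs and their jets along z = 0 *)

Section Indices.
Variables (R : realType) (s k : nat).
Local Notation C := R[i].
Local Notation N := (1 + (s + k))%N.
Local Notation V := 'cV[R[i]]_N.

Definition iw : 'I_N := lshift (s + k) (0 : 'I_1).
Definition iz (l : 'I_s) : 'I_N := rshift 1 (lshift k l).
Definition ia (a : 'I_k) : 'I_N := rshift 1 (rshift s a).

Lemma coord_wE (x : V) : coord_w x = x iw 0. Proof. by rewrite /coord_w mxE. Qed.
Lemma coord_zE (x : V) l : coord_z x l 0 = x (iz l) 0.
Proof. by rewrite /coord_z !mxE. Qed.
Lemma coord_zetaE (x : V) a : coord_zeta x a 0 = x (ia a) 0.
Proof. by rewrite /coord_zeta !mxE. Qed.

Lemma eq_iz l m : (iz l == iz m) = (l == m).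
Proof. by rewrite /iz (inj_eq (@rshift_inj _ _)) (inj_eq (@lshift_inj _ _)). Qed.
Lemma eq_ia a b : (ia a == ia b) = (a == b).
Proof. by rewrite /ia (inj_eq (@rshift_inj _ _)) (inj_eq (@rshift_inj _ _)). Qed.
Lemma iz_iw l : (iz l == iw) = false.
Proof. by rewrite eq_sym /iw /iz eq_lrshift. Qed.
Lemma ia_iw a : (ia a == iw) = false.
Proof. by rewrite eq_sym /iw /ia eq_lrshift. Qed.
Lemma ia_iz a l : (ia a == iz l) = false.
Proof. by rewrite /ia /iz (inj_eq (@rshift_inj _ _)) eq_sym eq_lrshift. Qed.
Lemma iz_ia a l : (iz l == ia a) = false.
Proof. by rewrite eq_sym ia_iz. Qed.

Lemma index_ind (P : 'I_N -> Prop) : P iw -> (forall l, P (iz l)) -> (forall a, P (ia a)) -> forall j, P j.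
Proof.
move=> Pw Pz Pa j; have [i ->|i ->] := split_ordP j; first by rewrite ord1.
by have [l ->|a ->] := split_ordP i; [exact: Pz|exact: Pa].
Qed.

Lemma big_index (F : 'I_N -> C) : \sum_j F j = F iw + (\sum_l F (iz l) + \sum_a F (ia a)).
Proof. by rewrite big_split_ord big_ord1 big_split_ord. Qed.

(** Functions of zeta alone. *)
Definition zfun (f : V -> C) := forall x y : V, (forall a, x (ia a) 0 = y (ia a) 0) -> f x = f y.

Lemma indep_dz (f : V -> C) j p : (forall x c, f (x + c *: delta_mx j 0) = f x) ->
  dz f j p = 0 /\ dzbar f j p = 0.
Proof. by move=> H; exact: (dzFw H). Qed.

Lemma zfun_indep f j : zfun f -> (forall a, ia a != j) ->
  forall x (c : C), f (x + c *: delta_mx j 0) = f x.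
Proof.
by move=> zf jn x c; apply: zf => a; rewrite !mxE (negbTE (jn a)) mulr0 addr0.
Qed.

Lemma zfun_vder f (v : cvec R N) p : zfun f ->
  vder v f p = \sum_a (v.1 (ia a) 0 * dz f (ia a) p + v.2 (ia a) 0 * dzbar f (ia a) p).
Proof.
move=> zf; rewrite /vder big_index.
have [-> ->] := indep_dz p (zfun_indep (j := iw) zf (fun a => negbT (ia_iw a))).
rewrite !mulr0 addr0 add0r big1 ?add0r // => l _.
have [-> ->] := indep_dz p (zfun_indep (j := iz l) zf (fun a => negbT (ia_iz a l))).
by rewrite !mulr0 addr0.
Qed.

End Indices.
Arguments iw {s k}.
Arguments iz {s k}.
Arguments ia {s k}.

Section Quadratic.
Variables (R : realType) (s k : nat).
Local Notation C := R[i].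
Local Notation N := (1 + (s + k))%N.
Local Notation V := 'cV[R[i]]_N.
Implicit Types (K : 'I_s -> 'I_s -> V -> C) (x p q : V) (v : cvec R N).

Definition zc (l : 'I_s) x : C := x (iz l) 0.

(** The shape z^T K conj(z) + (conj(z)^T K1 conj(z) + z^T K2 z) / 2, kept for independent K, K1, K2 so that zeta-derivatives have the same shape. *)
Definition quadf K K1 K2 x : C :=
  \sum_l \sum_m (zc l x * K l m x * (zc m x)^*)
  + 2^-1 * (\sum_l \sum_m ((zc l x)^* * K1 l m x * (zc m x)^*)
          + \sum_l \sum_m (zc l x * K2 l m x * zc m x)).

Lemma W_zc l p : W (zc l) p. Proof. exact: (W_coord (iz l) p).1. Qed.
Lemma W_zcc l p : W (fun x => (zc l x)^*) p. Proof. exact: (W_conj (W_zc l p)).1. Qed.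
Lemma vder_zc v l p : vder v (zc l) p = v.1 (iz l) 0. Proof. exact: vder_coord. Qed.
Lemma vder_zcc v l p : vder v (fun x => (zc l x)^*) p = v.2 (iz l) 0.
Proof. by rewrite (vder_conj _ (W_zc l p)) vder_zc mxE conjCK. Qed.

Lemma vder_mul3 v (f g h : V -> C) p : W f p -> W g p -> W h p ->
  W (fun x => f x * g x * h x) p /\
  vder v (fun x => f x * g x * h x) p =
    vder v f p * g p * h p + f p * vder v g p * h p + f p * g p * vder v h p.
Proof.
move=> Wf Wg Wh; have Wfg := (W_mul Wf Wg).1; split; first exact: (W_mul Wfg Wh).1.
by rewrite (vderM _ Wfg Wh) (vderM _ Wf Wg) mulrDl.
Qed.

Lemma vder_sum2 v (G : 'I_s -> 'I_s -> V -> C) p : (forall l m, W (G l m) p) ->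
  W (fun x => \sum_l \sum_m G l m x) p /\
  vder v (fun x => \sum_l \sum_m G l m x) p = \sum_l \sum_m vder v (G l m) p.
Proof.
move=> WG.
have H l := @W_sum _ _ _ (index_enum 'I_s) (fun m x => G l m x) p (WG l).
have [W1 D1] := @W_sum _ _ _ (index_enum 'I_s) (fun l x => \sum_m G l m x) p (fun l => (H l).1).
split; first exact: W1.
by rewrite D1; apply: eq_bigr => l _; rewrite (H l).2.
Qed.

Lemma vder_quadf v K K1 K2 p :
  (forall l m, W (K l m) p) -> (forall l m, W (K1 l m) p) -> (forall l m, W (K2 l m) p) ->
  W (quadf K K1 K2) p /\
  vder v (quadf K K1 K2) p =
  \sum_l \sum_m (v.1 (iz l) 0 * K l m p * (zc m p)^* + zc l p * vder v (K l m) p * (zc m p)^*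
                 + zc l p * K l m p * v.2 (iz m) 0)
  + 2^-1 * (\sum_l \sum_m (v.2 (iz l) 0 * K1 l m p * (zc m p)^* + (zc l p)^* * vder v (K1 l m) p * (zc m p)^*
                 + (zc l p)^* * K1 l m p * v.2 (iz m) 0)
          + \sum_l \sum_m (v.1 (iz l) 0 * K2 l m p * zc m p + zc l p * vder v (K2 l m) p * zc m p
                 + zc l p * K2 l m p * v.1 (iz m) 0)).
Proof.
move=> WK WK1 WK2.
have [A1 A2] := vder_sum2 v (fun l m => (vder_mul3 v (W_zc l p) (WK l m) (W_zcc m p)).1).
have [B1 B2] := vder_sum2 v (fun l m => (vder_mul3 v (W_zcc l p) (WK1 l m) (W_zcc m p)).1).
have [C1 C2] := vder_sum2 v (fun l m => (vder_mul3 v (W_zc l p) (WK2 l m) (W_zc m p)).1).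
have BC := (W_add B1 C1).1; have hBC := (W_mul (W_cst (2^-1) p).1 BC).1.
split; first exact: (W_add A1 hBC).1.
rewrite (vderD _ A1 hBC) (vderM _ (W_cst (2^-1) p).1 BC) vder_cst mul0r add0r (vderD _ B1 C1).
rewrite A2 B2 C2; congr (_ + _ * (_ + _)); apply: eq_bigr => l _; apply: eq_bigr => m _.
- by rewrite (vder_mul3 v (W_zc l p) (WK l m) (W_zcc m p)).2 vder_zc vder_zcc.
- by rewrite (vder_mul3 v (W_zcc l p) (WK1 l m) (W_zcc m p)).2 !vder_zcc.
- by rewrite (vder_mul3 v (W_zc l p) (WK2 l m) (W_zc m p)).2 !vder_zc.
Qed.

Lemma vder_quadf0 v K K1 K2 p :
  (forall l m, W (K l m) p) -> (forall l m, W (K1 l m) p) -> (forall l m, W (K2 l m) p) ->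
  (forall l, zc l p = 0) -> vder v (quadf K K1 K2) p = 0.
Proof.
move=> WK WK1 WK2 z0; rewrite (vder_quadf v WK WK1 WK2).2.
rewrite !big1 ?addr0 ?mulr0 ?addr0 // => l _; rewrite big1 // => m _;
  by rewrite !z0 ?conjC0 !(mulr0, mul0r) !addr0.
Qed.

Lemma smooth_quadf (U : set V) K K1 K2 : open U -> (forall l m, smooth_on U (K l m)) ->
  (forall l m, smooth_on U (K1 l m)) -> (forall l m, smooth_on U (K2 l m)) ->
  smooth_on U (quadf K K1 K2).
Proof.
move=> oU sK sK1 sK2 n.
have cz l : Ck n U (zc l) by apply: Ck_coord.
have czc l : Ck n U (fun x => (zc l x)^*) by apply: Ck_conj.
apply: Ck_add => //.
  by apply: Ck_sum => // l _; apply: Ck_sum => // m _; apply: Ck_mul => //; apply: Ck_mul => //; apply: sK.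
apply: Ck_mul => //; first exact: Ck_cst.
apply: Ck_add => //; apply: Ck_sum => // l _; apply: Ck_sum => // m _; apply: Ck_mul => //; apply: Ck_mul => //.
  exact: sK1.
exact: sK2.
Qed.

End Quadratic.

Section QuadGraph.
Variables (R : realType) (s k : nat).
Local Notation C := R[i].
Local Notation N := (1 + (s + k))%N.
Local Notation V := 'cV[R[i]]_N.
Variables (U M : set V) (H S : 'cV[C]_k -> 'M[C]_s).
Hypothesis oU : open U.
Let Hc l m (x : V) : C := H (coord_zeta x) l m.
Let Sc l m (x : V) : C := S (coord_zeta x) l m.
Let Scc l m (x : V) : C := (S (coord_zeta x) l m)^*.
Hypothesis sH : forall l m, smooth_on U (Hc l m).
Hypothesis sS : forall l m, smooth_on U (Sc l m).
Hypothesis Hherm : forall x, U x -> forall l m, Hc l m x = (Hc m l x)^*.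
Hypothesis Ssym : forall x, U x -> forall l m, Sc l m x = Sc m l x.
Hypothesis MF : forall x, U x -> (M x <-> model_graph H S x).

Definition qF : V -> C := quadf Hc Sc Scc.

Lemma qFE (x : V) : (((coord_z x)^T *m H (coord_zeta x) *m conjCmx (coord_z x)) 0 0
      + 'Re (((conjCmx (coord_z x))^T *m S (coord_zeta x) *m conjCmx (coord_z x)) 0 0)) = qF x.
Proof.
have E (a b : 'cV[C]_s) (A : 'M[C]_s) : (a^T *m A *m b) 0 0 = \sum_l \sum_m a l 0 * A l m * b m 0.
  rewrite mxE; under eq_bigr do rewrite mxE mulr_suml.
  rewrite exchange_big /=; apply: eq_bigr => l _; apply: eq_bigr => m _.
  by rewrite mxE.
have cz l : conjCmx (coord_z x) l 0 = (zc l x)^* by rewrite mxE coord_zE.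
rewrite ReC2 !E /qF /quadf; congr (_ + _ * (_ + _)).
- by apply: eq_bigr => l _; apply: eq_bigr => m _; rewrite cz coord_zE.
- by apply: eq_bigr => l _; apply: eq_bigr => m _; rewrite !cz.
- rewrite rmorph_sum /=; apply: eq_bigr => l _; rewrite rmorph_sum /=; apply: eq_bigr => m _.
  by rewrite !rmorphM /= !cz !conjCK.
Qed.

Lemma MFq x : U x -> (M x <-> 'Re (x iw 0) = qF x).
Proof. by move=> Ux; rewrite MF // /model_graph /= qFE coord_wE. Qed.

Lemma sSc l m : smooth_on U (Scc l m).
Proof. exact: (smooth_on_conj oU (sS l m)). Qed.

Lemma smooth_qF : smooth_on U qF.
Proof. exact: smooth_quadf oU sH sS sSc. Qed.

Lemma zfunE (f : 'cV[C]_k -> C) : zfun (fun x : V => f (coord_zeta x)).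
Proof.
move=> x y xy; congr f; apply/matrixP => i j; rewrite ord1 !coord_zetaE; exact: xy.
Qed.

Lemma qF_w x (c : C) : qF (x + c *: delta_mx iw 0) = qF x.
Proof.
have z l : zc l (x + c *: delta_mx iw 0) = zc l x by rewrite /zc !mxE iz_iw mulr0 addr0.
have h (f : 'cV[C]_k -> C) : f (coord_zeta (x + c *: delta_mx iw 0)) = f (coord_zeta x).
  by apply: zfunE => a; rewrite !mxE ia_iw mulr0 addr0.
rewrite /qF /quadf; congr (_ + _ * (_ + _)); apply: eq_bigr => l _; apply: eq_bigr => m _; rewrite !z.
- by rewrite /Hc (h (fun u => H u l m)).
- by rewrite /Sc (h (fun u => S u l m)).
- by rewrite /Scc (h (fun u => (S u l m)^*)).
Qed.

Lemma qF_real x : U x -> (qF x)^* = qF x.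
Proof.
move=> Ux; rewrite /qF /quadf rmorphD rmorphM rmorphD /= fmorphV /= conjC_nat [X in _ * X]addrC.
have cs (G : 'I_s -> 'I_s -> C) : (\sum_l \sum_m G l m)^* = \sum_l \sum_m (G l m)^*.
  by rewrite rmorph_sum /=; apply: eq_bigr => l _; rewrite rmorph_sum.
rewrite !cs; congr (_ + _ * (_ + _)).
- rewrite exchange_big /=; apply: eq_bigr => l _; apply: eq_bigr => m _.
  rewrite !rmorphM /= conjCK -(Hherm Ux l m); ring.
- by apply: eq_bigr => l _; apply: eq_bigr => m _; rewrite !rmorphM /= conjCK.
- by apply: eq_bigr => l _; apply: eq_bigr => m _; rewrite !rmorphM /= !conjCK.
Qed.

Local Notation rho := (grho iw qF).

Lemma zfH l m : zfun (Hc l m). Proof. exact: (zfunE (fun u => H u l m)). Qed.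
Lemma zfS l m : zfun (Sc l m). Proof. exact: (zfunE (fun u => S u l m)). Qed.
Lemma zfSc l m : zfun (Scc l m). Proof. exact: (zfunE (fun u => (S u l m)^*)). Qed.

Lemma dz_vder (f : V -> C) j p : dz f j p = vder (delta_mx j 0, 0) f p.
Proof.
rewrite /vder (bigD1 j) //= big1 => [|i ij]; rewrite !mxE mul0r addr0.
  by rewrite !eqxx /= mul1r addr0.
by rewrite (negbTE ij) /= mul0r.
Qed.

Lemma dzbar_vder (f : V -> C) j p : dzbar f j p = vder (0, delta_mx j 0) f p.
Proof.
rewrite /vder (bigD1 j) //= big1 => [|i ij]; rewrite !mxE mul0r add0r.
  by rewrite !eqxx /= mul1r addr0.
by rewrite (negbTE ij) /= mul0r.
Qed.

(** The derivative of F with respect to conj(z_i). *)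
Definition hz (i : 'I_s) (x : V) : C :=
  \sum_l (zc l x * Hc l i x + Sc i l x * (zc l x)^*).

Lemma dzbar_z i p : U p -> dzbar rho (iz i) p = hz i p.
Proof.
move=> Up; rewrite (@dz_grho R _ iw U qF oU smooth_qF _ (iz i) Up).2 iz_iw mulr0 subr0 dzbar_vder.
have WH l m := smooth_W oU Up (sH l m).
have WS l m := smooth_W oU Up (sS l m).
have WSc l m := smooth_W oU Up (sSc l m).
have z0 (f : V -> C) : zfun f -> vder (0, delta_mx (iz i) 0) f p = 0.
  move=> zf; rewrite zfun_vder // big1 // => a _; rewrite /= !mxE mul0r ia_iz mul0r addr0 //.
rewrite (vder_quadf _ WH WS WSc).2 /=.
have D l : (delta_mx (iz i) 0 : V) (iz l) 0 = (l == i)%:R by rewrite mxE eq_iz eqxx andbT.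
have K (G : 'I_s -> 'I_s -> C) : \sum_l \sum_m G l m * (m == i)%:R = \sum_l G l i.
  by apply: eq_bigr => l _; rewrite (bigD1 i) //= eqxx mulr1 big1 ?addr0 // => m /negbTE ->; rewrite mulr0.
have K' (G : 'I_s -> 'I_s -> C) : \sum_l \sum_m (l == i)%:R * G l m = \sum_m G i m.
  rewrite (bigD1 i) //= [X in _ + X]big1 ?addr0; last first.
    by move=> l /negbTE li; rewrite big1 // => m _; rewrite li mul0r.
  by apply: eq_bigr => m _; rewrite eqxx mul1r.
transitivity (\sum_l \sum_m (zc l p * Hc l m p) * (m == i)%:R +
   2^-1 * (\sum_l \sum_m (l == i)%:R * (Sc l m p * (zc m p)^*) + \sum_l \sum_m ((zc l p)^* * Sc l m p) * (m == i)%:R)).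
  congr (_ + _ * _).
    apply: eq_bigr => l _; apply: eq_bigr => m _.
    by rewrite mxE !mul0r add0r (z0 _ (zfH l m)) mulr0 mul0r add0r D.
  rewrite -[RHS]addr0; congr (_ + _).
    rewrite -big_split; apply: eq_bigr => l _; rewrite -big_split; apply: eq_bigr => m _ /=.
    by rewrite (z0 _ (zfS l m)) mulr0 mul0r addr0 !D mulrA.
  rewrite big1 // => l _; rewrite big1 // => m _.
  by rewrite !mxE (z0 _ (zfSc l m)) !(mulr0, mul0r) !addr0.
rewrite !K K' /hz big_split /=; congr (_ + _).
have -> : \sum_l (zc l p)^* * Sc l i p = \sum_m Sc i m p * (zc m p)^*.
  by apply: eq_bigr => m _; rewrite mulrC Ssym.
by move: (\sum_m _) => X; field.
Qed.

Lemma W_hz i p v : U p -> W (hz i) p /\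
  vder v (hz i) p = \sum_l (v.1 (iz l) 0 * Hc l i p + zc l p * vder v (Hc l i) p
    + (vder v (Sc i l) p * (zc l p)^* + Sc i l p * v.2 (iz l) 0)).
Proof.
move=> Up.
have WH l m := smooth_W oU Up (sH l m).
have WS l m := smooth_W oU Up (sS l m).
have WA l := (W_mul (W_zc l p) (WH l i)).1.
have WB l := (W_mul (WS i l) (W_zcc l p)).1.
have [W1 D1] := @W_sum _ _ _ (index_enum 'I_s) (fun l x => zc l x * Hc l i x + Sc i l x * (zc l x)^*) p
   (fun l => (W_add (WA l) (WB l)).1).
split; first exact: W1.
rewrite D1; apply: eq_bigr => l _.
by rewrite (vderD _ (WA l) (WB l)) (vderM _ (W_zc l p) (WH l i)) (vderM _ (WS i l) (W_zcc l p)) vder_zc vder_zcc.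
Qed.

(** The complex Hessian along z = 0 in terms of H and S; with [jet_w] and [jet_a] all second derivatives of rho needed below are known. *)
Lemma jet_z i p v : U p -> (forall l, zc l p = 0) ->
  vder v (dzbar rho (iz i)) p = \sum_l (v.1 (iz l) 0 * Hc l i p + Sc i l p * v.2 (iz l) 0).
Proof.
move=> Up z0.
rewrite (vder_near (f := hz i)); last exact: (W_hz i v Up).1.
  rewrite (W_hz i v Up).2; apply: eq_bigr => l _.
  by rewrite z0 conjC0 mul0r mulr0 addr0 add0r.
by apply: filterS (open_near oU Up) => q Uq; rewrite dzbar_z.
Qed.

Lemma jet_w p v : U p -> vder v (dz rho iw) p = 0 /\ vder v (dzbar rho iw) p = 0.
Proof.
move=> Up; split; rewrite -(vder_cst v (- 2^-1) p); apply: vder_near.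
- apply: filterS (open_near oU Up) => q Uq.
  by rewrite (@dz_grho R _ iw U qF oU smooth_qF _ iw Uq).1 (@dzFw R _ iw qF qF_w q).1 eqxx mulr1 sub0r.
- exact: (W_cst _ p).1.
- apply: filterS (open_near oU Up) => q Uq.
  by rewrite (@dz_grho R _ iw U qF oU smooth_qF _ iw Uq).2 (@dzFw R _ iw qF qF_w q).2 eqxx mulr1 sub0r.
- exact: (W_cst _ p).1.
Qed.

(** Derivatives in zeta directions are again quadratic in z, hence have vanishing 1-jet along z = 0. *)
Lemma jet_a a p v : U p -> (forall l, zc l p = 0) ->
  vder v (dz rho (ia a)) p = 0 /\ vder v (dzbar rho (ia a)) p = 0.
Proof.
move=> Up z0.
have W0 (f : V -> C) (sf : smooth_on U f) := smooth_W oU Up sf.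
split.
  rewrite (vder_near (f := quadf (fun l m => dz (Hc l m) (ia a)) (fun l m => dz (Sc l m) (ia a)) (fun l m => dz (Scc l m) (ia a)))).
  - by apply: vder_quadf0 => // l m; apply: W0; apply: smooth_dz => //; apply: sSc.
  - apply: filterS (open_near oU Up) => q Uq.
    rewrite (@dz_grho R _ iw U qF oU smooth_qF _ (ia a) Uq).1 ia_iw mulr0 subr0 dz_vder.
    have WW (f : V -> C) (sf : smooth_on U f) := smooth_W oU Uq sf.
    rewrite (vder_quadf _ (fun l m => WW _ (sH l m)) (fun l m => WW _ (sS l m)) (fun l m => WW _ (sSc l m))).2.
    rewrite /quadf; congr (_ + _ * (_ + _)); apply: eq_bigr => l _; apply: eq_bigr => m _;
      by rewrite /= !mxE ?iz_ia !mul0r !mulr0 addr0 add0r dz_vder.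
  - by apply: (vder_quadf v _ _ _).1 => l m; apply: W0; apply: smooth_dz => //; apply: sSc.
rewrite (vder_near (f := quadf (fun l m => dzbar (Hc l m) (ia a)) (fun l m => dzbar (Sc l m) (ia a)) (fun l m => dzbar (Scc l m) (ia a)))).
- by apply: vder_quadf0 => // l m; apply: W0; apply: smooth_dzbar => //; apply: sSc.
- apply: filterS (open_near oU Up) => q Uq.
  rewrite (@dz_grho R _ iw U qF oU smooth_qF _ (ia a) Uq).2 ia_iw mulr0 subr0 dzbar_vder.
  have WW (f : V -> C) (sf : smooth_on U f) := smooth_W oU Uq sf.
  rewrite (vder_quadf _ (fun l m => WW _ (sH l m)) (fun l m => WW _ (sS l m)) (fun l m => WW _ (sSc l m))).2.
  rewrite /quadf; congr (_ + _ * (_ + _)); apply: eq_bigr => l _; apply: eq_bigr => m _;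
    by rewrite /= !mxE ?iz_ia !mul0r !mulr0 addr0 add0r dzbar_vder.
- by apply: (vder_quadf v _ _ _).1 => l m; apply: W0; apply: smooth_dzbar => //; apply: sSc.
Qed.

End QuadGraph.

(** * Levi kernel and 2-nondegeneracy along z = 0 *)

Section QG.
Variables (R : realType) (s k : nat).
Local Notation C := R[i].
Local Notation N := (1 + (s + k))%N.
Local Notation V := 'cV[R[i]]_N.
Implicit Types (U M : set V) (H S : 'cV[C]_k -> 'M[C]_s).

(** The setting of the local study: on [U] the set [M] is the quadratic graph and its coefficients are smooth and have the required symmetries. *)
Record qgraph U M H S : Prop := QGraph {
  qg_open : open U;
  qg_H : forall l m, smooth_on U (fun x : V => H (coord_zeta x) l m);
  qg_S : forall l m, smooth_on U (fun x : V => S (coord_zeta x) l m);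
  qg_herm : forall x, U x -> forall l m, H (coord_zeta x) l m = (H (coord_zeta x) m l)^*;
  qg_sym : forall x, U x -> forall l m, S (coord_zeta x) l m = S (coord_zeta x) m l;
  qg_M : forall x, U x -> (M x <-> model_graph H S x) }.

Variables (U M : set V) (H S : 'cV[C]_k -> 'M[C]_s).
Hypothesis qg : qgraph U M H S.
Let oU := qg_open qg.
Local Notation F := (qF H S : V -> C).
Let sF := smooth_qF oU (qg_H qg) (qg_S qg) : smooth_on U F.
Let rF := qF_real S (qg_herm qg) : forall x, U x -> (F x)^* = F x.
Let Fw := @qF_w R s k H S.
Let MF := MFq (qg_M qg) : forall x, U x -> (M x <-> 'Re (x iw 0) = F x).
Local Notation rho := (grho iw F).
Local Notation z0 p := (forall l : 'I_s, zc l p = 0).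

Lemma vder_qF0 v p : U p -> z0 p -> vder v F p = 0.
Proof.
move=> Up zp; have W0 (f : V -> C) (sf : smooth_on U f) := smooth_W oU Up sf.
by apply: vder_quadf0 => // l m; apply: W0; [exact: (qg_H qg)|exact: (qg_S qg)|apply: smooth_on_conj; [exact: oU|exact: (qg_S qg)]].
Qed.

Definition hh_on A (X : cfield R N) := smooth_field A X /\ forall q, A q -> M q -> HHbar M q (X q).

Lemma hbundle_HH q (v : cvec R N) : U q -> M q -> Hbundle M q v -> HHbar M q v /\ HHbar M q (cconj v).
Proof.
move=> Uq Mq h; have h0 : Hbundle M q 0.
  by apply/(HbundleP oU sF rF Fw MF) => //; rewrite vder0v.
have c0 : cconj 0 = 0 :> cvec R N by rewrite /cconj !map_mx0.
split; first by exists v, 0; rewrite c0 addr0.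
by exists 0, v; rewrite add0r.
Qed.

Lemma sect_HH X p : U p -> section_near M (Hbundle M) p X ->
  exists A, [/\ open A, A p, A `<=` U, hh_on A X & hh_on A (conj_field X) /\
   forall q, A q -> M q -> Hbundle M q (X q)].
Proof.
move=> Up [A [oA Ap sX HX]]; exists (A `&` U); split=> //; [exact: openI| |split].
- split; first by apply: smooth_field_sub sX => x [].
  by move=> q [Aq Uq] Mq; have [] := hbundle_HH Uq Mq (HX q Aq Mq).
- split; first by apply: smooth_conj_field; [exact: openI|apply: smooth_field_sub sX => x []].
  by move=> q [Aq Uq] Mq; have [] := hbundle_HH Uq Mq (HX q Aq Mq).
- by move=> q [Aq Uq]; exact: HX.
Qed.

Lemma hh_sub A B X : B `<=` A -> hh_on A X -> hh_on B X.
Proof. by move=> BA [sX hX]; split; [apply: smooth_field_sub sX|move=> q Bq; exact: hX (BA q Bq)]. Qed.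

Lemma HHbarZ p (v : cvec R N) (c : C) : U p -> M p -> HHbar M p v -> HHbar M p (c *: v).
Proof.
move=> Up Mp /(HHbarP oU sF rF Fw MF v Up Mp) [h1 h2]; apply/(HHbarP oU sF rF Fw MF) => //.
have e1 : ((c *: v).1, 0) = c *: (v.1, 0) :> cvec R N by congr pair; rewrite /= scaler0.
have e2 : (0, (c *: v).2) = c *: (0, v.2) :> cvec R N by congr pair; rewrite /= scaler0.
by rewrite e1 e2 !vderZv h1 h2 mulr0.
Qed.

Lemma levi_lie X Y p : U p -> M p -> (HHbar M p (levi X Y p) <-> HHbar M p (lie X (conj_field Y) p)).
Proof.
move=> Up Mp; split=> h; last exact: HHbarZ.
have i0 : (2 * 'i : C) != 0 by rewrite mulf_neq0 ?pnatr_eq0 // neq0Ci.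
have -> : lie X (conj_field Y) p = (2 * 'i) *: levi X Y p by rewrite /levi scalerA divff // scale1r.
exact: HHbarZ.
Qed.

(** The Levi form and the iterated brackets are read off the second derivatives of rho. *)
Lemma lie_crit X Y p A : open A -> A p -> A `<=` U -> M p -> hh_on A X -> hh_on A Y ->
  (HHbar M p (lie X Y p) <->
   \sum_j ((X p).1 j 0 * vder (Y p) (dz rho j) p - (Y p).1 j 0 * vder (X p) (dz rho j) p) = 0 /\
   \sum_j ((X p).2 j 0 * vder (Y p) (dzbar rho j) p - (Y p).2 j 0 * vder (X p) (dzbar rho j) p) = 0).
Proof.
move=> oA Ap AU Mp [sX hX] [sY hY].
have B1 := bracket1 oU sF rF Fw MF oA Ap AU Mp sX sY hX hY.
have B2 := bracket2 oU sF rF Fw MF oA Ap AU Mp sX sY hX hY.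
have E1 : vder ((lie X Y p).1, 0) rho p = \sum_j dz rho j p * (lie X Y p).1 j 0.
  by apply: eq_bigr => j _; rewrite [(_,_).1]/= [(_,_).2]/= [(0 : V) _ _]mxE mul0r addr0 mulrC.
have E2 : vder (0, (lie X Y p).2) rho p = \sum_j dzbar rho j p * (lie X Y p).2 j 0.
  by apply: eq_bigr => j _; rewrite [(_,_).1]/= [(_,_).2]/= [(0 : V) _ _]mxE mul0r add0r mulrC.
have [HP1 HP2] := HHbarP oU sF rF Fw MF (lie X Y p) (AU _ Ap) Mp.
split=> [/HP1 [h1 h2]|[h1 h2]].
  by split; [exact: (etrans (esym B1) (etrans (esym E1) h1))|exact: (etrans (esym B2) (etrans (esym E2) h2))].
by apply: HP2; split; [exact: (etrans E1 (etrans B1 h1))|exact: (etrans E2 (etrans B2 h2))].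
Qed.

Lemma jw (v : cvec R N) p : U p -> vder v (dz rho iw) p = 0 /\ vder v (dzbar rho iw) p = 0.
Proof. by move=> Up; exact: (jet_w oU (qg_H qg) (qg_S qg) v Up). Qed.
Lemma ja a (v : cvec R N) p : U p -> z0 p -> vder v (dz rho (ia a)) p = 0 /\ vder v (dzbar rho (ia a)) p = 0.
Proof. by move=> Up zp; exact: (jet_a oU (qg_H qg) (qg_S qg) a v Up zp). Qed.
Lemma jz i (v : cvec R N) p : U p -> z0 p ->
  vder v (dzbar rho (iz i)) p = \sum_l (v.1 (iz l) 0 * H (coord_zeta p) l i + S (coord_zeta p) i l * v.2 (iz l) 0).
Proof. by move=> Up zp; exact: (jet_z oU (qg_H qg) (qg_S qg) (qg_sym qg) i v Up zp). Qed.

Lemma jet_zc i p v : U p -> z0 p ->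
  vder v (dz rho (iz i)) p = \sum_l (v.2 (iz l) 0 * (H (coord_zeta p) l i)^* + (S (coord_zeta p) i l)^* * v.1 (iz l) 0).
Proof.
move=> Up zp; have Wr q (Uq : U q) := smooth_W oU Uq (smooth_grho iw oU sF).
have sb := smooth_dzbar (iz i) oU (smooth_grho iw oU sF).
have Wb := smooth_W oU Up sb.
transitivity (vder v (fun q => (dzbar rho (iz i) q)^*) p).
  apply: vder_near; last exact: (W_conj Wb).1.
  apply: filterS (open_near oU Up) => q Uq.
  rewrite dzbar_vder dz_vder -(vder_grho_conj iw oU sF rF) //; congr (vder _ _ _).
  by rewrite /cconj map_mx0 map_delta_mx ?rmorph1.
rewrite (vder_conj _ Wb) jz // rmorph_sum /=.
by apply: eq_bigr => l _; rewrite rmorphD !rmorphM /= !mxE !conjCK.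
Qed.

Lemma sum0 (G : 'I_N -> C) : (forall j, G j = 0) -> \sum_j G j = 0.
Proof. by move=> G0; apply: big1 => j _; exact: G0. Qed.

Lemma sum_index0 (G : 'I_N -> C) : G iw = 0 -> (forall a, G (ia a) = 0) -> \sum_j G j = \sum_i G (iz i).
Proof.
move=> Gw Ga; have Z : \sum_a G (ia a) = 0 by apply: big1 => a _; exact: Ga.
by rewrite big_index Gw Z addr0 add0r.
Qed.

Lemma pair1 (u : V) v p : U p -> z0 p -> (forall l, u (iz l) 0 = 0) ->
  \sum_j u j 0 * vder v (dz rho j) p = 0.
Proof.
move=> Up zp u0.
rewrite (sum_index0 (G := fun j => u j 0 * vder v (dz rho j) p)).
- by rewrite big1 // => l _; rewrite u0 mul0r.
- by rewrite (jw v Up).1 mulr0.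
- by move=> a; rewrite (ja a v Up zp).1 mulr0.
Qed.

Lemma pair2 (u : V) v p : U p -> z0 p ->
  \sum_j u j 0 * vder v (dzbar rho j) p =
  \sum_i u (iz i) 0 * \sum_l (v.1 (iz l) 0 * H (coord_zeta p) l i + S (coord_zeta p) i l * v.2 (iz l) 0).
Proof.
move=> Up zp.
rewrite (sum_index0 (G := fun j => u j 0 * vder v (dzbar rho j) p)).
- by apply: eq_bigr => i _; rewrite (jz i v Up zp).
- by rewrite (jw v Up).2 mulr0.
- by move=> a; rewrite (ja a v Up zp).2 mulr0.
Qed.

Lemma unit_row (A : 'M[C]_s) (x : 'I_s -> C) : A \in unitmx ->
  (forall i, \sum_l x l * A l i = 0) -> forall l, x l = 0.
Proof.
move=> uA xA l; have E : (\row_j x j) *m A = 0.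
  by apply/matrixP => i j; rewrite !mxE -[RHS](xA j); apply: eq_bigr => m _; rewrite mxE.
have := congr1 (mulmx^~ (invmx A)) E; rewrite mulmxK // mul0mx => /matrixP /(_ 0 l).
by rewrite !mxE.
Qed.

Lemma hb_w p (v : cvec R N) : U p -> M p -> z0 p -> Hbundle M p v -> v.1 iw 0 = 0 /\ v.2 = 0.
Proof.
move=> Up Mp zp /(HbundleP oU sF rF Fw MF _ Up Mp) [].
rewrite (vder_grho iw oU sF) // vder_qF0 // => /eqP; rewrite sub0r oppr_eq0 mulf_eq0 invr_eq0 pnatr_eq0 /=.
by move=> h v2; move: h; rewrite v2 mxE addr0 => /eqP.
Qed.

Lemma frame_at (a : V) p : U p -> z0 p -> frame iw F a p = (a, 0).
Proof.
move=> Up zp; rewrite /frame; congr pair.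
suff -> : \sum_j a j 0 * dz F j p = 0 by rewrite mulr0 scale0r addr0.
by rewrite big1 // => j _; rewrite dz_vder vder_qF0 ?mulr0.
Qed.

Lemma frame_ctr (a : V) q (v : cvec R N) : U q ->
  \sum_j (conj_field (frame iw F a) q).2 j 0 * vder v (dzbar rho j) q =
  \sum_j (a j 0)^* * vder v (dzbar rho j) q.
Proof.
move=> Uq; apply: eq_bigr => j _; rewrite !mxE rmorphD mulrDl -[RHS]addr0; congr (_ + _).
have [->|jw] := eqVneq j iw; first by rewrite (jw v Uq).2 mulr0.
by rewrite /= mulr0 conjC0 mul0r.
Qed.

(** Testing a field of the Levi kernel against the frame field of direction z_i; this holds at all points of [M], and can therefore be differentiated along [M] in [nondeg_free]. *)
Lemma kernel_frame q X : U q -> M q -> section_near M (Hbundle M) q X -> levi_kernel M q (X q) ->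
  forall i, vder (X q) (dzbar rho (iz i)) q = 0.
Proof.
move=> Uq Mq sX [hX HX] i.
have aw : (delta_mx (iz i) 0 : V) iw 0 = 0 by rewrite mxE eq_sym iz_iw.
have sY := frame_section oU sF rF Fw MF Uq Mq aw.
have /(levi_lie _ _ Uq Mq) := HX _ _ sX erefl sY.
have [A [oA Aq AU hXA _]] := sect_HH Uq sX.
have [B [oB Bq BU _ [hYB _]]] := sect_HH Uq sY.
have oAB := openI oA oB; have ABq : (A `&` B) q by [].
have [sA sB sABU] : [/\ A `&` B `<=` A, A `&` B `<=` B & A `&` B `<=` U] by split=> x [] // /AU.
move=> /(lie_crit oAB ABq sABU Mq (hh_sub sA hXA) (hh_sub sB hYB)) [_].
rewrite sumrB frame_ctr // big1 ?sub0r => [|j _]; last by rewrite hX.2 mxE mul0r.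
move=> /eqP; rewrite oppr_eq0 => /eqP; rewrite (bigD1 (iz i)) //= big1 ?addr0.
  by rewrite mxE !eqxx rmorph1 mul1r.
by move=> j ji; rewrite mxE (negbTE ji) rmorph0 mul0r.
Qed.

(** Along z = 0 the Levi form is H in the z-directions. *)
Lemma kernel_z0 p (v : cvec R N) : U p -> M p -> z0 p -> H (coord_zeta p) \in unitmx ->
  levi_kernel M p v -> forall l, v.1 (iz l) 0 = 0.
Proof.
move=> Up Mp zp uH kv; have [vw v2] := hb_w Up Mp zp kv.1.
have sX := frame_section oU sF rF Fw MF Up Mp vw.
have vE : frame iw F v.1 p = v by rewrite frame_at // [RHS]surjective_pairing v2.
apply: unit_row uH _ => i.
have := @kernel_frame p _ Up Mp sX; rewrite vE => /(_ kv i).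
rewrite jz // => E; rewrite -[RHS]E; apply: eq_bigr => l _.
by rewrite v2 mxE mulr0 addr0.
Qed.

Lemma kernel_dir p (v : cvec R N) : U p -> M p -> z0 p -> v.2 = 0 -> v.1 iw 0 = 0 ->
  (forall l, v.1 (iz l) 0 = 0) -> levi_kernel M p v.
Proof.
move=> Up Mp zp v2 vw vz; split.
  apply/(HbundleP oU sF rF Fw MF) => //; split=> //.
  by rewrite (vder_grho iw oU sF) // vder_qF0 // v2 vw mxE addr0 mulr0 subr0.
move=> X Y sX Xp sY; apply/(levi_lie _ _ Up Mp).
have [A [oA Ap AU hXA _]] := sect_HH Up sX.
have [B [oB Bp BU _ [hYB hB]]] := sect_HH Up sY.
have oAB := openI oA oB; have ABp : (A `&` B) p by [].
have [sA sB sABU] : [/\ A `&` B `<=` A, A `&` B `<=` B & A `&` B `<=` U] by split=> x [] // /AU.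
apply/(lie_crit oAB ABp sABU Mp (hh_sub sA hXA) (hh_sub sB hYB)).
have [_ Y2] := hB p Bp Mp.
have T1 j : (conj_field Y p).1 j 0 * vder v (dz rho j) p = 0 by rewrite /= Y2 map_mx0 mxE mul0r.
have T2 j : v.2 j 0 * vder (conj_field Y p) (dzbar rho j) p = 0 by rewrite v2 mxE mul0r.
split; rewrite sumrB Xp.
  by rewrite (pair1 (conj_field Y p) Up zp vz) sub0r (sum0 T1) oppr0.
rewrite (sum0 T2) sub0r (pair2 (conj_field Y p).2 v Up zp) big1 ?oppr0 // => i _.
by rewrite big1 ?mulr0 // => l _; rewrite vz v2 mxE mul0r mulr0 addr0.
Qed.

Lemma jet_S (i : 'I_s) (a : 'I_k) p (v : cvec R N) : U p -> z0 p -> v.1 = 0 ->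
  vder v (dz (dzbar rho (iz i)) (ia a)) p =
  \sum_l dz (fun x : V => S (coord_zeta x) i l) (ia a) p * v.2 (iz l) 0.
Proof.
move=> Up zp v1.
pose K1 l := dz (fun x : V => H (coord_zeta x) l i) (ia a).
pose K2 l := dz (fun x : V => S (coord_zeta x) i l) (ia a).
have WK1 l : W (K1 l) p := smooth_W oU Up (smooth_dz (ia a) oU (qg_H qg l i)).
have WK2 l : W (K2 l) p := smooth_W oU Up (smooth_dz (ia a) oU (qg_S qg i l)).
have WA l := (W_mul (W_zc l p) (WK1 l)).1.
have WB l := (W_mul (WK2 l) (W_zcc l p)).1.
have [W1 D1] := @W_sum _ _ _ (index_enum 'I_s) (fun l x => zc l x * K1 l x + K2 l x * (zc l x)^*) p
   (fun l => (W_add (WA l) (WB l)).1).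
transitivity (vder v (fun x => \sum_l (zc l x * K1 l x + K2 l x * (zc l x)^*)) p).
  apply: vder_near W1; apply: filterS (open_near oU Up) => q Uq.
  have E : vder (delta_mx (ia a) 0, 0) (dzbar rho (iz i)) q = vder (delta_mx (ia a) 0, 0) (hz H S i) q.
    apply: vder_near; last exact: (W_hz oU (qg_H qg) (qg_S qg) i v Uq).1.
    by apply: filterS (open_near oU Uq) => y Uy; rewrite (dzbar_z oU (qg_H qg) (qg_S qg) (qg_sym qg)).
  rewrite dz_vder E (W_hz oU (qg_H qg) (qg_S qg) i _ Uq).2; apply: eq_bigr => l _.
  by rewrite /K1 /K2 !dz_vder /= !mxE iz_ia mul0r mulr0 add0r addr0.
rewrite D1; apply: eq_bigr => l _.
rewrite (vderD _ (WA l) (WB l)) (vderM _ (W_zc l p) (WK1 l)) (vderM _ (WK2 l) (W_zcc l p)) vder_zc vder_zcc.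
by rewrite v1 mxE mul0r zp mul0r rmorph0 mulr0 !add0r.
Qed.

(** A linear relation between the zeta-derivatives of S gives a vector of the Levi kernel at [p] for which all iterated brackets lie in H + conj H.  For a section V of the kernel through it, differentiating the relations of [kernel_frame] along conj(X1) shows that the z-part of [V, conj X1] vanishes at [p]. *)
Lemma nondeg_free (c : 'I_k -> C) p : U p -> M p -> z0 p -> H (coord_zeta p) \in unitmx ->
  S (coord_zeta p) = 0 -> nondegenerate2_at M p ->
  (forall i m, \sum_a c a * dz (fun x : V => S (coord_zeta x) i m) (ia a) p = 0) ->
  forall a, c a = 0.
Proof.
move=> Up Mp zp uH S0 nd cS.
pose v1 : V := \sum_a c a *: delta_mx (ia a) 0.
have v1a a : v1 (ia a) 0 = c a.
  rewrite /v1 summxE (bigD1 a) //= big1 ?addr0 => [|b ba]; rewrite !mxE eq_ia ?eqxx ?mulr1 //.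
  by rewrite eq_sym (negbTE ba) mulr0.
have v1w : v1 iw 0 = 0 by rewrite /v1 summxE big1 // => b _; rewrite !mxE eq_sym ia_iw mulr0.
have v1z l : v1 (iz l) 0 = 0 by rewrite /v1 summxE big1 // => b _; rewrite !mxE eq_sym ia_iz mulr0.
pose v : cvec R N := (v1, 0).
have kv : levi_kernel M p v by apply: kernel_dir.
suff v0 : v = 0 by move=> a; rewrite -v1a; apply: (etrans (congr1 (fun u : cvec R N => u.1 (ia a) 0) v0)); rewrite mxE.
apply: nd => // VV X1 X2 sV Vp sX1 sX2.
have sVh : section_near M (Hbundle M) p VV.
  by case: sV => A [oA Ap sA hA]; exists A; split=> // q Aq Mq; have [] := hA q Aq Mq.
have [A1 [oA1 A1p A1U hV1 [_ hbV]]] := sect_HH Up sVh.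
have [A2 [oA2 A2p _ [sX1' _] [hX1 hbX1]]] := sect_HH Up sX1.
have [A3 [oA3 A3p _ _ [hX2 hbX2]]] := sect_HH Up sX2.
case: sV => A4 [oA4 A4p _ kV].
pose A := (A1 `&` A2) `&` (A3 `&` A4).
have oA : open A by apply: openI; apply: openI.
have Ap : A p by [].
have AU : A `<=` U by move=> x [[/A1U]].
have {}hV : hh_on A VV by apply: hh_sub hV1 => x [[]].
have {}hX1 : hh_on A (conj_field X1) by apply: hh_sub hX1 => x [[]].
have {}hX2 : hh_on A (conj_field X2) by apply: hh_sub hX2 => x [_ []].
have secV q : A q -> M q -> section_near M (Hbundle M) q VV.
  by move=> Aq Mq; exists A; split=> // [|y [[A1y _] _]]; [exact: hV.1|exact: hbV].
have secX q : A q -> M q -> section_near M (Hbundle M) q X1.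
  by move=> [[_ A2q] _] Mq; exists A2.
pose WW := lie VV (conj_field X1).
have hW : hh_on A WW.
  split; first by apply: smooth_lie; [exact: oA|exact: hV.1|exact: hX1.1].
  move=> q Aq Mq; apply/(levi_lie _ _ (AU q Aq) Mq).
  by apply: (kV q _ Mq).2 => //; [case: Aq => _ []|exact: secV|exact: secX].
have VV2 q : A q -> M q -> (VV q).2 = 0 by move=> Aq Mq; have [_] := hbV q Aq.1.1 Mq.
have X11 q : A q -> M q -> (conj_field X1 q).1 = 0.
  by move=> Aq Mq; have [_ e] := hbX1 q Aq.1.2 Mq; rewrite /= e map_mx0.
have tanV := (ctangentP oU sF rF Fw MF (VV p) Up Mp).1 (HHbar_ctangent (hV.2 p Ap Mp)).
have tanX := (ctangentP oU sF rF Fw MF (conj_field X1 p) Up Mp).1 (HHbar_ctangent (hX1.2 p Ap Mp)).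
pose X := conj_field X1 p.
have D2 j : vder X (fun q => (VV q).2 j 0) p = 0.
  apply: (kill oU sF rF Fw MF Up Mp _ _ tanX); first exact: smooth_W oA Ap (hV.1 j).2.
  by apply: filterS (open_near oA Ap) => q Aq Mq; rewrite VV2 // mxE.
have D1 j : vder (VV p) (fun q => (conj_field X1 q).1 j 0) p = 0.
  apply: (kill oU sF rF Fw MF Up Mp _ _ tanV); first exact: smooth_W oA Ap (hX1.1 j).1.
  by apply: filterS (open_near oA Ap) => q Aq Mq; rewrite X11 // mxE.
have DV : forall l, vder X (fun q => (VV q).1 (iz l) 0) p = 0.
  apply: (unit_row (x := fun l => vder X (fun q => (VV q).1 (iz l) 0) p) uH) => i /=.
  have sb := smooth_dzbar (iz i) oU (smooth_grho iw oU sF).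
  have Wd j : W (dz (dzbar rho (iz i)) j) p := smooth_W oU Up (smooth_dz j oU sb).
  have Wdb j : W (dzbar (dzbar rho (iz i)) j) p := smooth_W oU Up (smooth_dzbar j oU sb).
  have W1 j : W (fun q => (VV q).1 j 0) p := smooth_W oA Ap (hV.1 j).1.
  have W2 j : W (fun q => (VV q).2 j 0) p := smooth_W oA Ap (hV.1 j).2.
  have WA j := (W_mul (W1 j) (Wd j)).1.
  have WB j := (W_mul (W2 j) (Wdb j)).1.
  have [WS DS] := @W_sum _ _ _ (index_enum 'I_N) (fun j q => (VV q).1 j 0 * dz (dzbar rho (iz i)) j q
       + (VV q).2 j 0 * dzbar (dzbar rho (iz i)) j q) p (fun j => (W_add (WA j) (WB j)).1).
  have K : vder X (fun q => vder (VV q) (dzbar rho (iz i)) q) p = 0.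
    apply: (kill oU sF rF Fw MF Up Mp _ _ tanX); first exact: WS.
    apply: filterS (open_near oA Ap) => q Aq Mq.
    apply: kernel_frame => //; [exact: AU|exact: secV|apply: kV => //; by case: Aq => _ []].
  have dzw j : dz (dzbar rho (iz i)) j p = vder (delta_mx j 0, 0) (dzbar rho (iz i)) p by rewrite dz_vder.
  have E j : vder X (fun q => (VV q).1 j 0 * dz (dzbar rho (iz i)) j q + (VV q).2 j 0 * dzbar (dzbar rho (iz i)) j q) p
     = vder X (fun q => (VV q).1 j 0) p * dz (dzbar rho (iz i)) j p + v1 j 0 * vder X (dz (dzbar rho (iz i)) j) p.
    rewrite (vderD _ (WA j) (WB j)) (vderM _ (W1 j) (Wd j)) (vderM _ (W2 j) (Wdb j)) D2 Vp /=.
    by rewrite [(0 : V) _ _]mxE !mul0r !addr0.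
  move: K; rewrite DS (eq_bigr _ (fun j _ => E j)) big_split /= => K.
  have P2 : \sum_j v1 j 0 * vder X (dz (dzbar rho (iz i)) j) p = 0.
    rewrite big_index v1w mul0r add0r big1 ?add0r => [|l _]; last by rewrite v1z mul0r.
    transitivity (\sum_a \sum_l c a * dz (fun x : V => S (coord_zeta x) i l) (ia a) p * X.2 (iz l) 0).
      apply: eq_bigr => a _; rewrite v1a (jet_S i a Up zp (X11 p Ap Mp)) mulr_sumr.
      by apply: eq_bigr => l _; rewrite mulrA.
    rewrite exchange_big big1 //= => l _.
    by rewrite -mulr_suml cS mul0r.
  move: K; rewrite P2 addr0 big_index.
  have -> : dz (dzbar rho (iz i)) iw p = 0.
    by rewrite dzw jz // big1 // => l _; rewrite /= !mxE iz_iw mul0r mulr0 addr0.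
  rewrite mulr0 add0r; set Q2 := (X in _ + X); have -> : Q2 = 0; last rewrite addr0 => K.
    rewrite {}/Q2; apply: big1 => a _.
    rewrite dzw jz // big1 ?mulr0 // => l _.
    by rewrite /= !mxE iz_ia mul0r mulr0 addr0.
  rewrite -[RHS]K; apply: eq_bigr => l _; congr (_ * _).
  rewrite dzw jz // (bigD1 l) //= big1 ?addr0.
    by rewrite !mxE !eqxx mul1r mulr0 addr0.
  by move=> m /negbTE ml; rewrite !mxE eq_iz ml mul0r mulr0 addr0.
have Wz l : (WW p).1 (iz l) 0 = 0 by rewrite mxE D1 DV subrr.
apply/(lie_crit oA Ap AU Mp hW hX2).
have X21 : (conj_field X2 p).1 = 0.
  by have [_ e] := hbX2 p A3p Mp; rewrite /= e map_mx0.
have S00 i l : S (coord_zeta p) i l = 0 by rewrite S0 mxE.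
have X21z l : (conj_field X2 p).1 (iz l) 0 = 0 by rewrite X21 mxE.
have P1 := pair1 (conj_field X2 p) Up zp Wz.
have P2 := pair1 (WW p) Up zp X21z.
have P3 : \sum_j (WW p).2 j 0 * vder (conj_field X2 p) (dzbar rho j) p = 0.
  rewrite (pair2 (WW p).2 (conj_field X2 p) Up zp) big1 // => i _.
  by rewrite big1 ?mulr0 // => l _; rewrite S00 X21z !mul0r addr0.
have P4 : \sum_j (conj_field X2 p).2 j 0 * vder (WW p) (dzbar rho j) p = 0.
  rewrite (pair2 (conj_field X2 p).2 (WW p) Up zp) big1 // => i _.
  by rewrite big1 ?mulr0 // => l _; rewrite S00 Wz !mul0r addr0.
by split; rewrite sumrB; [rewrite P1 P2|rewrite P3 P4]; exact: subrr.
Qed.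

End QG.

(** * Second-order identities along curves *)

Section Curve.
Variables (R : realType) (N : nat).
Local Notation C := R[i].
Local Notation V := 'cV[R[i]]_N.
Variables (rho : V -> C) (A A0 : set V) (p v e : V) (c : C).
Hypotheses (oA : open A) (Ap : A p) (sr : smooth_on A rho).
Hypotheses (oA0 : open A0) (A0p : A0 p) (cr : c^* = c).
Hypothesis rho0 : forall t : R, A0 (p + (t%:C)%C *: v + ((t%:C)%C ^+ 2 * c) *: e) ->
  rho (p + (t%:C)%C *: v + ((t%:C)%C ^+ 2 * c) *: e) = 0.

Let tt (y : 'cV[C]_1) : C := 2^-1 * (y 0 0 + (y 0 0)^*).
Let u : cvec R 1 := (const_mx 1, const_mx 1).
Let Phi (y : 'cV[C]_1) : V := p + tt y *: v + (tt y ^+ 2 * c) *: e.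

Let tt_real y : tt y = ((complex.Re (y 0 0))%:C)%C.
Proof. by rewrite /tt -ReC2; apply/eqP; rewrite eq_complex /= ReE /=; case: (y 0 0) => a b /=; rewrite !(mul0r, oppr0, addr0, subr0, mulr0) /=; apply/andP; split; apply/eqP; field. Qed.

Let ttJ y : (tt y)^* = tt y.
Proof. by rewrite tt_real conjE /= oppr0. Qed.

Let tt0 : tt 0 = 0.
Proof. by rewrite /tt mxE conjC0 addr0 mulr0. Qed.

Let W_tt y : W tt y /\ vder u tt y = 1.
Proof.
have Wc := (W_coord (0 : 'I_1) y).1; have Wcc := (W_conj Wc).1.
have Wh := (W_cst (2^-1 : C) y).1.
split; first exact: (W_mul Wh (W_add Wc Wcc).1).1.
rewrite /tt (vderM _ Wh (W_add Wc Wcc).1) vder_cst mul0r add0r (vderD _ Wc Wcc) (vder_conj _ Wc) !vder_coord.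
by rewrite !mxE rmorph1; field.
Qed.

Let PhiE j : (fun y => Phi y j 0) = (fun y => p j 0 + (tt y * v j 0 + tt y * tt y * (c * e j 0))).
Proof. by apply/funext => y; rewrite /Phi !mxE; ring. Qed.

Let W_Phi y j : W (fun y => Phi y j 0) y /\
  vder u (fun y => Phi y j 0) y = v j 0 + 2 * tt y * c * e j 0.
Proof.
rewrite PhiE; have [Wt Dt] := W_tt y.
have W1 := (W_cst (p j 0) y).1; have W2 := (W_cst (v j 0) y).1; have W3 := (W_cst (c * e j 0) y).1.
have W4 := (W_mul Wt W2).1; have W5 := (W_mul Wt Wt).1; have W6 := (W_mul W5 W3).1.
split; first exact: (W_add W1 (W_add W4 W6).1).1.
rewrite (vderD _ W1 (W_add W4 W6).1) (vderD _ W4 W6) (vderM _ Wt W2) (vderM _ W5 W3) (vderM _ Wt Wt).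
by rewrite !vder_cst Dt; ring.
Qed.

Let Phi_vder f y : W f (Phi y) -> W (fun y => f (Phi y)) y /\
  vder u (fun y => f (Phi y)) y = vder (rv v) f (Phi y) + 2 * tt y * c * vder (rv e) f (Phi y).
Proof.
move=> Wf; have [W1 D] := W_comp Wf (fun j => (W_Phi y j).1); split=> //.
rewrite D [vder (rv v) f _]/vder [vder (rv e) f _]/vder mulr_sumr -big_split; apply: eq_bigr => j _.
have uc : cconj u = u by rewrite /cconj /u !map_const_mx rmorph1.
rewrite (vder_conj _ (W_Phi y j).1) uc (W_Phi y j).2 /= !mxE.
move: (ttJ y) (Phi y); move: (tt y) => t tJ P; rewrite rmorphD !rmorphM /= conjC_nat cr tJ.
by move: (dz f j _) (dzbar f j _) => a b; ring.
Qed.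

Let Phi0 : Phi 0 = p.
Proof. by rewrite /Phi tt0 expr2 mul0r mul0r !scale0r !addr0. Qed.

(** Differentiate rho twice along the curve t |-> p + t v + t^2 c e, on which it vanishes. *)
Lemma curve2 : vder (rv v) rho p = 0 /\
  vder (rv v) (fun q => vder (rv v) rho q) p + 2 * c * vder (rv e) rho p = 0.
Proof.
pose B := [set y : 'cV[C]_1 | [set: 'cV[C]_1] y /\ (A `&` A0) (Phi y)].
have oB : open B.
  by apply: (open_preim (phi := Phi) (U := [set: 'cV[C]_1]) (A := A `&` A0) openT (openI oA oA0)) => y _ j; exact: (W_Phi y j).1.
have B0 : B 0 by split=> //; rewrite Phi0.
have z0 y : B y -> rho (Phi y) = 0.
  by move=> [_ [_]]; rewrite /Phi !tt_real; apply: rho0.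
have z1 y : B y -> vder (rv v) rho (Phi y) + 2 * tt y * c * vder (rv e) rho (Phi y) = 0.
  move=> By; have Wr := smooth_W oA By.2.1 sr; rewrite -(Phi_vder Wr).2 -(vder_cst u 0 y).
  apply: vder_near; last exact: (W_cst 0 y).1.
  by apply: filterS (open_near oB By) => x /z0 ->.
split; first by have := z1 0 B0; rewrite tt0 Phi0 mulr0 !mul0r addr0.
have sf w : smooth_field A (fun=> rv w).
  by move=> j; split; apply: smooth_on_cst.
have W1 : W (fun q => vder (rv v) rho q) (Phi 0).
  by rewrite Phi0; apply: (smooth_W oA Ap); apply: smooth_vder => //; apply: sf.
have W2 : W (fun q => vder (rv e) rho q) (Phi 0).
  by rewrite Phi0; apply: (smooth_W oA Ap); apply: smooth_vder => //; apply: sf.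
have [WA DA] := Phi_vder W1; have [WB DB] := Phi_vder W2.
have [Wt Dt] := W_tt 0; have Wc := (W_cst (2 * c) (0 : 'cV[C]_1)).1.
have Wtc := (W_mul Wt Wc).1; have WBc := (W_mul Wtc WB).1.
have : vder u (fun y => vder (rv v) rho (Phi y) + tt y * (2 * c) * vder (rv e) rho (Phi y)) 0 = 0.
  rewrite -(vder_cst u 0 0); apply: vder_near; last exact: (W_cst 0 _).1.
  by apply: filterS (open_near oB B0) => x /z1 <-; congr (_ + _ * _); ring.
rewrite (vderD _ WA WBc) (vderM _ Wtc WB) (vderM _ Wt Wc) DA DB vder_cst Dt tt0 Phi0.
by rewrite !(mulr0, mul0r, addr0) mul1r.
Qed.

End Curve.

(** * Polarizing the quadratic defining function *)

Section Extract.
Variables (R : realType) (s k : nat).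
Local Notation C := R[i].
Local Notation N := (1 + (s + k))%N.
Local Notation V := 'cV[R[i]]_N.

Definition pr0 (x : V) : V := \sum_a x (ia a) 0 *: delta_mx (ia a) 0.
Definition embz (z : 'cV[C]_s) : V := \sum_l z l 0 *: delta_mx (iz l) 0.

Lemma pr0_ia x a : pr0 x (ia a) 0 = x (ia a) 0.
Proof.
rewrite /pr0 summxE (bigD1 a) //= big1 ?addr0 => [|b ba]; rewrite !mxE eq_ia ?eqxx ?mulr1 //.
by rewrite eq_sym (negbTE ba) mulr0.
Qed.
Lemma pr0_iz x l : pr0 x (iz l) 0 = 0.
Proof. by rewrite /pr0 summxE big1 // => b _; rewrite !mxE iz_ia mulr0. Qed.
Lemma pr0_iw x : pr0 x iw 0 = 0.
Proof. by rewrite /pr0 summxE big1 // => b _; rewrite !mxE eq_sym ia_iw mulr0. Qed.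
Lemma embz_iz z l : embz z (iz l) 0 = z l 0.
Proof.
rewrite /embz summxE (bigD1 l) //= big1 ?addr0 => [|b ba]; rewrite !mxE eq_iz ?eqxx ?mulr1 //.
by rewrite eq_sym (negbTE ba) mulr0.
Qed.
Lemma embz_ia z a : embz z (ia a) 0 = 0.
Proof. by rewrite /embz summxE big1 // => b _; rewrite !mxE ia_iz mulr0. Qed.
Lemma embz_iw z : embz z iw 0 = 0.
Proof. by rewrite /embz summxE big1 // => b _; rewrite !mxE eq_sym iz_iw mulr0. Qed.

Lemma zeta_eq (x y : V) : (forall a, x (ia a) 0 = y (ia a) 0) -> coord_zeta x = coord_zeta y.
Proof. by move=> h; apply/matrixP => i j; rewrite ord1 !coord_zetaE h. Qed.

Lemma nsz_pr0 x : nsz 0 (pr0 x) <= nsz 0 x.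
Proof.
apply: ler_sum => j _; rewrite !mxE !subr0; elim/index_ind: j => [|l|a].
- by rewrite pr0_iw cn0 cn_ge0.
- by rewrite pr0_iz cn0 cn_ge0.
- by rewrite pr0_ia.
Qed.

Lemma nsz_zeta (x : V) : nsz 0 (coord_zeta x) <= nsz 0 x.
Proof.
rewrite /nsz.
have E : \sum_j cn (x j 0 - (0 : V) j 0) = cn (x iw 0) + (\sum_l cn (x (iz l) 0) + \sum_a cn (x (ia a) 0)).
  under eq_bigr do rewrite mxE subr0.
  by rewrite big_split_ord big_ord1 big_split_ord.
rewrite E (eq_bigr (fun a => cn (x (ia a) 0))) => [|a _]; last first.
  by rewrite [(0 : 'cV[C]_k) _ _]mxE subr0 coord_zetaE.
by rewrite addrA ler_wpDl // addr_ge0 ?cn_ge0 ?sumr_ge0 // => l _; exact: cn_ge0.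
Qed.

Definition bf (K : 'M[C]_s) (x y : 'I_s -> C) : C := \sum_l \sum_m x l * K l m * y m.

Lemma bfDl K x x' y : bf K (fun l => x l + x' l) y = bf K x y + bf K x' y.
Proof.
rewrite /bf -big_split; apply: eq_bigr => l _; rewrite -big_split; apply: eq_bigr => m _ /=.
by rewrite !mulrDl.
Qed.
Lemma bfDr K x y y' : bf K x (fun l => y l + y' l) = bf K x y + bf K x y'.
Proof.
rewrite /bf -big_split; apply: eq_bigr => l _; rewrite -big_split; apply: eq_bigr => m _ /=.
by rewrite mulrDr.
Qed.
Lemma bf_delta K (a b : C) l m : bf K (fun i => a * (i == l)%:R) (fun j => b * (j == m)%:R) = a * b * K l m.
Proof.
rewrite /bf (bigD1 l) //= [X in _ + X]big1 ?addr0 => [|i /negbTE il]; last first.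
  by rewrite big1 // => j _; rewrite il mulr0 !mul0r.
rewrite (bigD1 m) //= big1 ?addr0 => [|j /negbTE ->]; last by rewrite !mulr0.
by rewrite !eqxx !mulr1 mulrAC.
Qed.

Variables (H S : 'cV[C]_k -> 'M[C]_s).

(** F as a function of zeta for fixed z. *)
Definition Qz (z : 'cV[C]_s) (x : V) : C := qF H S (pr0 x + embz z).

Lemma zc_pe x z l : zc l (pr0 x + embz z) = z l 0.
Proof. by rewrite /zc mxE pr0_iz embz_iz add0r. Qed.
Lemma zeta_pe x z : coord_zeta (pr0 x + embz z) = coord_zeta x.
Proof. by apply: zeta_eq => a; rewrite mxE pr0_ia embz_ia addr0. Qed.

Lemma QzE z x : Qz z x = bf (H (coord_zeta x)) (fun l => z l 0) (fun l => (z l 0)^*)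
  + 2^-1 * (bf (S (coord_zeta x)) (fun l => (z l 0)^*) (fun l => (z l 0)^*)
  + bf (conjCmx (S (coord_zeta x))) (fun l => z l 0) (fun l => z l 0)).
Proof.
rewrite /Qz /qF /quadf zeta_pe; congr (_ + _ * (_ + _)); apply: eq_bigr => l _; apply: eq_bigr => m _;
  by rewrite !zc_pe // mxE.
Qed.

Lemma Qz_scale z x (t : C) : t^* = t -> Qz (t *: z) x = t ^+ 2 * Qz z x.
Proof.
move=> tr; rewrite !QzE !mulrDr.
have E K (f g : 'I_s -> C) (f' g' : 'I_s -> C) : (forall l, f' l = t * f l) -> (forall l, g' l = t * g l) ->
   bf K f' g' = t ^+ 2 * bf K f g.
  move=> hf hg; rewrite /bf mulr_sumr; apply: eq_bigr => l _; rewrite mulr_sumr; apply: eq_bigr => m _.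
  by rewrite hf hg; ring.
rewrite !(E _ (fun l => z l 0) (fun l => (z l 0)^*) (fun l => (t *: z) l 0) (fun l => ((t *: z) l 0)^*));
 first last; try by move=> l; rewrite mxE ?rmorphM /= ?tr.
rewrite (E _ (fun l => (z l 0)^*) (fun l => (z l 0)^*) (fun l => ((t *: z) l 0)^*) (fun l => ((t *: z) l 0)^*));
 first last; try by move=> l; rewrite mxE ?rmorphM /= ?tr.
rewrite (E _ (fun l => z l 0) (fun l => z l 0) (fun l => (t *: z) l 0) (fun l => (t *: z) l 0));
 first last; try by move=> l; rewrite mxE.
by ring.
Qed.

Definition Bz z z' x := Qz (z + z') x - Qz z x - Qz z' x.

Lemma Bz_delta (a b : C) l m x : S (coord_zeta x) l m = S (coord_zeta x) m l ->
  Bz (a *: delta_mx l 0) (b *: delta_mx m 0) x =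
  a * b^* * H (coord_zeta x) l m + b * a^* * H (coord_zeta x) m l
  + a^* * b^* * S (coord_zeta x) l m + a * b * (S (coord_zeta x) l m)^*.
Proof.
move=> sym; rewrite /Bz !QzE.
have fe (f g f' g' : 'I_s -> C) K : f =1 f' -> g =1 g' -> bf K f g = bf K f' g'.
  by move=> h1 h2; apply: eq_bigr => i _; apply: eq_bigr => j _; rewrite h1 h2.
pose fa i : C := a * (i == l)%:R; pose fb i : C := b * (i == m)%:R.
pose ga i : C := a^* * (i == l)%:R; pose gb i : C := b^* * (i == m)%:R.
have ea i : (a *: delta_mx l 0 : 'cV[C]_s) i 0 = fa i by rewrite !mxE eqxx andbT.
have eb i : (b *: delta_mx m 0 : 'cV[C]_s) i 0 = fb i by rewrite !mxE eqxx andbT.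
have ja i : ((a *: delta_mx l 0 : 'cV[C]_s) i 0)^* = ga i by rewrite ea rmorphM /= conjC_nat.
have jb i : ((b *: delta_mx m 0 : 'cV[C]_s) i 0)^* = gb i by rewrite eb rmorphM /= conjC_nat.
have eab i : (a *: delta_mx l 0 + b *: delta_mx m 0 : 'cV[C]_s) i 0 = fa i + fb i by rewrite mxE ea eb.
have jab i : ((a *: delta_mx l 0 + b *: delta_mx m 0 : 'cV[C]_s) i 0)^* = ga i + gb i.
  by rewrite mxE rmorphD /= ja jb.
rewrite !(fe _ _ _ _ _ eab jab) !(fe _ _ _ _ _ jab jab) !(fe _ _ _ _ _ eab eab).
rewrite !(fe _ _ _ _ _ ea ja) !(fe _ _ _ _ _ ja ja) !(fe _ _ _ _ _ ea ea).
rewrite !(fe _ _ _ _ _ eb jb) !(fe _ _ _ _ _ jb jb) !(fe _ _ _ _ _ eb eb).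
rewrite !bfDl !bfDr.
have -> : bf (H (coord_zeta x)) fa gb = a * b^* * H (coord_zeta x) l m by exact: bf_delta.
have -> : bf (H (coord_zeta x)) fb ga = b * a^* * H (coord_zeta x) m l by exact: bf_delta.
have -> : bf (S (coord_zeta x)) ga gb = a^* * b^* * S (coord_zeta x) l m by exact: bf_delta.
have -> : bf (S (coord_zeta x)) gb ga = b^* * a^* * S (coord_zeta x) l m by rewrite sym; exact: bf_delta.
have cS : conjCmx (S (coord_zeta x)) l m = (S (coord_zeta x) l m)^* by rewrite mxE.
have cS' : conjCmx (S (coord_zeta x)) m l = (S (coord_zeta x) l m)^* by rewrite mxE -sym.
have -> : bf (conjCmx (S (coord_zeta x))) fa fb = a * b * (S (coord_zeta x) l m)^* by rewrite -cS; exact: bf_delta.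
have -> : bf (conjCmx (S (coord_zeta x))) fb fa = b * a * (S (coord_zeta x) l m)^* by rewrite -cS'; exact: bf_delta.
move: (bf _ fa ga) (bf _ fb gb) (bf _ ga ga) (bf _ gb gb) (bf _ fa fa) (bf _ fb fb) => x1 x2 x3 x4 x5 x6.
by field.
Qed.

(** Polarization: the sesquilinear part and the symmetric part of F are separated by multiplying the arguments by i. *)
Lemma HS_Bz l m x : S (coord_zeta x) l m = S (coord_zeta x) m l ->
  let B a b := Bz (a *: delta_mx l 0) (b *: delta_mx m 0) x in
  H (coord_zeta x) l m = 4^-1 * (B 1 1 + B 'i 'i) - 'i * 4^-1 * (B 'i 1 - B 1 'i) /\
  S (coord_zeta x) l m = 4^-1 * (B 1 1 - B 'i 'i) + 'i * 4^-1 * (B 1 'i + B 'i 1).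
Proof.
move=> sym; rewrite /= !Bz_delta // !rmorph1 !conjCi.
move: (H _ l m) (H _ m l) (S _ l m) (S _ l m)^* => h h' t t'.
have ii : 'i * 'i = -1 :> C by rewrite -expr2 sqrCi.
have e0 : 'i * 'i + 1 = 0 :> C by rewrite ii addNr.
move: e0; clear ii; move: ('i : C) => j e0.
split; [transitivity (h + (j * j + 1) * (4^-1 * (- 3 * h + h' + t + t'))) | transitivity (t + (j * j + 1) * (4^-1 * (h + h' - 3 * t + t')))].
- by rewrite e0 mul0r addr0.
- by field.
- by rewrite e0 mul0r addr0.
- by field.
Qed.

End Extract.
Arguments embz {R s k} z.

(** * Smoothness of H and S *)

Lemma W_neq0 (R : realType) (N : nat) (f : 'cV[R[i]]_N -> R[i]) p : W f p -> f p != 0 -> \forall q \near p, f q != 0.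
Proof.
move=> /W_cont /cont_nszP cf fp; have fp0 : 0 < cn (f p) by rewrite cn_gt0.
have [d d0 H] := cf _ fp0; apply/nbhs_nszP; exists d => // q /H h.
by apply/eqP => fq; move: h; rewrite fq sub0r cnN ltxx.
Qed.

Section Herm.
Variables (R : realType) (n : nat).
Implicit Types A : 'M[R[i]]_n.

Lemma hermP A : A \is hermsymmx <-> forall l m, A l m = (A m l)^*.
Proof.
split=> [/is_hermitianmxP E l m|h]; first by rewrite {1}E expr0 scale1r !mxE.
by apply/is_hermitianmxP/matrixP => l m; rewrite expr0 scale1r !mxE.
Qed.

Lemma symP A : A \is symmetricmx <-> forall l m, A l m = A m l.
Proof.
split=> [/is_hermitianmxP E l m|h]; first by rewrite {1}E expr0 scale1r !mxE.
by apply/is_hermitianmxP/matrixP => l m; rewrite expr0 scale1r !mxE /= h.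
Qed.

End Herm.

Section ExtractMain.
Variables (R : realType) (s k : nat).
Local Notation C := R[i].
Local Notation N := (1 + (s + k))%N.
Local Notation V := 'cV[R[i]]_N.
Variables (M : set V) (H S : 'cV[C]_k -> 'M[C]_s).

Lemma graphE (x : V) : model_graph H S x <-> 'Re (x iw 0) = qF H S x.
Proof. by rewrite /model_graph /= qFE coord_wE. Qed.

Lemma qF_z0 (x : V) : (forall l, zc l x = 0) -> qF H S x = 0.
Proof.
move=> z0; rewrite /qF /quadf !big1 => [|l _|l _|l _]; first by rewrite !(addr0, mulr0).
all: by rewrite big1 // => m _; rewrite !z0 ?conjC0 !mul0r.
Qed.

Lemma rv_vder0 (f : V -> C) p : W f p -> (forall v : V, vder (rv v) f p = 0) -> forall u : cvec R N, vder u f p = 0.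
Proof.
move=> Wf h u; rewrite /vder big1 // => j _.
by rewrite /dz /dzbar !(W_rderive _ Wf).2 !h mulr0 subrr addr0 !mulr0 addr0.
Qed.

Lemma rv_real_scale (t : C) (v : V) : t^* = t -> rv (t *: v) = t *: rv v.
Proof. by move=> tr; rewrite /rv; congr pair; rewrite map_mxZ /= tr. Qed.
Lemma rvD (v w : V) : rv (v + w) = rv v + rv w.
Proof. by rewrite /rv; congr pair; rewrite map_mxD. Qed.

Lemma dec_V (v : V) : v = (v iw 0) *: delta_mx iw 0 + embz (coord_z v) + pr0 v.
Proof.
apply/matrixP => i j; rewrite ord1 => {j}; rewrite !mxE; elim/index_ind: i => [|l|a].
- by rewrite embz_iw pr0_iw !eqxx !(addr0, add0r, mulr0, mulr1).
- by rewrite embz_iz pr0_iz coord_zE iz_iw !(addr0, add0r, mulr0, mulr1).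
- by rewrite embz_ia pr0_ia ia_iw !(addr0, add0r, mulr0, mulr1).
Qed.

Variables (U0 A : set V) (rho : V -> C).
Hypotheses (oU0 : open U0) (U00 : U0 0) (MU : M `&` U0 = model_graph H S `&` U0).
Hypotheses (oA : open A) (A0 : A 0) (sr : smooth_on A rho).
Hypothesis MA : forall x, A x -> (M x <-> rho x = 0).

Let inM x : (A `&` U0) x -> model_graph H S x -> rho x = 0.
Proof.
move=> [Ax U0x] gx; apply/MA => //.
by have : (model_graph H S `&` U0) x by []; rewrite -MU => -[].
Qed.

Lemma curve_z x z : (A `&` U0) (pr0 x) -> (Qz H S z x)^* = Qz H S z x ->
  vder (rv (embz z)) rho (pr0 x) = 0 /\
  vder (rv (embz z)) (fun q => vder (rv (embz z)) rho q) (pr0 x)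
   + 2 * Qz H S z x * vder (rv (delta_mx iw 0)) rho (pr0 x) = 0.
Proof.
move=> Ax rQ; have [Axx _] := Ax.
apply: (curve2 oA Axx sr (openI oA oU0) Ax rQ) => t At; apply: inM => //; apply/graphE.
have tr : ((t%:C)%C)^* = (t%:C)%C by rewrite conjE /= oppr0.
have -> : pr0 x + (t%:C)%C *: embz z = pr0 x + embz ((t%:C)%C *: z) :> V.
  congr (_ + _); rewrite /embz scaler_sumr; apply: eq_bigr => l _.
  by rewrite scalerA mxE.
rewrite qF_w -/(Qz H S _ x) Qz_scale //.
rewrite !mxE pr0_iw embz_iw !eqxx !add0r mulr1.
by apply/Creal_ReP; rewrite CrealE rmorphM rmorphXn /= tr rQ.
Qed.

Hypothesis Hh0 : forall l m, H 0 l m = (H 0 m l)^*.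
Hypothesis rv0 : exists v : cvec R N, vder v rho 0 != 0.

Let zeta0 : coord_zeta (0 : V) = 0.
Proof. by apply/matrixP => i j; rewrite ord1 coord_zetaE !mxE. Qed.

Let pr00 : pr0 (0 : V) = 0.
Proof. by rewrite /pr0 big1 // => a _; rewrite mxE scale0r. Qed.

Lemma Qz_real z x : (forall l m, H (coord_zeta x) l m = (H (coord_zeta x) m l)^*) ->
  (Qz H S z x)^* = Qz H S z x.
Proof.
move=> hh; apply: (@qF_real R s k [set pr0 x + embz z] H S) => // y ->.
by move=> l m; rewrite zeta_pe hh.
Qed.

(** All other real directions at 0 are tangent to curves in [M], so rho could not have a nonzero differential otherwise. *)
Lemma Dw_neq0 : vder (rv (delta_mx iw 0)) rho 0 != 0.
Proof.
apply/negP => /eqP g0; case: rv0 => v /eqP; apply.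
have AU0 : (A `&` U0) 0 by [].
have Wr := smooth_W oA A0 sr.
apply: (rv_vder0 Wr) => {v} v.
have hz z : vder (rv (embz z)) rho 0 = 0.
  rewrite -pr00; apply: (curve_z (x := 0) _ _).1; first by rewrite pr00.
  by apply: Qz_real => l m; rewrite zeta0.
have ha y : vder (rv (pr0 y)) rho 0 = 0.
  apply: (curve2 (e := 0) (c := 0) oA A0 sr (openI oA oU0) AU0 (conjC0 _) _).1 => t At.
  apply: inM => //; apply/graphE; rewrite qF_z0 => [|l]; last by rewrite /zc !mxE pr0_iz !mulr0 !addr0.
  by rewrite !mxE pr0_iw !mulr0 !addr0 raddf0.
have hi : vder (rv ('i *: delta_mx iw 0)) rho 0 = 0.
  apply: (curve2 (e := 0) (c := 0) oA A0 sr (openI oA oU0) AU0 (conjC0 _) _).1 => t At.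
  apply: inM => //; apply/graphE; rewrite qF_z0 => [|l]; last by rewrite /zc !mxE iz_iw !mulr0 !addr0.
  rewrite !mxE !eqxx !mulr0 !addr0 add0r mulr1; have tr : ((t%:C)%C)^* = (t%:C)%C by rewrite conjE /= oppr0.
  by rewrite ReC2 rmorphM /= tr conjCi mulrN subrr mulr0.
rewrite (dec_V v) !rvD !vderDv hz ha !addr0.
have -> : v iw 0 *: delta_mx iw 0 = 'Re (v iw 0) *: delta_mx iw 0 + 'Im (v iw 0) *: ('i *: delta_mx iw 0) :> V.
  by rewrite scalerA -scalerDl {1}(Crect (v iw 0)) [_ * 'i]mulrC.
rewrite rvD (rv_real_scale _ (conj_Creal (Creal_Re _))) (rv_real_scale _ (conj_Creal (Creal_Im _))).
by rewrite vderDv !vderZv g0 hi !mulr0 addr0.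
Qed.

(** By [curve_z], F(z, zeta) is a quotient of smooth functions of zeta for each z; its values at finitely many z determine H and S. *)
Lemma extract_ball r : oball (0 : V) r `<=` A `&` U0 -> 0 < r ->
  (forall x, oball (0 : V) r x -> vder (rv (delta_mx iw 0)) rho x != 0) ->
  (forall x : V, oball (0 : V) r x -> H (coord_zeta x) \is hermsymmx /\ S (coord_zeta x) \is symmetricmx) ->
  qgraph (oball (0 : V) r) M H S.
Proof.
move=> sAU r0; have : open (oball (0 : V) r) by exact: open_oball.
move: sAU; move EB : (oball (0 : V) r) => B sAU oB Dw HSr.
have hh x : B x -> forall l m, H (coord_zeta x) l m = (H (coord_zeta x) m l)^*.
  by move=> Bx; exact: (hermP _).1 (HSr x Bx).1.
have ss x : B x -> forall l m, S (coord_zeta x) l m = S (coord_zeta x) m l.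
  by move=> Bx; exact: (symP _).1 (HSr x Bx).2.
have Bpr x : B x -> B (pr0 x) by rewrite -EB => Bx; apply: le_lt_trans (nsz_pr0 x) Bx.
have sf w : smooth_field A (fun=> rv w : cvec R N) by move=> j; split; apply: smooth_on_cst.
pose g := vder (rv (delta_mx iw 0 : V)) rho.
have sg : smooth_on A g by apply: smooth_vder.
have sgB : smooth_on B g by apply: (smooth_on_sub _ sg) => x /sAU [].
have sQ z : smooth_on B (Qz H S z).
  pose f := fun q => vder (rv (embz z)) (fun q => vder (rv (embz z)) rho q) q.
  have sff : smooth_on A f by apply: smooth_vder => //; apply: smooth_vder.
  (* the second-order identity solved for F(z, zeta) *)
  pose h q := - 2^-1 * (f q * (g q)^-1).
  have sh : smooth_on B h.
    apply: (smooth_on_mul oB (smooth_on_cst _ oB) _).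
    have sfB : smooth_on B f by apply: (smooth_on_sub _ sff) => x /sAU [].
    apply: (smooth_on_mul oB sfB _).
    by move=> n; exact: (Ck_inv oB Dw (sgB n)).
  have hQ x : B x -> h (pr0 x) = Qz H S z x.
    move=> Bx; have [_ E] := curve_z (sAU _ (Bpr x Bx)) (Qz_real z (hh x Bx)).
    have g0 := Dw _ (Bpr x Bx).
    rewrite /h /f /g; move: E g0; move: (vder _ _ _) (vder _ _ _) (Qz _ _ _ _) => a b c /eqP.
    by rewrite addr_eq0 => /eqP -> b0; field.
  have sp n j : Ck n B (fun x => pr0 x j 0).
    apply: (Ck_eq (f := fun x => \sum_a x (ia a) 0 * (delta_mx (ia a) 0 : V) j 0) oB) => [x _|].
      by rewrite /pr0 summxE; apply: eq_bigr => a _; rewrite [RHS]mxE.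
    by apply: Ck_sum => // a _; apply: Ck_mul => //; [exact: Ck_coord|exact: Ck_cst].
  have shp : smooth_on B (fun x => h (pr0 x)).
    by move=> n; have K := Ck_comp (k := n) (f := h) (phi := @pr0 R s k) oB oB Bpr (sp n) (sh n); exact: K.
  exact: (smooth_on_eq oB hQ shp).
have sB z z' : smooth_on B (Bz H S z z').
  by apply: smooth_on_add => //; [apply: smooth_on_add => //|]; apply: smooth_on_opp.
have s2 (f f' h h' : V -> C) c : smooth_on B f -> smooth_on B f' -> smooth_on B h -> smooth_on B h' ->
    smooth_on B (fun x => 4^-1 * (f x + f' x) + c * (h x + h' x)).
  by move=> *; apply: smooth_on_add => //; apply: smooth_on_mul => //; (exact: smooth_on_cst || apply: smooth_on_add).
split=> //.
- move=> l m;  apply: (smooth_on_eq (f := fun x => 4^-1 * (Bz H S (1 *: delta_mx l 0) (1 *: delta_mx m 0) x + Bz H S ('i *: delta_mx l 0) ('i *: delta_mx m 0) x)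
     + - ('i * 4^-1) * (Bz H S ('i *: delta_mx l 0) (1 *: delta_mx m 0) x + - Bz H S (1 *: delta_mx l 0) ('i *: delta_mx m 0) x)) oB) => [x Bx|].
    by rewrite (HS_Bz H (ss x Bx l m)).1 mulNr.
  by apply: s2 => //; apply: smooth_on_opp.
- move=> l m;  apply: (smooth_on_eq (f := fun x => 4^-1 * (Bz H S (1 *: delta_mx l 0) (1 *: delta_mx m 0) x + - Bz H S ('i *: delta_mx l 0) ('i *: delta_mx m 0) x)
     + 'i * 4^-1 * (Bz H S (1 *: delta_mx l 0) ('i *: delta_mx m 0) x + Bz H S ('i *: delta_mx l 0) (1 *: delta_mx m 0) x)) oB) => [x Bx|].
    by rewrite (HS_Bz H (ss x Bx l m)).2.
  by apply: s2 => //; apply: smooth_on_opp.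
- move=> x Bx; have [_ U0x] := sAU x Bx; split=> h.
    by have : (M `&` U0) x by []; rewrite MU => -[].
  by have : (model_graph H S `&` U0) x by []; rewrite -MU => -[].
Qed.

End ExtractMain.

Section ExtractAll.
Variables (R : realType) (s k : nat).
Local Notation C := R[i].
Local Notation N := (1 + (s + k))%N.
Local Notation V := 'cV[R[i]]_N.

Lemma extract (M : set V) H S : smooth_hypersurface M -> given_near0 M H S ->
  M 0 /\ exists U, [/\ qgraph U M H S, U 0, H 0 \in unitmx & exists2 r, 0 < r & U = oball 0 r].
Proof.
move=> hs [[md uH] [U0 [oU0 U00 MU]]].
have M0 : M 0.
  have : (model_graph H S `&` U0) 0.
    split=> //; apply/graphE; rewrite qF_z0 => [|l]; rewrite ?/zc mxE //; exact: raddf0.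
  by rewrite -MU => -[].
split=> //; have [rho [A [oA A0 sr rr [MA rv0]]]] := hs 0 M0.
have z0 : coord_zeta (0 : V) = 0 by apply/matrixP => i j; rewrite ord1 coord_zetaE !mxE.
have [/hermP Hh0 _] := nbhs_singleton md.
have Dw := Dw_neq0 oU0 U00 MU oA A0 sr MA Hh0 rv0.
have sg : smooth_on A (vder (rv (delta_mx iw 0 : V)) rho).
  by apply: smooth_vder => // j; split; apply: smooth_on_cst.
have n1 := W_neq0 (smooth_W oA A0 sg) Dw.
have [d1 d10 h1] := (nbhs_nszP 0 _).1 n1.
have [d2 d20 h2] := (nbhs_nszP 0 _).1 md.
have [d3 d30 h3] := (nbhs_nszP 0 _).1 (open_near oA A0).
have [d4 d40 h4] := (nbhs_nszP 0 _).1 (open_near oU0 U00).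
pose r := Num.min (Num.min d1 d2) (Num.min d3 d4).
have r0 : 0 < r by rewrite !lt_min d10 d20 d30 d40.
have lr x : oball (0 : V) r x -> [/\ nsz 0 x < d1, nsz 0 x < d2, nsz 0 x < d3 & nsz 0 x < d4].
  by rewrite /oball /= !lt_min => /andP[/andP[? ?] /andP[? ?]].
exists (oball 0 r); split=> //; last by exists r.
- apply: (extract_ball oU0 MU oA sr MA _ r0).
  + by move=> x /lr [_ _ /h3 ? /h4 ?].
  + by move=> x /lr [/h1].
  + by move=> x /lr [_ l2 _ _]; apply: h2; apply: le_lt_trans (nsz_zeta x) l2.
- by rewrite /oball /= /nsz big1 // => j _; rewrite subrr cn0.
Qed.

End ExtractAll.

(** * Complex differentiability and holomorphy *)

Lemma diff_intro (K : numFieldType) (V W : normedModType K) (f : V -> W) (L : {linear V -> W}) x :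
  continuous L ->
  (forall e : K, 0 < e -> \forall h \near (0 : V), `|f (h + x) - (f x + L h)| <= e * `|h|) ->
  differentiable f x /\ 'd f x = L :> (V -> W).
Proof.
move=> cL H; have E : f \o shift x = cst (f x) + L +o_ 0 id by apply/eqaddoP => e /H.
have dE := diff_unique cL E; split=> //.
by apply/diff_locallyP; rewrite dE.
Qed.

Section Differential.
Variables (R : realType) (N : nat).
Local Notation C := R[i].
Local Notation V := 'cV[R[i]]_N.
Implicit Types (f : V -> C) (x v : V).

Lemma normC_cn (z : C) : `|z| = ((cn z)%:C)%C.
Proof. by []. Qed.

Lemma leC_real (a b : R) : ((a%:C)%C <= (b%:C)%C) = (a <= b).
Proof. by rewrite lecR. Qed.

(** The norm of a column is the maximum modulus of its entries. *)
Lemma mxnorm_lt (h : V) (e : R) : 0 < e -> `|h| < (e%:C)%C <-> forall j, cn (h j 0) < e.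
Proof.
move=> e0; have E : `|h| < (e%:C)%C <-> ball (0 : V) (e%:C)%C h.
  by rewrite -ball_normE /ball_ /= sub0r normrN.
rewrite E; split=> [[_ H] j|H].
  by have := H j 0; rewrite -ball_normE /ball_ /= mxE sub0r normrN ltcn.
split; first by rewrite ltcR.
by move=> i j; rewrite ord1 -ball_normE /ball_ /= mxE sub0r normrN ltcn.
Qed.

Lemma mxnorm_real (h : V) : exists2 m : R, 0 <= m & `|h| = (m%:C)%C.
Proof.
have h0 : 0 <= `|h| by exact: normr_ge0.
have E : `|h| = ((complex.Re `|h|)%:C)%C by rewrite RRe_real // realE h0.
by exists (complex.Re `|h|) => //; rewrite -leC_real -E.
Qed.

Lemma mxnorm_nsz (h : V) : `|h| <= ((nsz 0 h)%:C)%C.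
Proof.
have [m m0 E] := mxnorm_real h; rewrite E leC_real leNgt; apply/negP => lt.
have mp : 0 < m by apply: le_lt_trans lt; exact: nsz_ge0.
have := (mxnorm_lt h mp).2; rewrite E ltxx => /(_ _) H; suff : false by [].
apply: H => j; apply: le_lt_trans lt.
by have := nsz_coord 0 h j; rewrite mxE subr0.
Qed.

(** The complex differential is complex linear, so it is an expansion without conjugate terms. *)
Lemma diff_hol f x : differentiable f x -> hol f x.
Proof.
move=> df; pose a j : C := 'd f x (delta_mx j 0).
have dE (v : V) : 'd f x v = \sum_j a j * v j 0.
  have -> : v = \sum_j v j 0 *: delta_mx j 0.
    by rewrite {1}[v]matrix_sum_delta; apply: eq_bigr => j _; rewrite big_ord1.
  rewrite linear_sum; apply: eq_bigr => j _; rewrite linearZ /= mulrC; congr (_ * _).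
  rewrite summxE (bigD1 j) //= big1 ?addr0 => [|l lj]; rewrite !mxE eqxx ?eqxx ?mulr1 //.
  by rewrite eq_sym (negbTE lj) mulr0.
suff [] : hol f x /\ forall j, dz f j x = a j by [].
apply: hol_intro; split.
  exists (\sum_j cn (a j)); first by apply: sumr_ge0 => j _; exact: cn_ge0.
  move=> y; rewrite mulr_suml; apply: le_trans (cn_sum _ _ _) _; apply: ler_sum => j _.
  by rewrite cnM ler_wpM2l ?cn_ge0 // !mxE nsz_coord.
move=> e e0.
have [_ /eqaddoP H] := (diff_locallyP x f).1 df.
have e0' : 0 < (e%:C)%C by rewrite ltcR.
have := H _ e0' => /nbhs_nszP[d d0 Hd]; exists d => // y xy.
have xy' : nsz 0 (y - x) < d by rewrite nsz_sub.
have : `|f (y - x + x) - (f x + 'd f x (y - x))| <= (e%:C)%C * `|y - x| := Hd (y - x) xy'.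
rewrite subrK normC_cn => h.
rewrite -dE -leC_real -(addrA (f y)) -opprD; apply: le_trans h _.
by rewrite rmorphM ler_wpM2l ?(ltW e0') // -(nsz_sub x y) mxnorm_nsz.
Qed.

Lemma mxnorm_coord (h : V) j : ((cn (h j 0))%:C)%C <= `|h|.
Proof.
have [m m0 E] := mxnorm_real h; rewrite E leC_real leNgt; apply/negP => lt.
have mp : 0 < cn (h j 0) by apply: le_lt_trans lt.
have [+ _] := mxnorm_lt h mp; rewrite E ltcR => /(_ lt) /(_ j).
by rewrite ltxx.
Qed.

Lemma nsz_mxnorm (h : V) : ((nsz 0 h)%:C)%C <= N%:R * `|h|.
Proof.
rewrite /nsz rmorph_sum /=; apply: le_trans (_ : \sum_(j < N) `|h| <= _); last first.
  by rewrite sumr_const card_ord mulr_natl.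
by apply: ler_sum => j _; rewrite mxE subr0 mxnorm_coord.
Qed.

Lemma hol_diff f x : hol f x -> differentiable f x /\ forall v, 'd f x v = Dv f v x.
Proof.
move=> hf.
have Llin : linear (fun v : V => Dv f v x : C) by move=> c u v; rewrite DvD DvZ.
pose LM := GRing.isLinear.Build _ _ _ _ (fun v : V => Dv f v x : C) Llin.
pose L : {linear V -> C} := HB.pack (fun v : V => Dv f v x : C) LM.
have LE : (L : V -> C) = (fun v => Dv f v x) by [].
have cL : continuous L.
  move=> y; rewrite LE; apply: W_cont.
  have [W1 _] := @W_sum _ _ _ (index_enum 'I_N) (fun j v => v j 0 * dz f j x) y (fun j => (W_mul (W_coord j y).1 (W_cst _ y).1).1).
  exact: W1.
have H (e : C) : 0 < e -> \forall h \near (0 : V), `|f (h + x) - (f x + L h)| <= e * `|h|.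
  move=> e0; have [d d0 ed] := posC_ex e0.
  have [_ Hf] := hol_fr hf; pose e1 := d / (N.+1)%:R.
  have e10 : 0 < e1 by rewrite divr_gt0.
  have [r r0 Hr] := Hf e1 e10; apply/nbhs_nszP; exists r => // h hr.
  have := Hr (x + h); rewrite nsz0 => /(_ hr) K.
  rewrite LE normC_cn [h + x]addrC opprD addrA -{2}[h](addKr x) [- x + _]addrC.
  apply: (@le_trans _ _ (((e1 * nsz 0 h)%:C)%C)); first by rewrite leC_real.
  rewrite rmorphM /=; apply: (@le_trans _ _ ((e1%:C)%C * (N%:R * `|h|))).
    by rewrite ler_wpM2l ?nsz_mxnorm // (leC_real 0) ltW.
  rewrite mulrA ler_wpM2r ?normr_ge0 // ed /e1.
  have -> : N%:R = ((N%:R)%:C)%C :> C by rewrite rmorph_nat.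
  rewrite -rmorphM leC_real -mulrA ler_piMr ?(ltW d0) // mulrC ler_pdivrMr ?ltr0n // mul1r ler_nat.
  exact: leqnSn.
have [dd dE] := diff_intro cL H.
by split=> // v; rewrite dE.
Qed.

Lemma diffmx_hol m (F : V -> 'cV[C]_m) x j : differentiable F x -> hol (fun y => F y j 0) x.
Proof.
move=> dF; apply: diff_hol.
exact: (differentiable_comp dF (differentiable_coord (F x) j 0)).
Qed.

Lemma holmx_diff m n (F : V -> 'M[C]_(m, n)) x : (forall i j, hol (fun y => F y i j) x) ->
  differentiable F x /\ forall v i j, 'D_v F x i j = Dv (fun y => F y i j) v x.
Proof.
move=> hF.
have dF : differentiable F x.
  have -> : F = \sum_i \sum_j (fun y => F y i j *: delta_mx i j).
    apply/funext => y; rewrite {1}[F y]matrix_sum_delta !fct_sumE; apply: eq_bigr => i _.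
    by rewrite fct_sumE.
  apply: differentiable_sum => i; apply: differentiable_sum => j.
  by apply: differentiableZl; exact: (hol_diff (hF i j)).1.
split=> // v i j; rewrite deriveE // -(hol_diff (hF i j)).2.
pose g (A : 'M[C]_(m, n)) : C := A i j.
have glin : linear g by move=> c A B; rewrite /g !mxE.
pose LM := GRing.isLinear.Build _ _ _ _ g glin.
pose L : {linear 'M[C]_(m, n) -> C} := HB.pack g LM.
have cL : continuous L by exact: coord_continuous.
have dg := linear_differentiable (F x) cL.
have -> : (fun y => F y i j) = L \o F by [].
by rewrite (diff_comp dF dg) /= (diff_lin _ cL).
Qed.

End Differential.

(** * Jets of symmetries along z = 0 *)

Section Symmetry.
Variables (R : realType) (s k : nat).
Local Notation C := R[i].
Local Notation N := (1 + (s + k))%N.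
Local Notation V := 'cV[R[i]]_N.

Definition emba (u : 'cV[C]_k) : V := \sum_a u a 0 *: delta_mx (ia a) 0.

Lemma emba_ia u a : emba u (ia a) 0 = u a 0.
Proof.
rewrite /emba summxE (bigD1 a) //= big1 ?addr0 => [|b ba]; rewrite !mxE eq_ia ?eqxx ?mulr1 //.
by rewrite eq_sym (negbTE ba) mulr0.
Qed.
Lemma emba_iz u l : emba u (iz l) 0 = 0.
Proof. by rewrite /emba summxE big1 // => b _; rewrite !mxE iz_ia mulr0. Qed.
Lemma emba_iw u : emba u iw 0 = 0.
Proof. by rewrite /emba summxE big1 // => b _; rewrite !mxE eq_sym ia_iw mulr0. Qed.
Lemma emba_zeta u : coord_zeta (emba u) = u.
Proof. by apply/matrixP => i j; rewrite ord1 coord_zetaE emba_ia. Qed.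
Lemma emba0 : emba 0 = 0.
Proof. by rewrite /emba big1 // => a _; rewrite mxE scale0r. Qed.

Lemma nsz_emba u : nsz 0 (emba u) = nsz 0 u.
Proof.
rewrite /nsz (eq_bigr (fun j => cn (emba u j 0))) => [|j _]; last by rewrite [(0 : V) _ _]mxE subr0.
rewrite big_split_ord big_ord1 big_split_ord /= -/iw emba_iw cn0 add0r.
rewrite big1 => [|l _]; last by rewrite -/(iz l) emba_iz cn0.
by rewrite add0r; apply: eq_bigr => a _; rewrite -/(ia a) emba_ia mxE subr0.
Qed.

Lemma hol_emba j u : hol (fun u => emba u j 0) u.
Proof.
apply: (hol_near (f := fun u => \sum_a u a 0 * (delta_mx (ia a) 0 : V) j 0)).
  by apply/nbhs_nszP; exists 1 => // y _; rewrite /emba summxE; apply: eq_bigr => a _; rewrite [RHS]mxE.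
by apply: hol_sum => a _; apply: hol_mul; [exact: hol_coord|exact: hol_cst].
Qed.

Variables (U M : set V) (H S : 'cV[C]_k -> 'M[C]_s).
Hypothesis qg : qgraph U M H S.
Let oU := qg_open qg.
Local Notation F := (qF H S : V -> C).
Let sF := smooth_qF oU (qg_H qg) (qg_S qg) : smooth_on U F.
Let rF := qF_real S (qg_herm qg) : forall x, U x -> (F x)^* = F x.
Let Fw := @qF_w R s k H S.
Let MF := MFq (qg_M qg) : forall x, U x -> (M x <-> 'Re (x iw 0) = F x).
Local Notation rho := (grho iw F).

(** Twice the derivative of rho along the real part of the field [f]; it vanishes on [M] when that field is tangent. *)
Definition tng (f : V -> V) q := \sum_j (f q j 0 * dz rho j q + (f q j 0)^* * dzbar rho j q).

Definition sym_on B (f : V -> V) := (forall j, holU B (fun q => f q j 0)) /\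
  forall q, B q -> M q -> tng f q = 0.

Lemma M_emba u : U (emba u) -> M (emba u).
Proof.
by move=> Uu; apply/(MF Uu); rewrite emba_iw qF_z0 ?raddf0 // => l; rewrite /zc emba_iz.
Qed.

Lemma tng_real (f : V -> V) q : U q -> M q -> rtangent M q (re_part (f q)) -> tng f q = 0.
Proof.
move=> Uq Mq [ct _]; have := (ctangentP oU sF rF Fw MF _ Uq Mq).1 ct.
rewrite /re_part vderZv => /eqP; rewrite mulf_eq0 invr_eq0 pnatr_eq0 /= => /eqP <-.
apply: eq_bigr => j _ /=; rewrite !mxE rmorph0 addr0 add0r //.
Qed.

(** The tangency relation holds along [M]; differentiate it along e_(z_i), which is tangent to [M] where z = 0.  Conjugates of holomorphic functions do not contribute. *)
Lemma sym_jet B f u i : open B -> sym_on B f -> U (emba u) -> B (emba u) ->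
  2^-1 * dz (fun q => f q iw 0) (iz i) (emba u) =
  \sum_l ((S u i l)^* * f (emba u) (iz l) 0 + H u i l * (f (emba u) (iz l) 0)^*).
Proof.
move=> oB [hf t0] Uu Bu; set p := emba u; have Mp := M_emba Uu.
have zp l : zc l p = 0 by rewrite /zc emba_iz.
pose e : cvec R N := (delta_mx (iz i) 0, 0).
have te : vder e rho p = 0.
  by rewrite (vder_grho iw oU sF) // (vder_qF0 qg e Uu zp) !mxE eq_sym iz_iw addr0 mulr0 subr0.
have sr := smooth_grho iw oU sF.
have W1 j : W (fun q => f q j 0) p := (hf j p Bu).1.
have W2 j : W (dz rho j) p := smooth_W oU Uu (smooth_dz j oU sr).
have W3 j : W (fun q => (f q j 0)^*) p := (W_conj (W1 j)).1.
have W4 j : W (dzbar rho j) p := smooth_W oU Uu (smooth_dzbar j oU sr).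
have WA j := (W_mul (W1 j) (W2 j)).1; have WB j := (W_mul (W3 j) (W4 j)).1.
have [WS DS] := @W_sum _ _ _ (index_enum 'I_N) (fun j q => f q j 0 * dz rho j q + (f q j 0)^* * dzbar rho j q)
   p (fun j => (W_add (WA j) (WB j)).1).
have K : vder e (tng f) p = 0.
  apply: (kill oU sF rF Fw MF Uu Mp WS _ te).
  by apply: filterS (open_near oB Bu) => q; exact: t0.
have z3 j : vder e (fun q => (f q j 0)^*) p = 0.
  by rewrite (vder_conj _ (W1 j)) (hol_vder _ (hf j p Bu)) /= map_mx0 Dv0 conjC0.
have z1 j : vder e (fun q => f q j 0) p = dz (fun q => f q j 0) (iz i) p by rewrite dz_vder.
have E j : vder e (fun q => f q j 0 * dz rho j q + (f q j 0)^* * dzbar rho j q) p =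
  dz (fun q => f q j 0) (iz i) p * dz rho j p + (f p j 0 * vder e (dz rho j) p
   + (f p j 0)^* * vder e (dzbar rho j) p).
  by rewrite (vderD _ (WA j) (WB j)) (vderM _ (W1 j) (W2 j)) (vderM _ (W3 j) (W4 j)) z3 mul0r add0r z1 addrA.
have R1 j : dz rho j p = - 2^-1 * (j == iw)%:R.
  rewrite (@dz_grho R _ iw U F oU sF _ j Uu).1 dz_vder (vder_qF0 qg _ Uu zp) sub0r mulNr //.
have Q1 : \sum_j dz (fun q => f q j 0) (iz i) p * dz rho j p = - (2^-1 * dz (fun q => f q iw 0) (iz i) p).
  rewrite (bigD1 iw) //= big1 ?addr0 => [|j /negbTE jw]; last by rewrite R1 jw !mulr0.
  by rewrite R1 eqxx mulr1 mulrN mulrC.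
have Q2 : \sum_j f p j 0 * vder e (dz rho j) p = \sum_l (S u i l)^* * f p (iz l) 0.
  rewrite (sum_index0 (G := fun j => f p j 0 * vder e (dz rho j) p)) /=.
  - apply: eq_bigr => l _; rewrite (jet_zc qg) // emba_zeta (bigD1 i) //= big1 ?addr0.
      rewrite !mxE !eqxx mul0r add0r mulr1 mulrC.
      by have := qg_sym qg Uu l i; rewrite emba_zeta => ->.
    by move=> m /negbTE mi; rewrite !mxE eq_iz mi mul0r mulr0 addr0.
  - by rewrite (jw qg e Uu).1 mulr0.
  - by move=> a; rewrite (ja qg a e Uu zp).1 mulr0.
have Q3 : \sum_j (f p j 0)^* * vder e (dzbar rho j) p = \sum_l H u i l * (f p (iz l) 0)^*.
  rewrite (sum_index0 (G := fun j => (f p j 0)^* * vder e (dzbar rho j) p)) /=.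
  - apply: eq_bigr => l _; rewrite (jz qg) // emba_zeta (bigD1 i) //= big1 ?addr0.
      by rewrite !mxE !eqxx mul1r mulr0 addr0 mulrC.
    by move=> m /negbTE mi; rewrite !mxE eq_iz mi mul0r mulr0 addr0.
  - by rewrite (jw qg e Uu).2 mulr0.
  - by move=> a; rewrite (ja qg a e Uu zp).2 mulr0.
move: K; rewrite DS (eq_bigr _ (fun j _ => E j)) big_split /= big_split /= Q1 Q2 Q3 => /eqP.
by rewrite addrC subr_eq0 eq_sym -big_split => /eqP.
Qed.

End Symmetry.
Arguments emba {R s k} u.

(** * Consequences of transitivity *)

Section Transitive.
Variables (R : realType) (s k : nat).
Local Notation C := R[i].
Local Notation N := (1 + (s + k))%N.
Local Notation V := 'cV[R[i]]_N.
Variables (U M : set V) (H S : 'cV[C]_k -> 'M[C]_s).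
Hypothesis qg : qgraph U M H S.
Hypothesis U0 : U 0.
Hypothesis uH : H 0 \in unitmx.
Let oU := qg_open qg.
Local Notation F := (qF H S : V -> C).
Let sF := smooth_qF oU (qg_H qg) (qg_S qg) : smooth_on U F.
Let rF := qF_real S (qg_herm qg) : forall x, U x -> (F x)^* = F x.
Let Fw := @qF_w R s k H S.
Let MF := MFq (qg_M qg) : forall x, U x -> (M x <-> 'Re (x iw 0) = F x).
Local Notation rho := (grho iw F).
Variable A : set (V -> V).
Hypothesis symA : forall f, A f -> hol_symmetry M 0 f.
Hypothesis trA : leaf_transitive M 0 A.

Let M0 : M 0.
Proof. by rewrite -(@emba0 R s k); apply: (M_emba qg); rewrite emba0. Qed.

Let z00 l : zc l (0 : V) = 0.
Proof. by rewrite /zc mxE. Qed.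

Lemma tng_sum m (f : 'I_m -> V -> V) (c : 'I_m -> C) q : (forall i, (c i)^* = c i) ->
  tng H S (fun q => \sum_i c i *: f i q) q = \sum_i c i * tng H S (f i) q.
Proof.
move=> cr; rewrite /tng; under [RHS]eq_bigr do rewrite mulr_sumr.
rewrite [RHS]exchange_big /=; apply: eq_bigr => j _.
rewrite summxE rmorph_sum /= !mulr_suml -big_split /=; apply: eq_bigr => i _.
rewrite mxE rmorphM /= cr; move: (dz _ _ _) (dzbar _ _ _) => a b; ring.
Qed.

(** Real combinations of symmetries are symmetries, and modulo the leaf the value at 0 is determined by its z-part ([kernel_z0]). *)
Lemma sym_at (z : 'cV[C]_s) : exists f : V -> V, (forall l, f 0 (iz l) 0 = z l 0) /\
  exists B : set V, [/\ open B, B 0, B `<=` U & sym_on M H S B f].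
Proof.
have rt : rtangent M 0 (rv (embz z : V)).
  split; last by rewrite /cconj /rv /=; congr pair; apply/matrixP => i j; rewrite !mxE ?conjCK.
  apply/(ctangentP oU sF rF Fw MF) => //.
  by rewrite (vder_grho iw oU sF) // (vder_qF0 qg _ U0 z00) /= !mxE embz_iw conjC0 addr0 mulr0 subr0.
have [m [f [c [Af [_ [v1 [v2 [k1 k2 E]]]]]]]] := trA rt.
(* the factor 1/2 comes from the real part of a (1,0)-vector *)
pose a i : C := ((c i)%:C)%C * 2^-1.
have ar i : (a i)^* = a i by rewrite /a rmorphM fmorphV /= conjC_nat conjE /= oppr0.
exists (fun q => \sum_i a i *: f i q); split.
  move=> l; pose L (u : cvec R N) := u.1 (iz l) 0.
  have LD u w : L (u + w) = L u + L w by rewrite /L /= mxE.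
  have LZ (t : C) u : L (t *: u) = t * L u by rewrite /L /= mxE.
  have L0 : L 0 = 0 by rewrite /L mxE.
  have zeta0 : coord_zeta (0 : V) = 0 by apply/matrixP => i j; rewrite ord1 coord_zetaE !mxE.
  have uH' : H (coord_zeta (0 : V)) \in unitmx by rewrite zeta0.
  have := congr1 L E; rewrite [RHS]LD.
  have -> : L v1 = 0 by exact: (kernel_z0 qg U0 M0 z00 uH' k1).
  have -> : L (cconj v2) = 0 by rewrite /L /cconj /= k2.1.2 map_mx0 mxE.
  rewrite LD -scaleN1r LZ (big_morph L LD L0) addr0 mulN1r => /eqP; rewrite subr_eq0 => /eqP.
  rewrite {1}/L /= embz_iz => ->; rewrite summxE; apply: eq_bigr => i _.
  by rewrite LZ /re_part LZ /L /= !mxE conjC0 addr0 /a mulrA.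
have near0 : \forall q \near (0 : V), forall i, (forall j, hol (fun q => f i q j 0) q) /\ (M q -> rtangent M q (re_part (f i q))).
  apply: (@filter_forall V 'I_m (fun i q => (forall j, hol (fun q => f i q j 0) q) /\ (M q -> rtangent M q (re_part (f i q)))) (nbhs (0 : V)) _) => i.
  have [D [oD D0 hD tD]] := symA (Af i).
  by apply: filterS (open_near oD D0) => q Dq; split=> [j|Mq]; [exact: diffmx_hol (hD q Dq)|exact: tD].
have [d1 d10 h1] := (nbhs_nszP 0 _).1 near0.
have [d2 d20 h2] := (nbhs_nszP 0 _).1 (open_near oU U0).
pose d := Num.min d1 d2; have d0 : 0 < d by rewrite lt_min d10.
have B12 q : oball (0 : V) d q -> nsz 0 q < d1 /\ nsz 0 q < d2 by rewrite /oball /= lt_min => /andP[].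
exists (oball (0 : V) d); split; first exact: open_oball.
- by rewrite /oball /= nszxx.
- by move=> q /B12 [_ /h2].
split=> [j q /B12 [q1 _]|q /B12 [q1 q2] Mq].
  apply: (hol_near (f := fun q => \sum_i a i * f i q j 0)).
    by apply/nbhs_nszP; exists 1 => // y _; rewrite summxE; apply: eq_bigr => i _; rewrite mxE.
  by apply: hol_sum => i _; apply: hol_mul; [exact: hol_cst|exact: (h1 q q1 i).1].
rewrite (tng_sum _ _ ar) big1 // => i _.
by rewrite (tng_real qg (h2 q q2) Mq ((h1 q q1 i).2 Mq)) mulr0.
Qed.

Lemma emba_near B : open B -> B (0 : V) -> \forall u \near (0 : 'cV[C]_k), B (emba u).
Proof.
move=> oB B0; have [d d0 h] := (nbhs_nszP 0 _).1 (open_near oB B0).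
by apply/nbhs_nszP; exists d => // u hu; apply: h; rewrite nsz_emba.
Qed.

Lemma sym_zeta (z : 'cV[C]_s) : exists ca : ('I_s -> 'cV[C]_k -> C) * ('I_s -> 'cV[C]_k -> C),
  (forall l, ca.1 l 0 = z l 0) /\
  \forall u \near (0 : 'cV[C]_k), [/\ forall l, hol (ca.1 l) u, forall i, hol (ca.2 i) u &
   forall i, ca.2 i u = \sum_l ((S u i l)^* * ca.1 l u + H u i l * (ca.1 l u)^*)].
Proof.
have [f [fz [B [oB B0 BU sf]]]] := sym_at z.
exists (fun l u => f (emba u) (iz l) 0, fun i u => 2^-1 * dz (fun q => f q iw 0) (iz i) (emba u)).
split=> [l|]; first by rewrite /= emba0.
apply: filterS (emba_near oB B0) => u Bu; split=> [l|i|i] /=.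
- by apply: (hol_comp (f := fun q => f q (iz l) 0)); [exact: sf.1|move=> j; exact: hol_emba].
- apply: hol_mul; first exact: hol_cst.
  apply: (hol_comp (f := dz (fun q => f q iw 0) (iz i))); last by move=> j; exact: hol_emba.
  by apply: (holU_dz _ oB (sf.1 iw)).
- exact: (sym_jet qg i oB sf (BU _ Bu) Bu).
Qed.

(** The relation of [sym_zeta] is real linear in the symmetry; the combinations c - i c' and c + i c' separate its linear and antilinear parts. *)
Lemma sym_PQ : exists P Q E G : 'cV[C]_k -> 'M[C]_s, [/\ P 0 = 1%:M, Q 0 = 0 &
  \forall u \near (0 : 'cV[C]_k),
   [/\ forall l m, hol (fun u => P u l m) u /\ hol (fun u => Q u l m) u,
       forall l m, hol (fun u => E u l m) u /\ hol (fun u => G u l m) u,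
       E u = conjCmx (S u) *m P u + H u *m conjCmx (Q u) &
       G u = conjCmx (S u) *m Q u + H u *m conjCmx (P u)]].
Proof.
have [ca Hca] := choice sym_zeta.
pose c1 m := ca (delta_mx m 0); pose c2 m := ca ('i *: delta_mx m 0).
exists (fun u => \matrix_(l, m) (2^-1 * ((c1 m).1 l u - 'i * (c2 m).1 l u))).
exists (fun u => \matrix_(l, m) (2^-1 * ((c1 m).1 l u + 'i * (c2 m).1 l u))).
exists (fun u => \matrix_(l, m) (2^-1 * ((c1 m).2 l u - 'i * (c2 m).2 l u))).
exists (fun u => \matrix_(l, m) (2^-1 * ((c1 m).2 l u + 'i * (c2 m).2 l u))).
have ii : 'i * 'i = -1 :> C by rewrite -expr2 sqrCi.
split.
- apply/matrixP => l m; rewrite !mxE (Hca _).1 (Hca _).1 !mxE eqxx andbT mulrA ii mulN1r opprK.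
  by move: (_ == _)%:R => x; field.
- apply/matrixP => l m; rewrite !mxE (Hca _).1 (Hca _).1 !mxE eqxx andbT mulrA ii mulN1r subrr mulr0 //.
have n1 : \forall u \near (0 : 'cV[C]_k), forall m,
   [/\ forall l, hol ((c1 m).1 l) u, forall i, hol ((c1 m).2 i) u &
   forall i, (c1 m).2 i u = \sum_l ((S u i l)^* * (c1 m).1 l u + H u i l * ((c1 m).1 l u)^*)] /\
   [/\ forall l, hol ((c2 m).1 l) u, forall i, hol ((c2 m).2 i) u &
   forall i, (c2 m).2 i u = \sum_l ((S u i l)^* * (c2 m).1 l u + H u i l * ((c2 m).1 l u)^*)].
  apply: (@filter_forall 'cV[C]_k 'I_s _ (nbhs (0 : 'cV[C]_k)) _) => m.
  by apply: filterI; [exact: (Hca (delta_mx m 0)).2|exact: (Hca ('i *: delta_mx m 0)).2].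
apply: filterS n1 => u hu.
have hm (b1 b2 : C) (f g : 'cV[C]_k -> C) : hol f u -> hol g u -> hol (fun u => 2^-1 * (f u + b1 * g u)) u.
  by move=> *; apply: hol_mul; [exact: hol_cst|apply: hol_add => //; apply: hol_mul => //; exact: hol_cst].
have hE (A1 A2 : 'cV[C]_k -> C) : A1 = A2 -> hol A2 u -> hol A1 u by move=> ->.
split.
- move=> l m; have [[h1 _ _] [h2 _ _]] := hu m; split.
    by apply: hE (hm (- 'i) 0 _ _ (h1 l) (h2 l)); apply/funext => v; rewrite mxE mulNr.
  by apply: hE (hm 'i 0 _ _ (h1 l) (h2 l)); apply/funext => v; rewrite mxE.
- move=> l m; have [[_ h1 _] [_ h2 _]] := hu m; split.
    by apply: hE (hm (- 'i) 0 _ _ (h1 l) (h2 l)); apply/funext => v; rewrite mxE mulNr.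
  by apply: hE (hm 'i 0 _ _ (h1 l) (h2 l)); apply/funext => v; rewrite mxE.
- apply/matrixP => l m; have [[_ _ e1] [_ _ e2]] := hu m; rewrite !mxE e1 e2 mulr_sumr -sumrB mulr_sumr -big_split /=.
  apply: eq_bigr => j _; rewrite !mxE rmorphM rmorphD rmorphM /= fmorphV /= conjC_nat conjCi.
  move: (S u l j)^* (H u l j) ((c1 m).1 j u) ((c2 m).1 j u) ((c1 m).1 j u)^* ((c2 m).1 j u)^* ('i : C) => *; ring.
- apply/matrixP => l m; have [[_ _ e1] [_ _ e2]] := hu m; rewrite !mxE e1 e2 mulr_sumr -big_split mulr_sumr -big_split /=.
  apply: eq_bigr => j _; rewrite !mxE rmorphM rmorphB rmorphM /= fmorphV /= conjC_nat conjCi.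
  move: (S u l j)^* (H u l j) ((c1 m).1 j u) ((c2 m).1 j u) ((c1 m).1 j u)^* ((c2 m).1 j u)^* ('i : C) => *; ring.
Qed.

End Transitive.

(** * Matrix identities of the normal form *)

Section Algebra.
Variables (R : realType) (s : nat).
Local Notation C := R[i].
Implicit Types A B X Y : 'M[C]_s.
Local Notation cj := (@conjCmx R _ _).

Lemma cjM m n p (A : 'M[C]_(m, n)) (B : 'M[C]_(n, p)) : cj (A *m B) = cj A *m cj B.
Proof. exact: map_mxM. Qed.
Lemma cjK m n (A : 'M[C]_(m, n)) : cj (cj A) = A.
Proof. by apply/matrixP => i j; rewrite !mxE conjCK. Qed.
Lemma cjT m n (A : 'M[C]_(m, n)) : cj A^T = (cj A)^T.
Proof. by rewrite /conjCmx map_trmx. Qed.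
Lemma cjD m n (A B : 'M[C]_(m, n)) : cj (A + B) = cj A + cj B.
Proof. exact: map_mxD. Qed.
Lemma cjN m n (A : 'M[C]_(m, n)) : cj (- A) = - cj A.
Proof. exact: map_mxN. Qed.
Lemma cj1 n : cj (1%:M : 'M[C]_n) = 1%:M.
Proof. exact: map_mx1. Qed.
Lemma cjV n (A : 'M[C]_n) : cj (invmx A) = invmx (cj A).
Proof. exact: map_invmx. Qed.
Lemma cj_unit n (A : 'M[C]_n) : (cj A \in unitmx) = (A \in unitmx).
Proof. exact: map_unitmx. Qed.
Lemma cj0 m n : cj (0 : 'M[C]_(m, n)) = 0.
Proof. exact: map_mx0. Qed.

Lemma solveL A B X : A \in unitmx -> A *m X = B -> invmx A *m B = X.
Proof. by move=> uA <-; rewrite mulKmx. Qed.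

Lemma subM1l A B : (1%:M - A) *m B = B - A *m B.
Proof. by rewrite mulmxBl mul1mx. Qed.
Lemma subM1r A B : A *m (1%:M - B) = A - A *m B.
Proof. by rewrite mulmxBr mulmx1. Qed.

Variables (P Q E G S H : 'M[C]_s).
Hypotheses (uP : P \in unitmx) (hS : S^T = S) (hH : H^T = cj H).
Hypothesis eE : E = cj S *m P + H *m cj Q.
Hypothesis eG : G = cj S *m Q + H *m cj P.

(** The matrices T, E', N, H', S' of the normal form. *)
Definition aT := invmx P *m Q.
Definition aE := P^T *m E.
Definition aN := P^T *m G - aE *m aT.
Definition aH := P^T *m H *m cj P.
Definition aW := P^T *m cj S *m P.

Let T := aT.
Local Notation Tc := (cj T).

Lemma PT : P *m T = Q. Proof. by rewrite /T /aT mulKVmx. Qed.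
Lemma aEE : aE = aW + aH *m Tc.
Proof. by rewrite /aE eE mulmxDr /aW /aH -{1}PT cjM !mulmxA. Qed.
Lemma aGE : P^T *m G = aW *m T + aH.
Proof. by rewrite eG mulmxDr /aW /aH -{1}PT !mulmxA. Qed.
Lemma aNE : aN = aH *m (1%:M - Tc *m T).
Proof.
rewrite /aN aGE aEE -/T mulmxDl opprD subM1r !mulmxA.
by rewrite addrACA subrr add0r.
Qed.
Lemma aHT : aH^T = cj aH.
Proof. by rewrite /aH !trmx_mul trmxK !cjM cjK hH cjT !mulmxA. Qed.
Lemma aWT : aW^T = aW.
Proof. by rewrite /aW !trmx_mul trmxK -cjT hS mulmxA. Qed.

Lemma adjXE : (cj (1%:M - Tc *m T))^T = 1%:M - Tc^T *m T^T.
Proof. by rewrite cjD cjN cjM cjK cj1 linearB /= trmx1 trmx_mul. Qed.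

Lemma adjN : (cj aN)^T = (1%:M - Tc^T *m T^T) *m aH.
Proof. by rewrite aNE cjM trmx_mul adjXE -aHT trmxK. Qed.

(** Hermitian symmetry of H', written without inverses so that both sides are products of holomorphic and antiholomorphic matrices. *)
Lemma hermitian_relation : (1%:M - Tc^T *m T^T) *m aN = (cj aN)^T *m (1%:M - Tc *m T).
Proof. by rewrite adjN {1}aNE mulmxA. Qed.

Variable HH : 'M[C]_s.
Hypotheses (hHH : HH^T = cj HH) (uHH : HH \in unitmx) (NH : aN = HH).

Let b1 : aH *m (1%:M - Tc *m T) = HH. Proof. by rewrite -aNE. Qed.
Let b2 : (1%:M - Tc^T *m T^T) *m aH = HH.
Proof. by rewrite -adjN NH -hHH trmxK. Qed.
Let b3 : Tc^T *m T^T *m aH = aH *m Tc *m T.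
Proof.
have := b2; rewrite -b1 subM1l subM1r mulmxA => /addrI /oppr_inj //.
Qed.

Lemma push A B : A *m (1%:M - B *m A) = (1%:M - A *m B) *m A.
Proof. by rewrite subM1l subM1r mulmxA. Qed.

Lemma I2_abs (K Tb L t X Y Z L' K' : 'M[C]_s) : K *m Tb *m Y = L *m Tb -> X *m t = t *m Z -> L' = Z *m K' ->
  X *m (K *m Tb - t *m K') *m Y = X *m L *m Tb - t *m L' *m Y.
Proof.
move=> e4 e2 e3; rewrite mulmxBr mulmxBl; congr (_ - _); first by rewrite -mulmxA e4 mulmxA.
by rewrite e3 !mulmxA e2.
Qed.

Lemma HTcE : aH *m Tc *m (1%:M - T *m Tc) = HH *m Tc.
Proof. by rewrite -mulmxA push mulmxA b1. Qed.

(** Symmetry of S', multiplied on both sides so that only T, E' and constants occur. *)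
Lemma symmetry_relation : (1%:M - Tc^T *m T^T) *m (aE - aE^T) *m (1%:M - T *m Tc) =
  (1%:M - Tc^T *m T^T) *m HH *m Tc - Tc^T *m HH^T *m (1%:M - T *m Tc).
Proof.
have -> : aE - aE^T = aH *m Tc - Tc^T *m aH^T.
  by rewrite aEE linearD /= aWT trmx_mul opprD addrACA subrr add0r.
have e2 : (1%:M - Tc^T *m T^T) *m Tc^T = Tc^T *m (1%:M - T^T *m Tc^T) by rewrite push.
have e3 : HH^T = (1%:M - T^T *m Tc^T) *m aH^T.
  by rewrite -b1 trmx_mul; congr (_ *m _); rewrite linearB /= trmx1 trmx_mul.
exact: (I2_abs HTcE e2 e3).
Qed.

Hypothesis sE : aE^T = aE.

Lemma KT : (aH *m Tc)^T = aH *m Tc.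
Proof.
have : aE - aW = aH *m Tc by rewrite aEE addrAC subrr add0r.
by move=> <-; rewrite linearB /= sE aWT.
Qed.

(** Uses that H' conj(T) = E' - S' is symmetric and that T* T^T H' = H' conj(T) T. *)
Lemma HTc_sym : (HH *m Tc)^T = HH *m Tc.
Proof.
have e : HH *m Tc = aH *m Tc - aH *m Tc *m T *m Tc by rewrite -HTcE subM1r !mulmxA.
rewrite e linearB /= KT; congr (_ - _).
transitivity (Tc^T *m T^T *m aH *m Tc); last by rewrite b3.
by rewrite trmx_mul (trmx_mul (aH *m Tc) T) KT !mulmxA.
Qed.

Definition aS := - (T *m invmx HH).

Lemma aS_sym : aS^T = aS.
Proof.
have h : T^T *m HH = HH^T *m T.
  have e : cj ((HH *m Tc)^T) = cj (HH *m Tc) by rewrite HTc_sym.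
  by move: e; rewrite cjT (cjM HH Tc) cjK -hHH trmx_mul trmxK.
have uT : HH^T \in unitmx by rewrite unitmx_tr.
rewrite /aS linearN /= trmx_mul trmx_inv; congr (- _).
apply: (solveL uT); rewrite mulmxA -h; exact: (mulmxK uHH).
Qed.

Lemma aS_H : aS *m HH = - T.
Proof. by rewrite /aS mulNmx mulmxKV. Qed.

Lemma caS_H : cj aS *m HH^T = - Tc.
Proof. by rewrite /aS cjN cjM cjV -hHH mulNmx mulmxKV // unitmx_tr. Qed.

Lemma uY : 1%:M - Tc *m T \in unitmx.
Proof. by have := uHH; rewrite -b1 unitmx_mul => /andP[]. Qed.

Lemma aH_inv : aH = HH *m invmx (1%:M - Tc *m T).
Proof. by rewrite -b1 mulmxK // uY. Qed.

(** With SS HH = - T and conj(SS) HH^T = - conj(T), both summands are HH (1 - conj(T) T)^-1. *)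
Lemma model_HE : 2^-1 *: (HH *m invmx (1%:M - cj aS *m HH^T *m aS *m HH)
   + invmx (1%:M - HH *m cj aS *m HH^T *m aS) *m HH) = aH.
Proof.
have -> : cj aS *m HH^T *m aS *m HH = Tc *m T by rewrite -mulmxA aS_H caS_H mulNmx mulmxN opprK.
set Z := 1%:M - _ *m aS.
have ZE : Z *m HH = HH *m (1%:M - Tc *m T).
  rewrite /Z subM1l subM1r -!mulmxA aS_H; congr (_ - _ *m _).
  by rewrite mulmxN mulmxN mulmxA caS_H mulNmx opprK.
have uZ : Z \in unitmx.
  have : Z *m HH \in unitmx by rewrite ZE unitmx_mul uHH uY.
  by rewrite unitmx_mul => /andP[].
have -> : invmx Z *m HH = HH *m invmx (1%:M - Tc *m T).
  apply: (solveL uZ); rewrite mulmxA ZE; exact: (mulmxK uY).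
rewrite -aH_inv; move: aH => X; apply/matrixP => i j; rewrite !mxE; move: (X i j) => x; by field.
Qed.

Lemma model_SE : HH^T *m invmx (1%:M - aS *m HH *m cj aS *m HH^T) *m aS *m HH = cj (aW - aE).
Proof.
have e : aW - aE = - (aH *m Tc) by rewrite aEE opprD addrA subrr sub0r.
rewrite -(mulmxA _ aS) aS_H -(mulmxA (- T)) caS_H mulNmx mulmxN opprK e cjN (cjM aH Tc) cjK mulmxN.
rewrite aH_inv (cjM HH) cjV cjD cjN (cjM Tc T) cjK cj1 -hHH; congr (- _).
Qed.

End Algebra.

(** * Holomorphic matrices and polarized identities *)

Section MatrixHol.
Variables (R : realType) (N : nat).
Local Notation C := R[i].
Local Notation V := 'cV[R[i]]_N.

Definition mhol m n (A : V -> 'M[C]_(m, n)) x := forall i j, hol (fun y => A y i j) x.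

Lemma hol_ext (f g : V -> C) x : f =1 g -> hol g x -> hol f x.
Proof. by move=> /funext ->. Qed.

Lemma mhol_cst m n (A : 'M[C]_(m, n)) x : mhol (fun=> A) x.
Proof. by move=> i j; exact: hol_cst. Qed.
Lemma mhol_add m n (A B : V -> 'M[C]_(m, n)) x : mhol A x -> mhol B x -> mhol (fun y => A y + B y) x.
Proof. by move=> hA hB i j; apply: (hol_ext (g := fun y => A y i j + B y i j)) => [y|]; [rewrite mxE|exact: hol_add]. Qed.
Lemma mhol_opp m n (A : V -> 'M[C]_(m, n)) x : mhol A x -> mhol (fun y => - A y) x.
Proof. by move=> hA i j; apply: (hol_ext (g := fun y => - A y i j)) => [y|]; [rewrite mxE|exact: hol_opp]. Qed.
Lemma mhol_sub m n (A B : V -> 'M[C]_(m, n)) x : mhol A x -> mhol B x -> mhol (fun y => A y - B y) x.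
Proof. by move=> hA hB; apply: mhol_add hA (mhol_opp hB). Qed.
Lemma mhol_tr m n (A : V -> 'M[C]_(m, n)) x : mhol A x -> mhol (fun y => (A y)^T) x.
Proof. by move=> hA i j; apply: (hol_ext (g := fun y => A y j i)) => [y|]; [rewrite mxE|exact: hA]. Qed.
Lemma mhol_mul m n p (A : V -> 'M[C]_(m, n)) (B : V -> 'M[C]_(n, p)) x : mhol A x -> mhol B x ->
  mhol (fun y => A y *m B y) x.
Proof.
move=> hA hB i j; apply: (hol_ext (g := fun y => \sum_l A y i l * B y l j)) => [y|]; first by rewrite mxE.
by apply: hol_sum => l _; apply: hol_mul.
Qed.

Lemma hol_det n (A : V -> 'M[C]_n) x : mhol A x -> hol (fun y => \det (A y)) x.
Proof.
move=> hA; apply: hol_sum => g _; apply: hol_mul; first exact: hol_cst.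
by apply: hol_prod => i _; exact: hA.
Qed.

Lemma near_unit n (A : V -> 'M[C]_n) x : mhol A x -> A x \in unitmx -> \forall y \near x, A y \in unitmx.
Proof.
move=> hA; rewrite unitmxE unitfE => d0.
have [d d0' hd] := (nbhs_nszP x _).1 (W_neq0 (hol_det hA).1 d0).
by apply/nbhs_nszP; exists d => // y /hd; rewrite unitmxE unitfE.
Qed.

Lemma mhol_inv n (A : V -> 'M[C]_n) x : mhol A x -> A x \in unitmx -> mhol (fun y => invmx (A y)) x.
Proof.
move=> hA uA i j; have d0 : \det (A x) != 0 by rewrite -unitfE -unitmxE.
apply: (hol_near (f := fun y => (\det (A y))^-1 * cofactor (A y) j i)).
  have [d d0' hd] := (nbhs_nszP x _).1 (near_unit hA uA).
  by apply/nbhs_nszP; exists d => // y /hd uy; rewrite /invmx uy !mxE.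
apply: hol_mul; first exact: (hol_inv d0 (hol_det hA)).
apply: hol_mul; first exact: hol_cst.
by apply: hol_det => a b; apply: (hol_ext (g := fun y => A y (lift j a) (lift i b))) => [y|]; [rewrite !mxE|exact: hA].
Qed.

(** Conjugating argument and value turns a holomorphic function into a holomorphic one; this is how conj(f(zeta)) becomes holomorphic in a variable replacing conj(zeta). *)
Lemma hol_cc (f : V -> C) x : hol f (conjCmx x) -> hol (fun y => (f (conjCmx y))^*) x.
Proof.
move=> hf; pose phi (y : V) : V := conjCmx y.
have E j : (fun y => phi y j 0) = (fun y => (y j 0)^*) by apply/funext => y; rewrite mxE.
have Wc j := (W_coord j x).1.
have Wp j : W (fun y => phi y j 0) x by rewrite E; exact: (W_conj (Wc j)).1.
have [W1 D] := W_comp hf.1 Wp.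
apply: hol_of_vder => [|v]; first exact: (W_conj W1).1.
rewrite (vder_conj _ W1) D big1 ?conjC0 // => j _.
rewrite hf.2 mul0r addr0 E (vder_conj _ (Wc j)) vder_coord /cconj /= !mxE !conjC0 mulr0 //.
Qed.

End MatrixHol.

Lemma mhol_comp (R : realType) (N N' m n : nat) (A : 'cV[R[i]]_N -> 'M[R[i]]_(m, n)) (phi : 'cV[R[i]]_N' -> 'cV[R[i]]_N) x :
  mhol A (phi x) -> mhol phi x -> mhol (fun y => A (phi y)) x.
Proof. by move=> hA hp i j; apply: (hol_comp (f := fun y => A y i j)) => // l; exact: hp. Qed.

Section Polar.
Variables (R : realType) (k : nat).
Local Notation C := R[i].
Local Notation Z := 'cV[R[i]]_k.
Local Notation cj := (@conjCmx R _ _).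

Lemma mhol_usub w : mhol (fun w : 'cV[C]_(k + k) => usubmx w) w.
Proof. by move=> i j; apply: (hol_ext (g := fun w => w (lshift k i) 0)) => [y|]; [rewrite mxE ord1|exact: hol_coord]. Qed.
Lemma mhol_dsub w : mhol (fun w : 'cV[C]_(k + k) => dsubmx w) w.
Proof. by move=> i j; apply: (hol_ext (g := fun w => w (rshift k i) 0)) => [y|]; [rewrite mxE ord1|exact: hol_coord]. Qed.

Lemma nsz_split (w : 'cV[C]_(k + k)) : nsz 0 w = nsz 0 (usubmx w : Z) + nsz 0 (dsubmx w : Z).
Proof.
rewrite /nsz (eq_bigr (fun j => cn (w j 0))) => [|j _]; last by rewrite [(0 : 'cV_ _) _ _]mxE subr0.
rewrite big_split_ord; congr (_ + _); apply: eq_bigr => j _; by rewrite !mxE subr0.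
Qed.

Lemma nsz_cj (u : Z) : nsz 0 (cj u) = nsz 0 u.
Proof. by apply: eq_bigr => j _; rewrite !mxE !subr0 cnJ. Qed.

Lemma nsz_us (w : 'cV[C]_(k + k)) : nsz 0 (usubmx w : Z) <= nsz 0 w.
Proof. by rewrite nsz_split lerDl nsz_ge0. Qed.
Lemma nsz_ds (w : 'cV[C]_(k + k)) : nsz 0 (dsubmx w : Z) <= nsz 0 w.
Proof. by rewrite nsz_split lerDr nsz_ge0. Qed.

(** An identity in (zeta, conj zeta) persists when conj(zeta) is replaced by an independent variable; here that variable is put equal to 0. *)
Lemma polar0 m n d (Phi : Z -> Z -> 'M[C]_(m, n)) : 0 < d ->
  (forall w : 'cV[C]_(k + k), nsz 0 (usubmx w : Z) < d -> nsz 0 (dsubmx w : Z) < d ->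
     mhol (fun w : 'cV[C]_(k + k) => Phi (usubmx w) (dsubmx w)) w) ->
  (forall u, nsz 0 u < d -> Phi u (cj u) = 0) ->
  \forall u \near (0 : Z), Phi u 0 = 0.
Proof.
move=> d0 hP P0.
have n1 : \forall u \near (0 : Z), forall i, forall j, Phi u 0 i j = 0.
  apply: (@filter_forall Z 'I_m _ (nbhs (0 : Z)) _) => i; apply: (@filter_forall Z 'I_n _ (nbhs (0 : Z)) _) => j.
  pose Psi (w : 'cV[C]_(k + k)) : C := Phi (usubmx w) (dsubmx w) i j.
  have hPsi : holU (oball 0 d) Psi.
    by move=> w hw; exact: (hP w (le_lt_trans (nsz_us w) hw) (le_lt_trans (nsz_ds w) hw) i j).
  have z0 : oball (0 : 'cV[C]_(k + k)) d 0 by rewrite /oball /= nszxx.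
  have van : exists2 d, 0 < d & forall z : Z, nsz 0 z < d -> Psi (wconj z) = 0.
    by exists d => // z hz; rewrite /Psi /wconj col_mxKu col_mxKd (P0 z hz) mxE.
  have [d' d'0 H] := polarize (@open_oball _ _ _ _) hPsi z0 van.
  apply/nbhs_nszP; exists d' => // u hu; have := H (col_mx u 0).
  by rewrite /Psi nsz_split !col_mxKu !col_mxKd nszxx addr0; apply.
by apply: filterS n1 => u hu; apply/matrixP => i j; rewrite hu mxE.
Qed.

End Polar.

Section Normal.
Variables (R : realType) (s k : nat).
Local Notation C := R[i].
Local Notation Z := 'cV[R[i]]_k.
Local Notation cj := (@conjCmx R _ _).
Variables (P Q E G S H : Z -> 'M[C]_s).
Hypotheses (P0 : P 0 = 1%:M) (Q0 : Q 0 = 0).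
Hypothesis HP : \forall u \near (0 : Z),
   [/\ forall l m, hol (fun u => P u l m) u /\ hol (fun u => Q u l m) u,
       forall l m, hol (fun u => E u l m) u /\ hol (fun u => G u l m) u,
       E u = cj (S u) *m P u + H u *m cj (Q u) &
       G u = cj (S u) *m Q u + H u *m cj (P u)].
Hypothesis HS : \forall u \near (0 : Z), H u \is hermsymmx /\ S u \is symmetricmx.

Definition good_at u := [/\ P u \in unitmx, (S u)^T = S u, (H u)^T = cj (H u),
  E u = cj (S u) *m P u + H u *m cj (Q u) & G u = cj (S u) *m Q u + H u *m cj (P u)].
Definition TT u := aT (P u) (Q u).

Lemma good_near : \forall u \near (0 : Z), good_at u /\ [/\ mhol P u, mhol Q u, mhol E u & mhol G u].
Proof.
have hP0 : mhol P 0 by move=> i j; have [h _ _ _] := nbhs_singleton HP; exact: (h i j).1.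
have uP : P 0 \in unitmx by rewrite P0 unitmx1.
have n1 : \forall u \near (0 : Z), P u \in unitmx := near_unit hP0 uP.
have [d1 d10 H1] := (nbhs_nszP 0 _).1 HP; have [d2 d20 H2] := (nbhs_nszP 0 _).1 HS.
have [d3 d30 H3] := (nbhs_nszP 0 _).1 n1.
apply/nbhs_nszP; exists (Num.min d1 (Num.min d2 d3)); first by rewrite !lt_min d10 d20.
move=> u; rewrite !lt_min => /and3P[/H1 [h1 h2 eE eG] /H2 [hH hS] /H3 uPu]; split; last first.
  by split=> i j; [exact: (h1 i j).1|exact: (h1 i j).2|exact: (h2 i j).1|exact: (h2 i j).2].
split=> //; first by apply/matrixP => i j; rewrite mxE; exact: (symP _).1 hS j i.
by apply/matrixP => i j; rewrite !mxE; exact: (hermP _).1 hH j i.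
Qed.

Lemma TT0 : TT 0 = 0.
Proof. by rewrite /TT /aT Q0 mulmx0. Qed.

Definition Tcv (v : Z) := cj (TT (cj v)).
Lemma Tcv0 : Tcv 0 = 0.
Proof. by rewrite /Tcv cj0 TT0 cj0. Qed.

(** Both relations are evaluated at conj(zeta) = 0, where the antiholomorphic factors vanish because T(0) = 0. *)
Lemma normal : exists2 d, 0 < d & forall u, nsz 0 u < d ->
  [/\ good_at u, mhol P u, mhol TT u, mhol E u &
      aN (P u) (Q u) (E u) (G u) = H 0 /\ (aE (P u) (E u))^T = aE (P u) (E u)].
Proof.
have [d d0 hd] := (nbhs_nszP 0 _).1 good_near.
have n00 : nsz 0 (0 : Z) < d by rewrite nszxx.
have hT u : nsz 0 u < d -> mhol TT u.
  by move=> /hd [[uP _ _ _ _] [h1 h2 _ _]]; apply: mhol_mul h2; apply: mhol_inv.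
have haE u : nsz 0 u < d -> mhol (fun u => aE (P u) (E u)) u.
  by move=> /hd [_ [h1 _ h3 _]]; apply: mhol_mul h3; apply: mhol_tr.
pose NN u := aN (P u) (Q u) (E u) (G u).
have hN u : nsz 0 u < d -> mhol NN u.
  move=> hu; have [_ [h1 _ _ h4]] := hd u hu; apply: mhol_sub.
    by apply: mhol_mul h4; apply: mhol_tr.
  by apply: mhol_mul (hT u hu); exact: haE.
have cch (A : Z -> 'M[C]_s) : (forall u, nsz 0 u < d -> mhol A u) -> forall u, nsz 0 u < d -> mhol (fun v => cj (A (cj v))) u.
  move=> hA u hu i j; apply: (hol_ext (g := fun v => (A (cj v) i j)^*)) => [v|]; first by rewrite mxE.
  by apply: (@hol_cc _ _ (fun v => A v i j)); apply: hA; rewrite nsz_cj.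
have hTc := cch _ hT; have hNc := cch _ hN.
have up (A : Z -> 'M[C]_s) (hA : forall u, nsz 0 u < d -> mhol A u) (w : 'cV[C]_(k + k)) : nsz 0 (usubmx w : Z) < d -> mhol (fun w => A (usubmx w)) w.
  by move=> hw; apply: (@mhol_comp _ _ _ _ _ A (fun w => usubmx w)); [exact: hA|exact: mhol_usub].
have dn (A : Z -> 'M[C]_s) (hA : forall u, nsz 0 u < d -> mhol A u) (w : 'cV[C]_(k + k)) : nsz 0 (dsubmx w : Z) < d -> mhol (fun w => A (dsubmx w)) w.
  by move=> hw; apply: (@mhol_comp _ _ _ _ _ A (fun w => dsubmx w)); [exact: hA|exact: mhol_dsub].
pose Ncv v := cj (NN (cj v)).
have m1 w : mhol (fun _ : 'cV[C]_(k + k) => (1%:M : 'M[C]_s)) w := mhol_cst _ _.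
have hX1 w : nsz 0 (usubmx w : Z) < d -> nsz 0 (dsubmx w : Z) < d -> mhol (fun w : 'cV[C]_(k + k) => 1%:M - (Tcv (dsubmx w))^T *m (TT (usubmx w))^T) w.
  by move=> h1 h2; apply: (mhol_sub (m1 w)); apply: mhol_mul; apply: mhol_tr; [exact: (dn _ hTc)|exact: (up _ hT)].
have hX2 w : nsz 0 (usubmx w : Z) < d -> nsz 0 (dsubmx w : Z) < d -> mhol (fun w : 'cV[C]_(k + k) => 1%:M - Tcv (dsubmx w) *m TT (usubmx w)) w.
  by move=> h1 h2; apply: (mhol_sub (m1 w)); apply: mhol_mul; [exact: (dn _ hTc)|exact: (up _ hT)].
have hX3 w : nsz 0 (usubmx w : Z) < d -> nsz 0 (dsubmx w : Z) < d -> mhol (fun w : 'cV[C]_(k + k) => 1%:M - TT (usubmx w) *m Tcv (dsubmx w)) w.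
  by move=> h1 h2; apply: (mhol_sub (m1 w)); apply: mhol_mul; [exact: (up _ hT)|exact: (dn _ hTc)].
have nN : \forall u \near (0 : Z), NN u = H 0.
  have K : \forall u \near (0 : Z), (1%:M - (Tcv 0)^T *m (TT u)^T) *m NN u - (Ncv 0)^T *m (1%:M - Tcv 0 *m TT u) = 0.
    apply: (@polar0 _ _ _ _ d (fun u v => (1%:M - (Tcv v)^T *m (TT u)^T) *m NN u - (Ncv v)^T *m (1%:M - Tcv v *m TT u)) d0).
      move=> w h1 h2; apply: mhol_sub; apply: mhol_mul; [exact: hX1|exact: (up _ hN)| |exact: hX2].
      by apply: mhol_tr; exact: (dn _ hNc).
    move=> u hu; have [[uP hS hH eE eG] _] := hd u hu.
    have := hermitian_relation uP hH eE eG; rewrite /Ncv /Tcv !cjK => I; apply/eqP; rewrite subr_eq0; apply/eqP; exact: I.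
  have Ku u : (1%:M - (Tcv 0)^T *m (TT u)^T) *m NN u - (Ncv 0)^T *m (1%:M - Tcv 0 *m TT u) = NN u - (Ncv 0)^T.
    by rewrite Tcv0 trmx0 !mul0mx subr0 mul1mx mulmx1.
  have N0 : (Ncv 0)^T = H 0.
    have [[uP hS hH eE eG] _] := hd 0 n00.
    rewrite /Ncv cj0 /NN (adjN uP hH eE eG) -/(TT 0) TT0 cj0 trmx0 mul0mx subr0 mul1mx.
    by rewrite /aH P0 trmx1 mul1mx cj1 mulmx1.
  by apply: filterS K => u; rewrite Ku N0 => /eqP; rewrite subr_eq0 => /eqP.
have H0T : (H 0)^T = cj (H 0) by have [[]] := hd 0 n00.
have [d1 d10 hd1] := (nbhs_nszP 0 _).1 nN.
(* on this ball N is already known to be constant *)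
pose d2 := Num.min d d1; have d20 : 0 < d2 by rewrite lt_min d0.
have l12 u : nsz 0 u < d2 -> nsz 0 u < d /\ nsz 0 u < d1 by rewrite lt_min => /andP[].
have nE : \forall u \near (0 : Z), aE (P u) (E u) - (aE (P u) (E u))^T = 0.
  have K : \forall u \near (0 : Z), (1%:M - (Tcv 0)^T *m (TT u)^T) *m (aE (P u) (E u) - (aE (P u) (E u))^T) *m (1%:M - TT u *m Tcv 0)
     - ((1%:M - (Tcv 0)^T *m (TT u)^T) *m H 0 *m Tcv 0 - (Tcv 0)^T *m (H 0)^T *m (1%:M - TT u *m Tcv 0)) = 0.
    apply: (@polar0 _ _ _ _ d2 (fun u v => (1%:M - (Tcv v)^T *m (TT u)^T) *m (aE (P u) (E u) - (aE (P u) (E u))^T) *m (1%:M - TT u *m Tcv v)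
     - ((1%:M - (Tcv v)^T *m (TT u)^T) *m H 0 *m Tcv v - (Tcv v)^T *m (H 0)^T *m (1%:M - TT u *m Tcv v))) d20).
      move=> w /l12 [h1 _] /l12 [h2 _]; have hc A : mhol (fun _ : 'cV[C]_(k + k) => (A : 'M[C]_s)) w := mhol_cst _ _.
      have hE1 := up _ haE w h1; have hT2 := dn _ hTc w h2.
      apply: mhol_sub.
        by apply: mhol_mul (hX3 w h1 h2); apply: mhol_mul (hX1 w h1 h2) _; apply: (mhol_sub hE1 (mhol_tr hE1)).
      apply: mhol_sub.
        by apply: mhol_mul hT2; apply: (mhol_mul (hX1 w h1 h2) (hc _)).
      by apply: mhol_mul (hX3 w h1 h2); apply: (mhol_mul (mhol_tr hT2) (hc _)).
    move=> u /l12 [hu hu1]; have [[uP hS hH eE eG] _] := hd u hu.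
    have := symmetry_relation uP hS eE eG (hd1 u hu1); rewrite /Tcv !cjK => I; apply/eqP; rewrite subr_eq0; apply/eqP; exact: I.
  by apply: filterS K => u; rewrite Tcv0 trmx0 !(mul0mx, mulmx0) !subr0 mul1mx mulmx1.
have [d3 d30 hd3] := (nbhs_nszP 0 _).1 nE.
exists (Num.min d2 d3); first by rewrite lt_min d20.
move=> u; rewrite lt_min => /andP[/l12 [h h1] h3]; have [gu [hP _ hE _]] := hd u h.
split=> //; first exact: hT.
split; first exact: hd1.
by have /eqP := hd3 u h3; rewrite subr_eq0 eq_sym => /eqP.
Qed.

End Normal.

(** * Analyticity of the model *)

Section AnalyticGraph.
Variables (R : realType) (s k : nat).
Local Notation C := R[i].
Local Notation N := (1 + (s + k))%N.
Local Notation V := 'cV[R[i]]_N.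
Local Notation Z := 'cV[R[i]]_k.
Local Notation cj := (@conjCmx R _ _).
Variables (hw sw swc : 'cV[C]_(k + k) -> 'M[C]_s) (Om : set 'cV[C]_(k + k)).
Hypotheses (oOm : open Om).
Hypothesis holw : forall w, Om w -> [/\ mhol hw w, mhol sw w & mhol swc w].
Variables (U M : set V) (H S : Z -> 'M[C]_s).
Hypothesis oU : open U.
Hypothesis UOm : forall x, U x -> Om (wconj (coord_zeta x)).
Hypothesis EH : forall x, U x -> H (coord_zeta x) = hw (wconj (coord_zeta x)).
Hypothesis ES : forall x, U x -> S (coord_zeta x) = sw (wconj (coord_zeta x)).
Hypothesis ESc : forall x, U x -> cj (S (coord_zeta x)) = swc (wconj (coord_zeta x)).
Hypothesis hH : forall x, U x -> H (coord_zeta x) \is hermsymmx.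
Hypothesis hS : forall x, U x -> S (coord_zeta x) \is symmetricmx.
Hypothesis MU : forall x, M x <-> U x /\ model_graph H S x.

Let xl (j : 'I_N) (w : 'cV[C]_(N + N)) : C := w (lshift N j) 0.
Let yl (j : 'I_N) (w : 'cV[C]_(N + N)) : C := w (rshift N j) 0.
Let zz (w : 'cV[C]_(N + N)) : 'cV[C]_(k + k) := col_mx (\col_a xl (ia a) w) (\col_a yl (ia a) w).

Let hol_xl j w : hol (xl j) w. Proof. exact: hol_coord. Qed.
Let hol_yl j w : hol (yl j) w. Proof. exact: hol_coord. Qed.

Let mhol_zz w : mhol zz w.
Proof.
move=> i j; case: (split_ordP i) => a ->.
  by apply: (hol_ext (g := xl (ia a))) => [y|]; [rewrite /zz col_mxEu mxE|exact: hol_xl].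
by apply: (hol_ext (g := yl (ia a))) => [y|]; [rewrite /zz col_mxEd mxE|exact: hol_yl].
Qed.

Let xl_w j x : xl j (wconj x) = x j 0.
Proof. by rewrite /xl /wconj col_mxEu. Qed.
Let yl_w j x : yl j (wconj x) = (x j 0)^*.
Proof. by rewrite /yl /wconj col_mxEd mxE. Qed.

Let zz_w x : zz (wconj x) = wconj (coord_zeta x).
Proof.
rewrite /zz [in RHS]/wconj; congr col_mx; apply/matrixP => i j; rewrite mxE ord1.
  by rewrite xl_w coord_zetaE.
by rewrite yl_w mxE coord_zetaE.
Qed.

Let Om' := [set w | [set: 'cV[C]_(N + N)] w /\ Om (zz w)].
Let oOm' : open Om'.
Proof.
apply: (open_preim (phi := zz) (U := [set: 'cV[C]_(N + N)]) (A := Om) openT oOm) => w _ j.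
exact: (mhol_zz w j 0).1.
Qed.

Let UOm' x : U x -> Om' (wconj x).
Proof. by move=> Ux; split=> //; rewrite zz_w; exact: UOm. Qed.

Let hol_A (A : 'cV[C]_(k + k) -> 'M[C]_s) l m w : mhol A (zz w) -> hol (fun w => A (zz w) l m) w.
Proof. by move=> hA; exact: (mhol_comp hA (mhol_zz w)). Qed.

Let smooth_A (A : 'cV[C]_(k + k) -> 'M[C]_s) (B : Z -> 'M[C]_s) : (forall w, Om w -> mhol A w) ->
  (forall x, U x -> B (coord_zeta x) = A (wconj (coord_zeta x))) ->
  forall l m, smooth_on U (fun x : V => B (coord_zeta x) l m).
Proof.
move=> hA EB l m; apply: (smooth_on_eq (f := fun x => (fun w => A (zz w) l m) (wconj x)) oU) => [x Ux|].
  by rewrite zz_w EB.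
have hp : holU Om' (fun w => A (zz w) l m) by move=> w [_ Ow]; apply: hol_A; exact: hA.
exact: (wconj_smooth oOm' oU hp UOm').
Qed.

Lemma analytic_qgraph : qgraph U M H S.
Proof.
split; first exact: oU.
- by apply: (smooth_A (A := hw)) => // w /holw [].
- by apply: (smooth_A (A := sw)) => // w /holw [].
- by move=> x Ux; exact: (hermP _).1 (hH Ux).
- by move=> x Ux; exact: (symP _).1 (hS Ux).
- by move=> x Ux; rewrite MU; split=> [[]|].
Qed.

Let q2 (x y : 'I_s -> C) (A : 'M[C]_s) : C := \sum_l \sum_m (x l * A l m * y m).
Let Phi (w : 'cV[C]_(N + N)) : C :=
  q2 (fun l => xl (iz l) w) (fun l => yl (iz l) w) (hw (zz w))
  + 2^-1 * (q2 (fun l => yl (iz l) w) (fun l => yl (iz l) w) (sw (zz w))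
   + q2 (fun l => xl (iz l) w) (fun l => xl (iz l) w) (swc (zz w)))
  - 2^-1 * (xl iw w + yl iw w).

Let hol_Phi : holU Om' Phi.
Proof.
have hq (A : 'cV[C]_(k + k) -> 'M[C]_s) (f g : 'I_s -> 'cV[C]_(N + N) -> C) w : mhol A (zz w) ->
   (forall l, hol (f l) w) -> (forall l, hol (g l) w) -> hol (fun w => q2 (f^~ w) (g^~ w) (A (zz w))) w.
  move=> hA hf hg; apply: hol_sum => l _; apply: hol_sum => m _.
  apply: (hol_mul (f := fun w => f l w * A (zz w) l m) (g := g m) _ (hg m)).
  exact: (hol_mul (f := f l) (g := fun w => A (zz w) l m) (hf l) (hol_A l m hA)).
move=> w [_ /holw [h1 h2 h3]].
have hx l : hol (xl (iz l)) w := hol_xl _ w; have hy l : hol (yl (iz l)) w := hol_yl _ w.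
have g1 := hq hw (fun l => xl (iz l)) (fun l => yl (iz l)) w h1 hx hy.
have g2 := hq sw (fun l => yl (iz l)) (fun l => yl (iz l)) w h2 hy hy.
have g3 := hq swc (fun l => xl (iz l)) (fun l => xl (iz l)) w h3 hx hx.
have c := hol_cst (2^-1 : C) w.
exact: (hol_sub (hol_add g1 (hol_mul c (hol_add g2 g3))) (hol_mul c (hol_add (hol_xl iw w) (hol_yl iw w)))).
Qed.

Let PhiE x : U x -> grho iw (qF H S) x = Phi (wconj x).
Proof.
move=> Ux; rewrite /grho ReC2 /Phi xl_w yl_w zz_w -EH // -ES // -ESc //; congr (_ - _).
rewrite /qF /quadf; congr (_ + _ * (_ + _)); apply: eq_bigr => l _; apply: eq_bigr => m _;
  by rewrite ?xl_w ?yl_w // mxE.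
Qed.

(** Replacing conj(x) by an independent variable in the defining function gives a holomorphic function. *)
Lemma analytic_graph : analytic_hypersurface M.
Proof.
have qg := analytic_qgraph.
have sF := smooth_qF oU (qg_H qg) (qg_S qg).
have rF := qF_real S (qg_herm qg).
have MF := MFq (qg_M qg).
move=> p Mp; have [Up gp] := (MU p).1 Mp.
exists (fun x => Phi (wconj x)); split; last exact: (wconj_analytic oOm' hol_Phi (UOm' Up)).
have := grho_local oU sF rF (@qF_w R s k H S) MF Up => -[A [oA Ap sr rr [Hr [v Hv]]]].
have E q : (A `&` U) q -> grho iw (qF H S) q = Phi (wconj q) by move=> [_ Uq]; exact: PhiE.
have oAU := openI oA oU; have AUp : (A `&` U) p by [].
exists (A `&` U); split=> //.
- by apply: (smooth_on_eq oAU E); apply: (smooth_on_sub _ sr) => q [].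
- by move=> q Aq; rewrite -E //; apply: rr; case: Aq.
- split; first by move=> q Aq; rewrite -E //; apply: Hr; case: Aq.
  exists v; rewrite (vder_near (f := grho iw (qF H S))) //; last exact: (smooth_W oA Ap sr).
  by apply: filterS (open_near oAU AUp) => q /E.
Qed.

End AnalyticGraph.

Section ModelMatrix.
Variables (R : realType) (s k : nat).
Local Notation C := R[i].
Local Notation Z := 'cV[R[i]]_k.
Local Notation cj := (@conjCmx R _ _).
Variables (T : Z -> 'M[C]_s) (HH : 'M[C]_s) (d : R).
Hypothesis hT : forall u, nsz 0 u < d -> mhol T u.

Let Tu (w : 'cV[C]_(k + k)) := T (usubmx w).
Let Tv (w : 'cV[C]_(k + k)) := cj (T (cj (dsubmx w))).
Definition Hw w := HH *m invmx (1%:M - Tv w *m Tu w).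
Definition Swc w := - (Hw w *m Tv w).
Definition Sw w := - (HH^T *m invmx (1%:M - Tu w *m Tv w) *m Tu w).
Let B := [set w : 'cV[C]_(k + k) | nsz 0 (usubmx w : Z) < d /\ nsz 0 (dsubmx w : Z) < d].
(** The points where the polarized inverses 1 - conj(T) T and 1 - T conj(T) exist. *)
Definition OmM := [set w : 'cV[C]_(k + k) | B w /\ (1%:M - Tv w *m Tu w \in unitmx /\ 1%:M - Tu w *m Tv w \in unitmx)].

Let mT w : B w -> mhol Tu w /\ mhol Tv w.
Proof.
move=> [h1 h2]; split.
  by apply: (@mhol_comp _ _ _ _ _ T (fun w => usubmx w)); [exact: hT|exact: mhol_usub].
apply: (@mhol_comp _ _ _ _ _ (fun v => cj (T (cj v))) (fun w => dsubmx w)); last exact: mhol_dsub.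
move=> i j; apply: (hol_ext (g := fun v => (T (cj v) i j)^*)) => [v|]; first by rewrite mxE.
by apply: (@hol_cc _ _ (fun v => T v i j)); apply: hT; rewrite nsz_cj.
Qed.

Let mY w : B w -> mhol (fun w => 1%:M - Tv w *m Tu w) w /\ mhol (fun w => 1%:M - Tu w *m Tv w) w.
Proof.
move=> Bw; have [h1 h2] := mT Bw.
by split; apply: (mhol_sub (mhol_cst _ _)); apply: mhol_mul.
Qed.

Lemma open_OmM : open OmM.
Proof.
have oB : open B.
  have o1 : open [set w : 'cV[C]_(k + k) | [set: 'cV[C]_(k + k)] w /\ oball (0 : Z) d (usubmx w)].
    apply: (open_preim (phi := fun w : 'cV[C]_(k + k) => (usubmx w : Z)) (U := [set: 'cV[C]_(k + k)]) (A := oball (0 : Z) d) openT (@open_oball _ _ _ _)) => w _ j.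
    exact: (mhol_usub w j 0).1.
  have o2 : open [set w : 'cV[C]_(k + k) | [set: 'cV[C]_(k + k)] w /\ oball (0 : Z) d (dsubmx w)].
    apply: (open_preim (phi := fun w : 'cV[C]_(k + k) => (dsubmx w : Z)) (U := [set: 'cV[C]_(k + k)]) (A := oball (0 : Z) d) openT (@open_oball _ _ _ _)) => w _ j.
    exact: (mhol_dsub w j 0).1.
  suff -> : B = [set w : 'cV[C]_(k + k) | [set: 'cV[C]_(k + k)] w /\ oball (0 : Z) d (usubmx w)] `&`
     [set w : 'cV[C]_(k + k) | [set: 'cV[C]_(k + k)] w /\ oball (0 : Z) d (dsubmx w)] by exact: openI.
  by apply/seteqP; split=> w; [move=> [h1 h2]; split|move=> [[_ h1] [_ h2]]; split].
rewrite openE => w [Bw [u1 u2]]; have [h1 h2] := mY Bw.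
have n : \forall y \near w, B y /\ (1%:M - Tv y *m Tu y \in unitmx /\ 1%:M - Tu y *m Tv y \in unitmx).
  by apply: filterI; [exact: open_near|apply: filterI; [exact: (near_unit h1 u1)|exact: (near_unit h2 u2)]].
exact: n.
Qed.

Lemma hol_OmM w : OmM w -> [/\ mhol Hw w, mhol Sw w & mhol Swc w].
Proof.
move=> [Bw [u1 u2]]; have [t1 t2] := mT Bw; have [y1 y2] := mY Bw.
have h1 : mhol Hw w by apply: (mhol_mul (mhol_cst _ _) (mhol_inv y1 u1)).
split; first exact: h1.
  by apply: mhol_opp; apply: mhol_mul t1; apply: (mhol_mul (mhol_cst _ _) (mhol_inv y2 u2)).
by apply: mhol_opp; apply: mhol_mul.
Qed.

Lemma wconj_us (u : Z) : usubmx (wconj u) = u. Proof. by rewrite /wconj col_mxKu. Qed.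
Lemma wconj_ds (u : Z) : dsubmx (wconj u) = cj u. Proof. by rewrite /wconj col_mxKd. Qed.

Lemma OmM_wconj u : nsz 0 u < d -> 1%:M - cj (T u) *m T u \in unitmx -> OmM (wconj u).
Proof.
move=> hu uY; have E : Tv (wconj u) = cj (T u) by rewrite /Tv wconj_ds cjK.
have E' : Tu (wconj u) = T u by rewrite /Tu wconj_us.
split; first by split; rewrite /= ?wconj_us ?wconj_ds ?nsz_cj.
split; rewrite E E' //; rewrite -cj_unit cjD cjN (cjM (T u)) cjK cj1 //.
Qed.

Lemma Hw_wconj u : Hw (wconj u) = HH *m invmx (1%:M - cj (T u) *m T u).
Proof. by rewrite /Hw /Tv /Tu wconj_us wconj_ds cjK. Qed.
Lemma Swc_wconj u : Swc (wconj u) = - (HH *m invmx (1%:M - cj (T u) *m T u) *m cj (T u)).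
Proof. by rewrite /Swc Hw_wconj /Tv wconj_ds cjK. Qed.
Lemma Sw_wconj u : HH^T = cj HH -> cj (Sw (wconj u)) = Swc (wconj u).
Proof.
move=> hh; rewrite Swc_wconj /Sw /Tv /Tu wconj_us wconj_ds cjK cjN.
rewrite (cjM _ (T u)) (cjM HH^T) cjV cjD cjN (cjM (T u)) cjK cj1 hh cjK //.
Qed.

End ModelMatrix.

(** * The normalizing biholomorphism *)

Section Normalization.
Variables (R : realType) (s k : nat).
Local Notation C := R[i].
Local Notation N := (1 + (s + k))%N.
Local Notation V := 'cV[R[i]]_N.
Local Notation Z := 'cV[R[i]]_k.
Local Notation cj := (@conjCmx R _ _).

Definition mk (w : C) (z : 'cV[C]_s) (u : Z) : V := w *: delta_mx iw 0 + embz z + emba u.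

Lemma mk_iw w z u : mk w z u iw 0 = w.
Proof. by rewrite !mxE embz_iw emba_iw !eqxx mulr1 !addr0. Qed.
Lemma mk_iz w z u l : mk w z u (iz l) 0 = z l 0.
Proof. by rewrite !mxE embz_iz emba_iz iz_iw mulr0 add0r addr0. Qed.
Lemma mk_ia w z u a : mk w z u (ia a) 0 = u a 0.
Proof. by rewrite !mxE embz_ia emba_ia ia_iw mulr0 !add0r. Qed.
Lemma mk_z w z u : coord_z (mk w z u) = z.
Proof. by apply/matrixP => i j; rewrite ord1 coord_zE mk_iz. Qed.
Lemma mk_zeta w z u : coord_zeta (mk w z u) = u.
Proof. by apply/matrixP => i j; rewrite ord1 coord_zetaE mk_ia. Qed.
Lemma mkE (x : V) : mk (x iw 0) (coord_z x) (coord_zeta x) = x.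
Proof.
apply/matrixP => i j; rewrite ord1; elim/index_ind: i => [|l|a].
- by rewrite mk_iw.
- by rewrite mk_iz coord_zE.
- by rewrite mk_ia coord_zetaE.
Qed.

Lemma mhol_z x : mhol (fun x : V => coord_z x) x.
Proof. by move=> i j; apply: (hol_ext (g := fun x => x (iz i) 0)) => [y|]; [rewrite ord1 coord_zE|exact: hol_coord]. Qed.
Lemma mhol_zeta x : mhol (fun x : V => coord_zeta x) x.
Proof. by move=> i j; apply: (hol_ext (g := fun x => x (ia i) 0)) => [y|]; [rewrite ord1 coord_zetaE|exact: hol_coord]. Qed.

Lemma hol_mk (f : V -> C) (g : V -> 'cV[C]_s) x j : hol f x -> mhol g x ->
  hol (fun x => mk (f x) (g x) (coord_zeta x) j 0) x.
Proof.
move=> hf hg; elim/index_ind: j => [|l|a].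
- by apply: (hol_ext (g := f)) => // y; rewrite mk_iw.
- by apply: (hol_ext (g := fun y => g y l 0)) => [y|]; [rewrite mk_iz|exact: hg].
- by apply: (hol_ext (g := fun y => coord_zeta y a 0)) => [y|]; [rewrite mk_ia|exact: mhol_zeta].
Qed.

Variables (P E : Z -> 'M[C]_s) (D : set Z).
Hypotheses (oD : open D) (uP : forall u, D u -> P u \in unitmx).
Hypotheses (hP : forall u, D u -> mhol P u) (hE : forall u, D u -> mhol E u).

(** The inverse of the change of coordinates z = P z', w = w' + z'^T E' z'. *)
Definition nphi (x : V) : V :=
  mk (x iw 0 - ((coord_z x)^T *m (E (coord_zeta x) *m invmx (P (coord_zeta x))) *m coord_z x) 0 0)
     (invmx (P (coord_zeta x)) *m coord_z x) (coord_zeta x).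
Definition npsi (y : V) : V :=
  mk (y iw 0 + ((coord_z y)^T *m aE (P (coord_zeta y)) (E (coord_zeta y)) *m coord_z y) 0 0)
     (P (coord_zeta y) *m coord_z y) (coord_zeta y).

Lemma zeta_nphi x : coord_zeta (nphi x) = coord_zeta x. Proof. exact: mk_zeta. Qed.
Lemma zeta_npsi x : coord_zeta (npsi x) = coord_zeta x. Proof. exact: mk_zeta. Qed.

Lemma aE_conj (A B : 'M[C]_s) (z : 'cV[C]_s) : A \in unitmx ->
  (invmx A *m z)^T *m aE A B *m (invmx A *m z) = z^T *m (B *m invmx A) *m z.
Proof.
move=> uA; have e : (invmx A *m z)^T *m A^T = z^T by rewrite -trmx_mul mulKVmx.
by rewrite /aE !mulmxA e.
Qed.

Lemma npsiK x : D (coord_zeta x) -> npsi (nphi x) = x.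
Proof.
move=> Dx; have uA := uP Dx; rewrite /npsi zeta_nphi /nphi mk_iw mk_z.
rewrite (aE_conj _ _ uA) subrK mulKVmx //; exact: mkE.
Qed.

Lemma nphiK y : D (coord_zeta y) -> nphi (npsi y) = y.
Proof.
move=> Dy; have uA := uP Dy; rewrite /nphi zeta_npsi /npsi mk_iw mk_z.
rewrite -(aE_conj _ _ uA) mulKmx // addrK; exact: mkE.
Qed.

Let hAz (A : Z -> 'M[C]_s) (x : V) : mhol A (coord_zeta x) -> mhol (fun x : V => A (coord_zeta x)) x.
Proof. by move=> hA; apply: (mhol_comp hA (mhol_zeta x)). Qed.

Lemma hol_nphi x j : D (coord_zeta x) -> hol (fun x => nphi x j 0) x.
Proof.
move=> Dx; have hPi := mhol_inv (hAz (hP Dx)) (uP Dx); have hEx := hAz (hE Dx); have hz := mhol_z x.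
apply: hol_mk; last exact: (mhol_mul hPi hz).
apply: hol_sub; first exact: hol_coord.
exact: (mhol_mul (mhol_mul (mhol_tr hz) (mhol_mul hEx hPi)) hz).
Qed.

Lemma hol_npsi x j : D (coord_zeta x) -> hol (fun x => npsi x j 0) x.
Proof.
move=> Dx; have hPx := hAz (hP Dx); have hEx := hAz (hE Dx); have hz := mhol_z x.
apply: hol_mk; last exact: (mhol_mul hPx hz).
apply: hol_add; first exact: hol_coord.
exact: (mhol_mul (mhol_mul (mhol_tr hz) (mhol_mul (mhol_tr hPx) hEx)) hz).
Qed.

Variables (H S H' S' : Z -> 'M[C]_s).
Hypothesis eH : forall u, D u -> H' u = aH (P u) (H u).
Hypothesis eS : forall u, D u -> cj (S' u) = aW (P u) (S u) - aE (P u) (E u).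

(** Substituting z = P z' turns H into H' and conj(S) into S'; the pluriharmonic term Re(z'^T E' z') is absorbed in w. *)
Lemma graph_nphi x : D (coord_zeta x) -> (model_graph H S x <-> model_graph H' S' (nphi x)).
Proof.
move=> Dx; rewrite /model_graph /=.
have -> : coord_w (nphi x) = x iw 0 - ((coord_z x)^T *m (E (coord_zeta x) *m invmx (P (coord_zeta x))) *m coord_z x) 0 0.
  by rewrite coord_wE mk_iw.
have -> : coord_z (nphi x) = invmx (P (coord_zeta x)) *m coord_z x by rewrite mk_z.
rewrite coord_wE zeta_nphi; move: (coord_z x) (x iw 0) => z w.
have uA := uP Dx; have Re_cj (A : 'M[C]_s) (y : 'cV[C]_s) : 'Re (((cj y)^T *m A *m cj y) 0 0) = 'Re ((y^T *m cj A *m y) 0 0).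
  have -> : (y^T *m cj A *m y) 0 0 = (((cj y)^T *m A *m cj y) 0 0)^*.
    have -> : y^T *m cj A *m y = cj ((cj y)^T *m A *m cj y) by rewrite !cjM cjT !cjK.
    by rewrite mxE.
  by rewrite !ReC2 conjCK [X in _ = _ * X]addrC.
rewrite !Re_cj (eH Dx) (eS Dx).
move: (P _) (E _) (H _) (S _) uA => A B K L uA.
have e : (invmx A *m z)^T *m A^T = z^T by rewrite -trmx_mul mulKVmx.
have e1 : (invmx A *m z)^T *m aH A K *m cj (invmx A *m z) = z^T *m K *m cj z.
  by rewrite /aH !mulmxA e -!mulmxA -cjM mulKVmx // mulmxA.
have e2 : (invmx A *m z)^T *m (aW A L - aE A B) *m (invmx A *m z) = z^T *m cj L *m z - z^T *m (B *m invmx A) *m z.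
  rewrite mulmxBr mulmxBl (aE_conj _ _ uA); congr (_ - _).
  by rewrite /aW !mulmxA e -!mulmxA mulKVmx // mulmxA.
have e3 (X Y : 'M[C]_1) : (X - Y) 0 0 = X 0 0 - Y 0 0 by rewrite !mxE.
rewrite e1 e2 e3.
move: ((z^T *m K *m cj z) 0 0) ((z^T *m cj L *m z) 0 0) ((z^T *m (B *m invmx A) *m z) 0 0) => a b c.
rewrite !raddfB /= addrA; split=> [->|/addIr] //.
Qed.

Variables (U M : set V).
Hypotheses (oU : open U) (MU : forall x, U x -> (M x <-> model_graph H S x)).

Definition nU := [set x | U x /\ D (coord_zeta x)].
Definition nU' := [set y | D (coord_zeta y) /\ U (npsi y)].

Lemma open_zetaD : open [set x : V | [set: V] x /\ D (coord_zeta x)].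
Proof.
apply: (open_preim (phi := fun x : V => coord_zeta x) (U := [set: V]) (A := D) openT oD) => x _ j.
exact: (mhol_zeta x j 0).1.
Qed.

Lemma normalize : biholo nU nU' nphi npsi M (model_graph H' S' `&` nU').
Proof.
have oD' : open [set x : V | D (coord_zeta x)].
  suff <- : [set x : V | [set: V] x /\ D (coord_zeta x)] = [set x : V | D (coord_zeta x)] by exact: open_zetaD.
  by apply/seteqP; split=> x; [move=> []|move=> ?; split].
have back x : nU x -> nU' (nphi x).
  by move=> [Ux Dx]; split; [rewrite zeta_nphi|rewrite npsiK].
split.
- exact: openI oU oD'.
- apply: (open_preim (phi := npsi) (U := [set x : V | D (coord_zeta x)]) (A := U) oD' oU) => x Dx j.
  exact: (hol_npsi j Dx).1.
- by move=> x Ux; split; [exact: back|exact: npsiK Ux.2].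
- by move=> y [Dy Uy]; split; [split; [exact: Uy|rewrite zeta_npsi]|exact: nphiK].
- split; [by move=> j x [_ Dx]; exact: hol_nphi|by move=> j x [Dx _]; exact: hol_npsi|].
  move=> x nx; have [Ux Dx] := nx; rewrite (MU Ux) (graph_nphi Dx).
  by split=> [h|[]]; [split; [exact: h|exact: back]|].
Qed.

End Normalization.

(** * The normal form *)

Section Main.
Variables (R : realType) (s k : nat).
Local Notation C := R[i].
Local Notation N := (1 + (s + k))%N.
Local Notation V := 'cV[R[i]]_N.
Local Notation Z := 'cV[R[i]]_k.
Local Notation cj := (@conjCmx R _ _).

(** The chain rule for functions of zeta. *)
Lemma vder_zeta (f : Z -> C) (c x : Z) : W f (coord_zeta (emba x : V)) ->
  vder (emba c : V, 0) (fun y => f (coord_zeta y)) (emba x) = vder (c, 0) f x.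
Proof.
move=> Wf; have Wz j : W (fun y : V => coord_zeta y j 0) (emba x) := (mhol_zeta (emba x) j 0).1.
have [_ D] := W_comp Wf Wz; rewrite D emba_zeta; apply: eq_bigr => j _.
have E : (fun y : V => coord_zeta y j 0) = (fun y => y (ia j) 0) by apply/funext => y; rewrite coord_zetaE.
have Wc := (W_coord (ia j : 'I_N) (emba x)).1.
have e1 : vder (emba c : V, 0) (fun y : V => coord_zeta y j 0) (emba x) = c j 0 by rewrite E vder_coord /= emba_ia.
have e2 : vder (emba c : V, 0) (fun y : V => (coord_zeta y j 0)^*) (emba x) = 0.
  have -> : (fun y : V => (coord_zeta y j 0)^*) = (fun y => (y (ia j) 0)^*) by apply/funext => y; rewrite coord_zetaE.
  by rewrite (vder_conj _ Wc) vder_coord /= !mxE conjC0 conjC0.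
by rewrite e1 e2 mulr0 addr0 /= mxE mul0r addr0 mulrC.
Qed.

Lemma sum_vder_ia (c : 'I_k -> C) (g : V -> C) p :
  \sum_a c a * dz g (ia a) p = vder (emba (\col_a c a) : V, 0) g p.
Proof.
pose e : V := emba (\col_a c a); pose t j := e j 0 * dz g j p + (0 : V) j 0 * dzbar g j p.
have tE j : t j = e j 0 * dz g j p by rewrite /t [(0 : V) _ _]mxE mul0r addr0.
have tz : \sum_l t (iz l) = 0 by apply: big1 => l _; rewrite tE emba_iz mul0r.
rewrite [RHS](big_index t) tE emba_iw mul0r tz !add0r.
by apply: eq_bigr => a _; rewrite tE emba_ia mxE.
Qed.

(** The leaf dimension [k] is arbitrary here, so no case distinction on its vanishing occurs. *)
Lemma transitive_normal_form (M : set V) (H S : Z -> 'M[C]_s)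
    (hsmooth : smooth_hypersurface M)
    (hnondeg : uniformly_2nondegenerate M)
    (hrank : forall p, M p -> levi_rank M p s)
    (hM : given_near0 M H S)
    (htrans : exists A : set (V -> V), (forall f, A f -> hol_symmetry M 0 f) /\ leaf_transitive M 0 A) :
  exists (HH : 'M[C]_s) (SS : Z -> 'M[C]_s),
    [/\ HH \is hermsymmx /\ HH \in unitmx,
        exists U : set Z, [/\ open U, U 0, holomorphic_on U SS & forall zeta, U zeta -> SS zeta \is symmetricmx],
        SS 0 = 0 /\ free [seq 'D_(delta_mx j 0) SS 0 | j : 'I_k],
        nondegenerate2_model (model_H HH SS) (model_S HH SS) &
        locally_CR_equivalent M (model_graph (model_H HH SS) (model_S HH SS))].
Proof.
have [M0 [U [qg U0 uH _]]] := extract hsmooth hM.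
have [A [symA trA]] := htrans.
have [P [Q [E [G [P0 Q0 HP]]]]] := sym_PQ qg U0 uH symA trA.
have HS := hM.1.1.
have [d d0 hd] := normal P0 Q0 HP HS.
pose HH := H 0; pose T := TT P Q; pose SS u := aS (P u) (Q u) HH.
pose D := oball (0 : Z) d; have oD : open D := @open_oball _ _ _ _.
have D0 : D 0 by rewrite /D /oball /= nszxx.
have hHH : HH^T = cj HH by have [[_ _ h _ _] _ _ _ _] := hd 0 D0; exact: h.
have hmH u : D u -> model_H HH SS u = aH (P u) (H u).
  move=> Du; have [[uP hS hH eE eG] _ _ _ [NH sE]] := hd u Du.
  exact: (model_HE uP eE eG hHH uH NH).
have hmS u : D u -> cj (model_S HH SS u) = aW (P u) (S u) - aE (P u) (E u).
  move=> Du; have [[uP hS hH eE eG] _ _ _ [NH sE]] := hd u Du.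
  by rewrite [model_S HH SS u](model_SE uP eE eG hHH uH NH) cjK.
have T0 : T 0 = 0 by exact: TT0.
have SS0 : SS 0 = 0 by rewrite /SS /aS -/(TT P Q 0) -/T T0 mul0mx oppr0.
have hT u : nsz 0 u < d -> mhol T u by move=> Du; have [_ _ h _ _] := hd u Du.
have hSS u : D u -> mhol SS u.
  by move=> Du; apply: mhol_opp; apply: (mhol_mul (hT u Du) (mhol_cst _ _)).
have sSS u : D u -> (SS u)^T = SS u.
  move=> Du; have [[uP hS hH eE eG] _ _ _ [NH sE]] := hd u Du.
  exact: (aS_sym uP hS hH eE eG hHH uH NH sE).
have uP u : D u -> P u \in unitmx by move=> Du; have [[h _ _ _ _] _ _ _ _] := hd u Du.
have hP u : D u -> mhol P u by move=> Du; have [_ h _ _ _] := hd u Du.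
have hE u : D u -> mhol E u by move=> Du; have [_ _ _ h _] := hd u Du.
have b := normalize oD uP hP hE hmH hmS (qg_open qg) (qg_M qg).
set mG := model_graph _ _ in b; set U1 := nU D U in b; set U2 := nU' P E D U in b.
set phi := nphi P E in b; set psi := npsi P E in b.
have [oU1 oU2 H1 H2 [h1 h2 HMG]] := b.
have b' : biholo U1 U2 phi psi M mG.
  split=> //; split=> // x Ux; rewrite (HMG x Ux).
  by split=> [[]|h] //; split=> //; have [] := H1 x Ux.
have cz0 : coord_zeta (0 : V) = 0 by apply/matrixP => i j; rewrite ord1 coord_zetaE !mxE.
have z0 : coord_z (0 : V) = 0 by apply/matrixP => i j; rewrite ord1 coord_zE !mxE.
have mk0 : mk 0 0 0 = 0 :> V.
  by have := mkE (0 : V); rewrite z0 cz0 mxE.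
have phi0 : phi 0 = 0 by rewrite /phi /nphi cz0 z0 !mulmx0 !mxE subr0 mk0.
have U10 : U1 0 by split=> //; rewrite /= cz0.
have U20 : U2 0 by have [] := H1 0 U10; rewrite phi0.
have zD x : U2 x -> D (coord_zeta x) by case.
set mH := model_H HH SS; set mS := model_S HH SS.
pose M2 := mG `&` U2.
have mHh u : D u -> mH u \is hermsymmx.
  move=> Du; have [[_ _ hH _ _] _ _ _ _] := hd u Du.
  apply/hermP => l m; rewrite /mH (hmH u Du); have := aHT (P u) hH => /matrixP /(_ m l).
  by rewrite !mxE.
have mSE u : D u -> mS u = - ((mH u)^T *m T u).
  move=> Du; have [[uPu hS hH eE eG] _ _ _ [NH sE]] := hd u Du.
  rewrite -[LHS]cjK (hmS u Du) /mH (hmH u Du) (aHT (P u) hH) (aEE uPu eE) opprD addrA subrr sub0r.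
  by rewrite cjN (cjM (aH _ _)) cjK.
have mSs u : D u -> mS u \is symmetricmx.
  move=> Du; have [[uPu hS hH eE eG] _ _ _ [NH sE]] := hd u Du.
  apply/symP => l m; have : (mS u)^T = mS u.
    by rewrite -[mS u]cjK (hmS u Du) -cjT linearB /= (aWT _ hS) sE.
  by move=> /matrixP /(_ m l); rewrite mxE.
have YU u : D u -> 1%:M - cj (T u) *m T u \in unitmx.
  move=> Du; have [[uPu hS hH eE eG] _ _ _ [NH sE]] := hd u Du; exact: (uY uPu eE eG uH NH).
have EHw u : D u -> mH u = Hw T HH (wconj u).
  move=> Du; have [[uPu hS hH eE eG] _ _ _ [NH sE]] := hd u Du.
  by rewrite Hw_wconj /mH (hmH u Du) (aH_inv uPu eE eG uH NH).
have EScw u : D u -> cj (mS u) = Swc T HH (wconj u).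
  move=> Du; rewrite (mSE u Du) Swc_wconj -Hw_wconj -(EHw u Du) cjN (cjM (mH u)^T) cjT.
  have -> : (cj (mH u))^T = mH u; last by [].
  have cT (B : 'M[C]_s) : B \is hermsymmx -> (cj B)^T = B.
    by move=> /hermP h; apply/matrixP => l m; rewrite !mxE -h.
  exact: cT (mHh u Du).
have ESw u : D u -> mS u = Sw T HH (wconj u).
  by move=> Du; rewrite -[LHS]cjK (EScw u Du) -(Sw_wconj T u hHH) cjK.
have MU2 x : M2 x <-> U2 x /\ model_graph mH mS x by split=> [[]|[]].
have an := analytic_graph (@open_OmM R s k T d hT) (@hol_OmM R s k T HH d hT) oU2
  (fun x Ux => OmM_wconj (zD x Ux) (YU _ (zD x Ux))) (fun x Ux => EHw _ (zD x Ux)) (fun x Ux => ESw _ (zD x Ux))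
  (fun x Ux => EScw _ (zD x Ux)) (fun x Ux => mHh _ (zD x Ux)) (fun x Ux => mSs _ (zD x Ux)) MU2.
have qg2 := analytic_qgraph (@open_OmM R s k T d hT) (@hol_OmM R s k T HH d hT) oU2
  (fun x Ux => OmM_wconj (zD x Ux) (YU _ (zD x Ux))) (fun x Ux => EHw _ (zD x Ux)) (fun x Ux => ESw _ (zD x Ux))
  (fun x Ux => mHh _ (zD x Ux)) (fun x Ux => mSs _ (zD x Ux)) MU2.
have back p : M2 p -> [/\ U1 (psi p), M (psi p) & phi (psi p) = p].
  move=> Mp; have [Up ep] := H2 p Mp.2; split=> //.
  by apply/(HMG _ Up); rewrite ep.
have rk p : M2 p -> levi_rank M2 p s.
  by move=> /back [Up Mp <-]; apply: (levi_rank_push b Up); exact: hrank.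
have [_ hker hnd] := hnondeg.
have nd p : M2 p -> nondegenerate2_at M2 p.
  by move=> /back [Up Mp <-]; apply: (nondegenerate2_push b Up); exact: hnd.
have ker p : M2 p -> exists v, levi_kernel M2 p v /\ v <> 0.
  move=> /back [Up Mp <-]; have [v [kv v0]] := hker _ Mp.
  exists (Defs.pushforward phi (psi p) v); split; first exact: (levi_kernel_push b Up kv).
  move=> pv; apply: v0.
  exact: (etrans (esym (pushforwardK b v Up)) (etrans (congr1 (Defs.pushforward psi (phi (psi p))) pv) (pushforward0 _ _))).
have mH0 : mH 0 = HH by rewrite /mH (hmH 0 D0) /aH P0 trmx1 mul1mx cj1 mulmx1.
have mS0 : mS 0 = 0 by rewrite (mSE 0 D0) T0 mulmx0 oppr0.
have M20 : M2 0 by split=> //; have [] := (HMG 0 U10).1 M0; rewrite phi0.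
have hHHs : HH \is hermsymmx by have [h _] := nbhs_singleton HS; exact: h.
exists HH, SS; split.
- by split; [exact: hHHs|exact: uH].
- exists D; split; [exact: oD|exact: D0|move=> u Du; exact: (holmx_diff (hSS u Du)).1|move=> u Du].
  by apply/symP => l m; have /matrixP /(_ m l) := sSS u Du; rewrite mxE.
- split; first exact: SS0.
  have [_ dS] := holmx_diff (hSS 0 D0).
  have fr : free [tuple 'D_(delta_mx j 0) SS 0 | j < k].
    apply/freeP => c cS; apply: (nondeg_free qg2 U20 M20 (fun l => mxE _ _ _ _)).
    - by rewrite cz0 mH0.
    - by rewrite cz0 mS0.
    - exact: nd.
    move=> i m; rewrite sum_vder_ia; set c' := \col_a c a.
    have DS p q : vder (c', 0) (fun u => SS u p q) 0 = 0.
      have e0 : (0 : 'M[C]_s) p q = 0 by rewrite mxE.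
      have e1 := etrans (congr1 (fun B : 'M[C]_s => B p q) cS) e0.
      rewrite (hol_vder _ (hSS 0 D0 p q)); apply: (etrans _ e1); rewrite /Dv summxE.
      apply: eq_bigr => a _; rewrite -tnth_nth tnth_mktuple [in RHS]mxE (dS (delta_mx a 0) p q) Dv_delta.
      by congr (_ * _); rewrite /= mxE.
    have TE u p q : T u p q = \sum_l SS u p l * - HH l q.
      have : SS u *m - HH = T u by rewrite mulmxN (aS_H _ _ uH) opprK.
      by move=> <-; rewrite mxE; apply: eq_bigr => l _; congr (_ * _); rewrite mxE.
    have DT p q : vder (c', 0) (fun u => T u p q) 0 = 0.
      have WS l := (hSS 0 D0 p l).1.
      have [_ K] := @W_sum _ _ _ (index_enum 'I_s) (fun l u => SS u p l * - HH l q) 0 (fun l => (W_mul (WS l) (W_cst (- HH l q) 0).1).1).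
      have -> : (fun u => T u p q) = (fun u => \sum_l SS u p l * - HH l q) by apply/funext => u; rewrite TE.
      rewrite K big1 // => l _; rewrite (vderM _ (WS l) (W_cst (- HH l q) 0).1) DS vder_cst mul0r mulr0 addr0 //.
    have WT p q : W (fun x : V => T (coord_zeta x) p q) 0.
      by apply: (mhol_comp (A := T) (phi := fun x : V => coord_zeta x) _ (mhol_zeta 0) p q).1; rewrite cz0; exact: hT.
    have WH p q : W (fun x : V => - mH (coord_zeta x) p q) 0.
      have Wm : W (fun x : V => mH (coord_zeta x) p q) 0 := smooth_W oU2 U20 (qg_H qg2 p q).
      have Wn := (W_mul (W_cst (-1) (0 : V)).1 Wm).1; move: Wn; rewrite (_ : (fun y => -1 * mH (coord_zeta y) p q) = (fun x : V => - mH (coord_zeta x) p q)) //; apply/funext => y; exact: mulN1r.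
    have [WS KS] := @W_sum _ _ _ (index_enum 'I_s) (fun p (x : V) => - mH (coord_zeta x) p i * T (coord_zeta x) p m) 0 (fun p => (W_mul (WH p i) (WT p m)).1).
    rewrite (vder_near (f := fun x : V => \sum_p - mH (coord_zeta x) p i * T (coord_zeta x) p m)); last exact: WS.
      rewrite KS big1 // => p _; rewrite (vderM _ (WH p i) (WT p m)) cz0 T0 [(0 : 'M[C]_s) _ _]mxE mulr0 add0r.
      have := @vder_zeta (fun u => T u p m) c' 0; rewrite emba0 cz0 => -> //; first by rewrite DT mulr0.
      exact: (hT 0 D0 p m).1.
    apply: filterS (open_near oU2 U20) => x /zD Dx; rewrite (mSE _ Dx).
    rewrite [RHS]mxE [X in _ = - X]mxE -sumrN; apply: eq_bigr => p _; rewrite mulNr; congr (- (_ * _)).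
    by move: (mH _) => B; rewrite mxE.
  exact: fr.
- split.
    split; last exact: (eq_ind_r (fun B : 'M[C]_s => is_true (B \in unitmx)) uH mH0).
    by apply: filterS (open_near oD D0) => u Du; split; [exact: mHh|exact: mSs].
  exists U2; split; [exact: oU2|exact: U20|exact: an|exact: rk|].
  by split; [exact: (ex_intro _ s rk)|exact: ker|exact: nd].
- exists U1, U2, phi, psi; split.
  + by split; [exact: oU1|exact: oU2|exact: U10|exact: U20|exact: phi0].
  + split=> [j n|p Up Mp]; first exact: (holU_Ck n oU1 (h1 j)).
    split; first by have [] := (HMG p Up).1 Mp.
    by move=> v hv; exact: (Hbundle_push b' Up hv).
  + have bs := biholo_sym b'; split=> [j n|p Up Mp]; first exact: (holU_Ck n oU2 (h2 j)).
    have [Up' ep] := H2 p Up; split; first by apply/(HMG _ Up'); rewrite ep.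
    by move=> v hv; exact: (Hbundle_push bs Up hv).
  + by move=> p Up _; exact: H1.
  + by move=> p Up _; exact: H2.
Qed.

End Main.

Theorem theorem1p4 (R : realType) (n s : nat) (hsn : (s <= n)%N)
    (M : set 'cV[R[i]]_(1 + (s + (n - s))))
    (H S : 'cV[R[i]]_(n - s) -> 'M[R[i]]_s)
    (hsmooth : smooth_hypersurface M)
    (hnondeg : uniformly_2nondegenerate M)
    (hrank : forall p, M p -> levi_rank M p s)
    (hM : given_near0 M H S)
    (htrans : exists A : set ('cV[R[i]]_(1 + (s + (n - s))) ->
                              'cV[R[i]]_(1 + (s + (n - s)))),
       (forall f, A f -> hol_symmetry M 0 f) /\ leaf_transitive M 0 A) :
  exists (HH : 'M[R[i]]_s) (SS : 'cV[R[i]]_(n - s) -> 'M[R[i]]_s),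
    [/\ HH \is hermsymmx /\ HH \in unitmx,
        exists U : set 'cV[R[i]]_(n - s),
          [/\ open U, U 0, holomorphic_on U SS &
              forall zeta, U zeta -> SS zeta \is symmetricmx],
        SS 0 = 0 /\
        free [seq 'D_(delta_mx j 0) SS 0 | j : 'I_(n - s)],
        nondegenerate2_model (model_H HH SS) (model_S HH SS) &
        locally_CR_equivalent M (model_graph (model_H HH SS) (model_S HH SS))].
Proof. exact: (transitive_normal_form hsmooth hnondeg hrank hM htrans). Qed.
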